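(* Let $\alpha,\beta,\gamma$ be positive integers and let $K=P(\downarrow 2\alpha+1\downarrow,\uparrow 2\beta+1\uparrow,\downarrow 2\gamma\uparrow)$ be the corresponding oriented pretzel knot. There exists a power series $\mathcal{T}^{\mathfrak{sl}_3}(K;q)\in\mathbb{Z}[[q]]$ such that for every positive integer $n$ $$\mathcal{T}^{\mathfrak{sl}_3}(K;q)-\hat{J}^{\mathfrak{sl}_3}_{(n,0)}(K;q)\in q^{n+1}\mathbb{Z}[[q]].$$
   Context: Normalization. For a nonzero (formal Laurent series) $f(q)$ with minimal degree $\mathrm{mindeg}(f)$, $\hat f(q)=\pm q^{-\mathrm{mindeg}(f)}f(q)=\sum_{i\ge0}a_iq^i$, with the sign chosen so that $a_0>0$. It is known (Le's integrality theorem) that $\hat J^{\mathfrak{sl}_3}_{(n,0)}(L;q)\in\mathbb{Z}[[q]]$. Notation. $[n]_q=\frac{q^{n/2}-q^{-n/2}}{q^{1/2}-q^{-1/2}}$. $A_2$ bracket. A web is a planar oriented graph whose vertices in the interior are trivalent and each a sink or a source (closed oriented loops allowed). The $A_2$ bracket $\langle\cdot\rangle_3$ is the $\mathbb{Q}(q^{1/6})$-linear evaluation of closed oriented link diagrams and webs (possibly with crossings) determined by the local relations: (positive crossing) $=q^{1/3}$(oriented smoothing)$-q^{-1/6}H$; (negative crossing) $=q^{-1/3}$(oriented smoothing)$-q^{1/6}H$, where, with both strands drawn upward, $H$ is the web in which the two incoming bottom strands end at a lower sink vertex, the two outgoing top strands leave an upper source vertex, and a middle edge runs from the source down to the sink;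 a square face is replaced by the sum of the two ways of joining its four legs in adjacent pairs by two disjoint arcs; a bigon face is replaced by $[2]_q$ times a single edge; a disjoint circle is replaced by $[3]_q$; the empty diagram has value $1$. Clasp of type $(n,0)$. For $n$ parallel strands oriented upward, $P_1$ is the single strand and $P_n=(P_{n-1}\otimes 1)-\frac{[n-1]_q}{[n]_q}(P_{n-1}\otimes1)(1_{n-2}\otimes H)(P_{n-1}\otimes 1)$, where $\otimes$ is horizontal juxtaposition and products are vertical composition. Put $\Delta(n,0)=\frac{[n+1]_q[n+2]_q}{[2]_q}$. Colored Jones polynomial. For an oriented link $L$ with diagram $\bar L$ of writhe $w(\bar L)$ (positive crossings count $+1$, negative $-1$), let $L(n,0)$ be obtained from $\bar L$ by replacing each component by $n$ parallel copies (in the blackboard framing, same orientation) and inserting one clasp $P_n$ in each component. Then $J^{\mathfrak{sl}_3}_{(n,0)}(L;q)=\left(q^{\frac{n^2+3n}{3}}\right)^{-w(\bar L)}\langle L(n,0)\rangle_3/\Delta(n,0)$. Pretzel links. $P(a,b,c)$ is the standard three-column pretzel link: three vertical two-strand twist columns placed side by side from left to right, with $|a|,|b|,|c|$ crossings; the right top (bottom) end of each column is joined to the left top (bottom) end of the next, and the right top (bottom) end of the last column is joined to the left top (bottom) end of the first by an outer arc. A positive entry means right-handed half twists, i.e. each crossing of the column is positive when the two strands of the column are oriented in the same vertical direction (hence negative when they are oriented oppositely); a negative entry means the mirror-image half twists. The arrows to the left and right of an entry give the vertical orientations of the strands of that column at its left and right ends. *)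

(* Defs.v *)
From HB Require Import structures.
From mathcomp Require Import all_boot all_order all_algebra.
From mathcomp Require Import boolp.
From mathcomp Require Import ring zify.

Set Implicit Arguments.
Unset Strict Implicit.
Unset Printing Implicit Defensive.

Import Order.TTheory GRing.Theory Num.Theory.
Local Open Scope ring_scope.

(* The field Q(q^(1/6)): the indeterminate 'X stands for q^(1/6). *)
Notation Qq := {fraction {poly rat}}.

(* q6 k is q^(k/6). *)
Definition q6 (k : int) : Qq := (FracField.tofrac ('X : {poly rat})) ^ k.

Definition qint (n : nat) : Qq :=
  (q6 (3 * n)%:Z - q6 (- (3 * n)%:Z)) / (q6 3 - q6 (- 3)).

(* Oriented planar diagrams (links, webs, webs with crossings) are taken in
   Morse position and read from bottom to top.  A horizontal section is the
   sequence of the directions of the strands it meets, from left to right. *)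
Notation up := true (only parsing).
Notation down := false (only parsing).

(* Elementary diagrams, named after their shape from bottom to top.
   - Cup o creates, and Cap o closes, two adjacent strands of which the left
     one has direction o;
   - Sinkij and Sourceij are the trivalent vertices with i legs below and j
     legs above;
   - in Cross b o1 o2 the strand from bottom left to top right has direction
     o1, the strand from bottom right to top left has direction o2, and the
     former is the overpass iff b = true. *)
Inductive gen :=
  | Cup of bool | Cap of bool
  | Sink21 | Sink12 | Source21 | Source12
  | Cross of bool & bool & bool.

Definition gdom (g : gen) : seq bool :=
  match g with
  | Cup _ => [::]
  | Cap o => [:: o; ~~ o]
  | Sink21 => [:: up; up]
  | Sink12 => [:: up]
  | Source21 => [:: down; down]
  | Source12 => [:: down]
  | Cross _ o1 o2 => [:: o1; o2]
  end.

Definition gcod (g : gen) : seq bool :=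
  match g with
  | Cup o => [:: o; ~~ o]
  | Cap _ => [::]
  | Sink21 => [:: down]
  | Sink12 => [:: down; down]
  | Source21 => [:: up]
  | Source12 => [:: up; up]
  | Cross _ o1 o2 => [:: o2; o1]
  end.

(* The slice (i, g) is g with i vertical strands on its left, and as many
   vertical strands on its right as the section below it requires.  Hence
   vertical composition is concatenation, D (x) 1 is D itself, and 1_i (x) D
   is shift i D. *)
Notation slice := (nat * gen)%type.
Notation diagram := (seq slice).

Definition shift (i : nat) (D : diagram) : diagram :=
  [seq ((i + x.1)%N, x.2) | x <- D].

Definition step (x : slice) (s : seq bool) : option (seq bool) :=
  let: (i, g) := x in
  let m := size (gdom g) in
  if (i <= size s)%N && (take m (drop i s) == gdom g)
  then Some (take i s ++ gcod g ++ drop (i + m) s) else None.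

(* The section reached at the top of D from the section s at its bottom, if
   D can be drawn on top of s.  Closed diagrams are those D such that
   run D [::] = Some [::]. *)
Fixpoint run (D : diagram) (s : seq bool) : option (seq bool) :=
  if D is x :: D' then obind (run D') (step x s) else Some s.

(* For opposite directions (o1 != o2), the smoothing respecting the
   orientations is horizontal. *)
Definition smoothing (o1 o2 : bool) : diagram :=
  if o1 == o2 then [::] else [:: (0, Cap o1); (0, Cup o2)]%N.

(* The web H, rotated so that its legs match those of Cross _ o1 o2: the two
   incoming legs meet at the sink and the two outgoing ones at the source. *)
Definition Hweb (o1 o2 : bool) : diagram :=
  match o1, o2 with
  | up, up => [:: (0, Sink21); (0, Source12)]
  | down, down => [:: (0, Source21); (0, Sink12)]
  | up, down => [:: (0, Sink12); (1, Source21)]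
  | down, up => [:: (0, Source12); (1, Sink21)]
  end%N.

(* A crossing is positive iff, seen with both strands upward, its overpass
   goes from bottom left to top right. *)
Definition positive (b o1 o2 : bool) : bool := (o1 == o2) == b.

(* skein s s' L R: the relation L = \sum_((c, D) in R) c D between diagrams
   with bottom s and top s'.  The first group of relations generates planar
   isotopy of diagrams in Morse position: distant slices commute, zigzags can
   be straightened, and the vertices can be rotated.  (For crossings,
   invariance under rotation follows from the crossing relations.) *)
Inductive skein :
    seq bool -> seq bool -> diagram -> seq (Qq * diagram) -> Prop :=
  | skein_comm g h m :
      skein (gdom g ++ m ++ gdom h) (gcod g ++ m ++ gcod h)
        [:: (0, g); (size (gcod g) + size m, h)]%N
        [:: (1, [:: (size (gdom g) + size m, h); (0, g)]%N)]
  | skein_zigzagl o :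
      skein [:: o] [:: o] [:: (0, Cup o); (1, Cap (~~ o))]%N [:: (1, [::])]
  | skein_zigzagr o :
      skein [:: o] [:: o] [:: (1, Cup (~~ o)); (0, Cap o)]%N [:: (1, [::])]
  | skein_sinkl :
      skein [:: up] [:: down; down]
        [:: (0, Cup down); (1, Sink21)]%N [:: (1, [:: (0, Sink12)]%N)]
  | skein_sinkr :
      skein [:: up] [:: down; down]
        [:: (1, Cup up); (0, Sink21)]%N [:: (1, [:: (0, Sink12)]%N)]
  | skein_sourcel :
      skein [:: down] [:: up; up]
        [:: (0, Cup up); (1, Source21)]%N [:: (1, [:: (0, Source12)]%N)]
  | skein_sourcer :
      skein [:: down] [:: up; up]
        [:: (1, Cup down); (0, Source21)]%N [:: (1, [:: (0, Source12)]%N)]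
  | skein_pos b o1 o2 of positive b o1 o2 :
      skein [:: o1; o2] [:: o2; o1] [:: (0, Cross b o1 o2)]%N
        [:: (q6 2, smoothing o1 o2); (- q6 (- 1), Hweb o1 o2)]
  | skein_neg b o1 o2 of ~~ positive b o1 o2 :
      skein [:: o1; o2] [:: o2; o1] [:: (0, Cross b o1 o2)]%N
        [:: (q6 (- 2), smoothing o1 o2); (- q6 1, Hweb o1 o2)]
  (* The square face is cut into two Sink12, two Source12 and two caps. *)
  | skein_square :
      skein [:: up; down] [:: up; down]
        [:: (0, Sink12); (2, Source12); (1, Cap down);
            (0, Source12); (2, Sink12); (1, Cap up)]%N
        [:: (1, [::]); (1, [:: (0, Cap up); (0, Cup up)]%N)]
  | skein_bigon :
      skein [:: down] [:: down] [:: (0, Source12); (0, Sink21)]%N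
        [:: (qint 2, [::])]
  | skein_circle o :
      skein [::] [::] [:: (0, Cup o); (0, Cap o)]%N [:: (qint 3, [::])].

(* The values of br on diagrams that are not closed are irrelevant. *)
Definition is_A2_bracket (br : diagram -> Qq) : Prop :=
  br [::] = 1 /\
  forall s s' L R, skein s s' L R ->
  forall (B T : diagram) (l r : seq bool),
    run B [::] = Some (l ++ s ++ r) -> run T (l ++ s' ++ r) = Some [::] ->
    br (B ++ shift (size l) L ++ T) =
    \sum_(cD <- R) cD.1 * br (B ++ shift (size l) cD.2 ++ T).

(* The relations are consistent: they hold in the following 3-colour state
   model, in which v = q^(-1/2) and s = q^(1/2). *)
Module Model.

Inductive color := C0 | C1 | C2.

Section Model.
Variables (F : fieldType) (t : F).

Let s := t ^+ 3.
Let v := t ^- 3.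

(* The possible colourings of the top of g, with their weights, given the
   colouring of its bottom. *)
Definition terms0 (g : gen) (z : seq color) : seq (F * seq color) :=
  match g, z with
  | Cup up, [::] =>
      [:: (1, [:: C0; C0]); (1, [:: C1; C1]); (1, [:: C2; C2])]
  | Cup down, [::] =>
      [:: (v ^+ 2, [:: C0; C0]); (1, [:: C1; C1]); (s ^+ 2, [:: C2; C2])]
  | Cap up, [:: C0; C0] => [:: (s ^+ 2, [::])]
  | Cap up, [:: C1; C1] => [:: (1, [::])]
  | Cap up, [:: C2; C2] => [:: (v ^+ 2, [::])]
  | Cap down, [:: C0; C0] => [:: (1, [::])]
  | Cap down, [:: C1; C1] => [:: (1, [::])]
  | Cap down, [:: C2; C2] => [:: (1, [::])]
  | Sink21, [:: C0; C1] => [:: (s ^+ 3, [:: C2])]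
  | Sink21, [:: C1; C0] => [:: (s ^+ 2, [:: C2])]
  | Sink21, [:: C1; C2] => [:: (s, [:: C0])]
  | Sink21, [:: C2; C1] => [:: (1, [:: C0])]
  | Sink21, [:: C0; C2] => [:: (s ^+ 2, [:: C1])]
  | Sink21, [:: C2; C0] => [:: (s, [:: C1])]
  | Source12, [:: C2] =>
      [:: (v ^+ 2, [:: C0; C1]); (v ^+ 3, [:: C1; C0])]
  | Source12, [:: C0] => [:: (1, [:: C1; C2]); (v, [:: C2; C1])]
  | Source12, [:: C1] => [:: (v, [:: C0; C2]); (v ^+ 2, [:: C2; C0])]
  | Sink12, [:: C0] => [:: (s ^+ 3, [:: C2; C1]); (s ^+ 2, [:: C1; C2])]
  | Sink12, [:: C1] => [:: (s ^+ 2, [:: C2; C0]); (s, [:: C0; C2])]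
  | Sink12, [:: C2] => [:: (1, [:: C0; C1]); (s, [:: C1; C0])]
  | Source21, [:: C0; C2] => [:: (v ^+ 2, [:: C1])]
  | Source21, [:: C1; C2] => [:: (v ^+ 3, [:: C0])]
  | Source21, [:: C1; C0] => [:: (1, [:: C2])]
  | Source21, [:: C2; C0] => [:: (v, [:: C1])]
  | Source21, [:: C0; C1] => [:: (v, [:: C2])]
  | Source21, [:: C2; C1] => [:: (v ^+ 2, [:: C0])]
  | _, _ => [::]
  end.

Definition step0 (l : seq (F * seq color)) (x : slice) :=
  let m := size (gdom x.2) in
  flatten [seq [seq (p.1 * r.1, take x.1 p.2 ++ r.2 ++ drop (x.1 + m) p.2)
               | r <- terms0 x.2 (take m (drop x.1 p.2))] | p <- l].

Definition terms (g : gen) (z : seq color) : seq (F * seq color) :=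
  if g is Cross b o1 o2 then
    let: (c, d) := if positive b o1 o2 then (t ^+ 2, - t^-1)
                   else (t ^- 2, - t) in
    [seq (c * p.1, p.2) | p <- foldl step0 [:: (1, z)] (smoothing o1 o2)] ++
    [seq (d * p.1, p.2) | p <- foldl step0 [:: (1, z)] (Hweb o1 o2)]
  else terms0 g z.

Definition act (x : slice) (G : seq color -> F) (y : seq color) : F :=
  let: (i, g) := x in
  let m := size (gdom g) in
  \sum_(p <- terms g (take m (drop i y)))
    p.1 * G (take i y ++ p.2 ++ drop (i + m) y).

Definition ev (D : diagram) (G : seq color -> F) : seq color -> F :=
  foldr act G D.

Lemma ev_cat D1 D2 G : ev (D1 ++ D2) G = ev D1 (ev D2 G).
Proof. exact: foldr_cat. Qed.

Lemma eq_terms g z (A B : F * seq color -> F) : size z = size (gdom g) ->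
  (forall p, size p.2 = size (gcod g) -> A p = B p) ->
  \sum_(p <- terms g z) A p = \sum_(p <- terms g z) B p.
Proof.
move=> sz eqAB.
have: all (fun p => size p.2 == size (gcod g)) (terms g z).
  by move: sz; case: g {eqAB} => [[]|[]|||||[] [] []];
     case: z => [|[] [|[] [|? ?]]].
elim: (terms g z) => [|p l IH] /=; first by rewrite !big_nil.
by case/andP=> /eqP szp /IH eql; rewrite !big_cons eqAB // eql.
Qed.

Lemma act_ext i g G G' y : (i + size (gdom g) <= size y)%N ->
  (forall y', size y' = (size y - size (gdom g) + size (gcod g))%N ->
    G y' = G' y') ->
  act (i, g) G y = act (i, g) G' y.
Proof.
move=> le_i eqG; apply: eq_terms => [|p szp].
  by rewrite size_takel // size_drop; lia.
congr (_ * _); apply: eqG.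
by rewrite !size_cat szp size_drop size_takel; lia.
Qed.

Lemma step_size i g b b' : step (i, g) b = Some b' ->
  (i + size (gdom g) <= size b)%N /\
  size b' = (size b - size (gdom g) + size (gcod g))%N.
Proof.
rewrite /step; case: andP => // -[le_i /eqP eq_g] [<-].
have := congr1 size eq_g; rewrite size_take_min size_drop => sz.
have {sz} le_m : (size (gdom g) <= size b - i)%N by rewrite -sz geq_minr.
by rewrite !size_cat size_takel // size_drop; lia.
Qed.

Lemma ev_ext D G G' b b' y : run D b = Some b' -> size y = size b ->
  (forall y', size y' = size b' -> G y' = G' y') -> ev D G y = ev D G' y.
Proof.
elim: D b y => [|[i g] D IH] b y; first by case=> <- sz; apply.
rewrite [run _ _]/(obind (run D) (step (i, g) b)).
case Eb: (step (i, g) b) => [b1|] //= Eb' sz eqG.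
have [le_i sz1] := step_size Eb.
apply: act_ext => [|y1 szy1]; first by rewrite sz.
by apply: IH Eb' _ eqG; rewrite szy1 sz.
Qed.

Lemma ev_shift i D G y : (i <= size y)%N ->
  ev (shift i D) G y = ev D (fun z => G (take i y ++ z)) (drop i y).
Proof.
elim: D y => [|[j g] D IH] y le_i /=; first by rewrite cat_take_drop.
rewrite /act drop_drop (addnC j i); apply: eq_bigr => p _; congr (_ * _).
have szi : size (take i y) = i by rewrite size_takel.
rewrite IH; last by rewrite size_cat size_take_min; lia.
rewrite takeD -!catA take_cat szi ltnn subnn take0 cats0.
by rewrite drop_cat szi ltnn subnn drop0 drop_drop -addnA (addnC i).
Qed.

Lemma ev_sum (I : Type) (R : seq I) (c : I -> F) G D y :
  ev D (fun y' => \sum_(p <- R) c p * G p y') y = \sum_(p <- R) c p * ev D (G p) y.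
Proof.
elim: D y => [|[i g] D IH] y //=; rewrite /act.
under eq_bigr do rewrite IH big_distrr /=.
rewrite exchange_big /=; apply: eq_bigr => p _; rewrite big_distrr /=.
by apply: eq_bigr => r _; rewrite mulrCA.
Qed.

Definition evl (R : seq (F * diagram)) G y := \sum_(cD <- R) cD.1 * ev cD.2 G y.

Lemma ev_comm g h m G z :
  (size (gdom g) + m + size (gdom h) <= size z)%N ->
  ev [:: (0, g); (size (gcod g) + m, h)]%N G z =
  ev [:: (size (gdom g) + m, h); (0, g)]%N G z.
Proof.
move=> le_z /=.
have szg : size (take (size (gdom g)) z) = size (gdom g).
  by rewrite size_takel; lia.
rewrite /act /= !drop0 !take0 !add0n /=.
pose z1 := drop (size (gdom g)) z.
transitivity (\sum_(p <- terms g (take (size (gdom g)) z))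
  \sum_(r <- terms h (take (size (gdom h)) (drop m z1)))
   p.1 * (r.1 * G (p.2 ++ take m z1 ++ r.2 ++ drop (m + size (gdom h)) z1))).
  apply: eq_terms => // p szp; rewrite /= -/z1 big_distrr /=.
  have dropp k : drop (size (gcod g) + k) (p.2 ++ z1) = drop k z1.
    by rewrite -szp addnC -drop_drop drop_size_cat.
  have takep k : take (size (gcod g) + k) (p.2 ++ z1) = p.2 ++ take k z1.
    by rewrite takeD -szp take_size_cat // drop_size_cat.
  by rewrite -addnA !dropp takep; rewrite -/z1; apply: eq_bigr => r _; rewrite -catA.
rewrite exchange_big /=.
have -> : drop m z1 = drop (size (gdom g) + m) z by rewrite /z1 drop_drop addnC.
apply: eq_bigr => r _; rewrite big_distrr /= drop0 takeD -!catA.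
rewrite take_size_cat // drop_size_cat // take0 /=.
apply: eq_bigr => p _; rewrite mulrCA /z1 drop_drop.
by rewrite (addnC (m + _)%N) addnA.
Qed.

Hypothesis t_neq0 : t != 0.

Local Ltac solve_model :=
  rewrite /evl; do ?[rewrite /act /=] ;
  rewrite ?take0 ?drop0 /= ?big_cons ?big_nil /=;
  repeat (progress (rewrite ?take0 ?drop0 /=; rewrite ?big_cons ?big_nil /=));
  rewrite /s /v; by field.

Lemma model_zigzagl o G z : (0 < size z)%N ->
  ev [:: (0, Cup o); (1, Cap (~~ o))]%N G z = evl [:: (1, [::])] G z.
Proof. by case: o; case: z => [|[] z] // _; solve_model. Qed.

Lemma model_zigzagr o G z : (0 < size z)%N ->
  ev [:: (1, Cup (~~ o)); (0, Cap o)]%N G z = evl [:: (1, [::])] G z.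
Proof. by case: o; case: z => [|[] z] // _; solve_model. Qed.

Lemma model_sinkl G z : (0 < size z)%N ->
  ev [:: (0, Cup down); (1, Sink21)]%N G z =
  evl [:: (1, [:: (0, Sink12)]%N)] G z.
Proof. by case: z => [|[] z] // _; solve_model. Qed.

Lemma model_sinkr G z : (0 < size z)%N ->
  ev [:: (1, Cup up); (0, Sink21)]%N G z =
  evl [:: (1, [:: (0, Sink12)]%N)] G z.
Proof. by case: z => [|[] z] // _; solve_model. Qed.

Lemma model_sourcel G z : (0 < size z)%N ->
  ev [:: (0, Cup up); (1, Source21)]%N G z =
  evl [:: (1, [:: (0, Source12)]%N)] G z.
Proof. by case: z => [|[] z] // _; solve_model. Qed.

Lemma model_sourcer G z : (0 < size z)%N ->
  ev [:: (1, Cup down); (0, Source21)]%N G z =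
  evl [:: (1, [:: (0, Source12)]%N)] G z.
Proof. by case: z => [|[] z] // _; solve_model. Qed.

Lemma model_pos b o1 o2 G z : positive b o1 o2 -> (1 < size z)%N ->
  ev [:: (0, Cross b o1 o2)]%N G z =
  evl [:: (t ^+ 2, smoothing o1 o2); (- t^-1, Hweb o1 o2)] G z.
Proof.
by case: b; case: o1; case: o2 => //= _; case: z => [|[] [|[] z]] // _;
   solve_model.
Qed.

Lemma model_neg b o1 o2 G z : ~~ positive b o1 o2 -> (1 < size z)%N ->
  ev [:: (0, Cross b o1 o2)]%N G z =
  evl [:: (t ^- 2, smoothing o1 o2); (- t, Hweb o1 o2)] G z.
Proof.
by case: b; case: o1; case: o2 => //= _; case: z => [|[] [|[] z]] // _;
   solve_model.
Qed.

Lemma model_square G z : (1 < size z)%N ->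
  ev [:: (0, Sink12); (2, Source12); (1, Cap down);
         (0, Source12); (2, Sink12); (1, Cap up)]%N G z =
  evl [:: (1, [::]); (1, [:: (0, Cap up); (0, Cup up)]%N)] G z.
Proof. by case: z => [|[] [|[] z]] // _; solve_model. Qed.

Lemma model_bigon G z : (0 < size z)%N ->
  ev [:: (0, Source12); (0, Sink21)]%N G z = evl [:: (s + v, [::])] G z.
Proof. by case: z => [|[] z] // _; solve_model. Qed.

Lemma model_circle o G z :
  ev [:: (0, Cup o); (0, Cap o)]%N G z =
  evl [:: (s ^+ 2 + 1 + v ^+ 2, [::])] G z.
Proof. by case: o; solve_model. Qed.

Lemma model_qint2 : s - v != 0 ->
  (t ^+ (3 * 2) - t ^- (3 * 2)) / (s - v) = s + v.
Proof.
by move=> d0; apply: (canLR (mulfK d0)); rewrite /s /v; field.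
Qed.

Lemma model_qint3 : s - v != 0 ->
  (t ^+ (3 * 3) - t ^- (3 * 3)) / (s - v) = s ^+ 2 + 1 + v ^+ 2.
Proof.
by move=> d0; apply: (canLR (mulfK d0)); rewrite /s /v; field.
Qed.

End Model.

Definition bracket (D : diagram) : Qq :=
  ev (q6 1) D (fun y => (size y == 0)%:R) [::].

Lemma q6_1_neq0 : q6 1 != 0.
Proof. by rewrite /q6 expr1z tofrac_eq0 polyX_eq0. Qed.

Lemma q6E : (q6 1 = FracField.tofrac 'X) * (forall k : nat, q6 k = q6 1 ^+ k)
  * (forall k : nat, q6 (- k%:Z) = q6 1 ^- k).
Proof. by split; [split|] => [|k|k]; rewrite /q6 expr1z // -invr_expz. Qed.

Lemma qint_den_neq0 : q6 3 - q6 (- 3) != 0.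
Proof.
rewrite !q6E subr_eq0; apply/negP => /eqP e.
have /eqP : q6 1 ^+ 6 = 1.
  by rewrite (exprD _ 3 3) {1}e mulVf // expf_neq0 // q6_1_neq0.
rewrite q6E -tofracXn -tofrac1 tofrac_eq => /eqP/(congr1 (fun p : {poly rat} => p`_6)).
by rewrite coefXn coef1 /= => /eqP; rewrite oner_eq0.
Qed.

Lemma qint2E : qint 2 = q6 1 ^+ 3 + q6 1 ^- 3.
Proof.
have d0 := qint_den_neq0; rewrite !q6E in d0.
by rewrite /qint !q6E (model_qint2 q6_1_neq0 d0).
Qed.

Lemma qint3E : qint 3 = (q6 1 ^+ 3) ^+ 2 + 1 + (q6 1 ^- 3) ^+ 2.
Proof.
have d0 := qint_den_neq0; rewrite !q6E in d0.
by rewrite /qint !q6E (model_qint3 q6_1_neq0 d0).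
Qed.

Lemma model_skein s s' L R G z : skein s s' L R -> (size s <= size z)%N ->
  ev (q6 1) L G z = evl (q6 1) R G z.
Proof.
have t0 := q6_1_neq0.
case=> [g h m|o|o|||||b o1 o2 pos|b o1 o2 neg|||o] sz.
- rewrite !size_cat addnA in sz; rewrite ev_comm //.
  by rewrite /evl big_cons big_nil addr0 mul1r.
- exact: model_zigzagl.
- exact: model_zigzagr.
- exact: model_sinkl.
- exact: model_sinkr.
- exact: model_sourcel.
- exact: model_sourcer.
- by rewrite !q6E expr1; exact: model_pos.
- by rewrite (q6E.2 2); exact: model_neg.
- exact: model_square.
- by rewrite qint2E; exact: model_bigon.
- by rewrite qint3E; exact: model_circle.
Qed.

Lemma bracketP : is_A2_bracket bracket.
Proof.
split=> [|s s' L R LR B T l r runB runT].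
  by rewrite /bracket /=.
pose d (y : seq color) : Qq := (size y == 0)%:R.
transitivity (ev (q6 1) B (fun y => \sum_(p <- R) p.1 *
    ev (q6 1) (shift (size l) p.2 ++ T) d y) [::]).
  rewrite /bracket ev_cat; apply: ev_ext runB _ _ => // y; rewrite !size_cat => sz.
  rewrite ev_cat ev_shift; last by lia.
  rewrite (model_skein _ LR); last by rewrite size_drop; lia.
  by apply: eq_bigr => p _; rewrite ev_cat ev_shift //; lia.
by rewrite ev_sum; apply: eq_bigr => p _; rewrite /bracket (ev_cat _ B).
Qed.

End Model.

Lemma A2_bracket_exists : exists br, is_A2_bracket br.
Proof. by exists Model.bracket; exact: Model.bracketP. Qed.

(* By Kuperberg's reduction of closed webs, the relations determine the values
   on closed diagrams, so that this choice is the A2 bracket there. *)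
Definition A2_bracket : diagram -> Qq := sval (cid A2_bracket_exists).

Lemma A2_bracketP : is_A2_bracket A2_bracket.
Proof. exact: svalP (cid A2_bracket_exists). Qed.

(* The clasp of type (n, 0), as a linear combination of diagrams from
   nseq n up to nseq n up. *)
Fixpoint clasp (n : nat) : seq (Qq * diagram) :=
  match n with
  | 0 => [:: (1, [::])]
  | m.+1 =>
    if m is k.+1 then
      clasp m ++
      [seq (- (qint m / qint m.+1) * x.1 * y.1,
            x.2 ++ shift k (Hweb up up) ++ y.2) | x <- clasp m, y <- clasp m]
    else [:: (1, [::])]
  end.

Definition cable_slice (n : nat) (x : slice) : diagram :=
  let: (i, g) := x in
  match g with
  | Cup _ => [seq ((n * i + k)%N, g) | k <- iota 0 n]
  | Cap _ => [seq ((n * i + k)%N, g) | k <- rev (iota 0 n)]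
  | Cross _ _ _ =>
      (* each strand coming from the right crosses the n strands on its left,
         the leftmost one first *)
      [seq ((n * i + j + k)%N, g) | j <- iota 0 n, k <- rev (iota 0 n)]
  | _ => [::] (* link diagrams have no trivalent vertex *)
  end.

Definition cable (n : nat) (D : diagram) : diagram :=
  flatten [seq cable_slice n x | x <- D].

Definition writhe (D : diagram) : int :=
  \sum_(x <- D)
    (if x.2 is Cross b o1 o2 then (if positive b o1 o2 then 1 else -1) else 0).

Definition Delta (n : nat) : Qq := qint n.+1 * qint n.+2 / qint 2.

(* The bracket <K(n,0)>_3 for a knot diagram K; the clasp is inserted in
   the cable of the strand number i (from the left) in the section above the
   first k slices.  This strand must be directed upward. *)
Definition clasped_bracket (n : nat) (K : diagram) (k i : nat) : Qq :=
  \sum_(cD <- clasp n)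
    cD.1 * A2_bracket
      (cable n (take k K) ++ shift (n * i) cD.2 ++ cable n (drop k K)).

(* The factor is (q^((n^2 + 3 n) / 3))^(- writhe). *)
Definition colored_jones (n : nat) (K : diagram) (k i : nat) : Qq :=
  q6 (2 * (n ^ 2 + 3 * n))%:Z ^ (- writhe K) * clasped_bracket n K k i / Delta n.

(* A twist column in positions i and i + 1, with bottom directions l and r.
   A positive crossing between two strands with the same direction has the
   strand from bottom left to top right as overpass; the mixed crossings of
   the same column have the same unoriented shape. *)
Fixpoint twist (m i : nat) (over l r : bool) : diagram :=
  if m is m'.+1 then (i, Cross over l r) :: twist m' i over r l else [::].

Definition column (i : nat) (l : bool) (a : int) (r : bool) : diagram :=
  twist `|a|%N i (0 <= a) l r.

(* P(l1 a r1, l2 b r2, l3 c r3), where the arrows at the left and at the right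
   of an entry are the directions of the strands both at the bottom and at the
   top of the column (so that l = r in a column with an odd entry).  This
   requires r1 = ~~ l2, r2 = ~~ l3 and r3 = ~~ l1. *)
Definition pretzel (l1 : bool) (a : int) (r1 : bool) (l2 : bool) (b : int)
    (r2 : bool) (l3 : bool) (c : int) (r3 : bool) : diagram :=
  [:: (0, Cup l1); (1, Cup r1); (3, Cup r2)]%N ++
  column 0 l1 a r1 ++ column 2 l2 b r2 ++ column 4 l3 c r3 ++
  [:: (3, Cap r2); (1, Cap r1); (0, Cap l1)]%N.

(* f has the expansion \sum_k a k t^k in Q[[t]], where t = q^(1/6). *)
Definition expands_to (f : Qq) (a : nat -> rat) : Prop :=
  exists p r : {poly rat},
    [/\ r`_0 != 0, f = FracField.tofrac p / FracField.tofrac r &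
        forall k, \sum_(j < k.+1) r`_j * a (k - j)%N = p`_k].

(* a is the power series in Z[[q]] obtained from the Laurent series f by the
   normalization f^ = +/- q^(- mindeg f) f. *)
Definition normalization (f : Qq) (a : nat -> int) : Prop :=
  0 < a 0%N /\
  exists (e : bool) (d : int),
    expands_to ((-1) ^+ e * q6 d * f)
      (fun k => if (6 %| k)%N then (a (k %/ 6)%N)%:~R else 0).

(* Main.v *)
From HB Require Import structures.
From mathcomp Require Import all_boot all_order all_algebra.
From mathcomp Require Import boolp.
From mathcomp Require Import ring zify.
Require Import Defs.

(** Why the tail exists.

The clasped bracket of the pretzel knot is a finite sum (bracket_value) whose
terms visibly stabilize.

A single clasp can be copied to all six bundles of the cabled diagram
(spread_clasp): it slides along the arcs and through the columns.  After that,
each column is evaluated between clasps.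

In a parallel column, one crossing is a grid of n times n positive crossings.
Between clasps this grid lies in a commutative algebra, spanned by the rungs
that regroup n + n strands as n + r and n - r.  The algebra acts through n + 1
eigenvalues, and on the u-th of them the grid is, up to a common scalar,
(-1)^u q^((u^2 + u) / 2) (rep_braid).  Powers of the grid are thus free.

The antiparallel column is a power of the full twist of two antiparallel
bundles.  Between clasps the full twist is a combination of nested turnbacks,
and on these it acts by a triangular matrix with entries
q^(l + k^2 + k) (q)_l^2 / ((q)_k^2 (q)_(l - k)), up to a common scalar, where l
and k count the strands that go through (twist_D).

In the term where k strands go through the third column, closing the diagram
amounts to k partial traces of both parallel columns, followed by a pairing.  A
partial trace acts on eigenvalues by a weighted sum over the neighbours u and
u + 1 (trace_eig), adding strands by a weighted sum over u and u - 1
(lift_eig), and quantum dimensions make the two operations adjoint to each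
other (adjoint).  Hence the bracket is
  sum over k of c(k) times the sum over u of dim(k, u) a(k, u) b(k, u).

Up to one common factor q^d, everything is now a quotient of integral
polynomials in q with denominators of constant term 1.  The numbers of crossings
2 alpha + 1 and 2 beta + 1 are at least 3, so a(k, u) and b(k, u) are divisible
by q^(3 u), while dim(k, u) costs only q^(-u); and c(k) is divisible by
q^(k^2 + k).  Replacing n by n + 1 changes a(k, u) by a multiple of
q^(n + 1 - k + u) (ac_diff) and c(k) by a multiple of q^(n + 1) (cc_diff).
Altogether the normalized series for n and n + 1 differ by a multiple of
q^(n + 1) (Jhat_diff), and their constant term is 1.  The i-th coefficient of
the tail is the i-th coefficient of the i-th series.

To compute with diagrams, words in elementary slices act by stacking on the
space of all states, that is, of combinations of diagrams evaluated by the
bracket with a diagram on top.  The skein relations become identities in one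
associative algebra of endomorphisms, to which the abstract computations with
clasps apply. *)

Set Implicit Arguments.
Unset Strict Implicit.
Unset Printing Implicit Defensive.
Import Order.TTheory GRing.Theory Num.Theory.
Local Open Scope ring_scope.

(** * Quantum integers and clasps *)

HB.lock Definition qn (F : fieldType) (v : F) (n : nat) : F :=
  (v ^+ n - v ^- n) / (v - v^-1).

(** What is used of the parameter: it is not a root of unity, so that the
    clasp recursion never divides by zero. *)
Definition generic_q (F : fieldType) (v : F) :=
  forall n, (0 < n)%N -> qn v n != 0.

Section Qnum.
Variables (F : fieldType) (v : F).
Hypothesis vgen : generic_q v.
Local Notation "[ n ]" := (qn v n) (at level 0, format "[ n ]").

Lemma qden_neq0 : v - v^-1 != 0.
Proof. by have := vgen (isT : 0 < 1)%N; apply: contraNneq => d0; rewrite qn.unlock d0 invr0 mulr0. Qed.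

Lemma v_neq0 : v != 0.
Proof. by apply: contraNneq qden_neq0 => ->; rewrite invr0 subr0. Qed.

Lemma vX_neq0 n : v ^+ n != 0. Proof. exact: expf_neq0 v_neq0. Qed.

Lemma qn0 : [0] = 0. Proof. by rewrite qn.unlock expr0 invr1 subrr mul0r. Qed.
Lemma qn1 : [1] = 1. Proof. by rewrite qn.unlock expr1 divff ?qden_neq0. Qed.

Lemma qn2 : [2] = v + v^-1.
Proof.
rewrite qn.unlock; apply: (canLR (mulfK qden_neq0)); have := v_neq0 => v0; by field.
Qed.

Lemma qn3 : [3] = v ^+ 2 + 1 + v ^- 2.
Proof.
rewrite qn.unlock; apply: (canLR (mulfK qden_neq0)); have := v_neq0 => v0; by field.
Qed.

Lemma qnD m n : [m + n] = v ^+ m * [n] + v ^- n * [m].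
Proof.
rewrite qn.unlock !exprD; have h1 := vX_neq0 m; have h2 := vX_neq0 n.
have v0 := v_neq0; have d0 := qden_neq0.
rewrite !invfM !mulrA -mulrDl; congr (_ / _); by field; rewrite ?h1 ?h2.
Qed.

End Qnum.

Fixpoint clasp_rec (F : fieldType) (v : F) (R : algType F) (e : nat -> R) (s n : nat) : R :=
  if n is m.+1 then
    clasp_rec v e s m -
    (qn v m / qn v m.+1) *: (clasp_rec v e s m * e (s + m).-1 * clasp_rec v e s m)
  else 1.

(** The clasp on the n strands s, ..., s + n - 1, in an algebra with generators
    e i attached to the strands i and i + 1. *)
HB.lock Definition clasp_at (F : fieldType) (v : F) (R : algType F) (e : nat -> R) (s n : nat) : R :=
  clasp_rec v e s n.

Section Hecke.
Variables (F : fieldType) (v : F) (R : algType F).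
Hypothesis vgen : generic_q v.
Local Notation "[ n ]" := (qn v n) (at level 0, format "[ n ]").

Lemma zml (c : F) (x y : R) : (c *: x) * y = c *: (x * y).
Proof. by rewrite scalerAl. Qed.
Lemma zmr (c : F) (x y : R) : x * (c *: y) = c *: (x * y).
Proof. by rewrite scalerAr. Qed.

(** The relations of the web H: a bigon gives the first one, and the third one
    says that the two ways of resolving a triangle of three strands agree.  The
    value of e i * e i.+1 * e i itself is left free, unlike in the
    Temperley-Lieb algebra. *)
Definition hecke (e : nat -> R) (N : nat) : Prop :=
  [/\ forall i, (i.+1 < N)%N -> e i * e i = [2] *: e i,
      forall i j, (i.+1 < j)%N -> (j.+1 < N)%N -> e i * e j = e j * e i &
      forall i, (i.+2 < N)%N ->
        e i * e i.+1 * e i - e i = e i.+1 * e i * e i.+1 - e i.+1].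

Local Notation clasp_at := (@clasp_at F v R).

Lemma clasp_atS e s m : clasp_at e s m.+1 =
  clasp_at e s m - ([m] / [m.+1]) *: (clasp_at e s m * e (s + m).-1 * clasp_at e s m).
Proof. by rewrite clasp_at.unlock. Qed.

Lemma clasp_at0 e s : clasp_at e s 0 = 1. Proof. by rewrite clasp_at.unlock. Qed.

Lemma clasp_at1 e s : clasp_at e s 1 = 1.
Proof. by rewrite clasp_atS clasp_at0 qn0 mul0r scale0r subr0. Qed.

(** A clasp is 1 plus products that end with a generator. *)
Lemma clasp_fixl e s n (x : R) :
  (forall i, (s <= i)%N -> (i.+1 < s + n)%N -> e i * x = 0) ->
  clasp_at e s n * x = x.
Proof.
elim: n => [|m IH] ex; first by rewrite clasp_at0 mul1r.
have fx : clasp_at e s m * x = x by apply: IH => i si im; apply: ex => //; lia.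
rewrite clasp_atS mulrBl zml -!mulrA fx.
case: m {IH} ex fx => [|m] ex fx; first by rewrite qn0 mul0r scale0r subr0.
by rewrite ex ?mulr0 ?scaler0 ?subr0 //; lia.
Qed.

Lemma clasp_fixr e s n (x : R) :
  (forall i, (s <= i)%N -> (i.+1 < s + n)%N -> x * e i = 0) ->
  x * clasp_at e s n = x.
Proof.
elim: n => [|m IH] ex; first by rewrite clasp_at0 mulr1.
have fx : x * clasp_at e s m = x by apply: IH => i si im; apply: ex => //; lia.
rewrite clasp_atS mulrBr zmr !mulrA fx.
case: m {IH} ex fx => [|m] ex fx; first by rewrite qn0 mul0r scale0r subr0.
by rewrite ex ?mul0r ?scaler0 ?subr0 //; lia.
Qed.

Lemma clasp_comm e s n (x : R) :
  (forall i, (s <= i)%N -> (i.+1 < s + n)%N -> e i * x = x * e i) ->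
  clasp_at e s n * x = x * clasp_at e s n.
Proof.
elim: n => [|m IH] ex; first by rewrite clasp_at0 mul1r mulr1.
have fx : clasp_at e s m * x = x * clasp_at e s m.
  by apply: IH => i si im; apply: ex => //; lia.
rewrite clasp_atS mulrBl mulrBr zml zmr fx.
case: m {IH} ex fx => [|m] ex fx; first by rewrite qn0 mul0r !scale0r.
congr (_ - _ *: _); rewrite -mulrA fx !mulrA; congr (_ * _).
by rewrite -mulrA ex ?mulrA ?fx //; lia.
Qed.

Section Kill.
Variables (e : nat -> R) (N : nat).
Hypothesis eH : hecke e N.

Let e_sq i : (i.+1 < N)%N -> e i * e i = [2] *: e i.
Proof. by move: i; case: eH. Qed.

Let e_far i j : (i.+1 < j)%N -> (j.+1 < N)%N -> e i * e j = e j * e i.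
Proof. by move: i j; case: eH. Qed.

Let e_braid i : (i.+2 < N)%N ->
  e i.+1 * e i * e i.+1 = e i * e i.+1 * e i - e i + e i.+1.
Proof. by case: eH => _ _ h /h ->; rewrite subrK. Qed.

Lemma qn_ratio n : [2] - [n] / [n.+1] = [n.+2] / [n.+1].
Proof.
have h := vgen (ltn0Sn n); apply: (canRL (mulfK h)).
rewrite mulrBl divfK // -[n.+2]/(2 + n)%N -[n.+1]/(1 + n)%N !(qnD vgen) qn2 // (qn1 vgen).
have v0 := v_neq0 vgen; move: (v ^- n) => y; by field.
Qed.

(** The coefficient in the clasp recursion is chosen for this: in the product of
    e s.+n with a clasp of width n + 1, the braid-like relation turns the middle
    generator around and the remaining terms cancel by the identity
    [2] - [n] / [n + 1] = [n + 2] / [n + 1]. *)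
Lemma clasp_kill_aux s n : (s + n <= N)%N ->
  [/\ forall i, (s <= i)%N -> (i.+1 < s + n)%N -> e i * clasp_at e s n = 0 &
      forall i, (s <= i)%N -> (i.+1 < s + n)%N -> clasp_at e s n * e i = 0].
Proof.
elim/ltn_ind: n => -[|m] IH le_N; first by split=> i *; lia.
have [|kl kr] := IH m (ltnSn m); first by lia.
have PP : clasp_at e s m * clasp_at e s m = clasp_at e s m by apply: clasp_fixl.
have [m0|m_gt0] := posnP m; first by split=> i *; lia.
have [k Ek] : {k | m = k.+1} by exists m.-1; rewrite prednK.
pose P := clasp_at e s m; pose P' := clasp_at e s k.
pose f := e (s + m).-1; pose f' := e (s + k).-1.
have [||kl' kr'] := IH k; [by lia|by lia|].
have fP' : f * P' = P' * f.
  by rewrite /P' clasp_comm // => i si ik; rewrite /f e_far //; lia.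
have P'P : P' * P = P by apply: clasp_fixl => i si ik; apply: kl => //; lia.
have PP' : P * P' = P by apply: clasp_fixr => i si ik; apply: kr => //; lia.
have key : f * P * f * P = ([m.+1] / [m]) *: (f * P) /\
           P * f * P * f = ([m.+1] / [m]) *: (P * f).
  have [k0|k_gt0] := posnP k.
    rewrite /P Ek k0 clasp_atS clasp_at0 qn0 mul0r scale0r subr0 !mulr1 !mul1r /f e_sq; last by lia.
    by rewrite qn1 // divr1.
  have e1 : f * f' * f = f' * f * f' - f' + f.
    have -> : f = e (s + k).-1.+1 by rewrite /f Ek; congr e; lia.
    by rewrite /f' e_braid //; lia.
  have f'P : f' * P = 0 by apply: kl; lia.
  have Pf' : P * f' = 0 by apply: kr; lia.
  have ff : f * f = [2] *: f by apply: e_sq; lia.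
  have PE : P = P' - ([k] / [m]) *: (P' * f' * P') by rewrite /P Ek clasp_atS.
  have fPf : f * P * f = [2] *: (P' * f) - ([k] / [m]) *: (P' * (f' * f * f' - f' + f) * P').
    rewrite {1}PE mulrBr mulrBl zmr zml -e1; congr (_ - _ *: _).
      by rewrite fP' -mulrA ff zmr.
    by rewrite !mulrA fP' -!mulrA; congr (_ * _); rewrite fP'.
  have r := qn_ratio k; rewrite -Ek in r.
  split.
    rewrite fPf mulrBl zml zml -[_ * P' * P]mulrA P'P.
    rewrite -[P' * (_ + _) * P]mulrA mulrDl mulrBl -!mulrA f'P !mulr0 subr0 add0r.
    by rewrite mulrA -fP' -mulrA P'P -scalerBl r.
  have -> : P * f * P * f = P * (f * P * f) by rewrite !mulrA.
  rewrite fPf mulrBr zmr zmr.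
  rewrite !mulrA PP' mulrDr mulrBr !mulrA Pf' !mul0r subr0 add0r.
  by rewrite -[_ * f * P']mulrA fP' mulrA PP' -scalerBl r.
have c1 : [m] / [m.+1] * ([m.+1] / [m]) = 1.
  by rewrite mulrA divfK ?divff // vgen.
have [kf fk] := key.
split=> i si im; rewrite clasp_atS -/P -/f.
  have [Ei|ne] := eqVneq i (s + m).-1.
    by rewrite Ei -/f mulrBr zmr !mulrA kf scalerA c1 scale1r subrr.
  by rewrite mulrBr zmr !mulrA kl ?mul0r ?scaler0 ?subrr //; lia.
have [Ei|ne] := eqVneq i (s + m).-1.
  by rewrite Ei -/f mulrBl zml fk scalerA c1 scale1r subrr.
by rewrite mulrBl zml -!mulrA kr ?mulr0 ?scaler0 ?subrr //; lia.
Qed.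

Lemma clasp_killl s n i : (s + n <= N)%N -> (s <= i)%N -> (i.+1 < s + n)%N ->
  e i * clasp_at e s n = 0.
Proof. by move=> h; case: (clasp_kill_aux h) => k _; apply: k. Qed.

Lemma clasp_killr s n i : (s + n <= N)%N -> (s <= i)%N -> (i.+1 < s + n)%N ->
  clasp_at e s n * e i = 0.
Proof. by move=> h; case: (clasp_kill_aux h) => _ k; apply: k. Qed.

Lemma clasp_absl s n s' n' : (s + n <= N)%N -> (s <= s')%N -> (s' + n' <= s + n)%N ->
  clasp_at e s' n' * clasp_at e s n = clasp_at e s n.
Proof. by move=> *; apply: clasp_fixl => i *; apply: clasp_killl; lia. Qed.

Lemma clasp_absr s n s' n' : (s + n <= N)%N -> (s <= s')%N -> (s' + n' <= s + n)%N ->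
  clasp_at e s n * clasp_at e s' n' = clasp_at e s n.
Proof. by move=> *; apply: clasp_fixr => i *; apply: clasp_killr; lia. Qed.

Lemma clasp_idem s n : (s + n <= N)%N ->
  clasp_at e s n * clasp_at e s n = clasp_at e s n.
Proof. by move=> *; apply: clasp_absl. Qed.

Lemma clasp_e_comm s n i : (s + n <= N)%N -> (i.+1 < N)%N ->
  (i.+1 < s)%N || (s + n <= i)%N -> clasp_at e s n * e i = e i * clasp_at e s n.
Proof.
move=> sn iN h; apply: clasp_comm => j sj jn.
by case/orP: h => h; [rewrite -e_far|rewrite e_far] => //; lia.
Qed.

Lemma clasp_clasp_comm s n s' n' : (s + n <= s')%N -> (s' + n' <= N)%N ->
  clasp_at e s n * clasp_at e s' n' = clasp_at e s' n' * clasp_at e s n.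
Proof.
move=> h1 h2; apply: clasp_comm => i si is_; symmetry.
by apply: clasp_e_comm; lia.
Qed.

End Kill.

(** Reading the N strands from right to left. *)
Definition flip N (e : nat -> R) i := e (N - i.+2)%N.

Lemma flip_hecke e N : hecke e N -> hecke (flip N e) N.
Proof.
case=> sq far br; split=> [i iN|i j ij jN|i iN]; rewrite /flip.
- by apply: sq; lia.
- by rewrite -far //; lia.
- have := br (N - i.+3)%N; have -> : (N - i.+3).+1 = (N - i.+2)%N by lia.
  by move=> -> //; lia.
Qed.

(** The clasp is characterized by its absorption and annihilation properties,
    which are symmetric; hence its recursion may be run from either side. *)
Lemma flip_clasp e N s n : hecke e N -> (s + n <= N)%N ->
  clasp_at (flip N e) s n = clasp_at e (N - s - n) n.
Proof.
move=> eH snN; have fH := flip_hecke eH.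
transitivity (clasp_at e (N - s - n) n * clasp_at (flip N e) s n).
  rewrite clasp_fixl // => i si isn.
  have -> : e i = flip N e (N - i.+2)%N by rewrite /flip; congr e; lia.
  by apply: (clasp_killl fH); lia.
rewrite clasp_fixr // => i si isn.
by rewrite /flip; apply: (clasp_killr eH); lia.
Qed.

Lemma clasp_recl e N s n : hecke e N -> (s + n.+1 <= N)%N ->
  clasp_at e s n.+1 = clasp_at e s.+1 n -
    ([n] / [n.+1]) *: (clasp_at e s.+1 n * e s * clasp_at e s.+1 n).
Proof.
move=> eH snN; have fH := flip_hecke eH.
have := flip_clasp (s := N - s - n.+1) (n := n.+1) eH.
have -> : (N - (N - s - n.+1) - n.+1 = s)%N by lia.
move=> <-; last by lia.
rewrite clasp_atS flip_clasp //; last by lia.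
have -> : (N - (N - s - n.+1) - n = s.+1)%N by lia.
have [->|n_gt0] := posnP n; first by rewrite qn0 mul0r !scale0r.
have -> : flip N e (N - s - n.+1 + n).-1 = e s by rewrite /flip; congr e; lia.
by [].
Qed.

End Hecke.

(** * Ladders between pairs of clasps *)

(** Two side by side clasps, of widths c and N - c. *)
HB.lock Definition ladder (F : fieldType) (v : F) (R : algType F) (e : nat -> R) (N c : nat) : R :=
  clasp_at v e 0 c * clasp_at v e c (N - c).

Section Ladder.
Variables (F : fieldType) (v : F) (R : algType F).
Hypothesis vgen : generic_q v.
Local Notation "[ n ]" := (qn v n) (at level 0, format "[ n ]").
Local Notation clasp_at := (@clasp_at F v R).
Variables (e : nat -> R) (N : nat).
Hypothesis eH : hecke v e N.
Local Notation lad := (ladder v e N).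

Lemma ladderE c : lad c = clasp_at e 0 c * clasp_at e c (N - c).
Proof. by rewrite ladder.unlock. Qed.

Lemma ladderE' c : (c <= N)%N -> lad c = clasp_at e c (N - c) * clasp_at e 0 c.
Proof. by move=> cN; rewrite ladder.unlock (clasp_clasp_comm eH) //; lia. Qed.

Lemma lad_absr c s n : (c <= N)%N -> (s + n <= c)%N || (c <= s)%N && (s + n <= N)%N ->
  lad c * clasp_at e s n = lad c.
Proof.
move=> cN /orP[h|/andP[h1 h2]].
  by rewrite (ladderE' cN) -mulrA (clasp_absr vgen eH) //; lia.
by rewrite ladder.unlock -mulrA (clasp_absr vgen eH) //; lia.
Qed.

Lemma lad_absl c s n : (c <= N)%N -> (s + n <= c)%N || (c <= s)%N && (s + n <= N)%N ->
  clasp_at e s n * lad c = lad c.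
Proof.
move=> cN /orP[h|/andP[h1 h2]].
  by rewrite ladder.unlock mulrA (clasp_absl vgen eH) //; lia.
by rewrite (ladderE' cN) mulrA (clasp_absl vgen eH) //; lia.
Qed.

Lemma lad_idem c : (c <= N)%N -> lad c * lad c = lad c.
Proof. by move=> cN; rewrite {2}ladder.unlock mulrA !lad_absr //; lia. Qed.

(** A chain of ladders can be shortened as long as the widths are monotone: the
    intermediate clasps are absorbed. *)
Lemma lad_up a b c : (a <= b)%N -> (b <= c)%N -> (c <= N)%N ->
  lad c * lad b * lad a = lad c * lad a.
Proof.
move=> ab bc cN; rewrite {2}ladder.unlock mulrA [lad c * _]lad_absr; [|lia|lia].
by rewrite -mulrA lad_absl //; lia.
Qed.

Lemma lad_down a b c : (c <= b)%N -> (b <= a)%N -> (a <= N)%N ->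
  lad c * lad b * lad a = lad c * lad a.
Proof.
move=> cb ba aN; rewrite (@ladderE' b); last lia.
rewrite mulrA [lad c * _]lad_absr; [|lia|lia].
by rewrite -mulrA lad_absl //; lia.
Qed.

Lemma lad_turn_up a : (a < N)%N -> lad a * lad a.+1 * lad a =
  lad a - ([a] / [a.+1]) *: (lad a * e a.-1 * lad a).
Proof.
move=> aN; have aN' := ltnW aN.
have -> : lad a * lad a.+1 * lad a = lad a * clasp_at e 0 a.+1 * lad a.
  by rewrite {2}ladder.unlock -!mulrA (lad_absl (c := a)) //; lia.
rewrite clasp_atS mulrBr mulrBl zmr zml !mulrA lad_absr //; last lia.
by rewrite lad_idem // -[_ * _ * lad a]mulrA lad_absl //; lia.
Qed.

Lemma lad_turn_down a : (a < N)%N -> lad a.+1 * lad a * lad a.+1 =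
  lad a.+1 - ([N - a.+1] / [N - a]) *: (lad a.+1 * e a * lad a.+1).
Proof.
move=> aN.
have -> : lad a.+1 * lad a * lad a.+1 = lad a.+1 * clasp_at e a (N - a) * lad a.+1.
  by rewrite {2}ladder.unlock mulrA lad_absr //; lia.
have E : (N - a = (N - a.+1).+1)%N by lia.
rewrite E (clasp_recl vgen eH); last by lia.
rewrite mulrBr mulrBl zmr zml !mulrA lad_absr //; last lia.
by rewrite lad_idem // -[_ * _ * lad a.+1]mulrA lad_absl //; lia.
Qed.

(** A ladder that turns back after one step is a combination of the identity and
    the ladder that turns back one step further: both are affine in the single
    element e b between the clasps. *)
Lemma lad_turn1 b : (b.+1 <= N)%N ->
  let y := [b.+2] * [N - b.+1] / ([b.+1] * [N - b]) in
  lad b.+1 * lad b * lad b.+1 = (1 - y) *: lad b.+1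
     + y *: (lad b.+1 * lad b.+2 * lad b.+1).
Proof.
move=> bN /=; have g1 := vgen (ltn0Sn b); have g2 : [N - b] != 0 by apply: vgen; lia.
rewrite lad_turn_down //.
have [E|ne] := eqVneq b.+1 N.
  by rewrite E subnn qn0 !(mul0r, mulr0) !scale0r !subr0 addr0 scale1r.
rewrite lad_turn_up; last by lia.
rewrite /= scalerBl scale1r scalerBr addrA subrK scalerA; congr (_ - _ *: _).
by field; rewrite g1 g2 vgen.
Qed.

(** Iterating the one-step turn gives the multiplication rule of the rungs. *)
Lemma lad_turn b r : (b + r.+1 <= N)%N -> let c := (b + r.+1)%N in
  let y := [c.+1] * [N - c] / ([b.+1] * [N - b]) in
  lad b.+1 * lad b * lad c = (1 - y) *: (lad b.+1 * lad c)
     + y *: (lad b.+1 * lad c.+1 * lad c).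
Proof.
elim: r b => [|r IH] b cN.
  by rewrite addn1 /= lad_idem ?lad_turn1 //; lia.
move=> c y.
have bN : (b < N)%N by lia.
have E1 : lad b.+1 * lad b * lad c = lad b.+1 * lad b * lad b.+1 * lad c.
  by rewrite -![lad b.+1 * lad b * _]mulrA -mulrA lad_down //; lia.
have Ec : (b.+1 + r.+1 = c)%N by rewrite /c; lia.
have := IH b.+1; rewrite Ec => /(_ cN) /=.
set y2 := _ / _ => IH2.
have := lad_turn1 bN; set y1 := _ / _ => /= t1.
have Ey : y1 * y2 = y.
  have h1 : [b.+1] != 0 by apply: vgen.
  have h2 : [b.+2] != 0 by apply: vgen.
  have h3 : [N - b] != 0 by apply: vgen; lia.
  have h4 : [N - b.+1] != 0 by apply: vgen; lia.
  by rewrite /y1 /y2 /y; field; rewrite h1 h2 h3 h4.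
rewrite E1 t1 mulrDl !zml -!mulrA [lad b.+2 * (_ * _)]mulrA IH2 mulrDr !zmr.
rewrite mulrA lad_down; [|lia|lia|lia].
have -> : y2 *: (lad b.+1 * (lad b.+2 * lad c.+1 * lad c)) = y2 *: (lad b.+1 * lad c.+1 * lad c).
  have [E|ne] := eqVneq c N; first by rewrite /y2 E subnn qn0 mulr0 mul0r !scale0r.
  by rewrite !mulrA lad_down //; rewrite ?/c; lia.
rewrite scalerDr !scalerA Ey addrA -scalerDl -mulrA; congr (_ *: _ + _).
by rewrite mulrBr mulr1 Ey addrA subrK.
Qed.
End Ladder.

(** * The commutative algebra of rungs *)

Section Spectrum.
Variables (F : fieldType) (v : F) (R : algType F).
Hypothesis vgen : generic_q v.
Local Notation "[ n ]" := (qn v n) (at level 0, format "[ n ]").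

(** The strands of the two bundles n and b are regrouped as n + r and b - r, and
    back.  These elements span the algebra in which all the twists of a parallel
    column live. *)
Definition rung (e : nat -> R) (n b r : nat) : R :=
  ladder v e (n + b) n * ladder v e (n + b) (n + r) * ladder v e (n + b) n.

(** The spectrum of the one-step rung, up to an affine change: multiplication by
    rung 1 sends rung r to a combination of rung r and rung r + 1, with
    diagonal entries 1 - level r / level 0. *)
Definition level n b s : F := [n + s.+1] * [b - s].

(** The eigenvalue of rung r at the point z of the spectrum, obtained by solving
    the two-term recursion of the rungs. *)
Definition rung_eig n b r (z : F) : F :=
  \prod_(s < r) ((level n b s - z) / level n b s).

(** The element x is a combination of rungs whose eigenvalue at the point z u is
    a u, for u < U.  Products of such elements are then computed pointwise,
    without knowing that the rungs are linearly independent. *)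
Definition rep (e : nat -> R) (n b U : nat) (z : nat -> F) (x : R) (a : nat -> F) :=
  exists c : nat -> F, x = \sum_(r < b.+1) c r *: rung e n b r /\
    forall u, (u < U)%N -> a u = \sum_(r < b.+1) c r * rung_eig n b r (z u).

Lemma level_neq0 n b s : (s < b)%N -> level n b s != 0.
Proof. by move=> sb; rewrite mulf_neq0 // vgen //; lia. Qed.

Section Fix.
Variables (e : nat -> R) (n b U : nat) (z : nat -> F).
Hypothesis eH : hecke v e (n + b).
Local Notation X := (rung e n b).
Local Notation Y := (level n b).
Local Notation lad := (ladder v e (n + b)).
Local Notation rep' := (rep e n b U z).

Lemma rep_eq x a a' : (forall u, (u < U)%N -> a u = a' u) -> rep' x a -> rep' x a'.
Proof. by move=> E [c [-> h]]; exists c; split=> // u uU; rewrite -E // h. Qed.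

Lemma rep0 : rep' 0 (fun=> 0).
Proof.
by exists (fun=> 0); split=> [|u _]; rewrite big1 // => r _; rewrite ?scale0r ?mul0r.
Qed.

Lemma rep_lin k x a x' a' : rep' x a -> rep' x' a' ->
  rep' (k *: x + x') (fun u => k * a u + a' u).
Proof.
move=> [c [-> h]] [c' [-> h']]; exists (fun r => k * c r + c' r); split=> [|u uU].
  rewrite scaler_sumr -big_split; apply: eq_bigr => r _ /=.
  by rewrite scalerDl scalerA.
rewrite h // h' // mulr_sumr -big_split; apply: eq_bigr => r _ /=.
by rewrite mulrDl mulrA.
Qed.

Lemma rep_add x a x' a' : rep' x a -> rep' x' a' -> rep' (x + x') (fun u => a u + a' u).
Proof.
move=> h h'; have := rep_lin 1 h h'; rewrite scale1r; apply: rep_eq => u _.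
by rewrite mul1r.
Qed.

Lemma rep_scale k x a : rep' x a -> rep' (k *: x) (fun u => k * a u).
Proof.
move=> h; have := rep_lin k h rep0; rewrite addr0; apply: rep_eq => u _.
by rewrite addr0.
Qed.

Lemma rep_sum m (x : nat -> R) (a : nat -> nat -> F) :
  (forall r, (r < m)%N -> rep' (x r) (a r)) ->
  rep' (\sum_(r < m) x r) (fun u => \sum_(r < m) a r u).
Proof.
elim: m => [|m IH] h.
  by rewrite big_ord0; apply: rep_eq rep0 => u _; rewrite big_ord0.
rewrite big_ord_recr; have h1 := IH (fun r hr => h r (ltnW hr)).
apply: rep_eq (rep_add h1 (h m (ltnSn m))) => u _.
by rewrite big_ord_recr.
Qed.

Lemma rep_rung r : (r <= b)%N -> rep' (X r) (fun u => rung_eig n b r (z u)).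
Proof.
move=> rb; exists (fun s => (s == r)%:R); split=> [|u uU].
  rewrite (bigD1 (Ordinal (rb : (r < b.+1)%N))) //= eqxx scale1r big1 ?addr0 // => s.
  by rewrite -val_eqE /= => /negPf->; rewrite scale0r.
rewrite (bigD1 (Ordinal (rb : (r < b.+1)%N))) //= eqxx mul1r big1 ?addr0 // => s.
by rewrite -val_eqE /= => /negPf->; rewrite mul0r.
Qed.

Lemma rep_map (f : {linear R -> R}) (g : nat -> F) x a :
  (forall r, (r <= b)%N -> rep' (f (X r)) (fun u => g u * rung_eig n b r (z u))) ->
  rep' x a -> rep' (f x) (fun u => g u * a u).
Proof.
move=> h [c [-> ha]].
have : rep' (\sum_(r < b.+1) c r *: f (X r))
   (fun u => \sum_(r < b.+1) c r * (g u * rung_eig n b r (z u))).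
  apply: (rep_sum (x := fun r => c r *: f (X r))
    (a := fun r u => c r * (g u * rung_eig n b r (z u)))) => r rb.
  by apply: rep_scale; apply: h.
rewrite linear_sum; under [X in _ -> rep' X _]eq_bigr do rewrite linearZ.
apply: rep_eq => u uU; rewrite ha // mulr_sumr; apply: eq_bigr => r _.
by rewrite mulrCA.
Qed.

Lemma rung0 : X 0 = lad n.
Proof. by rewrite /rung addn0 !(lad_idem vgen eH) //; lia. Qed.

Lemma lad_rung r : lad n * X r = X r.
Proof. by rewrite /rung !mulrA (lad_idem vgen eH) //; lia. Qed.

(** This is the turning rule of ladders; it makes the rungs a commutative
    algebra generated by the first one. *)
Lemma rung_step r : (r <= b)%N ->
  Y 0 *: (X 1 * X r) = (Y 0 - Y r) *: X r + Y r *: X r.+1.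
Proof.
case: r => [|r] rb; first by rewrite rung0 subrr scale0r add0r /rung -mulrA (lad_idem vgen eH) //; lia.
have Y0 : Y 0 != 0 by apply: level_neq0; lia.
have rn : (n + r.+1 <= n + b)%N by lia.
have /= := lad_turn vgen eH rn.
have E1 : (n + b - (n + r.+1) = b - r.+1)%N by lia.
have E2 : (n + b - n = b)%N by lia.
rewrite E1 E2; set y := _ / _ => T.
have Ey : Y 0 * y = Y r.+1.
  move: Y0; rewrite /y /level addn1 subn0 => Y0.
  by rewrite mulrC divfK // !addnS.
have -> : X 1 * X r.+1 = lad n * (lad n.+1 * lad n * lad (n + r.+1)) * lad n.
  rewrite /rung addn1 !mulrA; congr (_ * _ * _); rewrite -!mulrA; do 2!congr (_ * _).
  by rewrite (lad_idem vgen eH) //; lia.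
rewrite T mulrDr mulrDl !zmr !zml scalerDr !scalerA mulrBr mulr1 Ey.
congr (_ *: _ + _).
  by rewrite mulrA (lad_down vgen eH) //; lia.
have [E|ne] := eqVneq r.+1 b; first by rewrite /level E subnn qn0 mulr0 !scale0r.
congr (_ *: _); rewrite /rung addnS !mulrA (lad_down vgen eH); [|lia|lia|lia].
by rewrite -[_ * lad (n + r).+2 * _ * _]mulrA -mulrA [_ * (_ * lad n)]mulrA !addnS (lad_up vgen eH) ?mulrA //; lia.
Qed.

Hypothesis zspec : forall u, (u < U)%N -> exists2 s, (s <= b)%N & z u = Y s.

Lemma rung_eigS r x : (r < b)%N ->
  Y r * rung_eig n b r.+1 x = (Y r - x) * rung_eig n b r x.
Proof.
move=> rb; rewrite /rung_eig big_ord_recr /= mulrCA; rewrite mulrC; congr (_ * _).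
by rewrite mulrC divfK // level_neq0.
Qed.

(** The recursion stops at r = b because the last factor vanishes on the
    spectrum; this is where the points z u must be eigenvalues. *)
Lemma rung_eig_top u : (u < U)%N -> z u * rung_eig n b b (z u) = 0.
Proof.
move=> uU; have [s sb ->] := zspec uU.
have [E|ne] := eqVneq s b; first by rewrite E /level subnn qn0 mulr0 mul0r.
have sb' : (s < b)%N by rewrite ltn_neqAle ne.
by rewrite /rung_eig (bigD1 (Ordinal sb')) //= subrr mul0r mul0r mulr0.
Qed.

Lemma rep_step x a : rep' x a ->
  rep' (Y 0 *: (X 1 * x)) (fun u => (Y 0 - z u) * a u).
Proof.
move=> h.
have lf : linear (fun x : R => Y 0 *: (X 1 * x)).
  by move=> k y y'; rewrite mulrDr scalerDr zmr scalerA mulrC -scalerA.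
pose f : {linear R -> R} := HB.pack (fun x : R => Y 0 *: (X 1 * x))
  (GRing.isLinear.Build F R R *:%R _ lf).
apply: (rep_map (f := f)) h => r rb /=; rewrite rung_step //.
have h1 := rep_scale (Y 0 - Y r) (rep_rung rb).
have [E|ne] := eqVneq r b.
  have Yb : Y b = 0 by rewrite /level subnn qn0 mulr0.
  move: h1; rewrite E Yb scale0r subr0 addr0; apply: rep_eq => u uU.
  by rewrite mulrBl rung_eig_top ?subr0.
have rb' : (r < b)%N by rewrite ltn_neqAle ne.
apply: rep_eq (rep_add h1 (rep_scale (Y r) (rep_rung rb'))) => u uU.
by rewrite rung_eigS // -mulrDl addrA subrK.
Qed.

(** Every rung is a polynomial in rung 1, on which both sides agree by the
    two-term recursion. *)
Lemma rep_mul x a x' a' : rep' x a -> rep' x' a' -> rep' (x * x') (fun u => a' u * a u).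
Proof.
move=> hx hx'.
have lf : linear (fun x : R => x * x').
  by move=> k y y'; rewrite mulrDl zml.
pose f : {linear R -> R} := HB.pack (fun x : R => x * x')
  (GRing.isLinear.Build F R R *:%R _ lf).
have lx : lad n * x' = x'.
  case: hx' => c [-> _]; rewrite mulr_sumr; apply: eq_bigr => r _.
  by rewrite zmr lad_rung.
apply: (rep_map (f := f)) hx => r rb /=.
elim: r rb => [_|r IH rb].
  rewrite rung0 lx; apply: rep_eq hx' => u _; by rewrite /rung_eig big_ord0 mulr1.
have Yr := level_neq0 n rb.
have -> : X r.+1 * x' = (Y r)^-1 *: (Y 0 *: (X 1 * (X r * x')) + (- (Y 0 - Y r)) *: (X r * x')).
  rewrite mulrA -zml rung_step; last exact: ltnW.
  by rewrite mulrDl !zml addrAC scaleNr subrr add0r scalerA mulVf // scale1r.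
have IH' := IH (ltnW rb).
apply: rep_eq (rep_scale _ (rep_add (rep_step IH') (rep_scale _ IH'))) => u uU.
apply: (mulfI Yr); rewrite mulVKf // [RHS]mulrCA rung_eigS //.
by ring.
Qed.

Lemma rep_unit : rep' (lad n) (fun=> 1).
Proof.
by rewrite -rung0; apply: rep_eq (rep_rung (leq0n b)) => u _; rewrite /rung_eig big_ord0.
Qed.

Lemma rep_exp x a k : rep' x a -> rep' (iter k ( *%R x) (lad n)) (fun u => a u ^+ k).
Proof.
move=> hx; elim: k => [|k IH] /=; first exact: rep_unit.
by apply: rep_eq (rep_mul hx IH) => u _; rewrite exprSr.
Qed.

End Fix.

Lemma flip_ladder (e : nat -> R) N c : hecke v e N -> (c <= N)%N ->
  ladder v (flip N e) N c = ladder v e N (N - c).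
Proof.
move=> eH cN; rewrite (ladderE' eH) ?leq_subr // ladder.unlock !(flip_clasp vgen eH); [|lia|lia].
by congr (clasp_at _ _ _ _ * clasp_at _ _ _ _); lia.
Qed.

Lemma flip_rung (e : nat -> R) n b r : hecke v e (n + b) -> (r <= n)%N ->
  rung (flip (b + n) e) b n r =
  ladder v e (n + b) n * ladder v e (n + b) (n - r) * ladder v e (n + b) n.
Proof.
rewrite addnC => eH rn; rewrite /rung !flip_ladder //; try lia.
by congr (ladder _ _ _ _ * ladder _ _ _ _ * ladder _ _ _ _); lia.
Qed.

(** Moving a strand from the first bundle to the second or the other way round
    involves the same middle generator, so both elements are affine functions
    of it. *)
Lemma rung_up_down (e : nat -> R) n b : hecke v e (n + b) -> (0 < n + b)%N ->
  level n b 0 *: rung e n b 1 - level b n 0 *: rung (flip (b + n) e) b n 1 =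
  (level n b 0 - level b n 0) *: ladder v e (n + b) n.
Proof.
move=> eH nb; pose M := ladder v e (n + b) n * e n.-1 * ladder v e (n + b) n.
have -> : level n b 0 *: rung e n b 1 =
    level n b 0 *: ladder v e (n + b) n - ([n] * [b]) *: M.
  have [->|b0] := posnP b; first by rewrite /level qn0 !mulr0 !scale0r subr0.
  rewrite /rung addn1 (lad_turn_up vgen eH); last by lia.
  rewrite scalerBr scalerA /level addn1 subn0; congr (_ - _ *: _).
  by have := vgen (ltn0Sn n) => h; field.
have -> : level b n 0 *: rung (flip (b + n) e) b n 1 =
    level b n 0 *: ladder v e (n + b) n - ([n] * [b]) *: M.
  case: n eH nb @M => [|n] eH nb M; first by rewrite /level qn0 mulr0 mul0r !scale0r subr0.
  rewrite flip_rung // subSS subn0 (lad_turn_down vgen eH) /M //=; last by lia.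
  have -> : (n.+1 + b - n.+1 = b)%N by lia.
  have -> : (n.+1 + b - n = b.+1)%N by lia.
  rewrite scalerBr scalerA /level addn1 subn0; congr (_ - _ *: _).
  by have := vgen (ltn0Sn b) => h; field.
by rewrite opprB addrA subrK scalerBl.
Qed.

(** By the affine relation between the two one-step rungs, the eigenvalues do not
    depend on the side from which the rungs are read; only the polynomial
    expressing the element changes. *)
Lemma rep_flip (e : nat -> R) n b U z x a : hecke v e (n + b) -> (0 < n + b)%N ->
  (forall u, (u < U)%N -> exists2 s, (s <= b)%N & z u = level n b s) ->
  rep (flip (b + n) e) b n U z x a -> rep e n b U z x a.
Proof.
move=> eH nb zs [c [-> h]].
have eH' : hecke v e (b + n) by rewrite addnC.
have fH := flip_hecke eH'.
have key r : (r <= n)%N ->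
    rep e n b U z (rung (flip (b + n) e) b n r) (fun u => rung_eig b n r (z u)).
  elim: r => [_|r IH rn].
    rewrite (rung0 fH) flip_ladder //; last by lia.
    rewrite addKn addnC; apply: rep_eq (rep_unit _ _ eH) => u _.
    by rewrite /rung_eig big_ord0.
  have Yr := level_neq0 b rn.
  pose X' := rung (flip (b + n) e) b n.
  have lX : ladder v e (n + b) n * X' r = X' r.
    by rewrite /X' flip_rung //; [rewrite !mulrA (lad_idem vgen eH) //; lia|exact: ltnW].
  have ud := rung_up_down eH nb.
  rewrite -/X'; have -> : X' r.+1 = (level b n r)^-1 *: (level n b 0 *: (rung e n b 1 * X' r) +
      (level b n r - level n b 0) *: X' r).
    rewrite -zml; move/eqP: ud; rewrite subr_eq => /eqP ->.
    rewrite mulrDl !zml lX rung_step //; last exact: ltnW.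
    apply: (canRL (scalerK Yr)); rewrite addrA -scalerDl addrAC -scalerDl.
    rewrite [X in _ = X *: X' r + _](_ : _ = 0) ?scale0r ?add0r //; by ring.
  have IH' := IH (ltnW rn).
  apply: rep_eq (rep_scale _ (rep_add (rep_step eH zs IH') (rep_scale _ IH'))) => u uU.
  apply: (mulfI Yr); rewrite mulVKf // rung_eigS //.
  by ring.
apply: rep_eq (rep_sum (x := fun r => c r *: rung (flip (b + n) e) b n r)
   (a := fun r u => c r * rung_eig b n r (z u)) _).
  by move=> u uU; rewrite h.
by move=> r rn; apply: rep_scale; apply: key.
Qed.

End Spectrum.

(** * Eigenvalues under lifts and partial traces *)

Section Numbers.
Variables (F : fieldType) (v : F).
Hypothesis vgen : generic_q v.
Local Notation "[ n ]" := (qn v n) (at level 0, format "[ n ]").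

(** The quantum integer [a - b], allowed to be negative. *)
Definition dq (a b : nat) : F := (v ^+ a / v ^+ b - v ^+ b / v ^+ a) / (v - v^-1).

Lemma dqE a b : (b <= a)%N -> dq a b = [a - b].
Proof.
move=> ba; rewrite /dq qn.unlock -{1 2}(subnK ba) exprD.
have h1 := vX_neq0 vgen (a - b); have h2 := vX_neq0 vgen b.
by congr (_ / _); field; rewrite h1 h2.
Qed.

Lemma dqxx a : dq a a = 0.
Proof. by rewrite dqE // subnn qn0. Qed.

Lemma dqSS a b : dq a.+1 b.+1 = dq a b.
Proof.
have v0 := v_neq0 vgen; have h1 := vX_neq0 vgen a; have h2 := vX_neq0 vgen b.
by rewrite /dq !exprS; congr (_ / _); field; rewrite h1 h2 v0.
Qed.

Lemma qnE n : [n] = (v ^+ n - (v ^+ n)^-1) / (v - v^-1).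
Proof. by rewrite qn.unlock. Qed.

(** Differences of levels factor, so that eigenvalues of rungs are products of
    quantum integers. *)
Lemma level_diff b K s u : (s <= b)%N -> (u <= b)%N ->
  level v (b + K) b s - level v (b + K) b u = dq u s * [u + s + K + 1].
Proof.
move=> sb ub; rewrite /level -!dqE // !qnE /dq !exprD !exprS expr0.
have v0 := v_neq0 vgen; have d0 := qden_neq0 vgen.
have h1 := vX_neq0 vgen s; have h2 := vX_neq0 vgen b; have h3 := vX_neq0 vgen u.
have h4 := vX_neq0 vgen K.
move: (v ^+ s) (v ^+ b) (v ^+ u) (v ^+ K) (v - v^-1) h1 h2 h3 h4 d0.
move=> S B U KK D h1 h2 h3 h4 d0; by field; rewrite h1 h2 h3 h4 v0 d0.
Qed.

Lemma level_diff' b K s u : (s <= b + K)%N -> (u <= b)%N ->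
  level v b (b + K) s - level v (b + K) b u = dq (u + K) s * [u + s + 1].
Proof.
move=> sb ub; rewrite /level -!dqE // !qnE /dq !exprD !exprS expr0.
have v0 := v_neq0 vgen; have d0 := qden_neq0 vgen.
have h1 := vX_neq0 vgen s; have h2 := vX_neq0 vgen b; have h3 := vX_neq0 vgen u.
have h4 := vX_neq0 vgen K.
move: (v ^+ s) (v ^+ b) (v ^+ u) (v ^+ K) (v - v^-1) h1 h2 h3 h4 d0.
move=> S B U KK D h1 h2 h3 h4 d0; by field; rewrite h1 h2 h3 h4 v0 d0.
Qed.

Lemma level_diffn n b K s u : n = (b + K)%N -> (s <= b)%N -> (u <= b)%N ->
  level v n b s - level v n b u = dq u s * [u + s + K + 1].
Proof. by move->; exact: level_diff. Qed.

Lemma level_diffn' n b K s u : n = (b + K)%N -> (s <= n)%N -> (u <= b)%N ->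
  level v b n s - level v n b u = dq (u + K) s * [u + s + 1].
Proof. by move->; exact: level_diff'. Qed.

Lemma dq_n0 u : dq u 0 = [u].
Proof. by rewrite dqE // subn0. Qed.

Lemma rung_eig_recr n b r z :
  rung_eig v n b r.+1 z = rung_eig v n b r z * ((level v n b r - z) / level v n b r).
Proof. by rewrite /rung_eig big_ord_recr. Qed.

Lemma rung_eig0 n b z : rung_eig v n b 0 z = 1.
Proof. by rewrite /rung_eig big_ord0. Qed.

(** Adding a parallel strand to a bundle merges neighbouring spectral points: the
    new eigenvalue at u is an average of the old ones at u and u - 1, with these
    weights. *)
Definition lift_stay k b u : F := [u + k.+1] * [b.+1 - u] / ([b.+1] * [2 * u + k.+1]).
Definition lift_down k b u : F := [u] * [b + k.+1 + u + 1] / ([b.+1] * [2 * u + k.+1]).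

Lemma lift_sum k b u : (u <= b.+1)%N -> lift_stay k b u + lift_down k b u = 1.
Proof.
move=> ub; rewrite /lift_stay /lift_down -mulrDl.
have h1 : [b.+1] != 0 by apply: vgen.
have h2 : [2 * u + k.+1] != 0 by apply: vgen; lia.
apply: (canLR (mulfK _)); rewrite ?mulf_neq0 // mul1r -dqE //.
rewrite !qnE /dq mul2n -addnn !exprD !exprS expr0.
have v0 := v_neq0 vgen; have d0 := qden_neq0 vgen.
have h3 := vX_neq0 vgen b; have h4 := vX_neq0 vgen u; have h5 := vX_neq0 vgen k.
move: (v ^+ b) (v ^+ u) (v ^+ k) (v - v^-1) h3 h4 h5 d0.
by move=> B U KK D h3 h4 h5 d0; field; rewrite h3 h4 h5 v0 d0.
Qed.

(** All the rungs involved share the factor G, after which the claim is a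
    three-term identity between quantum integers. *)
Lemma lift_eig_pre k b r u : (r.+1 <= b)%N -> (u < b)%N -> let n := (b + k.+1)%N in
  exists G,
  [/\ rung_eig v n b r.+1 (level v n b u.+1) = [u.+1] * [u + r + k + 3] * G,
      rung_eig v n b r.+1 (level v n b u) = dq u r * [u + k + 2] * G &
      rung_eig v n b.+1 r.+1 (level v n b.+1 u.+1) =
         [u.+1] * [u + k + 2] * ([b - r] / [b.+1]) * G].
Proof.
move=> rb ub n; elim: r rb => [|r IH] rb.
  exists (level v n b 0)^-1; rewrite !rung_eig_recr !rung_eig0 !mul1r.
  have Y0 : level v n b 0 != 0 by apply: level_neq0.
  rewrite !level_diff //; try lia.
  rewrite dq_n0 dq_n0; split; try by congr (_ * [_] / _); lia.
  have -> : n = (b.+1 + k)%N by rewrite /n addnS addSn.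
  rewrite level_diff //; last lia.
  rewrite dq_n0 /level !subn0.
  have h1 : [b.+1] != 0 by apply: vgen.
  have h2 : [b] != 0 by apply: vgen; lia.
  have h3 : [b.+1 + k + 1] != 0 by apply: vgen; lia.
  have -> : (u.+1 + 0 + k + 1 = u + k + 2)%N by lia.
  by field; rewrite h1 h2 h3.
have [G [E1 E2 E3]] := IH (ltnW rb).
have Y1 : level v n b r.+1 != 0 by apply: level_neq0.
exists (G * [u + r + k + 3] * dq u r / level v n b r.+1).
rewrite !(rung_eig_recr _ _ r.+1) E1 E2 E3 !level_diff //; try lia.
split.
- rewrite dqSS (_ : (u.+1 + r.+1 + k.+1 + 1)%N = (u + r.+1 + k + 3)%N); last lia.
  by ring.
- have -> : (u + r.+1 + k.+1 + 1 = u + r + k + 3)%N by lia.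
  by ring.
have E : n = (b.+1 + k)%N by rewrite /n addnS addSn.
rewrite (level_diffn E); [|lia|lia].
have h1 : [b.+1] != 0 by apply: vgen.
have h2 : [b - r] != 0 by apply: vgen; lia.
have h2' : [b - r.+1] != 0 by apply: vgen; lia.
have h3 : [n + r.+2] != 0 by apply: vgen; lia.
rewrite /level subSS dqSS.
have -> : (u.+1 + r.+1 + k + 1 = u + r + k + 3)%N by lia.
by field; rewrite h1 h2 h2' h3.
Qed.

(** The eigenvalues of a rung on one more strand satisfy the lifting rule; the
    rung itself is unchanged by the lift. *)
Lemma lift_eig k b r u : (r <= b)%N -> (u <= b.+1)%N -> let n := (b + k.+1)%N in
  rung_eig v n b.+1 r (level v n b.+1 u) =
  lift_stay k b u * rung_eig v n b r (level v n b u)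
   + lift_down k b u * rung_eig v n b r (level v n b u.-1).
Proof.
move=> rb ub n.
have [->|r_gt0] := posnP r; first by rewrite !rung_eig0 !mulr1 lift_sum.
case: r rb r_gt0 => // r rb _.
case: u ub => [|u] ub.
  rewrite /lift_down qn0 !mul0r addr0.
  by rewrite /rung_eig !big_ord_recl /= !subrr !mul0r mulr0.
have [E|ne] := eqVneq u b.
  have z0 m : level v n m m = 0 by rewrite /level subnn qn0 mulr0.
  have e1 m s : (s <= m)%N -> rung_eig v n m s 0 = 1.
    by move=> sm; rewrite /rung_eig big1 // => i _; have im := ltn_ord i; rewrite subr0 divff // level_neq0 //; lia.
  rewrite E /= !z0 !e1 //; last exact: leqW.
  have st0 : lift_stay k b b.+1 = 0 by rewrite /lift_stay subnn qn0 mulr0 mul0r.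
  by have := lift_sum k ub; rewrite E st0 add0r => ->; rewrite mul0r add0r mulr1.
have ub' : (u < b)%N by lia.
have [G [E1 E2 E3]] := lift_eig_pre k rb ub'.
rewrite -/n in E1 E2 E3; rewrite /= E1 E2 E3 /lift_stay /lift_down.
have h1 : [b.+1] != 0 by apply: vgen.
have h2 : [2 * u.+1 + k.+1] != 0 by apply: vgen; lia.
have -> : (u.+1 + k.+1 = u + k + 2)%N by lia.
have -> : (b + k.+1 + u.+1 + 1 = b + k + u + 3)%N by lia.
have key : [b - r] * [2 * u.+1 + k.+1] = [b.+1 - u.+1] * [u + r + k + 3] + [b + k + u + 3] * dq u r.
  rewrite subSS -!dqE //; try lia.
  rewrite !qnE /dq mul2n -addnn !exprD !exprS expr0.
  have v0 := v_neq0 vgen; have d0 := qden_neq0 vgen.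
  have h3 := vX_neq0 vgen b; have h4 := vX_neq0 vgen u; have h5 := vX_neq0 vgen k.
  have h6 := vX_neq0 vgen r.
  move: (v ^+ b) (v ^+ u) (v ^+ k) (v ^+ r) (v - v^-1) h3 h4 h5 h6 d0.
  by move=> B U KK S D h3 h4 h5 h6 d0; field; rewrite h3 h4 h5 h6 v0 d0.
transitivity ([u.+1] * [u + k + 2] * G * ([b - r] * [2 * u.+1 + k.+1]) / ([b.+1] * [2 * u.+1 + k.+1])).
  by field; rewrite h1 h2.
by rewrite key; field; rewrite h1 h2.
Qed.

(** Closing a strand of a bundle spreads an eigenvalue over two neighbouring
    spectral points, with these weights. *)
Definition trace_stay k b u : F := [u + k.+1] * [b.+2 - u] / ([b.+1] * [2 * u + k.+2]).
Definition trace_down k b u : F := [u.+1] * [b + k + u + 4] / ([b.+1] * [2 * u + k.+2]).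

(** As for lifts, the common factor G reduces the claim to an identity between
    three products of quantum integers. *)
Lemma trace_eig_pre k b r u : (r < b.+1 + k)%N -> (u <= b)%N -> let n := (b.+1 + k)%N in
  exists G,
  [/\ rung_eig v b.+1 n r.+1 (level v n b.+1 u) = dq (u + k) r * [u.+1] * G,
      rung_eig v b.+1 n r.+1 (level v n b.+1 u.+1) = [u + k.+1] * [u + r + 2] * G &
      rung_eig v b n r.+1 (level v n b u) =
         [u + k.+1] * [u.+1] * ([b + r.+2] / [b.+1]) * G].
Proof.
move=> rb ub n; elim: r rb => [|r IH] rb.
  exists (level v b.+1 n 0)^-1; rewrite !rung_eig_recr !rung_eig0 !mul1r.
  have Y0 : level v b.+1 n 0 != 0 by apply: level_neq0.
  rewrite !level_diff' //; try lia.
  rewrite !dq_n0; split; try by congr (_ * [_] / _); lia.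
    have -> : (u.+1 + k = u + k.+1)%N by lia.
    by congr (_ * [_] / _); lia.
  have E : n = (b + k.+1)%N by rewrite /n addSnnS.
  rewrite (level_diffn' E) // dq_n0 /level !subn0 addn0.
  have h1 : [b.+1] != 0 by apply: vgen.
  have h2 : [b + 2] != 0 by apply: vgen; lia.
  have h3 : [n] != 0 by apply: vgen; rewrite /n.
  rewrite !addn1 !addn2 in h2 *.
  by field; rewrite h1 h2 h3.
have [G [E1 E2 E3]] := IH (ltnW rb).
have Y1 : level v b.+1 n r.+1 != 0 by apply: level_neq0.
exists (G * [u + r + 2] * dq (u + k) r / level v b.+1 n r.+1).
rewrite !(rung_eig_recr _ _ r.+1) E1 E2 E3 !level_diff' //; try lia.
split.
- rewrite (_ : (u + r.+1 + 1)%N = (u + r + 2)%N); last lia.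
  by ring.
- rewrite (_ : (u.+1 + r.+1 + 1)%N = (u + r.+1 + 2)%N); last lia.
  by rewrite addSn dqSS; ring.
have E : n = (b + k.+1)%N by rewrite /n addSnnS.
rewrite (level_diffn' E); [|lia|lia].
have h1 : [b.+1] != 0 by apply: vgen.
have h2 : [b + r.+2] != 0 by apply: vgen; lia.
have h2' : [b + r.+3] != 0 by apply: vgen; lia.
have h3 : [n - r.+1] != 0 by apply: vgen; lia.
rewrite /level addnS dqSS addSn -addnS.
have -> : (u + r.+1 + 1 = u + r + 2)%N by lia.
rewrite (_ : (b + r.+2).+1 = (b + r.+3)%N); last by rewrite !addnS.
by field; rewrite h1 h2 h2' h3.
Qed.

(** The factor on the left is the ratio of quantum dimensions produced by closing
    one strand of a clasp. *)
Lemma trace_eig k b r u : (r <= b.+1 + k)%N -> (u <= b)%N -> let n := (b.+1 + k)%N in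
  ([b + r + 3] / [b + r + 1]) * rung_eig v b n r (level v n b u) =
  trace_stay k b u * rung_eig v b.+1 n r (level v n b.+1 u)
   + trace_down k b u * rung_eig v b.+1 n r (level v n b.+1 u.+1).
Proof.
move=> rb ub n.
have h1 : [b.+1] != 0 by apply: vgen.
have h2 : [2 * u + k.+2] != 0 by apply: vgen; lia.
have key r' : [b + r' + 3] * [2 * u + k.+2] = [b.+2 - u] * dq (u + k.+1) r' + [b + k + u + 4] * [u + r' + 1].
  rewrite -dqE //; try lia.
  rewrite !qnE /dq mul2n -addnn !exprD !exprS expr0.
  have v0 := v_neq0 vgen; have d0 := qden_neq0 vgen.
  have h3 := vX_neq0 vgen b; have h4 := vX_neq0 vgen u; have h5 := vX_neq0 vgen k.
  have h6 := vX_neq0 vgen r'.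
  move: (v ^+ b) (v ^+ u) (v ^+ k) (v ^+ r') (v - v^-1) h3 h4 h5 h6 d0.
  by move=> B U KK S D h3 h4 h5 h6 d0; field; rewrite h3 h4 h5 h6 v0 d0.
case: r rb => [|r] rb.
  have := key 0; rewrite !addn0 dq_n0 addn1 => key0.
  rewrite !rung_eig0 !mulr1 /trace_stay /trace_down addn1 -mulrDl.
  apply: (canRL (mulfK _)); first by rewrite mulf_neq0.
  rewrite mulrA divfK // key0; ring.
have [G [E1 E2 E3]] := trace_eig_pre rb ub.
rewrite -/n in E1 E2 E3; rewrite E1 E2 E3 /trace_stay /trace_down.
have h3 : [b + r.+2] != 0 by apply: vgen; lia.
have := key r.+1; rewrite (addnS u k) dqSS => keyr.
have -> : (b + r.+1 + 1 = b + r.+2)%N by lia.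
have -> : (u + r + 2 = u + r.+1 + 1)%N by lia.
transitivity ([(u + k).+1] * [u.+1] * G * ([b + r.+1 + 3] * [2 * u + k.+2]) / ([b.+1] * [2 * u + k.+2])).
  by field; rewrite h1 h2 h3.
by rewrite keyr; field; rewrite h1 h2.
Qed.

End Numbers.

(** * Braiding two clasped bundles *)

Section Braid.
Variables (F : fieldType) (v : F) (R : algType F).
Hypothesis vgen : generic_q v.
Local Notation "[ n ]" := (qn v n) (at level 0, format "[ n ]").

(** A positive crossing, up to the scalar q^(-1/6). *)
Definition braid_gen (e : nat -> R) i : R := v%:A - e i.

(** The strand s + a crosses the strands s, ..., s + a - 1. *)
Fixpoint chain (e : nat -> R) s a : R :=
  if a is a'.+1 then chain e s a' * braid_gen e (s + a') else 1.

(** The b strands on the right cross the a strands on the left one after the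
    other, as in the cable of a crossing. *)
Fixpoint bgrid (e : nat -> R) s a b : R :=
  if b is b'.+1 then chain e (s + b') a * bgrid e s a b' else 1.

(** A clasp is a polynomial in its generators, so it moves wherever they do. *)
Lemma clasp_intertwine (x : R) (e e' : nat -> R) s s' n :
  (forall i, (i.+1 < n)%N -> x * e (s + i)%N = e' (s' + i)%N * x) ->
  x * clasp_at v e s n = clasp_at v e' s' n * x.
Proof.
elim: n => [|m IH] h; first by rewrite !clasp_at0 mulr1 mul1r.
have fx := IH (fun i im => h i (ltnW im)).
rewrite !clasp_atS mulrBr mulrBl zml zmr fx.
case: m {IH} h fx => [|m] h fx; first by rewrite qn0 mul0r !scale0r.
congr (_ - _ *: _); rewrite !addnS -!pred_Sn !mulrA fx -!mulrA; congr (_ * _).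
by rewrite -fx !mulrA h.
Qed.

Section Fix.
Variables (e : nat -> R) (N : nat).
Hypothesis eH : hecke v e N.
Local Notation g := (braid_gen e).

Lemma braid_far i j : (i.+1 < j)%N -> (j.+1 < N)%N -> g i * e j = e j * g i.
Proof.
move=> ij jN; case: eH => _ far _.
by rewrite /braid_gen mulrBl mulrBr zml zmr mul1r mulr1 far.
Qed.

Lemma braid_far' i j : (i.+1 < j)%N -> (j.+1 < N)%N -> g j * e i = e i * g j.
Proof.
move=> ij jN; case: eH => _ far _.
by rewrite /braid_gen mulrBl mulrBr zml zmr mul1r mulr1 -far.
Qed.

Lemma comm_braid (x : R) i : x * e i = e i * x -> x * g i = g i * x.
Proof. by move=> h; rewrite /braid_gen mulrBl mulrBr zml zmr mul1r mulr1 h. Qed.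

(** The third Reidemeister move in the form in which it is used: a generator
    slides under a strand that crosses both of its strands. *)
Lemma braid_pair (a b : R) : a * a = [2] *: a -> b * b = [2] *: b ->
  a * b * a - a = b * a * b - b ->
  (v%:A - a) * (v%:A - b) * a = b * ((v%:A - a) * (v%:A - b)).
Proof.
move=> aa bb ab.
have c : v * v - v * [2] = -1 by have v0 := v_neq0 vgen; rewrite qn2 //; field.
have E1 : (v%:A - b) * a = v *: a - b * a by rewrite mulrBl zml mul1r.
have E2 : b * (v%:A - a) = v *: b - b * a by rewrite mulrBr zmr mulr1.
have -> : (v%:A - a) * (v%:A - b) * a = (a * b * a - a) - v *: (b * a).
  rewrite -mulrA E1 mulrBr !mulrBl !zml zmr mul1r mul1r zmr aa mulrA.
  rewrite !scalerA opprB [RHS]addrAC -[- a]scaleN1r -c scalerBl.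
  by rewrite addrC.
have -> : b * ((v%:A - a) * (v%:A - b)) = (b * a * b - b) - v *: (b * a).
  rewrite mulrA E2 mulrBl !mulrBr !zmr !mulr1 !zml bb !scalerA.
  rewrite opprB [RHS]addrAC -[- b]scaleN1r -c scalerBl.
  move: (b * a * b) (v *: (b * a)) => x y.
  by rewrite [RHS]addrC.
by rewrite ab.
Qed.

Lemma braid_up i : (i.+2 < N)%N -> g i * g i.+1 * e i = e i.+1 * (g i * g i.+1).
Proof. by move=> iN; case: eH => sq _ br; apply: braid_pair; [apply: sq; lia|apply: sq|apply: br]. Qed.

Lemma braid_down i : (i.+2 < N)%N -> g i.+1 * g i * e i.+1 = e i * (g i.+1 * g i).
Proof.
by move=> iN; case: eH => sq _ br; apply: braid_pair; [apply: sq|apply: sq; lia|rewrite br].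
Qed.

Lemma chainS s a : chain e s a.+1 = chain e s a * g (s + a). Proof. by []. Qed.

Lemma chainl s a : chain e s a.+1 = g s * chain e s.+1 a.
Proof.
elim: a => [|a IH]; first by rewrite /= addn0 mul1r mulr1.
by rewrite chainS IH -mulrA; congr (_ * _); rewrite chainS addSnnS.
Qed.

Lemma chain_far s a j : (s + a < N)%N -> (j.+1 < N)%N ->
  (j.+1 < s)%N || (s + a < j)%N -> chain e s a * e j = e j * chain e s a.
Proof.
move=> saN jN; elim: a saN => [|a IH] saN h; first by rewrite mul1r mulr1.
rewrite chainS -mulrA; have -> : g (s + a)%N * e j = e j * g (s + a)%N.
  by case/orP: h => h; [apply: braid_far'|apply: braid_far]; lia.
by rewrite !mulrA IH //; lia.
Qed.

Lemma chain_gfar s a j : (s + a < N)%N -> (j.+1 < N)%N ->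
  (j.+1 < s)%N || (s + a < j)%N -> chain e s a * g j = g j * chain e s a.
Proof. by move=> *; apply: comm_braid; rewrite chain_far. Qed.

Lemma chain_slide s a i : (s + a < N)%N -> (s <= i)%N -> (i.+1 < s + a)%N ->
  chain e s a * e i = e i.+1 * chain e s a.
Proof.
elim: a => [|a IH] saN si ia; first by lia.
have [E|ne] := eqVneq i.+1 (s + a)%N.
  case: a IH saN ia E => [|a] IH saN ia E; first by lia.
  have Ei : (s + a)%N = i by lia.
  rewrite !chainS addnS Ei -[_ * g i * g i.+1]mulrA -mulrA braid_up; last by lia.
  by rewrite mulrA chain_far ?mulrA //; lia.
rewrite chainS -mulrA; have -> : g (s + a)%N * e i = e i * g (s + a)%N by apply: braid_far'; lia.
by rewrite !mulrA IH //; lia.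
Qed.

Lemma chain_swap s a : (s + a.+1 < N)%N ->
  chain e s.+1 a * chain e s a * e (s + a)%N = e s * (chain e s.+1 a * chain e s a).
Proof.
elim: a => [|a IH] saN; first by rewrite !mul1r addn0 !mulr1.
rewrite !chainS addSn.
have -> : chain e s.+1 a * g (s + a).+1 * (chain e s a * g (s + a)) =
          chain e s.+1 a * chain e s a * (g (s + a).+1 * g (s + a)).
  by rewrite -!mulrA; congr (_ * _); rewrite mulrA -chain_gfar ?mulrA //; lia.
rewrite addnS -mulrA -[g _ * g _ * e _]mulrA.
rewrite [g (s + a).+1 * _]mulrA braid_down; last by lia.
by rewrite !mulrA IH ?mulrA //; lia.
Qed.

Lemma bgridS s a b : bgrid e s a b.+1 = chain e (s + b) a * bgrid e s a b.
Proof. by []. Qed.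

Lemma bgrid_far s a b j : (s + a + b <= N)%N -> (j.+1 < N)%N ->
  (s + a + b <= j)%N -> bgrid e s a b * e j = e j * bgrid e s a b.
Proof.
elim: b => [|b IH] sN jN h; first by rewrite mul1r mulr1.
rewrite bgridS -mulrA IH; [|lia..]; rewrite !mulrA chain_far //; lia.
Qed.

Lemma bgrid_slidel s a b i : (s + a + b <= N)%N -> (i.+1 < a)%N ->
  bgrid e s a b * e (s + i)%N = e (s + b + i)%N * bgrid e s a b.
Proof.
elim: b => [|b IH] sN ia; first by rewrite mul1r mulr1 addn0.
rewrite bgridS -mulrA IH; [|lia..]; rewrite !mulrA chain_slide; [|lia..].
by congr (e _ * _ * _); lia.
Qed.

Lemma bgrid_slider s a b j : (s + a + b <= N)%N -> (j.+1 < b)%N ->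
  bgrid e s a b * e (s + a + j)%N = e (s + j)%N * bgrid e s a b.
Proof.
elim: b => [|b IH] sN jb; first by lia.
have [E|ne] := eqVneq j.+1 b; last first.
  rewrite bgridS -mulrA IH; [|lia..]; rewrite !mulrA chain_far //; lia.
rewrite -E !bgridS addnS -!mulrA bgrid_far; [|lia..].
rewrite !mulrA; congr (_ * _); rewrite -[RHS]mulrA -chain_swap; last by lia.
by congr (_ * _ * e _); lia.
Qed.

Lemma bgrid_claspl s a b : (s + a + b <= N)%N ->
  bgrid e s a b * clasp_at v e s a = clasp_at v e (s + b) a * bgrid e s a b.
Proof. by move=> sN; apply: clasp_intertwine => i ia; rewrite bgrid_slidel. Qed.

Lemma bgrid_claspr s a b : (s + a + b <= N)%N ->
  bgrid e s a b * clasp_at v e (s + a) b = clasp_at v e s b * bgrid e s a b.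
Proof. by move=> sN; apply: clasp_intertwine => i ia; rewrite bgrid_slider. Qed.

Lemma chain_clasp s a : (s + a < N)%N ->
  chain e s a * clasp_at v e s a = clasp_at v e s.+1 a * chain e s a.
Proof.
by move=> sN; apply: clasp_intertwine => i ia; rewrite chain_slide //; lia.
Qed.

(** Next to a clasp a chain of crossings collapses to two terms, the wider clasp
    and a product of two overlapping ones, because the clasp kills most of the
    smoothings. *)
Lemma chain_expand s a : (s + a < N)%N ->
  chain e s a * clasp_at v e s a = [a.+1] *: clasp_at v e s a.+1
    - (v^-1 * [a]) *: (clasp_at v e s.+1 a * clasp_at v e s a).
Proof.
elim: a s => [|a IH] s sN.
  by rewrite clasp_at1 !clasp_at0 /= qn0 qn1 // mulr0 scale0r subr0 scale1r mulr1.
pose Q := clasp_at v e s.+1 a.+1; pose P := clasp_at v e s a.+1.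
have PP : P * P = P by apply: (clasp_idem vgen eH); lia.
have QQ : Q * Q = Q by apply: (clasp_idem vgen eH); lia.
have P1P : clasp_at v e s.+1 a * P = P by apply: (clasp_absl vgen eH); lia.
have QP2 : Q * clasp_at v e s.+2 a = Q by apply: (clasp_absr vgen eH); lia.
have Q0 : chain e s a.+1 * P = Q * chain e s a.+1 * P.
  by rewrite -{1}PP mulrA /P chain_clasp.
have E1 : chain e s.+1 a * P = [a.+1] *: (Q * P) - (v^-1 * [a]) *: (clasp_at v e s.+2 a * P).
  rewrite -[in LHS]P1P mulrA IH; last by lia.
  by rewrite mulrBl !zml -mulrA P1P.
have Qg : Q * g s * Q = (v - [a.+2] / [a.+1]) *: Q + ([a.+2] / [a.+1]) *: clasp_at v e s a.+2.
  have := clasp_recl vgen eH (s := s) (n := a.+1); rewrite -/Q => ->; last by lia.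
  rewrite /braid_gen mulrBr mulrBl zmr zml mulr1 QQ scalerBl scalerBr scalerA.
  rewrite addrA subrK; congr (_ - _); rewrite -[LHS]scale1r; congr (_ *: _).
  by have h1 := vgen (ltn0Sn a); have h2 := vgen (ltn0Sn a.+1); field; rewrite h1 h2.
have Pa2 : clasp_at v e s a.+2 * P = clasp_at v e s a.+2.
  by apply: (clasp_absr vgen eH); lia.
rewrite Q0 chainl mulrA -mulrA E1 mulrBr !zmr !mulrA Qg mulrDl !zml Pa2.
have -> : (v^-1 * [a]) *: (Q * g s * clasp_at v e s.+2 a * P) = [a] *: (Q * P).
  have [->|a_gt0] := posnP a; first by rewrite qn0 mulr0 !scale0r.
  have -> : Q * g s * clasp_at v e s.+2 a = Q * g s.
    have C : clasp_at v e s.+2 a * g s = g s * clasp_at v e s.+2 a.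
      by apply: comm_braid; rewrite (clasp_e_comm eH) //; lia.
    by rewrite -mulrA -C mulrA QP2.
  rewrite -mulrA; have -> : g s * P = v *: P.
    by rewrite /braid_gen mulrBl zml mul1r (clasp_killl vgen eH) ?subr0 //; lia.
  rewrite zmr scalerA mulrAC mulVf ?mul1r //; exact: v_neq0.
rewrite scalerDr !scalerA addrAC -scalerBl addrC; congr (_ *: _ + _).
  by have h1 := vgen (ltn0Sn a); field.
rewrite -scaleNr; congr (_ *: _).
have h1 := vgen (ltn0Sn a); have r := qn_ratio vgen a.
rewrite -r qn2 //; have v0 := v_neq0 vgen; by field; rewrite h1 v0.
Qed.

(** The coefficients of the grid, next to clasps, in terms of ladders: the
    recursion adds the strands of the right bundle one by one. *)
Fixpoint bcoef a b j : F :=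
  if b is b'.+1 then
    (bcoef a b' j * (v ^+ a - [a + j.+1] * v ^+ (b' - j) / [b])
     + (if j is j'.+1 then bcoef a b' j' * ([a + j] * v ^+ (b - j) / [b]) else 0))
  else (j == 0%N)%:R.

Lemma bcoef_gt a b j : (b < j)%N -> bcoef a b j = 0.
Proof.
elim: b j => [|b IH] [|j] //= bj.
by rewrite IH ?mul0r ?add0r; [|lia]; rewrite IH ?mul0r //; lia.
Qed.

End Fix.

(** The strands of the right bundle are passed over one at a time; each passage is
    a chain next to a clasp, hence has two terms, and the turning rule of ladders
    brings the result back to normal form. *)
Lemma bgrid_ladder (e : nat -> R) a b : (b <= a)%N -> hecke v e (a + b) ->
  bgrid e 0 a b * ladder v e (a + b) a = \sum_(j < b.+1) bcoef a b j *:
    (ladder v e (a + b) b * ladder v e (a + b) (a + j) * ladder v e (a + b) a).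
Proof.
elim: b => [|b IH] ba eH.
  rewrite big_ord1 /= addn0 mul1r scale1r.
  have absl := lad_absr vgen eH; rewrite addn0 in absl eH.
  have E : ladder v e a a = ladder v e a 0.
    by rewrite !ladder.unlock subnn subn0 !clasp_at0 mulr1 mul1r.
  by rewrite -E !(lad_idem vgen eH).
pose L := ladder v e (a + b.+1); pose L' := ladder v e (a + b).
have eH' : hecke v e (a + b).
  by case: eH => h1 h2 h3; split=> i *; [apply: h1|apply: h2|apply: h3]; lia.
have := IH (ltnW ba) eH' => IH'.
have LL c : (c <= a + b.+1)%N -> L c * L c = L c by apply: (lad_idem vgen eH).
have aN : (a <= a + b.+1)%N by lia.
have slide : bgrid e 0 a b.+1 * L a = L b.+1 * bgrid e 0 a b.+1 * L a.
  rewrite -[in LHS](LL a aN) mulrA; congr (_ * _).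
  have hl := bgrid_claspl eH (s := 0) (a := a) (b := b.+1).
  have hr := bgrid_claspr eH (s := 0) (a := a) (b := b.+1).
  rewrite !add0n in hl hr.
  rewrite /L (ladderE' eH (c := b.+1)); last by lia.
  rewrite ladder.unlock addKn mulrA hl // -mulrA hr // mulrA.
  by have -> : (a + b.+1 - b.+1 = a)%N by lia.
have sub c : (c <= a + b)%N -> L' c * L c = L c.
  move=> cN; rewrite /L' ladder.unlock -mulrA !(lad_absl vgen eH) //; lia.
have sup c : (c <= a + b)%N -> L c * L' c = L c.
  move=> cN; rewrite /L' ladder.unlock mulrA !(lad_absr vgen eH) //; lia.
have La c d : (c <= d)%N -> (d <= a + b)%N -> L' d * L c = L d * L c.
  move=> cd dN; rewrite [L' d]ladderE -mulrA (lad_absl vgen eH); [|lia|lia].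
  by rewrite [L d]ladderE -[RHS]mulrA [X in _ = _ * X](lad_absl vgen eH) //; lia.
have step : bgrid e 0 a b * L a = \sum_(j < b.+1) bcoef a b j *:
    (clasp_at v e 0 b * (clasp_at v e b a * (L (a + j)%N * L a))).
  rewrite -[in LHS](sub a) ?leq_addr // mulrA IH' mulr_suml; apply: eq_bigr => j _.
  have jb := ltn_ord j.
  rewrite zml; congr (_ *: _); rewrite -!mulrA sub ?leq_addr // La; [|lia|lia].
  by rewrite ladder.unlock addnK -!mulrA.
pose Z j := L b.+1 * L (a + j)%N * L a.
pose be j := [a + j.+1] * v ^+ (b - j) / [b.+1].
have term j : (j <= b)%N -> L b.+1 * (chain e b a *
    (clasp_at v e 0 b * (clasp_at v e b a * (L (a + j)%N * L a)))) =
    (v ^+ a - be j) *: Z j + be j *: Z j.+1.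
  move=> jb.
  have C : chain e b a * clasp_at v e 0 b = clasp_at v e 0 b * chain e b a.
    by rewrite -clasp_comm // => i _ ib; rewrite -(chain_far eH) //; lia.
  rewrite [chain e b a * _]mulrA C !mulrA (lad_absr vgen eH); [|lia|lia].
  rewrite -[L b.+1 * _ * _]mulrA (chain_expand eH); last by lia.
  pose c := (a + j)%N.
  have rE : (b + (a + j - b.+1).+1 = c)%N by rewrite /c; lia.
  have cN : (c <= a + b)%N by rewrite /c; lia.
  have Z1 : L b.+1 * L c.+1 * L c * L a = Z j.+1.
    have U : L c.+1 * L c * L a = L c.+1 * L a by apply: (lad_up vgen eH); rewrite /c; lia.
    by rewrite -mulrA -mulrA [L c.+1 * _]mulrA U /Z mulrA addnS.
  have T1 : L b.+1 * clasp_at v e b a.+1 * L c * L a =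
      (1 - [c.+1] * [b.+1 - j] / ([b.+1] * [a.+1])) *: Z j +
      ([c.+1] * [b.+1 - j] / ([b.+1] * [a.+1])) *: Z j.+1.
    have -> : L b.+1 * clasp_at v e b a.+1 = L b.+1 * L b.
      rewrite [L b]ladderE mulrA [L b.+1 * clasp_at _ _ 0 b](lad_absr vgen eH); [|lia|lia].
      by congr (_ * clasp_at _ _ _ _); lia.
    have := lad_turn vgen eH (b := b) (r := (a + j - b.+1)%N); rewrite rE /= -/L => ->; last by rewrite /c; lia.
    have -> : (a + b.+1 - c = b.+1 - j)%N by rewrite /c; lia.
    have -> : (a + b.+1 - b = a.+1)%N by lia.
    by rewrite mulrDl !zml Z1.
  have T2 : L b.+1 * (clasp_at v e b.+1 a * clasp_at v e b a) * L c * L a =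
      (1 - [c.+1] * [b - j] / ([b.+1] * [a])) *: Z j +
      ([c.+1] * [b - j] / ([b.+1] * [a])) *: Z j.+1.
    rewrite mulrA [L b.+1 * _](lad_absr vgen eH); [|lia|lia].
    have -> : L b.+1 * clasp_at v e b a = L b.+1 * (L' b.+1 * L' b).
      have -> : L' b.+1 * L' b = L' b.+1 * clasp_at v e b a.
        rewrite [L' b]ladderE mulrA (lad_absr vgen eH'); [|lia|lia].
        by congr (_ * clasp_at _ _ _ _); lia.
      by rewrite mulrA sup //; lia.
    rewrite -(sub c) //.
    have -> : L b.+1 * (L' b.+1 * L' b) * (L' c * L c) * L a =
              L b.+1 * (L' b.+1 * L' b * L' c) * L c * L a by rewrite !mulrA.
    have := lad_turn vgen eH' (b := b) (r := (a + j - b.+1)%N).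
    rewrite rE /= -/L' => ->; last by rewrite /c; lia.
    have -> : (a + b - c = b - j)%N by rewrite /c; lia.
    have -> : (a + b - b = a)%N by lia.
    rewrite mulrDr !mulrDl !zmr !zml !mulrA sup; last by lia.
    rewrite -[L b.+1 * _ * L c]mulrA sub //; congr (_ + _).
    have [->|ne] := eqVneq j b; first by rewrite subnn qn0 mulr0 mul0r !scale0r.
    rewrite -[L b.+1 * _ * L' c * L c]mulrA sub // -[L b.+1 * _ * L c]mulrA.
    by rewrite La ?mulrA ?Z1 //; rewrite /c; lia.
  have -> : L b.+1 * ([a.+1] *: clasp_at v e b a.+1 -
      v^-1 * [a] *: (clasp_at v e b.+1 a * clasp_at v e b a)) * L (a + j)%N * L a =
      [a.+1] *: (L b.+1 * clasp_at v e b a.+1 * L c * L a) -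
      (v^-1 * [a]) *: (L b.+1 * (clasp_at v e b.+1 a * clasp_at v e b a) * L c * L a).
    by rewrite mulrBr !mulrBl !zmr !zml.
  rewrite T1 T2 !scalerDr !scalerA opprD addrACA -!scaleNr -!scalerDl.
  have v0 := v_neq0 vgen; have h1 := vgen (ltn0Sn a); have h2 := vgen (ltn0Sn b).
  have h3 : [a] != 0 by apply: vgen; lia.
  have r1 : [a.+1] = v ^+ a + v^-1 * [a].
    by rewrite -addn1 (qnD vgen) // qn1 // mulr1 expr1.
  have r2 : [b.+1 - j] = v ^+ (b - j) + v^-1 * [b - j].
    have -> : (b.+1 - j = b - j + 1)%N by lia.
    by rewrite (qnD vgen) // qn1 // mulr1 expr1.
  congr (_ *: _ + _ *: _); rewrite /be r2 /c addnS.
    have r1' : v ^+ a = [a.+1] - v^-1 * [a] by rewrite r1 addrK.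
    by rewrite r1'; field; rewrite ?h1 ?h2 ?h3 ?v0.
  by field; rewrite ?h1 ?h2 ?h3 ?v0.
rewrite slide bgridS -!mulrA step mulr_sumr mulr_sumr.
under eq_bigr do rewrite !zmr.
transitivity (\sum_(j < b.+1) bcoef a b j *: ((v ^+ a - be j) *: Z j + be j *: Z j.+1)).
  by apply: eq_bigr => j _; rewrite term //; have := ltn_ord j.
under eq_bigr do rewrite scalerDr !scalerA.
rewrite big_split /=.
have -> : \sum_(j < b.+1) (bcoef a b j * (v ^+ a - be j)) *: Z j =
   \sum_(j < b.+2) (bcoef a b j * (v ^+ a - be j)) *: Z j.
  by rewrite [RHS]big_ord_recr /= bcoef_gt // mul0r scale0r addr0.
have -> : \sum_(j < b.+1) (bcoef a b j * be j) *: Z j.+1 =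
   \sum_(j < b.+2) (if (j : nat) is j'.+1 then bcoef a b j' * be j' else 0) *: Z j.
  by rewrite [RHS]big_ord_recl /= scale0r add0r.
rewrite -big_split /=; apply: eq_bigr => -[j jb] _ /=; rewrite -scalerDl; congr (_ *: _).
by congr (_ + _); case: j jb.
Qed.
End Braid.

(** * Eigenvalues of the braiding *)

Section BraidEigen.
Variables (F : fieldType) (v : F).
Hypothesis vgen : generic_q v.
Local Notation "[ n ]" := (qn v n) (at level 0, format "[ n ]").

Definition qfact n : F := \prod_(i < n) [i.+1].

Lemma qfactS n : qfact n.+1 = qfact n * [n.+1].
Proof. by rewrite /qfact big_ord_recr. Qed.

Lemma qfact0 : qfact 0 = 1. Proof. by rewrite /qfact big_ord0. Qed.

Lemma qfact_neq0 n : qfact n != 0.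
Proof. by elim: n => [|n IH]; rewrite ?qfact0 ?oner_eq0 // qfactS mulf_neq0 // vgen. Qed.

(** The solution of the recursion of the coefficients in closed form. *)
Lemma bcoefE b d j : (j <= b)%N -> bcoef v (b + d) b j =
  (- v^-1) ^+ (b - j) * qfact (b + d + j) / (qfact (b - j) * qfact j * qfact (d + j)).
Proof.
have v0 := v_neq0 vgen.
elim: b d j => [|b IH] d j jb.
  have -> : j = 0%N by lia.
  by rewrite /= !qfact0 expr0 add0n addn0 !mul1r mulfV // qfact_neq0.
have E j' : (j' <= b)%N -> bcoef v (b.+1 + d) b j' =
    (- v^-1) ^+ (b - j') * qfact (b.+1 + d + j') / (qfact (b - j') * qfact j' * (qfact (d + j') * [(d + j').+1])).
  by move=> jb'; rewrite addSnnS IH // addSn qfactS.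
rewrite /=.
have first : v ^+ (b.+1 + d) - [b.+1 + d + j.+1] * v ^+ (b - j) / [b.+1] =
   - v^-1 * v^-1 ^+ j * [(d + j).+1] / [b.+1] \/ (b < j)%N.
  have [lt|le] := ltnP b j; [by right|left].
  have h1 := vgen (ltn0Sn b); apply: (mulIf h1); rewrite mulrBl !divfK //.
  have -> : v ^+ (b - j) = v ^+ b / v ^+ j.
    by rewrite -{2}(subnK le) exprD mulfK // expf_neq0.
  rewrite !qnE !addSn !exprS !exprD !exprS exprVn.
  have h2 := vX_neq0 vgen b; have h3 := vX_neq0 vgen d; have h4 := vX_neq0 vgen j.
  have d0 := qden_neq0 vgen; move: (v ^+ b) (v ^+ d) (v ^+ j) (v - v^-1) h2 h3 h4 d0.
  by move=> B D J dd h2 h3 h4 d0; field; rewrite h2 h3 h4 d0 v0.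
have s1 : bcoef v (b.+1 + d) b j * (v ^+ (b.+1 + d) - [b.+1 + d + j.+1] * v ^+ (b - j) / [b.+1])
   = (- v^-1) ^+ (b.+1 - j) * qfact (b.+1 + d + j) / (qfact (b.+1 - j) * qfact j * qfact (d + j))
     * (v^-1 ^+ j * [b.+1 - j] / [b.+1]).
  have [lt|le] := ltnP b j.
    have -> : j = b.+1 by lia.
    by rewrite (bcoef_gt _ _ (ltnSn b)) // subnn qn0 mulr0 !mul0r mulr0.
  case: first => [->|]; last by rewrite ltnNge le.
  rewrite E // subSn // exprS qfactS.
  have h1 := vgen (ltn0Sn b); have h2 := vgen (ltn0Sn (d + j)); have h3 := vgen (ltn0Sn (b - j)).
  have h4 := qfact_neq0 (b - j); have h5 := qfact_neq0 j; have h6 := qfact_neq0 (d + j).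
  by field; rewrite h1 h2 h3 h4 h5 h6 v0.
have s2 : (if j is j'.+1 then bcoef v (b.+1 + d) b j' * ([b.+1 + d + j] * v ^+ (b.+1 - j) / [b.+1]) else 0)
   = (- v^-1) ^+ (b.+1 - j) * qfact (b.+1 + d + j) / (qfact (b.+1 - j) * qfact j * qfact (d + j))
     * (v ^+ (b.+1 - j) * [j] / [b.+1]).
  case: j jb {first s1} => [|j] jb; first by rewrite qn0 mulr0 mul0r mulr0.
  rewrite E // subSS !addnS !qfactS.
  have h1 := vgen (ltn0Sn b); have h2 := vgen (ltn0Sn (d + j)); have h3 := vgen (ltn0Sn j).
  have h4 := qfact_neq0 (b - j); have h5 := qfact_neq0 j; have h6 := qfact_neq0 (d + j).
  by field; rewrite h1 h2 h3 h4 h5 h6 ?v0.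
rewrite s1 s2 -mulrDr -[RHS]mulr1; congr (_ * _).
have h1 := vgen (ltn0Sn b); rewrite -mulrDl; apply: (canLR (mulfK h1)); rewrite mul1r.
have -> : b.+1 = (j + (b.+1 - j))%N by lia.
rewrite addKn addnC (qnD vgen) addrC; congr (_ * _ + _ * _).
by rewrite exprVn.
Qed.

(** The terms of the alternating sum that computes the eigenvalue of the
    braiding: a terminating basic hypergeometric series in u. *)
Definition vterm u j : F := (- v) ^+ j * \prod_(s < j) (dq v u s * [u + s.+1] / [s.+1] ^+ 2).

Lemma vtermS u j : vterm u j.+1 = vterm u j * (- v * dq v u j * [u + j.+1] / [j.+1] ^+ 2).
Proof. by rewrite /vterm exprS big_ord_recr /=; ring. Qed.

Lemma vterm0 u : vterm u 0 = 1. Proof. by rewrite /vterm expr0 big_ord0 mul1r. Qed.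

Lemma vterm_shift u m : vterm u.+1 m.+1 =
  vterm u m * (- v * [u + m + 2] * [u + m + 1] / [m.+1] ^+ 2).
Proof.
elim: m => [|m IH].
  by rewrite vtermS !vterm0 dq_n0 // !addn0 !addn1 !addn2 /=; ring.
rewrite vtermS IH vtermS dqSS //.
rewrite (_ : (u.+1 + m.+2)%N = (u + m.+1 + 2)%N); last lia.
rewrite (_ : (u + m + 2)%N = (u + m.+1 + 1)%N); last lia.
rewrite (_ : (u + m + 1)%N = (u + m.+1)%N); last lia.
by ring.
Qed.

(** The combination of the sums for u and u + 1 telescopes, which evaluates them
    by induction on u. *)
Lemma vterm_tel u m :
  \sum_(j < m.+1) (vterm u.+1 j + v ^+ (2 * u + 2) * vterm u j) =
  vterm u m * (v ^+ u.+1 / v ^+ m * [u + m + 1] * [2 * u + 2] / [u.+1] ^+ 2).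
Proof.
have v0 := v_neq0 vgen; have d0 := qden_neq0 vgen.
have hu := vX_neq0 vgen u; have h1 := vgen (ltn0Sn u).
elim: m => [|m IH].
  rewrite big_ord1 !vterm0 addn0 expr0 mul1r mulr1 divr1.
  apply: (canRL (mulfK _)); first by rewrite expf_neq0.
  rewrite !qnE mul2n -addnn addn2 addn1 !exprS !exprD.
  move: (v ^+ u) (v - v^-1) hu d0 => U D hu d0.
  by field; rewrite hu v0 d0.
rewrite big_ord_recr /= IH vterm_shift vtermS.
have hm := vX_neq0 vgen m; have h2 := vgen (ltn0Sn m).
set T := [2 * u + 2]; set W := v ^+ u / v ^+ m.
have k1 : dq v u m * [u + m + 2] = [u.+1] ^+ 2 - [m.+1] ^+ 2.
  rewrite !qnE /dq addn2 !exprS !exprD.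
  move: (v ^+ u) (v ^+ m) (v - v^-1) hu hm d0 => U M D hu hm d0.
  by field; rewrite hu hm v0 d0.
have k2 : [u + m + 2] + v ^+ (2 * u + 2) * dq v u m = W * T.
  rewrite /T /W !qnE /dq mul2n -addnn !addn2 !exprS !exprD.
  move: (v ^+ u) (v ^+ m) (v - v^-1) hu hm d0 => U M D hu hm d0.
  by field; rewrite hu hm v0 d0.
have -> : v ^+ u.+1 / v ^+ m.+1 = W by rewrite /W !exprS; field; rewrite hm v0.
have -> : v ^+ u.+1 / v ^+ m = v * W by rewrite /W exprS mulrA.
rewrite (_ : (u + m.+1 + 1)%N = (u + m + 2)%N); last lia.
rewrite (_ : (u + m.+1)%N = (u + m + 1)%N); last lia.
transitivity (vterm u m * [u + m + 1] * (v * W * T / [u.+1] ^+ 2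
   - v / [m.+1] ^+ 2 * ([u + m + 2] + v ^+ (2 * u + 2) * dq v u m))); first by ring.
transitivity (vterm u m * [u + m + 1] * (- v / [m.+1] ^+ 2 * (dq v u m * [u + m + 2]) * (W * T / [u.+1] ^+ 2))); last by ring.
rewrite k1 k2; congr (_ * _).
by field; rewrite h1 h2.
Qed.

Lemma vterm_gt u j : (u < j)%N -> vterm u j = 0.
Proof.
by move=> uj; rewrite /vterm (bigD1 (Ordinal uj)) //= dqxx // !mul0r mulr0.
Qed.

(** This is the q-Chu-Vandermonde summation in the case that occurs here. *)
Lemma vterm_sum u n : (u <= n)%N ->
  \sum_(j < n.+1) vterm u j = (-1) ^+ u * v ^+ (u ^ 2 + u).
Proof.
elim: u => [|u IH] un.
  rewrite big_ord_recl vterm0 big1 ?addr0 ?expr0 ?mulr1 // => j _.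
  by rewrite vterm_gt.
have := vterm_tel u n; rewrite big_split /= -mulr_sumr IH; last exact: ltnW.
have [m Em] : exists m, n = m.+1 by exists n.-1; lia.
rewrite vterm_gt // mul0r => /eqP; rewrite addr_eq0 => /eqP ->.
rewrite exprS mulrCA mulN1r mulNr -exprD; congr (- (_ * v ^+ _)).
by lia.
Qed.

(** The eigenvalue of a grid of crossings between two clasped bundles of n
    strands: a half twist acts by a sign and a power of q on each component. *)
Definition twist_eig n u : F := (-1) ^+ (n + u) * v ^+ (u ^ 2 + u) / v ^+ n.

Lemma bcoef_eig n u : (u <= n)%N ->
  \sum_(j < n.+1) bcoef v n n j * rung_eig v n n j (level v n n u) = twist_eig n u.
Proof.
move=> un; have v0 := v_neq0 vgen.
transitivity ((- v^-1) ^+ n * \sum_(j < n.+1) vterm u j).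
  rewrite mulr_sumr; apply: eq_bigr => -[j jn] _ /=.
  have := bcoefE (b := n) 0 (j := j); rewrite addn0 add0n => ->; last by lia.
  have E : forall j, (j <= n)%N -> rung_eig v n n j (level v n n u) =
     \prod_(s < j) (dq v u s * [u + s.+1]) * (qfact (n - j) / qfact (n + j)).
    elim=> [|i IH] ijn; first by rewrite rung_eig0 big_ord0 subn0 addn0 mul1r divff ?qfact_neq0.
    rewrite rung_eig_recr IH; last exact: ltnW.
    rewrite (level_diffn vgen (K := 0)) ?addn0 //; last exact: ltnW.
    rewrite big_ord_recr /= /level !(addnS n i) (addnS u i) (addn1 (u + i)) qfactS.
    have -> : (n - i = (n - i.+1).+1)%N by lia.
    rewrite qfactS.
    have h1 := vgen (ltn0Sn (n - i.+1)); have h2 := vgen (ltn0Sn (n + i)).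
    have h3 := qfact_neq0 (n + i); have h4 := qfact_neq0 (n - i.+1).
    by field; rewrite h1 h2 h3.
  rewrite E; last by lia.
  have -> : (- v^-1) ^+ n = (- v^-1) ^+ (n - j) * (- v^-1) ^+ j.
    by rewrite -exprD subnK //; lia.
  rewrite /vterm -[RHS]mulrA [(- v^-1) ^+ j * _]mulrA -exprMn_comm; last exact: mulrC.
  rewrite mulrNN mulVf // expr1n mul1r.
  have -> : \prod_(s < j) (dq v u s * [u + s.+1] / [s.+1] ^+ 2) =
     \prod_(s < j) (dq v u s * [u + s.+1]) / qfact j ^+ 2.
    elim: j {jn} => [|i IH]; first by rewrite !big_ord0 qfact0 expr1n divr1.
    rewrite !big_ord_recr /= IH qfactS exprMn.
    have h1 := qfact_neq0 i; have h2 := vgen (ltn0Sn i).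
    by field; rewrite h1 h2.
  have h1 := qfact_neq0 j; have h2 := qfact_neq0 (n - j); have h3 := qfact_neq0 (n + j).
  by field; rewrite h1 h2 h3.
rewrite vterm_sum // /twist_eig (exprNn v^-1) exprVn exprD.
by rewrite exprD; ring.
Qed.

End BraidEigen.

(** The coefficients of the grid in the rungs are known, so its eigenvalue is an
    explicit alternating sum, which sums to a single power of v. *)
Lemma rep_braid (F : fieldType) (v : F) (R : algType F) (e : nat -> R) n :
  generic_q v -> hecke v e (n + n) ->
  rep v e n n n.+1 (level v n n) (bgrid v e 0 n n * ladder v e (n + n) n) (twist_eig v n).
Proof.
move=> vgen eH; rewrite bgrid_ladder //.
apply: rep_eq (rep_sum (x := fun j => bcoef v n n j *: rung v e n n j)
  (a := fun j u => bcoef v n n j * rung_eig v n n j (level v n n u)) _).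
  by move=> u un; rewrite bcoef_eig.
by move=> r rn; apply: rep_scale; apply: rep_rung.
Qed.

(** * Transport along nested arcs *)

Section Nest.
Variables (F : fieldType) (v : F) (R : algType F).
Hypothesis vgen : generic_q v.
Variables (e f : nat -> R) (x : R).

(** Sliding the generators of a clasp one by one along nested arcs reverses the
    order of its factors.  The clasp recursion is palindromic, so the result is
    again a clasp. *)
Lemma nest_claspl s n : (forall i, (s <= i)%N -> (i.+1 < s + n)%N -> e i * x = f i * x) ->
  (forall i j, (s <= i)%N -> (i.+1 < s + n)%N -> (s <= j)%N -> (j.+1 < s + n)%N -> e i * f j = f j * e i) ->
  clasp_at v e s n * x = clasp_at v f s n * x.
Proof.
elim: n => [|n IH] ex ef; first by rewrite !clasp_at0.
have {}IH : clasp_at v e s n * x = clasp_at v f s n * x.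
  by apply: IH => [i|i j] *; [apply: ex|apply: ef] => //; lia.
rewrite !clasp_atS !mulrBl IH !zml -!mulrA IH.
case: n IH ex ef => [|n] IH ex ef; first by rewrite qn0 mul0r !scale0r.
set c := clasp_at v f s n.+1; set k := (s + n.+1).-1.
have ck : c * e k = e k * c by apply: clasp_comm => i h1 h2; rewrite ef //; lia.
have ce : clasp_at v e s n.+1 * f k = f k * clasp_at v e s n.+1.
  by apply: clasp_comm => i h1 h2; rewrite ef //; lia.
have cc : c * clasp_at v e s n.+1 = clasp_at v e s n.+1 * c.
  by apply: clasp_comm => i h1 h2; apply/esym/clasp_comm => j h3 h4; rewrite ef //; lia.
have ecf : e k * (c * x) = c * (f k * x) by rewrite mulrA -ck -mulrA ex //; lia.
by rewrite ecf (mulrA (clasp_at v e s n.+1) c) -cc -mulrA (mulrA _ (f k) x) ce -mulrA IH.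
Qed.

Lemma nest_claspr s n : (forall i, (s <= i)%N -> (i.+1 < s + n)%N -> x * e i = x * f i) ->
  (forall i j, (s <= i)%N -> (i.+1 < s + n)%N -> (s <= j)%N -> (j.+1 < s + n)%N -> e i * f j = f j * e i) ->
  x * clasp_at v e s n = x * clasp_at v f s n.
Proof.
elim: n => [|n IH] ex ef; first by rewrite !clasp_at0.
have {}IH : x * clasp_at v e s n = x * clasp_at v f s n.
  by apply: IH => [i|i j] *; [apply: ex|apply: ef] => //; lia.
rewrite !clasp_atS !mulrBr IH !zmr !mulrA IH.
case: n IH ex ef => [|n] IH ex ef; first by rewrite qn0 mul0r !scale0r.
set c := clasp_at v f s n.+1; set k := (s + n.+1).-1.
have ck : c * e k = e k * c by apply: clasp_comm => i h1 h2; rewrite ef //; lia.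
have ce : clasp_at v e s n.+1 * f k = f k * clasp_at v e s n.+1.
  by apply: clasp_comm => i h1 h2; rewrite ef //; lia.
have cc : c * clasp_at v e s n.+1 = clasp_at v e s n.+1 * c.
  by apply: clasp_comm => i h1 h2; apply/esym/clasp_comm => j h3 h4; rewrite ef //; lia.
have ecf : x * c * e k = x * f k * c by rewrite -mulrA ck mulrA ex //; lia.
by rewrite ecf -(mulrA _ c) cc mulrA -(mulrA x (f k)) -ce mulrA IH.
Qed.

Lemma nest_ladderl N c : hecke v f N -> (c <= N)%N ->
  (forall i, (i.+1 < N)%N -> e i * x = f i * x) ->
  (forall i j, (i.+1 < N)%N -> (j.+1 < N)%N -> e i * f j = f j * e i) ->
  ladder v e N c * x = ladder v f N c * x.
Proof.
move=> fH cN ex ef; rewrite ladderE (ladderE' fH) // -mulrA.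
rewrite nest_claspl => [|i *|i j *]; rewrite ?ex ?ef //; try lia.
rewrite mulrA (_ : clasp_at v e 0 c * clasp_at v f c (N - c) = clasp_at v f c (N - c) * clasp_at v e 0 c); last first.
  by apply: clasp_comm => i h1 h2; apply/esym/clasp_comm => j h3 h4; rewrite ef //; lia.
by rewrite -!mulrA nest_claspl => [|i *|i j *]; rewrite ?ex ?ef //; lia.
Qed.
Lemma nest_ladderr N c : hecke v f N -> (c <= N)%N ->
  (forall i, (i.+1 < N)%N -> x * e i = x * f i) ->
  (forall i j, (i.+1 < N)%N -> (j.+1 < N)%N -> e i * f j = f j * e i) ->
  x * ladder v e N c = x * ladder v f N c.
Proof.
move=> fH cN ex ef; rewrite ladderE (ladderE' fH) // !mulrA.
rewrite nest_claspr => [|i *|i j *]; rewrite ?ex ?ef //; try lia.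
rewrite -mulrA (_ : clasp_at v f 0 c * clasp_at v e c (N - c) = clasp_at v e c (N - c) * clasp_at v f 0 c); last first.
  by apply/esym/clasp_comm => i h1 h2; apply/esym/clasp_comm => j h3 h4; rewrite ef //; lia.
by rewrite mulrA nest_claspr => [|i *|i j *]; rewrite ?ex ?ef //; lia.
Qed.

Lemma ladder_comm N c (y : R) : (c <= N)%N -> (forall i, (i.+1 < N)%N -> e i * y = y * e i) ->
  ladder v e N c * y = y * ladder v e N c.
Proof.
move=> cN ey; have C s n : (s + n <= N)%N -> clasp_at v e s n * y = y * clasp_at v e s n.
  by move=> sn; apply: clasp_comm => i *; apply: ey; lia.
by rewrite ladderE -mulrA C ?subnKC // !mulrA C.
Qed.
Lemma rung_comm n b r (y : R) : (r <= b)%N -> (forall i, (i.+1 < n + b)%N -> e i * y = y * e i) ->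
  rung v e n b r * y = y * rung v e n b r.
Proof.
move=> rb ey; rewrite /rung -!mulrA !(ladder_comm _ ey) ?leq_add2l ?leq_addr //.
by rewrite [_ * (y * _)]mulrA !(ladder_comm _ ey) ?leq_add2l ?leq_addr // !mulrA !(ladder_comm _ ey) ?leq_add2l ?leq_addr.
Qed.
End Nest.

Lemma nest_rung (F : fieldType) (v : F) (R : algType F) (e f : nat -> R) (x : R) n b r :
  generic_q v -> hecke v f (n + b) -> (r <= b)%N ->
  (forall i, (i.+1 < n + b)%N -> e i * x = f i * x) ->
  (forall i j, (i.+1 < n + b)%N -> (j.+1 < n + b)%N -> e i * f j = f j * e i) ->
  rung v e n b r * x = rung v f n b r * x.
Proof.
move=> vgen fH rb ex ef; rewrite /rung.
have L c : (c <= n + b)%N -> ladder v e (n + b) c * x = ladder v f (n + b) c * x.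
  by move=> cN; apply: nest_ladderl.
have C c c' : (c <= n + b)%N -> (c' <= n + b)%N ->
  ladder v e (n + b) c * ladder v f (n + b) c' = ladder v f (n + b) c' * ladder v e (n + b) c.
  move=> h h'; apply: ladder_comm => // i ib; apply/esym/ladder_comm => // j jb.
  by rewrite ef.
have h1 : (n <= n + b)%N by lia.
have h2 : (n + r <= n + b)%N by lia.
rewrite -!mulrA L // (mulrA (ladder v e _ (n + r))) C // -!mulrA L //.
by rewrite (mulrA (ladder v e _ n)) C // -mulrA [ladder v e _ n * _]mulrA C // -!mulrA L.
Qed.

(** A rung is a palindromic product of ladders, hence survives the transport along
    nested arcs. *)
Lemma nest_rep (F : fieldType) (v : F) (R : algType F) (e f : nat -> R) (x y : R) n b U z a :
  generic_q v -> hecke v f (n + b) ->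
  (forall i, (i.+1 < n + b)%N -> e i * x = f i * x) ->
  (forall i j, (i.+1 < n + b)%N -> (j.+1 < n + b)%N -> e i * f j = f j * e i) ->
  rep v e n b U z y a -> exists2 y', rep v f n b U z y' a & y * x = y' * x.
Proof.
move=> vgen fH ex ef [c [-> ac]]; exists (\sum_(r < b.+1) c r *: rung v f n b r); first by exists c.
by rewrite !mulr_suml; apply: eq_bigr => r _; rewrite !zml (nest_rung vgen fH) // -ltnS.
Qed.

Lemma rep_comm (F : fieldType) (v : F) (R : algType F) (e : nat -> R) (x y : R) n b U z a :
  generic_q v -> rep v e n b U z x a -> (forall i, (i.+1 < n + b)%N -> e i * y = y * e i) ->
  x * y = y * x.
Proof.
move=> vgen [c [-> _]] ey; rewrite mulr_suml mulr_sumr; apply: eq_bigr => r _.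
by rewrite zml zmr; congr (_ *: _); apply: rung_comm ey; rewrite -ltnS.
Qed.

(** * Lifts and partial traces of rungs *)

Section LiftTrace.
Variables (F : fieldType) (v : F) (R : algType F).
Hypothesis vgen : generic_q v.
Local Notation "[ n ]" := (qn v n) (at level 0, format "[ n ]").
Local Notation clasp_at := (@clasp_at F v R).

Definition lift_fun k b (a : nat -> F) u : F :=
  lift_stay v k b u * a u + lift_down v k b u * a u.-1.
Definition trace_fun k b (a : nat -> F) u : F :=
  trace_stay v k b u * a u + trace_down v k b u * a u.+1.

Lemma hecke_le (e : nat -> R) N M : hecke v e N -> (M <= N)%N -> hecke v e M.
Proof.
by case=> h1 h2 h3 MN; split=> [i h|i j h h'|i h]; [apply: h1|apply: h2|apply: h3]; lia.
Qed.

(** The clasps of the wider bundle absorb those of the narrower one. *)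
Lemma rung_lift (e : nat -> R) n b r : hecke v e (n + b.+1) -> (r <= b)%N ->
  ladder v e (n + b.+1) n * rung v e n b r * ladder v e (n + b.+1) n = rung v e n b.+1 r.
Proof.
move=> eH rb; have nb : (n <= n + b.+1)%N by lia.
set L := ladder v e (n + b.+1) n.
have L1 : L * ladder v e (n + b) n = L.
  by rewrite [ladder v e (n + b) n]ladderE mulrA !(lad_absr vgen eH) //; lia.
have L2 : ladder v e (n + b) n * L = L.
  by rewrite [ladder v e (n + b) n]ladderE -mulrA !(lad_absl vgen eH) //; lia.
rewrite /rung -/L !mulrA L1 -!mulrA L2; congr (L * _).
by rewrite ladderE [in RHS]ladderE -!mulrA; congr (_ * _); rewrite !(lad_absl vgen eH) //; lia.
Qed.

Lemma rep_lift (e : nat -> R) n b k x a : hecke v e (n + b.+1) -> n = (b + k.+1)%N ->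
  rep v e n b b.+1 (level v n b) x a ->
  rep v e n b.+1 b.+2 (level v n b.+1)
    (ladder v e (n + b.+1) n * x * ladder v e (n + b.+1) n) (lift_fun k b a).
Proof.
move=> eH nE [c [-> ac]]; exists (fun r => if (r <= b)%N then c r else 0); split.
  rewrite [RHS]big_ord_recr /= ltnn scale0r addr0 mulr_sumr mulr_suml; apply: eq_bigr => r _.
  have rb : (r <= b)%N by rewrite -ltnS.
  by rewrite rb zmr zml rung_lift.
move=> u ub; rewrite [RHS]big_ord_recr /= ltnn mul0r addr0.
transitivity (\sum_(r < b.+1) c r * (lift_stay v k b u * rung_eig v n b r (level v n b u)
   + lift_down v k b u * rung_eig v n b r (level v n b u.-1))); last first.
  apply: eq_bigr => r _; have rb : (r <= b)%N by rewrite -ltnS.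
  by rewrite rb nE (lift_eig vgen).
rewrite /lift_fun.
transitivity (lift_stay v k b u * (\sum_(r < b.+1) c r * rung_eig v n b r (level v n b u)) +
   lift_down v k b u * (\sum_(r < b.+1) c r * rung_eig v n b r (level v n b u.-1))); last first.
  by rewrite !mulr_sumr -big_split; apply: eq_bigr => r _; rewrite mulrDr !(mulrCA (c r)).
congr (_ + _); last by rewrite ac //; lia.
have [ub'|ub'] := ltnP u b.+1; first by rewrite ac.
by rewrite /lift_stay (_ : b.+1 - u = 0)%N ?qn0 ?mulr0 ?mul0r //; lia.
Qed.

Section Trace.
Variables (e e1 : nat -> R) (N : nat) (c k w : R).
Hypotheses (eH : hecke v e N) (eH1 : hecke v e1 N.+1).
Hypothesis ce : forall i, (i.+1 < N)%N -> c * e1 i = e i * c.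
Hypothesis ek : forall i, (i.+1 < N)%N -> k * e i = e1 i * k.
Hypothesis we : forall i, (i.+1 < N)%N -> e i * w = w * e i.
Hypothesis ck : c * k = [3] *: w.
Hypothesis cek : (0 < N)%N -> c * e1 N.-1 * k = [2] *: w.

(** With the clasp recursion, closing the last strand gives a circle minus a
    multiple of a closed generator: [3] - [2] [m] / [m + 1] = [m + 3] / [m + 1]. *)
Lemma trace_clasp s m : (s + m = N)%N -> c * clasp_at e1 s m.+1 * k =
  ([m + 3] / [m + 1]) *: (clasp_at e s m * w).
Proof.
move=> sm; have cC : c * clasp_at e1 s m = clasp_at e s m * c.
  apply: (@clasp_intertwine _ _ _ _ _ _ s s) => i im; apply: ce; lia.
have Ck : clasp_at e1 s m * k = k * clasp_at e s m.
  by apply/esym; apply: (@clasp_intertwine _ _ _ _ _ _ s s) => i im; apply: ek; lia.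
have Cw : clasp_at e s m * w = w * clasp_at e s m by apply: clasp_comm => i *; apply: we; lia.
rewrite clasp_atS mulrBr mulrBl zmr zml cC -(mulrA _ c) ck.
have E : c * (clasp_at e1 s m * e1 (s + m).-1 * clasp_at e1 s m) * k =
  clasp_at e s m * (c * e1 (s + m).-1 * k) * clasp_at e s m.
  by rewrite -!mulrA Ck !mulrA cC.
rewrite E; case: m sm {cC Ck E} Cw => [|m] sm Cw.
  by rewrite qn0 mul0r scale0r subr0 add0n qn1 // divr1 zmr.
rewrite sm cek; last by lia.
rewrite !zmr zml -mulrA -Cw mulrA (clasp_idem vgen eH); last by lia.
rewrite scalerA -scalerBl; congr (_ *: _).
have h1 : [m.+2] != 0 by exact: vgen.
rewrite addn1; apply: (mulIf h1); rewrite mulrBl mulrAC !divfK //.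
rewrite qn3 // qn2 // !qnE addn3 !exprS; have v0 := v_neq0 vgen; have d0 := qden_neq0 vgen.
have := vX_neq0 vgen m; move: (v ^+ m) => z z0.
have d1 : v ^+ 2 - 1 != 0 by rewrite -(mulfV v0) -[v ^+ 2]/(v * v) -mulrBr mulf_neq0.
by field; rewrite ?d1 ?v0 ?z0.
Qed.

(** Read from the right, a rung is a wide clasp between two copies of the left
    clasp; the closed strand only meets the wide clasp. *)
Lemma trace_rung n b r : N = (n + b)%N -> (r <= n)%N ->
  c * rung v (flip (b.+1 + n) e1) b.+1 n r * k =
  ([b + r + 3] / [b + r + 1]) *: (rung v (flip (b + n) e) b n r * w).
Proof.
move=> nE rn.
have G f M : hecke v f (n + M) -> rung v (flip (M + n) f) M n r =
    clasp_at f 0 n * clasp_at f (n - r) (M + r) * clasp_at f 0 n.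
  move=> fH; rewrite flip_rung //.
  have h1 : ladder v f (n + M) n * ladder v f (n + M) (n - r) = clasp_at f 0 n * ladder v f (n + M) (n - r).
    by rewrite [ladder v f (n + M) n]ladderE -mulrA (lad_absl vgen fH) //; lia.
  have h2 : ladder v f (n + M) (n - r) * ladder v f (n + M) n = ladder v f (n + M) (n - r) * clasp_at f 0 n.
    by rewrite [ladder v f (n + M) n](ladderE' fH) ?leq_addr // mulrA (lad_absr vgen fH) //; lia.
  rewrite h1 -mulrA h2 ladderE !mulrA (clasp_absr vgen fH); try lia.
  by congr (_ * clasp_at _ _ _ * _); lia.
have cP : c * clasp_at e1 0 n = clasp_at e 0 n * c.
  by apply: (@clasp_intertwine _ _ _ _ _ _ 0%N 0%N) => i im; apply: ce; lia.
have Pk : clasp_at e1 0 n * k = k * clasp_at e 0 n.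
  by apply/esym; apply: (@clasp_intertwine _ _ _ _ _ _ 0%N 0%N) => i im; apply: ek; lia.
have Pw : clasp_at e 0 n * w = w * clasp_at e 0 n by apply: clasp_comm => i *; apply: we; lia.
rewrite !G -?nE //; last by rewrite addnS -nE.
rewrite !mulrA cP -!mulrA Pk !mulrA -(mulrA _ c) -(mulrA _ (c * _)) addSn trace_clasp; last by lia.
by rewrite zmr zml -!mulrA Pw.
Qed.

Lemma rep_trace n b j x a : N = (n + b)%N -> n = (b.+1 + j)%N ->
  rep v (flip (b.+1 + n) e1) b.+1 n b.+2 (level v n b.+1) x a ->
  exists2 x', rep v (flip (b + n) e) b n b.+1 (level v n b) x' (trace_fun j b a) &
    c * x * k = x' * w.
Proof.
move=> nE jE [d [-> ad]].
exists (\sum_(r < n.+1) (d r * ([b + r + 3] / [b + r + 1])) *: rung v (flip (b + n) e) b n r).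
  exists (fun r => d r * ([b + r + 3] / [b + r + 1])); split=> // u ub.
  rewrite /trace_fun !ad; try lia.
  rewrite !mulr_sumr -big_split; apply: eq_bigr => r _ /=.
  have rn : (r <= b.+1 + j)%N by rewrite -jE -ltnS.
  have := trace_eig vgen rn (ltnSE ub); rewrite -jE => E.
  by rewrite -mulrA E mulrDr !(mulrCA (d r)).
rewrite mulr_sumr !mulr_suml; apply: eq_bigr => r _.
by rewrite !zmr !zml trace_rung ?scalerA // -ltnS.
Qed.
End Trace.
End LiftTrace.

(** * Adjointness of lifts and partial traces *)

Section Adjoint.
Variables (F : fieldType) (v : F).
Hypothesis vgen : generic_q v.
Local Notation "[ n ]" := (qn v n) (at level 0, format "[ n ]").

(** The quantum dimension of the component u of the product of clasps of n and
    n - k strands. *)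
Definition qdim n k u : F := [2 * u + k + 1] * [n - k - u + 1] * [n + u + 2] / [2].

(** The eigenvalues after k partial traces on the second bundle. *)
Fixpoint trs n k (a : nat -> F) : nat -> F :=
  if k is k'.+1 then trace_fun v k' (n - k) (trs n k' a) else a.
(** The eigenvalues after k lifts, back to two bundles of n strands. *)
Fixpoint lfs n k (a : nat -> F) : nat -> F :=
  if k is k'.+1 then lfs n k' (lift_fun v k' (n - k) a) else a.

Lemma adj_alg (A B C D E G H : F) : A != 0 -> B != 0 -> G != 0 ->
  A * C * D / G * (E * H / (B * A)) = C * D * E * H / (G * B).
Proof. by move=> *; field; do !(apply/andP; split). Qed.

(** The two weights of a lift and the two weights of a trace are matched by the
    quantum dimensions; at the ends of the range one of the weights vanishes. *)
Lemma adjoint_step n b k (a c : nat -> F) : n = (b + k.+1)%N ->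
  \sum_(u < b.+1) qdim n k.+1 u * (trace_fun v k b a u * c u) =
  \sum_(u < b.+2) qdim n k u * (a u * lift_fun v k b c u).
Proof.
move=> nE; have q0 i : (0 < i)%N -> [i] != 0 by exact: vgen.
have e1 u : (u <= b)%N -> qdim n k.+1 u * trace_stay v k b u = qdim n k u * lift_stay v k b u.
  move=> ub; rewrite /qdim /trace_stay /lift_stay.
  rewrite (_ : n - k - u + 1 = b.+2 - u)%N; last by lia.
  rewrite (_ : n - k.+1 - u + 1 = b.+1 - u)%N; last by lia.
  rewrite (_ : 2 * u + k.+1 + 1 = 2 * u + k.+2)%N; last by lia.
  rewrite (_ : 2 * u + k + 1 = 2 * u + k.+1)%N; last by lia.
  rewrite !adj_alg ?q0 //; try lia.
  by congr (_ / _); ring.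
have e2 u : (u <= b)%N -> qdim n k.+1 u * trace_down v k b u = qdim n k u.+1 * lift_down v k b u.+1.
  move=> ub; rewrite /qdim /trace_down /lift_down.
  rewrite (_ : n - k.+1 - u + 1 = b.+1 - u)%N; last by lia.
  rewrite (_ : n - k - u.+1 + 1 = b.+1 - u)%N; last by lia.
  rewrite (_ : 2 * u + k.+1 + 1 = 2 * u + k.+2)%N; last by lia.
  rewrite (_ : 2 * u.+1 + k + 1 = 2 * u.+1 + k.+1)%N; last by lia.
  rewrite (_ : n + u.+1 + 2 = b + k + u + 4)%N; last by lia.
  rewrite (_ : b + k.+1 + u.+1 + 1 = n + u + 2)%N; last by lia.
  rewrite !adj_alg ?q0 //; try lia.
  by congr (_ / _); ring.
transitivity (\sum_(u < b.+1) (qdim n k u * lift_stay v k b u) * (a u * c u) +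
   \sum_(u < b.+1) (qdim n k u.+1 * lift_down v k b u.+1) * (a u.+1 * c u)).
  rewrite -big_split; apply: eq_bigr => u _ /=.
  have ub : (u <= b)%N by rewrite -ltnS.
  by rewrite -e1 // -e2 // /trace_fun; ring.
transitivity (\sum_(u < b.+2) (qdim n k u * lift_stay v k b u) * (a u * c u) +
   \sum_(u < b.+2) (qdim n k u * lift_down v k b u) * (a u * c u.-1)); last first.
  by rewrite -big_split; apply: eq_bigr => u _; rewrite /lift_fun /=; ring.
congr (_ + _).
  rewrite [RHS]big_ord_recr /= /lift_stay (_ : b.+1 - b.+1 = 0)%N ?subnn //.
  by rewrite qn0 // mulr0 mul0r mulr0 mul0r addr0.
rewrite [RHS]big_ord_recl /= /lift_down qn0 // mul0r mul0r mulr0 mul0r add0r.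
by apply: eq_bigr.
Qed.

Lemma adjoint n k (a c : nat -> F) : (k <= n)%N ->
  \sum_(u < (n - k).+1) qdim n k u * (trs n k a u * c u) =
  \sum_(u < n.+1) qdim n 0 u * (a u * lfs n k c u).
Proof.
elim: k c => [|k IH] c kn; first by rewrite subn0.
rewrite /= adjoint_step; last by lia.
by rewrite -IH ?(ltnW kn) // (_ : (n - k.+1).+1 = n - k)%N //; lia.
Qed.

Lemma lfs1 n k (c : nat -> F) u : (k <= n)%N -> (forall u, (u <= n - k)%N -> c u = 1) -> (u <= n)%N -> lfs n k c u = 1.
Proof.
elim: k c u => [|k IH] c u kn c1 un; first by apply: c1; rewrite subn0.
apply: IH => //; [exact: ltnW|move=> {un} u un].
rewrite /lift_fun; have un' : (u <= (n - k.+1).+1)%N by lia.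
have [un2|un2] := leqP u (n - k.+1); last first.
  rewrite -[RHS](lift_sum vgen k un') /lift_stay (_ : (n - k.+1).+1 - u = 0)%N; last by lia.
  by rewrite qn0 // mulr0 !mul0r !add0r c1 ?mulr1 //; lia.
by rewrite !c1 ?mulr1 ?lift_sum //; lia.
Qed.

Lemma trs_total n a : qdim n n 0 * trs n n a 0 = \sum_(u < n.+1) qdim n 0 u * a u.
Proof.
have := @adjoint n n a (fun=> 1) (leqnn n); rewrite subnn big_ord1 mulr1 => ->.
by apply: eq_bigr => u _; rewrite lfs1 ?mulr1 // -ltnS.
Qed.

(** Closing a product completely can be done after moving the lifts of one factor
    to partial traces of the other. *)
Lemma trs_pairing n k a b : (k <= n)%N ->
  qdim n n 0 * trs n n (fun u => a u * lfs n k (trs n k b) u) 0 =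
  \sum_(u < (n - k).+1) qdim n k u * (trs n k a u * trs n k b u).
Proof. by move=> kn; rewrite trs_total adjoint. Qed.
End Adjoint.

Lemma rep_lfs (F : fieldType) (v : F) (R : algType F) (e : nat -> R) n k x a :
  generic_q v -> hecke v e (n + n) -> (k <= n)%N ->
  rep v e n (n - k) (n - k).+1 (level v n (n - k)) x a ->
  rep v e n n n.+1 (level v n n) (ladder v e (n + n) n * x * ladder v e (n + n) n) (lfs v n k a).
Proof.
move=> vgen eH; elim: k x a => [|k IH] x a kn xa.
  rewrite subn0 in xa; have := rep_mul vgen eH (z := level v n n) (U := n.+1).
  have zs u : (u < n.+1)%N -> exists2 s, (s <= n)%N & level v n n u = level v n n s.
    by move=> un; exists u; rewrite // -ltnS.
  move=> /(_ zs) M; have L : rep v e n n n.+1 (level v n n) (ladder v e (n + n) n) (fun=> 1) by apply: rep_unit.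
  by apply: rep_eq (M _ _ _ _ (M _ _ _ _ L xa) L) => u _; rewrite mul1r mulr1.
have nb : (n - k = (n - k.+1).+1)%N by lia.
have eH' : hecke v e (n + (n - k.+1).+1) by apply: hecke_le eH _; lia.
have := rep_lift vgen eH' (k := k) _ xa; rewrite -nb => /(_ ltac:(lia)) xa'.
have := IH _ _ (ltnW kn) xa'; set L := ladder _ _ _ _; set L' := ladder v e (n + (n - k)) n.
have -> : L * (L' * x * L') * L = L * x * L; last by [].
have e1 : L * L' = L.
  by rewrite /L' ladderE mulrA !(lad_absr vgen eH) //; lia.
have e2 : L' * L = L.
  by rewrite /L' ladderE -mulrA !(lad_absl vgen eH) //; lia.
by rewrite !mulrA e1 -!mulrA e2.
Qed.

(** * Transport of rung elements *)

Section RepTransport.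
Variables (F : fieldType) (v : F) (R : algType F).
Hypothesis vgen : generic_q v.

Lemma rung_intertwine (e e' : nat -> R) x n b r : (r <= b)%N ->
  (forall i, (i.+1 < n + b)%N -> x * e i = e' i * x) -> x * rung v e n b r = rung v e' n b r * x.
Proof.
move=> rb xe; have L c : (c <= n + b)%N -> x * ladder v e (n + b) c = ladder v e' (n + b) c * x.
  move=> cN; rewrite !ladderE mulrA.
  rewrite (@clasp_intertwine _ _ _ _ e e' 0 0) => [|i ic]; last by apply: xe; lia.
  rewrite -!mulrA (@clasp_intertwine _ _ _ _ e e' c c) // => i ic; apply: xe; lia.
by rewrite /rung !mulrA L -?mulrA; [rewrite (mulrA x) L -?mulrA ?L|]; try lia.
Qed.

Lemma rep_intertwine (e e' : nat -> R) x y n b U z a :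
  (forall i, (i.+1 < n + b)%N -> x * e i = e' i * x) -> rep v e n b U z y a ->
  exists2 y', rep v e' n b U z y' a & x * y = y' * x.
Proof.
move=> xe [c [-> ac]]; exists (\sum_(r < b.+1) c r *: rung v e' n b r); first by exists c.
rewrite mulr_sumr mulr_suml; apply: eq_bigr => r _; rewrite zmr zml; congr (_ *: _).
by apply: rung_intertwine xe; rewrite -ltnS.
Qed.
Lemma rep_intertwine' (e e' : nat -> R) x y n b U z a :
  (forall i, (i.+1 < n + b)%N -> e i * x = x * e' i) -> rep v e n b U z y a ->
  exists2 y', rep v e' n b U z y' a & y * x = x * y'.
Proof.
move=> xe [c [-> ac]]; exists (\sum_(r < b.+1) c r *: rung v e' n b r); first by exists c.
rewrite mulr_sumr mulr_suml; apply: eq_bigr => r _; rewrite zmr zml; congr (_ *: _).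
apply/esym; apply: rung_intertwine; [by rewrite -ltnS|by move=> i ib; rewrite xe].
Qed.

Lemma rep_unflip (e : nat -> R) n y a : hecke v e (n + n) -> (0 < n)%N ->
  rep v e n n n.+1 (level v n n) y a -> rep v (flip (n + n) e) n n n.+1 (level v n n) y a.
Proof.
move=> eH n0 yr; have [|y' y'r E1] := @rep_intertwine e (flip (n + n) (flip (n + n) e)) 1 _ _ _ _ _ _ _ yr.
  by move=> i iN; rewrite mul1r mulr1 /flip; congr e; lia.
rewrite mul1r mulr1 in E1; rewrite E1; apply: rep_flip y'r => //.
- exact: flip_hecke.
- lia.
- by move=> u un; exists u; rewrite // -ltnS.
Qed.

Lemma rep_ladl (e : nat -> R) n b U z y a : hecke v e (n + b) -> rep v e n b U z y a ->
  ladder v e (n + b) n * y = y.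
Proof.
move=> eH [c [-> _]]; rewrite mulr_sumr; apply: eq_bigr => r _.
by rewrite zmr /rung !mulrA (lad_idem vgen eH) // leq_addr.
Qed.
Lemma rep_ladr (e : nat -> R) n b U z y a : hecke v e (n + b) -> rep v e n b U z y a ->
  y * ladder v e (n + b) n = y.
Proof.
move=> eH [c [-> _]]; rewrite mulr_suml; apply: eq_bigr => r _.
by rewrite zml /rung -!mulrA (lad_idem vgen eH) // leq_addr.
Qed.
End RepTransport.

(** * Spreading one clasp over six bundles *)

Section Spread.
Variables (R : nzRingType) (Q : nat -> R) (Om G B A Ps : R).
Hypothesis QQ : forall i j, Q i * Q j = Q j * Q i.
Hypothesis Qid : forall i, Q i * Q i = Q i.
Hypothesis A0 : A * Q 0 = Q 1 * A.
Hypothesis A1 : A * Q 1 = Q 0 * A.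
Hypothesis AQ : forall i, (1 < i)%N -> A * Q i = Q i * A.
Hypothesis B2 : B * Q 2 = Q 3 * B.
Hypothesis B3 : B * Q 3 = Q 2 * B.
Hypothesis BQ : forall i, (i < 2)%N || (3 < i)%N -> B * Q i = Q i * B.
Hypothesis GQ : forall i, G * Q i = Q i * G.
Hypothesis P05 : Q 0 * Ps = Q 5 * Ps.
Hypothesis P12 : Q 1 * Ps = Q 2 * Ps.
Hypothesis P34 : Q 3 * Ps = Q 4 * Ps.
Hypothesis O05 : Om * Q 0 = Om * Q 5.
Hypothesis O12 : Om * Q 1 = Om * Q 2.
Hypothesis O34 : Om * Q 3 = Om * Q 4.

Let T x := Om * (G * (B * (A * x))).
Let T0 x : T (Q 0 * x) = Om * (Q 1 * (G * (B * (A * x)))).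
Proof. by rewrite /T (mulrA A) A0 -mulrA (mulrA B) BQ // -mulrA (mulrA G) GQ -mulrA. Qed.
Let T1 x : T (Q 1 * x) = Om * (Q 0 * (G * (B * (A * x)))).
Proof. by rewrite /T (mulrA A) A1 -mulrA (mulrA B) BQ // -mulrA (mulrA G) GQ -mulrA. Qed.
Let T3 x : T (Q 3 * x) = Om * (Q 2 * (G * (B * (A * x)))).
Proof. by rewrite /T (mulrA A) AQ // -mulrA (mulrA B) B3 // -mulrA (mulrA G) GQ -mulrA. Qed.
Let T5 x : T (Q 5 * x) = Om * (Q 5 * (G * (B * (A * x)))).
Proof. by rewrite /T (mulrA A) AQ // -mulrA (mulrA B) BQ // -mulrA (mulrA G) GQ -mulrA. Qed.
Let T01 x : T (Q 0 * x) = T (Q 0 * (Q 3 * x)).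
Proof.
transitivity (T (Q 0 * (Q 0 * x))); first by rewrite mulrA Qid.
rewrite T0 [RHS]T0 mulrA O12 -mulrA.
transitivity (T (Q 3 * (Q 0 * x))); first by rewrite T3.
by rewrite mulrA QQ -mulrA T0.
Qed.
Let T51 x : T (Q 5 * x) = T (Q 5 * (Q 1 * x)).
Proof.
transitivity (T (Q 5 * (Q 5 * x))); first by rewrite mulrA Qid.
rewrite T5 mulrA -O05 -mulrA.
transitivity (T (Q 1 * (Q 5 * x))); first by rewrite T1.
by rewrite mulrA QQ -mulrA.
Qed.

(** One clasp suffices to put a clasp on every bundle: it slides along the nested
    arcs above and below, is doubled by idempotence, and passes through the
    columns; a parallel column exchanges its two bundles, and the six bundles form
    one closed path. *)
Lemma spread_clasp :
  Om * G * B * A * Q 5 * Ps = Om * (G * (Q 4 * Q 5)) * (B * (Q 2 * Q 3)) * (A * (Q 0 * Q 1)) * Ps.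
Proof.
have E5 : Q 5 * Ps = Q 0 * (Q 5 * Ps) by rewrite mulrA QQ -mulrA P05 mulrA Qid.
have E3 : Q 3 * Ps = Q 3 * (Q 4 * Ps) by rewrite -P34 mulrA Qid.
have E1 : Q 1 * Ps = Q 1 * (Q 2 * Ps) by rewrite -P12 mulrA Qid.
have C i j x : Q i * (Q j * x) = Q j * (Q i * x) by rewrite mulrA QQ -mulrA.
transitivity (T (Q 5 * Ps)); first by rewrite /T !mulrA.
rewrite E5 T01 (C 3) (C 0) T51 (C 1).
have -> : Q 5 * (Q 0 * (Q 1 * (Q 3 * Ps))) = Q 4 * (Q 5 * (Q 2 * (Q 3 * (Q 0 * (Q 1 * Ps))))).
  rewrite E3 (C 3) (C 1 4) (C 0 4) (C 5 4); congr (_ * (_ * _)).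
  by rewrite (C 1 3) [in LHS]E1 (C 1 2) (C 3 2) (C 0 2) (C 0 3).
rewrite /T -!mulrA; congr (Om * (G * _)).
rewrite (mulrA A) AQ // -mulrA (mulrA B) BQ // -mulrA; congr (_ * _).
rewrite (mulrA A) AQ // -mulrA (mulrA B) BQ // -mulrA; congr (_ * (_ * _)).
rewrite (mulrA A) AQ // -mulrA; congr (_ * _).
by rewrite (mulrA A) AQ // -mulrA.
Qed.

(** The clasps of the third column can be slid along the arcs into the clasps of
    the first two. *)
Lemma spread_absorb (C : R) : (forall i, (i < 4)%N -> Q i * C = C * Q i) ->
  Om * ((Q 4 * Q 5) * C * (Q 4 * Q 5)) * (B * (Q 2 * Q 3)) * (A * (Q 0 * Q 1)) * Ps =
  Om * C * (B * (Q 2 * Q 3)) * (A * (Q 0 * Q 1)) * Ps.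
Proof.
move=> CQ; set xB := B * _; set xA := A * _.
have xB3 : xB * Q 3 = xB by rewrite /xB -!mulrA Qid.
have xB3' : Q 3 * xB = xB by rewrite /xB !mulrA -B2 -!mulrA (mulrA (Q 2)) Qid.
have xA0 : xA * Q 0 = xA by rewrite /xA -!mulrA (QQ 1) (mulrA (Q 0)) Qid.
have xA0' : Q 0 * xA = xA by rewrite /xA !mulrA -A1 -!mulrA (QQ 0) (mulrA (Q 1)) Qid.
have xAi i : (1 < i)%N -> xA * Q i = Q i * xA.
  by move=> i1; rewrite /xA -!mulrA QQ (mulrA _ (Q i)) (QQ 0) -!mulrA (mulrA A) AQ // !mulrA.
have xBi i : (i < 2)%N || (3 < i)%N -> xB * Q i = Q i * xB.
  by move=> i1; rewrite /xB -!mulrA QQ (mulrA _ (Q i)) (QQ 2) -!mulrA (mulrA B) BQ // !mulrA.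
have xAc i x : (1 < i)%N -> Q i * (xA * x) = xA * (Q i * x) by move=> i1; rewrite mulrA -xAi // -mulrA.
have xBc i x : (i < 2)%N || (3 < i)%N -> Q i * (xB * x) = xB * (Q i * x).
  by move=> i1; rewrite mulrA -xBi // -mulrA.
clearbody xA xB.
have Cc i x : (i < 4)%N -> Q i * (C * x) = C * (Q i * x) by move=> i1; rewrite mulrA CQ // -mulrA.
have R4 : Q 4 * (Q 5 * (xB * (xA * Ps))) = xB * (xA * Ps).
  rewrite (xBc 5) // (xAc 5) // -P05 (mulrA xA) xA0 (xBc 4) // (xAc 4) // -P34 -xAc //.
  by rewrite (mulrA xB) xB3.
rewrite -!mulrA R4 (mulrA Om) -O34 -mulrA (mulrA (Q 3)) QQ -mulrA (mulrA Om) -O05 -mulrA.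
by rewrite (Cc 3) // (mulrA (Q 3)) xB3' (Cc 0) // (xBc 0) // (mulrA (Q 0)) xA0'.
Qed.
End Spread.

(** * Endomorphisms as an algebra *)

Section LinearEndomorphisms.
Variables (K : fieldType) (V : lmodType K).

(** The scalar makes the ring nontrivial whatever the space V is. *)
Record lend := Lend { lfun :> V -> V; laux : K; lfun_linear : linear lfun }.

HB.instance Definition _ := gen_eqMixin lend.
HB.instance Definition _ := gen_choiceMixin lend.
HB.instance Definition _ (f : lend) := GRing.isLinear.Build K V V *:%R (lfun f) (lfun_linear f).

Lemma lendP (f g : lend) : f =1 g -> laux f = laux g -> f = g.
Proof.
case: f => f a hf; case: g => g b hg /= /funext E; case: _ / E in hg * => ->.
by rewrite (Prop_irrelevance hf hg).
Qed.

Fact lend0_linear : linear (fun _ : V => 0 : V).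
Proof. by move=> k x y; rewrite scaler0 addr0. Qed.
Fact lendN_linear (f : lend) : linear (fun x => - f x).
Proof. by move=> k x y; rewrite linearP opprD scalerN. Qed.
Fact lendD_linear (f g : lend) : linear (fun x => f x + g x).
Proof. by move=> k x y; rewrite !linearP scalerDr addrACA. Qed.
Fact lend1_linear : linear (fun x : V => x).
Proof. by []. Qed.
Fact lendM_linear (f g : lend) : linear (fun x => f (g x)).
Proof. by move=> k x y; rewrite !linearP. Qed.
Fact lendZ_linear a (f : lend) : linear (fun x => a *: f x).
Proof. by move=> k x y; rewrite linearP scalerDr !scalerA mulrC. Qed.

Definition lend_add (f g : lend) := Lend (laux f + laux g) (lendD_linear f g).
Definition lend_opp (f : lend) := Lend (- laux f) (lendN_linear f).
Definition lend_zero := Lend 0 lend0_linear.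
Definition lend_mul (f g : lend) := Lend (laux f * laux g) (lendM_linear f g).
Definition lend_one := Lend 1 lend1_linear.
Definition lend_scale a (f : lend) := Lend (a * laux f) (lendZ_linear a f).

Fact lend_addA : associative lend_add.
Proof. by move=> f g h; apply: lendP => [x|] /=; rewrite addrA. Qed.
Fact lend_addC : commutative lend_add.
Proof. by move=> f g; apply: lendP => [x|] /=; rewrite addrC. Qed.
Fact lend_add0 : left_id lend_zero lend_add.
Proof. by move=> f; apply: lendP => [x|] /=; rewrite add0r. Qed.
Fact lend_addN : left_inverse lend_zero lend_opp lend_add.
Proof. by move=> f; apply: lendP => [x|] /=; rewrite addNr. Qed.
HB.instance Definition _ := GRing.isZmodule.Build lend lend_addA lend_addC lend_add0 lend_addN.

Fact lend_mulA : associative lend_mul.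
Proof. by move=> f g h; apply: lendP => //=; rewrite mulrA. Qed.
Fact lend_mul1l : left_id lend_one lend_mul.
Proof. by move=> f; apply: lendP => //=; rewrite mul1r. Qed.
Fact lend_mul1r : right_id lend_one lend_mul.
Proof. by move=> f; apply: lendP => //=; rewrite mulr1. Qed.
Fact lend_mulDl : left_distributive lend_mul +%R.
Proof. by move=> f g h; apply: lendP => //=; rewrite mulrDl. Qed.
Fact lend_mulDr : right_distributive lend_mul +%R.
Proof. by move=> f g h; apply: lendP => [x|] /=; rewrite ?linearD ?mulrDr. Qed.
Fact lend_1neq0 : lend_one != 0.
Proof. by apply/eqP => /(congr1 laux) /= /eqP; rewrite oner_eq0. Qed.
HB.instance Definition _ := GRing.Zmodule_isNzRing.Build lend
  lend_mulA lend_mul1l lend_mul1r lend_mulDl lend_mulDr lend_1neq0.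

Fact lend_scaleA a b (f : lend) : lend_scale a (lend_scale b f) = lend_scale (a * b) f.
Proof. by apply: lendP => [x|] /=; rewrite ?scalerA ?mulrA. Qed.
Fact lend_scale1 : left_id 1 lend_scale.
Proof. by move=> f; apply: lendP => [x|] /=; rewrite ?scale1r ?mul1r. Qed.
Fact lend_scaleDr : right_distributive lend_scale +%R.
Proof. by move=> a f g; apply: lendP => [x|] /=; rewrite ?scalerDr ?mulrDr. Qed.
Fact lend_scaleDl (f : lend) : {morph lend_scale^~ f : a b / a + b}.
Proof. by move=> a b; apply: lendP => [x|] /=; rewrite ?scalerDl ?mulrDl. Qed.
HB.instance Definition _ := GRing.Zmodule_isLmodule.Build K lend
  lend_scaleA lend_scale1 lend_scaleDr lend_scaleDl.

Fact lend_scaleAl a (f g : lend) : a *: (f * g) = a *: f * g.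
Proof. by apply: lendP => //=; rewrite mulrA. Qed.
HB.instance Definition _ := GRing.Lmodule_isLalgebra.Build K lend lend_scaleAl.
Fact lend_scaleAr a (f g : lend) : a *: (f * g) = f * (a *: g).
Proof. by apply: lendP => [x|] /=; rewrite ?linearZ // mulrCA. Qed.
HB.instance Definition _ := GRing.Lalgebra_isAlgebra.Build K lend lend_scaleAr.

Lemma lendME (f g : lend) x : (f * g) x = f (g x). Proof. by []. Qed.
Lemma lendZE a (f : lend) x : (a *: f) x = a *: f x. Proof. by []. Qed.
End LinearEndomorphisms.

(** * Diagrams as operators *)

Definition Kq : fieldType := Qq.

Definition bval (D : diagram) : Kq := if run D [::] == Some [::] then A2_bracket D else 0.

(** The functions of the diagram on top that come from combinations of diagrams
    below, closed by the bracket. *)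
Definition is_state (S : seq bool) (phi : diagram -> Kq) : Prop :=
  exists2 L : seq (Kq * diagram), all (fun x => run x.2 [::] == Some S) L &
    phi = fun T => \sum_(x <- L) x.1 * bval (x.2 ++ T).

(** All sections are kept together, so that diagrams between different sections
    become elements of one algebra. *)
Record states := States { sfun :> seq bool -> diagram -> Kq;
  sfunP : forall S, is_state S (sfun S) }.

Section States.
Local Notation V := states.

HB.instance Definition _ := gen_eqMixin V.
HB.instance Definition _ := gen_choiceMixin V.

Lemma statesP (f g : V) : (forall S T, f S T = g S T) -> f = g.
Proof.
case: f => f hf; case: g => g hg /= E.
have {E} E : f = g by apply: funext => S; apply: funext => T.
by case: _ / E in hg *; rewrite (Prop_irrelevance hf hg).
Qed.

Fact is_state0 S : is_state S (fun=> 0).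
Proof. by exists [::] => //; apply: funext => T; rewrite big_nil. Qed.

Fact is_state_lin S a f g : is_state S f -> is_state S g ->
  is_state S (fun T => a * f T + g T).
Proof.
move=> [L hL ->] [M hM ->]; exists ([seq (a * x.1, x.2) | x <- L] ++ M).
  by rewrite all_cat hM all_map andbT; apply: sub_all hL.
apply: funext => T; rewrite big_cat big_map mulr_sumr; congr (_ + _).
by apply: eq_bigr => x _; rewrite mulrA.
Qed.

Definition states_lin a (f g : V) :=
  States (fun S => is_state_lin a (sfunP f S) (sfunP g S)).
Definition states_zero := States is_state0.
Definition states_add (f g : V) := states_lin 1 f g.
Definition states_opp (f : V) := states_lin (-1) f states_zero.
Definition states_scale a (f : V) := states_lin a f states_zero.

Fact states_addA : associative states_add.
Proof. by move=> f g h; apply: statesP => S T /=; ring. Qed.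
Fact states_addC : commutative states_add.
Proof. by move=> f g; apply: statesP => S T /=; ring. Qed.
Fact states_add0 : left_id states_zero states_add.
Proof. by move=> f; apply: statesP => S T /=; ring. Qed.
Fact states_addN : left_inverse states_zero states_opp states_add.
Proof. by move=> f; apply: statesP => S T /=; ring. Qed.
HB.instance Definition _ :=
  GRing.isZmodule.Build V states_addA states_addC states_add0 states_addN.

Fact states_scaleA a b f : states_scale a (states_scale b f) = states_scale (a * b) f.
Proof. by apply: statesP => S T /=; ring. Qed.
Fact states_scale1 : left_id 1 states_scale.
Proof. by move=> f; apply: statesP => S T /=; ring. Qed.
Fact states_scaleDr : right_distributive states_scale +%R.
Proof. by move=> a f g; apply: statesP => S T /=; ring. Qed.
Fact states_scaleDl f : {morph states_scale^~ f : a b / a + b}.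
Proof. by move=> a b; apply: statesP => S T /=; ring. Qed.
HB.instance Definition _ := GRing.Zmodule_isLmodule.Build Kq V
  states_scaleA states_scale1 states_scaleDr states_scaleDl.

Lemma statesDE (f g : V) S T : (f + g) S T = f S T + g S T.
Proof. by rewrite /= mul1r. Qed.
Lemma statesZE a (f : V) S T : (a *: f) S T = a * f S T.
Proof. by rewrite /= addr0. Qed.

Lemma states_sumE (I : Type) (r : seq I) (f : I -> V) S T :
  (\sum_(i <- r) f i) S T = \sum_(i <- r) f i S T.
Proof. by elim: r => [|i r IH]; rewrite ?big_nil // !big_cons statesDE IH. Qed.
End States.

Arguments step : simpl never.
Lemma run_cons x D s : run (x :: D) s = obind (run D) (step x s).
Proof. by []. Qed.

Lemma run_cat D1 D2 s : run (D1 ++ D2) s = obind (run D2) (run D1 s).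
Proof. by elim: D1 s => //= x D1 IH s; case: (step x s) => //=. Qed.

Fact is_state_draw S S' D phi : run D S = Some S' -> is_state S phi ->
  is_state S' (fun T => phi (D ++ T)).
Proof.
move=> rD [L hL ->]; exists [seq (x.1, x.2 ++ D) | x <- L].
  by rewrite all_map; apply: sub_all hL => x /= /eqP rx; rewrite run_cat rx /= rD.
by apply: funext => T; rewrite big_map; apply: eq_bigr => x _; rewrite catA.
Qed.

Fact is_state_op S D (phi : states) X :
  is_state X (fun T => if run D S == Some X then phi S (D ++ T) else 0).
Proof.
case: eqP => [e|_]; last exact: is_state0.
exact: is_state_draw e (sfunP phi S).
Qed.
Definition op_fun S D phi := States (is_state_op S D phi).
Fact op_linear S D : linear (op_fun S D).
Proof.
move=> a f g; apply: statesP => X T; rewrite statesDE statesZE /=.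
by case: ifP => _; rewrite ?mulr0 ?addr0 ?mul1r.
Qed.

(** The diagram D placed on top of a state with section S.  All these operators
    live in one algebra, whose product is composition: w S' D' * w S D stands
    for D with D' on top. *)
HB.lock Definition w S D : lend states := Lend 0 (op_linear S D).
Notation "'R" := (lend states).

Lemma wE S D (phi : states) X T :
  w S D phi X T = if run D S == Some X then phi S (D ++ T) else 0.
Proof. by rewrite w.unlock. Qed.

Lemma waux S D : laux (w S D) = 0. Proof. by rewrite w.unlock. Qed.

Lemma laux_sum (I : Type) (r : seq I) (f : I -> 'R) :
  laux (\sum_(i <- r) f i) = \sum_(i <- r) laux (f i).
Proof. by elim: r => [|i r IH]; rewrite ?big_nil // !big_cons -IH. Qed.

Lemma lend_sumE (I : Type) (r : seq I) (f : I -> 'R) phi :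
  (\sum_(i <- r) f i) phi = \sum_(i <- r) f i phi.
Proof. by elim: r => [|i r IH]; rewrite ?big_nil // !big_cons -IH. Qed.

Lemma w_cat S S' D1 D2 : run D1 S = Some S' -> w S' D2 * w S D1 = w S (D1 ++ D2).
Proof.
move=> r1; apply: lendP => [phi|]; last by rewrite /= !waux mul0r.
rewrite lendME; apply: statesP => X T.
by rewrite !wE run_cat r1 /= eqxx; case: ifP; rewrite ?catA.
Qed.

Lemma stepP i g S S' : step (i, g) S = Some S' <->
  exists l r, [/\ S = l ++ gdom g ++ r, S' = l ++ gcod g ++ r & size l = i].
Proof.
split.
  rewrite /step; case: ifP => // /andP[iS /eqP E] [<-].
  exists (take i S), (drop (i + size (gdom g)) S); split=> //.
    by rewrite -{1}(cat_take_drop i S) -{1}(cat_take_drop (size (gdom g)) (drop i S)) E drop_drop addnC.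
  by rewrite size_takel.
move=> [l [r [-> -> <-]]]; rewrite /step size_cat leq_addr drop_size_cat // take_size_cat // eqxx /=.
rewrite take_size_cat //; congr (Some (_ ++ _ ++ _)).
by rewrite catA drop_size_cat // size_cat.
Qed.

Lemma step_cat l g r : step (size l, g) (l ++ gdom g ++ r) = Some (l ++ gcod g ++ r).
Proof. by apply/stepP; exists l, r. Qed.

Lemma run_shift D s s' l r : run D s = Some s' ->
  run (shift (size l) D) (l ++ s ++ r) = Some (l ++ s' ++ r).
Proof.
elim: D s => [|[i g] D IH] s /=; first by case=> ->.
case E: (step (i, g) s) => [s1|] //= rD.
have [l1 [r1 [-> Es1 Ei]]] := (stepP _ _ _ _).1 E.
have -> : step ((size l + i)%N, g) (l ++ (l1 ++ gdom g ++ r1) ++ r) = Some (l ++ s1 ++ r).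
  apply/stepP; exists (l ++ l1), (r1 ++ r); split; rewrite ?Es1 -?catA //.
  by rewrite size_cat Ei.
exact: IH.
Qed.

Lemma skein_typed s s' L R : skein s s' L R ->
  run L s = Some s' /\ (forall cD, List.In cD R -> run cD.2 s = Some s').
Proof.
have c1 (g h : gen) m : run [:: (0, g); (size (gcod g) + size m, h)]%N
    (gdom g ++ m ++ gdom h) = Some (gcod g ++ m ++ gcod h).
  rewrite [run _ _]/(obind _ _) (step_cat [::] g) /=.
  have := step_cat (gcod g ++ m) h [::]; rewrite !cats0 size_cat -!catA.
  by move=> -> .
have c2 (g h : gen) m : run [:: (size (gdom g) + size m, h); (0, g)]%N
    (gdom g ++ m ++ gdom h) = Some (gcod g ++ m ++ gcod h).
  rewrite [run _ _]/(obind _ _).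
  have := step_cat (gdom g ++ m) h [::]; rewrite !cats0 size_cat -!catA => -> /=.
  by rewrite (step_cat [::] g).
case=> [g h m|[]|[]|||||[] [] [] p|[] [] [] p|||[]] //; split=> //=;
  try (by move=> cD [<-|[]]); try (by move=> cD [<-|[<-|[]]]).
- exact: c1.
by move=> cD [<-|[]] //; exact: c2.
Qed.

Definition wl S D1 i (L : seq (Kq * diagram)) D2 : 'R :=
  \sum_(x <- L) x.1 *: w S (D1 ++ shift i x.2 ++ D2).

(** Equality in every context, as operators, so that local relations can be used
    as rewriting rules inside longer words. *)
Record leqv (s : seq bool) (A B : seq (Kq * diagram)) : Prop := Leqv {
  leqvE : forall S D1 l r D2, run D1 S = Some (l ++ s ++ r) ->
    wl S D1 (size l) A D2 = wl S D1 (size l) B D2 }.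
Definition weq s A B := leqv s [:: (1, A)] [:: (1, B)].

Lemma shift_cat i A B : shift i (A ++ B) = shift i A ++ shift i B.
Proof. exact: map_cat. Qed.

Lemma shift_shift i j A : shift i (shift j A) = shift (i + j) A.
Proof. by rewrite /shift -map_comp; apply: eq_map => x /=; rewrite addnA. Qed.

(** A skein relation holds for operators because it holds for the bracket with any
    diagram below and any diagram on top. *)
Lemma w_skein s s' L R S D1 l r D2 : skein s s' L R -> run D1 S = Some (l ++ s ++ r) ->
  w S (D1 ++ shift (size l) L ++ D2) = wl S D1 (size l) R D2.
Proof.
move=> sk r1; have [tL tR] := skein_typed sk.
have rX X : run X s = Some s' -> run (D1 ++ shift (size l) X ++ D2) S = run D2 (l ++ s' ++ r).
  by move=> rX; rewrite run_cat r1 /= run_cat (run_shift l r rX).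
apply: lendP => [phi|]; last first.
  by rewrite waux laux_sum big1 // => x _; rewrite /= waux mulr0.
apply: statesP => X T; rewrite lend_sumE states_sumE wE rX //.
have -> : \sum_(i <- R) ((i.1 : Kq) *: w S (D1 ++ shift (size l) i.2 ++ D2)) phi X T
  = if run D2 (l ++ s' ++ r) == Some X
    then \sum_(cD <- R) cD.1 * phi S ((D1 ++ shift (size l) cD.2 ++ D2) ++ T) else 0.
  elim: R tR {sk} => [|cD R IH] tR; rewrite ?big_nil; first by case: ifP.
  rewrite !big_cons IH; last by move=> cD' h; apply: tR; right.
  rewrite lendZE statesZE wE rX; last by apply: tR; left.
  by case: ifP => _; rewrite ?mulr0 ?addr0.
case: eqP => // r2.
case: (sfunP phi S) => M hM ->.
elim: M hM => [|[c B] M IH] /=.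
  by move=> _; rewrite !big_nil big1 // => cD _; rewrite big_nil mulr0.
case/andP=> /eqP rB /IH {IH} E; rewrite big_cons E /=.
under [RHS]eq_bigr do rewrite big_cons /= mulrDr.
rewrite big_split /=; congr (_ + _).
have rBL Y : run Y s = Some s' ->
    run (B ++ (D1 ++ shift (size l) Y ++ D2) ++ T) [::] = run T X.
  by move=> rY; rewrite run_cat rB /= run_cat rX // r2.
rewrite /bval rBL //; case: eqP => rT; last first.
  elim: R tR {sk E} => [|cD R IH] tR; rewrite ?big_nil ?mulr0 // !big_cons -IH; last first.
    by move=> cD' h; apply: tR; right.
  rewrite rBL; last by apply: tR; left.
  by case: eqP => // _; rewrite !mulr0 add0r.
have rBD : run (B ++ D1) [::] = Some (l ++ s ++ r) by rewrite run_cat rB.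
have rDT : run (D2 ++ T) (l ++ s' ++ r) = Some [::] by rewrite run_cat r2.
have := proj2 A2_bracketP _ _ _ _ sk (B ++ D1) (D2 ++ T) l r rBD rDT.
rewrite -!catA => ->.
rewrite mulr_sumr; elim: R tR {sk E} => [|cD R IH] tR; rewrite ?big_nil // !big_cons IH; last first.
  by move=> cD' h; apply: tR; right.
rewrite -!catA; congr (_ + _); have := rBL _ (tR cD (or_introl erefl)); rewrite -!catA => ->.
by rewrite rT eqxx mulrCA.
Qed.

Lemma leqv_skein s s' L R : skein s s' L R -> leqv s [:: (1, L)] R.
Proof.
by move=> sk; split=> S D1 l r D2 r1; rewrite {1}/wl big_cons big_nil addr0 scale1r (w_skein _ sk r1).
Qed.

Lemma leqv_refl s A : leqv s A A. Proof. by []. Qed.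
Lemma leqv_sym s A B : leqv s A B -> leqv s B A.
Proof. by move=> h; split=> S D1 l r D2 r1; rewrite (leqvE h _ r1). Qed.
Lemma leqv_trans s B A C : leqv s A B -> leqv s B C -> leqv s A C.
Proof. by move=> h h'; split=> S D1 l r D2 r1; rewrite (leqvE h _ r1) (leqvE h' _ r1). Qed.

Definition inctx D1 i (L : seq (Kq * diagram)) D2 : seq (Kq * diagram) :=
  [seq (x.1, D1 ++ shift i x.2 ++ D2) | x <- L].

Lemma leqv_ctx s1 A B s E1 E2 a b : leqv s1 A B -> run E1 s = Some (a ++ s1 ++ b) ->
  leqv s (inctx E1 (size a) A E2) (inctx E1 (size a) B E2).
Proof.
move=> h rE; split=> S D1 l r D2 r1.
have := @leqvE _ _ _ h S (D1 ++ shift (size l) E1) (l ++ a) (b ++ r) (shift (size l) E2 ++ D2).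
rewrite run_cat r1 /= (run_shift l r rE) -!catA => /(_ erefl).
rewrite /wl !big_map size_cat => E.
etransitivity; [etransitivity; last exact: E|]; last apply: eq_bigr => x _;
  try by apply: eq_bigr => x _; rewrite /= !shift_cat shift_shift -!catA.
by rewrite /= !shift_cat shift_shift -!catA.
Qed.

Lemma leqv_cat s A B A' B' : leqv s A B -> leqv s A' B' -> leqv s (A ++ A') (B ++ B').
Proof.
move=> h h'; split=> S D1 l r D2 r1; have := (leqvE h D2 r1, leqvE h' D2 r1).
by rewrite /wl !big_cat => -[/= -> ->]. Qed.

Definition lscale c (L : seq (Kq * diagram)) := [seq (c * x.1, x.2) | x <- L].
Lemma leqv_scale s c A B : leqv s A B -> leqv s (lscale c A) (lscale c B).
Proof.
move=> h; split=> S D1 l r D2 r1; rewrite /wl !big_map.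
have E L : \sum_(j <- L) (c * j.1) *: w S (D1 ++ shift (size l) j.2 ++ D2) =
    c *: wl S D1 (size l) L D2.
  by rewrite /wl scaler_sumr; apply: eq_bigr => x _; rewrite scalerA.
by rewrite !E (leqvE h _ r1).
Qed.

(** * Local relations between webs *)

(** The two kinds of trivalent vertices, indexed by the direction of the strands:
    reversing all the arrows exchanges sinks and sources. *)
Definition V21 o := if o then Sink21 else Source21.
Definition V12 o := if o then Sink12 else Source12.
Notation U := true (only parsing).
Notation D := false (only parsing).

(** The web H between two strands of the same direction o. *)
Definition Eo o : diagram := [:: (0, V21 o); (0, V12 (~~ o))]%N.
Definition s0 : seq bool := [::].
Lemma weq_refl s A : weq s A A. Proof. by []. Qed.
Lemma weq_sym s A B : weq s A B -> weq s B A. Proof. exact: leqv_sym. Qed.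
Lemma weq_trans s B A C : weq s A B -> weq s B C -> weq s A C. Proof. exact: leqv_trans. Qed.

Lemma weq_step s1 X Y s k a b A C : weq s1 X Y -> run (take k A) s = Some (a ++ s1 ++ b) ->
  A = take k A ++ shift (size a) X ++ drop (k + size X) A ->
  weq s (take k A ++ shift (size a) Y ++ drop (k + size X) A) C -> weq s A C.
Proof.
move=> h r1 EA; apply: weq_trans; rewrite [X in weq _ X]EA.
exact: (leqv_ctx (drop (k + size X) A) h r1).
Qed.

Ltac wred := cbv [take drop shift size cat map fst snd gdom gcod inctx addn plus Nat.add V12 V21 negb Eo s0].
(** One rewriting step at the k-th slice of the left-hand side, whose section is
    a, the domain of the relation, and b. *)
Ltac wst k a b rel :=
  apply: (@weq_step _ _ _ _ k a b _ _ rel); [reflexivity|reflexivity|]; wred.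
Ltac wend := exact: weq_refl.

Lemma weq_comm g h m : weq (gdom g ++ m ++ gdom h)
  [:: (0, g); (size (gcod g) + size m, h)]%N
  [:: (size (gdom g) + size m, h); (0, g)]%N.
Proof. exact: leqv_skein (skein_comm g h m). Qed.

Lemma zigl o : weq [:: o] [:: (0, Cup o); (1, Cap (~~ o))]%N [::].
Proof. exact: leqv_skein (skein_zigzagl o). Qed.
Lemma zigr o : weq [:: o] [:: (1, Cup (~~ o)); (0, Cap o)]%N [::].
Proof. exact: leqv_skein (skein_zigzagr o). Qed.

Lemma rotl o : weq [:: o] [:: (0, Cup (~~ o)); (1, V21 o)]%N [:: (0, V12 o)]%N.
Proof. by case: o; [exact: leqv_skein skein_sinkl|exact: leqv_skein skein_sourcel]. Qed.
Lemma rotr o : weq [:: o] [:: (1, Cup o); (0, V21 o)]%N [:: (0, V12 o)]%N.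
Proof. by case: o; [exact: leqv_skein skein_sinkr|exact: leqv_skein skein_sourcer]. Qed.

Ltac wcomm k a b g h m := wst k a b (weq_comm g h m).
Ltac wcomm' k a b g h m := wst k a b (weq_sym (weq_comm g h m)).

Lemma unrot_r o : weq [:: o; o] [:: (0, V12 o); (1, Cap (~~ o))]%N [:: (0, V21 o)]%N.
Proof.
case: o.
  wst 0%N s0 [:: U] (weq_sym (rotr U)).
  wcomm 1%N s0 s0 (V21 U) (Cap D) s0.
  wst 0%N [:: U] s0 (zigl U); wend.
wst 0%N s0 [:: D] (weq_sym (rotr D)).
wcomm 1%N s0 s0 (V21 D) (Cap U) s0.
wst 0%N [:: D] s0 (zigl D); wend.
Qed.

Lemma unrot_l o : weq [:: o; o] [:: (1, V12 o); (0, Cap o)]%N [:: (0, V21 o)]%N.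
Proof.
case: o.
  wst 0%N [:: U] s0 (weq_sym (rotl U)).
  wcomm' 1%N s0 s0 (Cap U) (V21 U) s0.
  wst 0%N s0 [:: U] (zigr U); wend.
wst 0%N [:: D] s0 (weq_sym (rotl D)).
wcomm' 1%N s0 s0 (Cap D) (V21 D) s0.
wst 0%N s0 [:: D] (zigr D); wend.
Qed.

Lemma capT o : weq [:: o; o; o] [:: (1, V21 o); (0, Cap o)]%N [:: (0, V21 o); (0, Cap (~~ o))]%N.
Proof.
case: o.
  wst 0%N [:: U] s0 (weq_sym (unrot_r U)).
  wcomm' 1%N s0 s0 (Cap U) (Cap D) s0.
  wst 0%N s0 [:: U] (unrot_l U); wend.
wst 0%N [:: D] s0 (weq_sym (unrot_r D)).
wcomm' 1%N s0 s0 (Cap D) (Cap U) s0.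
wst 0%N s0 [:: D] (unrot_l D); wend.
Qed.

Lemma cupT o : weq [::] [:: (0, Cup (~~ o)); (0, V12 (~~ o))]%N [:: (0, Cup o); (1, V12 (~~ o))]%N.
Proof.
case: o.
  wst 1%N s0 [:: U] (weq_sym (rotl D)).
  wcomm' 0%N s0 s0 (Cup U) (Cup D) s0.
  wst 1%N [:: U] s0 (rotr D); wend.
wst 1%N s0 [:: D] (weq_sym (rotl U)).
wcomm' 0%N s0 s0 (Cup D) (Cup U) s0.
wst 1%N [:: D] s0 (rotr U); wend.
Qed.

(** The web H rotated by a quarter turn can be drawn with either vertex first. *)
Lemma Hrot o : weq [:: ~~ o; o] [:: (0, V12 (~~ o)); (1, V21 o)]%N [:: (1, V12 o); (0, V21 (~~ o))]%N.
Proof.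
case: o.
  wst 0%N s0 [:: U] (weq_sym (rotr D)).
  wcomm 1%N s0 s0 (V21 D) (V21 U) s0.
  wst 0%N [:: D] s0 (rotl U); wend.
wst 0%N s0 [:: D] (weq_sym (rotr U)).
wcomm 1%N s0 s0 (V21 U) (V21 D) s0.
wst 0%N [:: U] s0 (rotl D); wend.
Qed.

Definition leq1 s A R := leqv s [:: (1, A)] R.

Lemma leq_step s1 X Y s k a b A R : weq s1 X Y -> run (take k A) s = Some (a ++ s1 ++ b) ->
  A = take k A ++ shift (size a) X ++ drop (k + size X) A ->
  leq1 s (take k A ++ shift (size a) Y ++ drop (k + size X) A) R -> leq1 s A R.
Proof.
move=> h r1 EA; apply: leqv_trans; rewrite [X in leqv _ [:: (_, X)]]EA.
exact: (leqv_ctx (drop (k + size X) A) h r1).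
Qed.

Lemma leq_lin s1 X Y s k a b A R : leq1 s1 X Y -> run (take k A) s = Some (a ++ s1 ++ b) ->
  A = take k A ++ shift (size a) X ++ drop (k + size X) A ->
  leqv s (inctx (take k A) (size a) Y (drop (k + size X) A)) R -> leq1 s A R.
Proof.
move=> h r1 EA; apply: leqv_trans; rewrite /leq1 [X in leqv _ [:: (_, X)]]EA.
exact: (leqv_ctx (drop (k + size X) A) h r1).
Qed.

Lemma leqv_cons s c X Y R R' : weq s X Y -> leqv s R R' -> leqv s ((c, X) :: R) ((c, Y) :: R').
Proof.
move=> h; rewrite -[_ :: R]cat1s -[_ :: R']cat1s; apply: leqv_cat.
by have := leqv_scale c h; rewrite /lscale /= mulr1.
Qed.

Ltac lst k a b rel :=
  apply: (@leq_step _ _ _ _ k a b _ _ rel); [reflexivity|reflexivity|]; wred.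
Ltac llin k a b rel :=
  apply: (@leq_lin _ _ _ _ k a b _ _ rel); [reflexivity|reflexivity|]; wred.
Ltac lcomm k a b g h m := lst k a b (weq_comm g h m).
Lemma bigonD : leq1 [:: D] [:: (0, V12 D); (0, V21 U)]%N [:: (qint 2, [::])].
Proof. exact: leqv_skein skein_bigon. Qed.

Lemma bigon o : leq1 [:: o] [:: (0, V12 o); (0, V21 (~~ o))]%N [:: (qint 2, [::])].
Proof.
case: o; last exact: bigonD.
have E : weq [:: U] [:: (1, Cup D); (1, V12 D); (1, V21 U); (0, Cap U)]%N [:: (0, V12 U); (0, V21 D)]%N.
  wst 2%N s0 [:: U] (capT U).
  wst 0%N [:: U] s0 (cupT U).
  wcomm' 1%N s0 s0 (V21 U) (V12 D) s0.
  wst 0%N s0 s0 (rotr U).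
  wst 1%N s0 s0 (unrot_l D); wend.
apply: leqv_trans (weq_sym E) _.
llin 1%N [:: U] [:: U] bigonD.
exact: leqv_cons (zigr U) (leqv_refl _ _).
Qed.

Lemma squareD : leq1 [:: U; D] [:: (0, V12 U); (1, V21 D); (1, V12 U); (0, V21 D)]%N
  [:: (1, [::]); (1, [:: (0, Cap U); (0, Cup U)]%N)].
Proof.
apply: leqv_trans (leqv_skein skein_square); apply: weq_sym.
wst 1%N [:: D] s0 (unrot_l D).
wst 3%N [:: U] s0 (unrot_l U).
wst 2%N s0 s0 (Hrot U); wend.
Qed.

Lemma square o : leq1 [:: ~~ o; o]
  [:: (0, V12 (~~ o)); (1, V21 o); (1, V12 (~~ o)); (0, V21 o)]%N
  [:: (1, [::]); (1, [:: (0, Cap (~~ o)); (0, Cup (~~ o))]%N)].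
Proof.
case: o; last exact: squareD.
have E : weq [:: D; U]
  [:: (0, Cup D); (1, V12 U); (2, V21 D); (2, V12 U); (1, V21 D); (2, Cap D)]%N
  [:: (0, V12 D); (1, V21 U); (1, V12 D); (0, V21 U)]%N.
  wst 0%N s0 [:: D; U] (weq_sym (cupT D)).
  wcomm 1%N s0 [:: U] (V12 U) (V21 D) s0.
  wst 0%N s0 [:: U] (rotl D).
  wcomm 3%N [:: D] s0 (V21 D) (Cap D) s0.
  wst 2%N [:: D; D] s0 (unrot_r U).
  wcomm 1%N s0 s0 (V12 U) (V21 U) s0.
  wst 2%N s0 s0 (Hrot D); wend.
apply: leqv_trans (weq_sym E) _.
llin 1%N [:: D] [:: U] squareD.

apply: (@leqv_trans _ [:: (1, [:: (0%N, Cap D); (0%N, Cup D)]); (1, [::])]).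
  apply: leqv_cons; first by wcomm 0%N s0 s0 (Cup D) (Cap D) s0; wend.
  apply: leqv_cons (leqv_refl _ _).
  wst 0%N s0 [:: U] (zigl D); wst 0%N [:: D] s0 (zigl U); wend.
by split=> S D1 l r D2 r1; rewrite /wl !big_cons !big_nil !addr0 addrC.
Qed.

Lemma Eo_sq o : leq1 [:: o; o] (Eo o ++ Eo o) [:: (qint 2, Eo o)].
Proof. by case: o; [llin 1%N s0 s0 (bigon D)|llin 1%N s0 s0 (bigon U)]. Qed.

(** Both triple products contain a square face; besides the
    terms shown, expanding it leaves the same web on both sides. *)
Lemma Eo_cubic o : leqv [:: o; o; o]
  [:: (1, Eo o ++ shift 1 (Eo o) ++ Eo o); (1, shift 1 (Eo o))]
  [:: (1, shift 1 (Eo o) ++ Eo o ++ shift 1 (Eo o)); (1, Eo o)].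
Proof.
have E1 : leq1 [:: o; o; o] (Eo o ++ shift 1 (Eo o) ++ Eo o)
  [:: (1, Eo o); (1, [:: (0, V21 o); (0, Cap (~~ o)); (0, Cup (~~ o)); (0, V12 (~~ o))]%N)].
  by case: o; [llin 1%N s0 s0 (square U)|llin 1%N s0 s0 (square D)]; exact: leqv_refl.
have E2 : leq1 [:: o; o; o] (shift 1 (Eo o) ++ Eo o ++ shift 1 (Eo o))
  [:: (1, shift 1 (Eo o)); (1, [:: (0, V21 o); (0, Cap (~~ o)); (0, Cup (~~ o)); (0, V12 (~~ o))]%N)].
  case: o {E1}.
    lst 1%N s0 s0 (weq_sym (Hrot D)); lst 3%N s0 s0 (Hrot U).
    llin 1%N s0 s0 (square D); apply: leqv_cons; first wend.
    apply: leqv_cons (leqv_refl _ _).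
    wst 0%N s0 s0 (capT U); wst 2%N s0 s0 (weq_sym (cupT U)); wend.
  lst 1%N s0 s0 (weq_sym (Hrot U)); lst 3%N s0 s0 (Hrot D).
  llin 1%N s0 s0 (square U); apply: leqv_cons; first wend.
  apply: leqv_cons (leqv_refl _ _).
  wst 0%N s0 s0 (capT D); wst 2%N s0 s0 (weq_sym (cupT D)); wend.
split=> S D1 l r D2 r1; have := (leqvE E1 D2 r1, leqvE E2 D2 r1).
rewrite /wl !big_cons !big_nil !addr0 !scale1r => -[-> ->].
by rewrite [LHS]addrC [X in _ + X = _]addrC addrA.
Qed.

Lemma circle o : leq1 [::] [:: (0, Cup o); (0, Cap o)]%N [:: (qint 3, [::])].
Proof. exact: leqv_skein (skein_circle o). Qed.

Lemma trace_r o : leq1 [:: o] ((1, Cup o) :: Eo o ++ [:: (1, Cap o)])%N [:: (qint 2, [::])].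
Proof.
by case: o; [lst 0%N s0 s0 (rotr U); lst 1%N s0 s0 (unrot_r D); exact: (bigon U)
            |lst 0%N s0 s0 (rotr D); lst 1%N s0 s0 (unrot_r U); exact: (bigon D)].
Qed.

Lemma trace_l o : leq1 [:: o] ((0, Cup (~~ o)) :: shift 1 (Eo o) ++ [:: (0, Cap (~~ o))])%N [:: (qint 2, [::])].
Proof.
by case: o; [lst 0%N s0 s0 (rotl U); lst 1%N s0 s0 (unrot_l D); exact: (bigon U)
            |lst 0%N s0 s0 (rotl D); lst 1%N s0 s0 (unrot_l U); exact: (bigon D)].
Qed.

(** The vertices of H are rotated one after the other around the nested arcs. *)
Lemma cup_slide o : weq [::] ([:: (0, Cup o); (1, Cup o)]%N ++ Eo o)
  ([:: (0, Cup o); (1, Cup o)]%N ++ shift 2 (Eo (~~ o))).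
Proof.
case: o; wred.
  wst 1%N s0 [:: D] (rotr U); wst 0%N s0 s0 (cupT D).
  wcomm' 1%N s0 s0 (V12 D) (V12 U) s0; wst 0%N s0 s0 (cupT U).
  wst 1%N [:: U] s0 (weq_sym (rotl D)); wend.
wst 1%N s0 [:: U] (rotr D); wst 0%N s0 s0 (cupT U).
wcomm' 1%N s0 s0 (V12 U) (V12 D) s0; wst 0%N s0 s0 (cupT D).
wst 1%N [:: D] s0 (weq_sym (rotl U)); wend.
Qed.

Lemma cap_slide o : weq [:: o; o; ~~ o; ~~ o] (Eo o ++ [:: (1, Cap o); (0, Cap o)]%N)
  (shift 2 (Eo (~~ o)) ++ [:: (1, Cap o); (0, Cap o)]%N).
Proof.
case: o; wred.
  wst 1%N s0 [:: D] (unrot_r D); wst 1%N s0 s0 (weq_sym (capT D)).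
  wcomm 0%N s0 s0 (V21 U) (V21 D) s0; wst 1%N s0 s0 (weq_sym (capT U)).
  wst 1%N [:: U] s0 (weq_sym (unrot_l U)); wend.
wst 1%N s0 [:: U] (unrot_r U); wst 1%N s0 s0 (weq_sym (capT U)).
wcomm 0%N s0 s0 (V21 D) (V21 U) s0; wst 1%N s0 s0 (weq_sym (capT D)).
wst 1%N [:: D] s0 (weq_sym (unrot_l D)); wend.
Qed.

Notation Cr o := (Cross true o (~~ o)) (only parsing).
Notation Ng o := (Cross false o o) (only parsing).
Lemma cross_pos o : leq1 [:: o; o] [:: (0, Cross true o o)]%N [:: (q6 2, [::]); (- q6 (- 1), Eo o)].
Proof. by case: o; exact: leqv_skein (skein_pos _). Qed.
Lemma cross_neg o : leq1 [:: o; o] [:: (0, Ng o)]%N [:: (q6 (- 2), [::]); (- q6 1, Eo o)].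
Proof. by case: o; exact: leqv_skein (skein_neg _). Qed.
Definition Ho o : diagram := [:: (0, V12 o); (1, V21 (~~ o))]%N.
Definition Uo o : diagram := [:: (0, Cap o); (0, Cup (~~ o))]%N.
Lemma cross_anti o : leq1 [:: o; ~~ o] [:: (0, Cr o)]%N [:: (q6 (- 2), Uo o); (- q6 1, Ho o)].
Proof. by case: o; exact: leqv_skein (skein_neg _). Qed.

(** An antiparallel crossing is a bent negative parallel crossing: rotating the
    web H by a quarter turn exchanges its two smoothings. *)
Lemma bend_l o : weq [:: o; ~~ o] [:: (0, Cr o)]%N
  [:: (0, Cup (~~ o)); (1, Ng o); (2, Cap o)]%N.
Proof.
apply: leqv_trans (cross_anti o) _; apply: leqv_sym; case: o.
  llin 1%N [:: D] [:: D] (cross_neg U).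
  apply: leqv_cons; first by wcomm 0%N s0 s0 (Cup D) (Cap U) s0; wend.
  apply: leqv_cons (leqv_refl _ _).
  wst 0%N s0 [:: D] (rotl U); wst 1%N [:: D] s0 (unrot_r D); wend.
llin 1%N [:: U] [:: U] (cross_neg D).
apply: leqv_cons; first by wcomm 0%N s0 s0 (Cup U) (Cap D) s0; wend.
apply: leqv_cons (leqv_refl _ _).
wst 0%N s0 [:: U] (rotl D); wst 1%N [:: U] s0 (unrot_r U); wend.
Qed.

Lemma bend_r o : weq [:: o; ~~ o] [:: (0, Cr o)]%N
  [:: (2, Cup (~~ o)); (1, Ng (~~ o)); (0, Cap o)]%N.
Proof.
apply: leqv_trans (cross_anti o) _; apply: leqv_sym; case: o.
  llin 1%N [:: U] [:: U] (cross_neg D).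
  apply: leqv_cons; first by wcomm' 0%N s0 s0 (Cap U) (Cup D) s0; wend.
  apply: leqv_cons (leqv_refl _ _).
  wst 0%N [:: U] s0 (rotr D); wst 1%N s0 [:: U] (unrot_l U).
  wst 0%N s0 s0 (weq_sym (Hrot D)); wend.
llin 1%N [:: D] [:: D] (cross_neg U).
apply: leqv_cons; first by wcomm' 0%N s0 s0 (Cap D) (Cup U) s0; wend.
apply: leqv_cons (leqv_refl _ _).
wst 0%N [:: D] s0 (rotr U); wst 1%N s0 [:: D] (unrot_l D).
wst 0%N s0 s0 (weq_sym (Hrot U)); wend.
Qed.

Lemma cap_bend o : weq [:: o; ~~ o; ~~ o] [:: (0, Cr o); (1, Cap o)]%N
  [:: (1, Ng (~~ o)); (0, Cap o)]%N.
Proof.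
have T u : weq [:: u; ~~ u; ~~ u] [:: (0, Cr u); (1, Cap u)]%N
  [:: (2, Cup (~~ u)); (1, Ng (~~ u)); (0, Cap u); (1, Cap u)]%N.
  by case: u; [wst 0%N s0 [:: D] (bend_r U)|wst 0%N s0 [:: U] (bend_r D)]; wend.
apply: weq_trans (T o) _.
case: o.
  wcomm 2%N s0 s0 (Cap U) (Cap U) [:: D]; wcomm 1%N [:: U] s0 (Ng D) (Cap U) s0.
  wst 0%N [:: U; D] s0 (zigl D); wend.
wcomm 2%N s0 s0 (Cap D) (Cap D) [:: U]; wcomm 1%N [:: D] s0 (Ng U) (Cap D) s0.
wst 0%N [:: D; U] s0 (zigl U); wend.
Qed.

Lemma cup_bend o : weq [:: o] [:: (1, Cup (~~ o)); (0, Cr o)]%N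
  [:: (0, Cup (~~ o)); (1, Ng o)]%N.
Proof.
case: o.
  wst 1%N s0 [:: U] (bend_l U); wcomm' 0%N s0 s0 (Cup D) (Cup D) [:: U].
  wcomm' 1%N [:: D] s0 (Ng U) (Cup D) s0; wst 2%N [:: D; U] s0 (zigr U); wend.
wst 1%N s0 [:: D] (bend_l D); wcomm' 0%N s0 s0 (Cup U) (Cup U) [:: D].
wcomm' 1%N [:: U] s0 (Ng D) (Cup U) s0; wst 2%N [:: U; D] s0 (zigr D); wend.
Qed.

Lemma bend2_l o : weq [:: o; o; ~~ o] [:: (1, Cr o); (0, Cr o)]%N
  [:: (0, Cup (~~ o)); (1, Ng o); (2, Ng o); (3, Cap o)]%N.
Proof.
Ltac bend2_l_tac u d :=
  wst 0%N [:: u] s0 (bend_l u); wst 3%N s0 [:: u] (bend_l u);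
  wcomm' 2%N s0 s0 (Cup d) (Cap u) [:: u; d; u];
  wcomm' 1%N s0 [:: d] (Cup d) (Ng u) [:: u; d];
  wcomm' 0%N s0 [:: u; d] (Cup d) (Cup d) [:: u];
  wcomm' 3%N [:: d] s0 (Ng u) (Cap u) [:: d; u];
  wcomm' 2%N [:: d] [:: d] (Ng u) (Ng u) [:: d];
  wcomm' 1%N [:: d] [:: u; d] (Ng u) (Cup d) s0;
  wcomm' 4%N [:: d; u] s0 (Cap u) (Cap u) [:: u];
  wcomm' 3%N [:: d; u] [:: d] (Cap u) (Ng u) s0;
  wst 2%N [:: d; u] [:: u; d] (zigr u); wend.
by case: o; [bend2_l_tac U D|bend2_l_tac D U].
Qed.

Lemma bend2_r o : weq [:: o; ~~ o; ~~ o] [:: (0, Cr o); (1, Cr o)]%N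
  [:: (3, Cup (~~ o)); (2, Ng (~~ o)); (1, Ng (~~ o)); (0, Cap o)]%N.
Proof.
Ltac bend2_r_tac u d :=
  wst 0%N s0 [:: d] (bend_r u); wst 3%N [:: d] s0 (bend_r u);
  wcomm 2%N s0 s0 (Cap u) (Cup d) [:: d; u; d];
  wcomm 3%N s0 [:: u] (Cap u) (Ng d) [:: d; u];
  wcomm 4%N s0 [:: d; u] (Cap u) (Cap u) [:: d];
  wcomm 1%N [:: u] s0 (Ng d) (Cup d) [:: u; d];
  wcomm 2%N [:: u] [:: u] (Ng d) (Ng d) [:: u];
  wcomm 3%N [:: u] [:: d; u] (Ng d) (Cap u) s0;
  wcomm 0%N [:: u; d] s0 (Cup d) (Cup d) [:: d];
  wcomm 1%N [:: u; d] [:: u] (Cup d) (Ng d) s0;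
  wst 2%N [:: u; d] [:: d; u] (zigl d); wend.
by case: o; [bend2_r_tac U D|bend2_r_tac D U].
Qed.

(** * Local relations inside wider sections *)

Lemma shift0 A : shift 0 A = A.
Proof. by rewrite /shift -[RHS]map_id; apply: eq_map => -[]. Qed.

Lemma weq_in s1 X Y s E1 E2 a b : weq s1 X Y -> run E1 s = Some (a ++ s1 ++ b) ->
  weq s (E1 ++ shift (size a) X ++ E2) (E1 ++ shift (size a) Y ++ E2).
Proof. by move=> h r1; exact: (leqv_ctx E2 h r1). Qed.

Lemma weq_pre s s1 E X Y : run E s = Some s1 -> weq s1 X Y -> weq s (E ++ X) (E ++ Y).
Proof.
move=> r1 h; have := @weq_in _ _ _ s E [::] [::] [::] h.
by rewrite !shift0 !cats0; apply.
Qed.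

Lemma weq_post s E X Y : weq s X Y -> weq s (X ++ E) (Y ++ E).
Proof.
move=> h; have := @weq_in _ _ _ s [::] E [::] [::] h.
by rewrite !shift0 cats0; apply.
Qed.

Lemma weq_wide a b s X Y : weq s X Y -> weq (a ++ s ++ b) (shift (size a) X) (shift (size a) Y).
Proof.
move=> h; have := @weq_in _ _ _ (a ++ s ++ b) [::] [::] a b h.
by rewrite !cats0; apply.
Qed.

Lemma run1 x s : run [:: x] s = step x s.
Proof. by rewrite /=; case: (step x s). Qed.

(** Diagrams side by side can be drawn in either order. *)
Lemma weq_far1 x y s s' m t t' : step x s = Some s' -> step y t = Some t' ->
  weq (s ++ m ++ t) (x :: shift (size s' + size m) [:: y]) (shift (size s + size m) [:: y] ++ [:: x]).
Proof.
case: x => i g; case: y => j h /stepP[a [b [-> -> <-]]] /stepP[a' [b' [-> _ <-]]].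
have := weq_wide a b' (weq_comm g h (b ++ m ++ a')).
rewrite /shift /= -!catA addn0; congr (weq _ _ _); rewrite ?size_cat;
  by do 2?[congr (_ :: _)]; congr pair; lia.
Qed.

Lemma shift1E i x : shift i [:: x] = [:: ((i + x.1)%N, x.2)]. Proof. by []. Qed.

Lemma run_at D s s' l r i : run D s = Some s' -> i = size l ->
  run (shift i D) (l ++ s ++ r) = Some (l ++ s' ++ r).
Proof. by move=> h ->; exact: run_shift. Qed.
Lemma run_at_r D s s' l i : run D s = Some s' -> i = size l ->
  run (shift i D) (l ++ s) = Some (l ++ s').
Proof. by move=> h e; have := @run_at _ _ _ l [::] _ h e; rewrite !cats0. Qed.
Lemma run_at_l D s s' r : run D s = Some s' -> run D (s ++ r) = Some (s' ++ r).
Proof. by move=> h; have := @run_at _ _ _ [::] r _ h erefl; rewrite shift0. Qed.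

Lemma weq_far D1 D2 s s' m t t' : run D1 s = Some s' -> run D2 t = Some t' ->
  weq (s ++ m ++ t) (D1 ++ shift (size s' + size m) D2) (shift (size s + size m) D2 ++ D1).
Proof.
have far1 x : forall D2 s s' t t', step x s = Some s' -> run D2 t = Some t' ->
    weq (s ++ m ++ t) (x :: shift (size s' + size m) D2) (shift (size s + size m) D2 ++ [:: x]).
  clear; elim=> [|y D IH] s s' t t' rx; first by move=> _; exact: weq_refl.
  rewrite run_cons; case E: (step y t) => [t1|] //= rD.
  have h1 := weq_post (shift (size s' + size m) D) (weq_far1 m rx E).
  apply: weq_trans h1 _; rewrite -catA; apply: (@weq_pre _ (s ++ m ++ t1)); last exact: IH rD.
  rewrite !catA; apply: run_at_r; last by rewrite size_cat.
  by rewrite run1.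
move=> r1 r2; elim: D1 s r1 => [|x D IH] s; first by case=> ->; rewrite cats0; exact: weq_refl.
rewrite run_cons; case E: (step x s) => [s1|] //= rD.
have rx : run [:: x] (s ++ m ++ t) = Some (s1 ++ m ++ t) by apply: run_at_l; rewrite run1.
have := weq_pre rx (IH _ rD); rewrite !cat1s; move/weq_trans; apply.
have := weq_post D (far1 _ _ _ _ _ _ E r2).
by rewrite -!catA /=.
Qed.

Arguments shift : simpl never.
Arguments Eo : simpl never.
Lemma leq_w s A B l r S i : leqv s A B -> S = l ++ s ++ r -> i = size l ->
  \sum_(x <- A) x.1 *: w S (shift i x.2) = \sum_(x <- B) x.1 *: w S (shift i x.2).
Proof.
move=> h -> ->; have := leqvE h [::] (erefl : run [::] (l ++ s ++ r) = Some _).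
by rewrite /wl; under eq_bigr do rewrite /= cats0; under [X in _ = X]eq_bigr do rewrite /= cats0.
Qed.

Lemma weq_w s A B l r S i : weq s A B -> S = l ++ s ++ r -> i = size l ->
  w S (shift i A) = w S (shift i B).
Proof. by move=> h e e'; have := leq_w h e e'; rewrite !big_seq1 !scale1r. Qed.

Lemma w_far D1 D2 s s' t t' l m r S S1 S2 i j k : run D1 s = Some s' -> run D2 t = Some t' ->
  S = l ++ s ++ m ++ t ++ r -> S1 = l ++ s' ++ m ++ t ++ r -> S2 = l ++ s ++ m ++ t' ++ r ->
  i = size l -> j = (size l + size s + size m)%N -> k = (size l + size s' + size m)%N ->
  w S1 (shift k D2) * w S (shift i D1) = w S2 (shift i D1) * w S (shift j D2).
Proof.
move=> r1 r2 -> -> -> -> -> ->; rewrite !w_cat.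
- have := weq_w (weq_far m r1 r2) (erefl : l ++ (s ++ m ++ t) ++ r = _) erefl.
  by rewrite -!catA !shift_cat !shift_shift !addnA.
- by have := @run_at _ _ _ (l ++ s ++ m) r _ r2 erefl; rewrite -!catA !size_cat addnA; apply.
- exact: run_at.
Qed.

Definition v0 : Kq := q6 3.
Definition EE o S p i : 'R := w S (shift (p + i) (Eo o)).

Lemma run_Eo o : run (Eo o) [:: o; o] = Some [:: o; o]. Proof. by case: o. Qed.

Lemma w1l S S' D : run D S = Some S' -> w S' [::] * w S D = w S D.
Proof. by move=> r; rewrite (w_cat _ r) cats0. Qed.
Lemma w1r S D : w S D * w S [::] = w S D.
Proof. by rewrite (@w_cat _ S). Qed.

Lemma block_split (o : bool) N i n (l r : seq bool) : (i + n <= N)%N ->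
  l ++ nseq N o ++ r = (l ++ nseq i o) ++ nseq n o ++ (nseq (N - i - n) o ++ r).
Proof. by move=> h; rewrite {1}(_ : N = i + (n + (N - i - n)))%N; [rewrite !nseqD -?catA|lia]. Qed.

Lemma run_EE o N i l r : (i.+1 < N)%N ->
  run (shift (size l + i) (Eo o)) (l ++ nseq N o ++ r) = Some (l ++ nseq N o ++ r).
Proof.
move=> h; rewrite (@block_split o N i 2); last lia.
by apply: run_at (run_Eo o) _; rewrite size_cat size_nseq.
Qed.

Lemma qintE n : qint n = qn v0 n.
Proof.
rewrite qn.unlock /qint /v0 (_ : q6 (- 3) = (q6 3)^-1); last by rewrite !Model.q6E.
congr ((_ - _) / _); first by rewrite !Model.q6E exprM.
by rewrite !Model.q6E exprM.
Qed.

Lemma q6_expn (n : nat) : q6 n = q6 1 ^+ n. Proof. by rewrite Model.q6E. Qed.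

Lemma q6D a b : q6 (a + b) = q6 a * q6 b.
Proof. by apply: expfzDr; rewrite -[_ 'X]expr1z; exact: Model.q6_1_neq0. Qed.

Lemma q6_root (n : nat) : (0 < n)%N -> q6 1 ^+ n != 1.
Proof.
move=> n0; rewrite Model.q6E -tofracXn -tofrac1 tofrac_eq; apply/eqP.
move/(congr1 (fun p : {poly rat} => p`_n)).
rewrite coefXn coef1 eqxx eqn0Ngt n0 /= => /eqP; by rewrite oner_eq0.
Qed.

Lemma v0_generic : generic_q v0.
Proof.
move=> n n0; rewrite -qintE /qint; apply: mulf_neq0; last first.
  by rewrite invr_eq0; exact: Model.qint_den_neq0.
have h := @q6_root (3 * n + 3 * n).
rewrite (_ : q6 (- (3 * n)%N%:Z) = (q6 1 ^+ (3 * n))^-1); last by rewrite Model.q6E.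
rewrite q6_expn subr_eq0; apply: contra_neqN (h _) => [/eqP e|]; last lia.
by rewrite exprD {1}e mulVf //; apply: expf_neq0; exact: Model.q6_1_neq0.
Qed.

(** The web H on adjacent strands of a bundle satisfies the relations required
    from the abstract generators. *)
Lemma EE_hecke o S l r N p : S = l ++ nseq N o ++ r -> p = size l -> hecke v0 (EE o S p) N.
Proof.
move=> ES ->.
have rE i : (i.+1 < N)%N -> run (shift (size l + i) (Eo o)) S = Some S.
  by move=> h; rewrite ES run_EE.
split=> [i h|i j h h'|i h].
- have /= := leq_w (Eo_sq o) (_ : S = (l ++ nseq i o) ++ [:: o; o] ++ (nseq (N - i - 2) o ++ r)) erefl.
  rewrite !big_seq1 /= scale1r size_cat size_nseq -qintE => <-.
    by rewrite /EE (w_cat _ (rE _ h)) -shift_cat.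
  by rewrite ES (@block_split o N i 2) //; lia.
- have ES2 : S = (l ++ nseq i o) ++ [:: o; o] ++ nseq (j - i - 2) o ++ [:: o; o] ++ (nseq (N - j - 2) o ++ r).
    rewrite ES -catA; congr (l ++ _); rewrite (_ : N = i + (2 + (j - i - 2 + (2 + (N - j - 2)))))%N; last lia.
    by rewrite !nseqD -!catA; do !congr (_ ++ _); congr nseq; lia.
  rewrite /EE; symmetry; apply: (w_far (run_Eo o) (run_Eo o) ES2 ES2 ES2);
    by rewrite size_cat !size_nseq /=; lia.
have := leq_w (Eo_cubic o) (_ : S = (l ++ nseq i o) ++ [:: o; o; o] ++ (nseq (N - i - 3) o ++ r)) erefl.
rewrite !big_cons !big_nil; cbn [fst snd]; rewrite !scale1r !addr0 size_cat size_nseq !shift_cat !shift_shift.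
rewrite -!(@w_cat _ S) ?rE -?addnA ?addn1 ?rE //; try lia.
rewrite /EE => E; apply/eqP; rewrite subr_eq addrAC eq_sym subr_eq eq_sym; apply/eqP.
by apply: E; rewrite ES (@block_split o N i 3) //; lia.
Qed.

(** * Crossings and the generators *)

Lemma weqI s s' A B : run A s = Some s' -> run B s = Some s' ->
  (forall l r, w (l ++ s ++ r) (shift (size l) A) = w (l ++ s ++ r) (shift (size l) B)) ->
  weq s A B.
Proof.
move=> rA rB h; split=> S D1 l r D2 r1; rewrite /wl !big_seq1 !scale1r.
rewrite -!(w_cat _ r1) /= -(w_cat _ (run_shift l r rA)) -(w_cat _ (run_shift l r rB)).
by rewrite h.
Qed.

Lemma crossN_w o S l r i : S = l ++ [:: o; o] ++ r -> i = size l ->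
  w S (shift i [:: (0%N, Ng o)]) = (q6 1 : Kq) *: (v0^-1 *: w S [::] - w S (shift i (Eo o))).
Proof.
move=> eS ei; have := leq_w (cross_neg o) eS ei.
rewrite !big_cons !big_nil !addr0 => /= E.
rewrite -[LHS]scale1r E scalerBr scaleNr scalerA; congr (_ *: _ - _).
by rewrite /v0 (_ : (q6 3)^-1 = q6 (- 3)) -?q6D // !Model.q6E.
Qed.

Lemma crossP_w o S l r i : S = l ++ [:: o; o] ++ r -> i = size l ->
  w S (shift i [:: (0%N, Cross true o o)]) = (q6 (-1) : Kq) *: (v0 *: w S [::] - w S (shift i (Eo o))).
Proof.
move=> eS ei; have := leq_w (cross_pos o) eS ei.
rewrite !big_cons !big_nil !addr0 => /= E.
rewrite -[LHS]scale1r E scalerBr scaleNr scalerA; congr (_ *: _ - _).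
by rewrite /v0 -q6D.
Qed.

Lemma braid_w (a b : 'R) : a * a = qn v0 2 *: a -> b * b = qn v0 2 *: b ->
  a * b * a - a = b * a * b - b ->
  (v0^-1 *: 1 - a) * (v0^-1 *: 1 - b) * a = b * ((v0^-1 *: 1 - a) * (v0^-1 *: 1 - b)).
Proof.
move=> ha hb hab; have v1 : generic_q v0^-1.
  move=> n n0; have := v0_generic n0; rewrite qn.unlock invrK.
  by rewrite -[(v0^-1 - v0)]opprB -[v0^-1 ^+ n - _]opprB !exprVn invrK invrN mulrNN.
have q2 : qn v0^-1 2 = qn v0 2.
  by rewrite !qn2 ?invrK; [exact: addrC|exact: v0_generic|exact: v1].
by apply: (braid_pair v1); rewrite ?q2.
Qed.

Lemma braid_wi (i a b : 'R) : i * i = i -> i * a = a -> i * b = b -> a * i = a -> b * i = b ->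
  a * a = qn v0 2 *: a -> b * b = qn v0 2 *: b -> a * b * a - a = b * a * b - b ->
  (v0^-1 *: i - a) * (v0^-1 *: i - b) * a = b * ((v0^-1 *: i - a) * (v0^-1 *: i - b)).
Proof.
move=> ii ia ib ai bi ha hb hab; have := braid_w ha hb hab.
have ix x y : i * x = x -> i * (x * y) = x * y by rewrite mulrA => ->.
rewrite !(mulrBl, mulrBr, zml, zmr, mul1r, mulr1, scalerBr) -!mulrA.
by rewrite ?ii ?ai ?bi ?ia ?ib ?(ix _ _ ia) ?(ix _ _ ib) ?ia ?ib ?ii ?ia.
Qed.

(** The third Reidemeister move, deduced from its algebraic form. *)
Lemma braid_ng o :
  weq [:: o; o; o] (shift 1 (Eo o) ++ [:: (0, Ng o); (1, Ng o)]%N)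
     ([:: (0, Ng o); (1, Ng o)]%N ++ Eo o) /\
  weq [:: o; o; o] (Eo o ++ [:: (1, Ng o); (0, Ng o)]%N)
     ([:: (1, Ng o); (0, Ng o)]%N ++ shift 1 (Eo o)).
Proof.
suff h (l r : seq bool) (S := l ++ [:: o; o; o] ++ r)
   (n0 := w S (shift (size l) [:: (0%N, Ng o)])) (n1 := w S (shift (size l + 1) [:: (0%N, Ng o)]))
   (e0 := w S (shift (size l) (Eo o))) (e1 := w S (shift (size l + 1) (Eo o))) :
   [/\ n1 * n0 * e1 = e0 * (n1 * n0), n0 * n1 * e0 = e1 * (n0 * n1),
    (run (shift (size l) [:: (0%N, Ng o)]) S = Some S) *
    (run (shift (size l + 1) [:: (0%N, Ng o)]) S = Some S) &
    (run (shift (size l) (Eo o)) S = Some S) * (run (shift (size l + 1) (Eo o)) S = Some S)].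
  have E01 i : shift i [:: (0, Ng o); (1, Ng o)]%N =
      shift i [:: (0%N, Ng o)] ++ shift (i + 1) [:: (0%N, Ng o)] by rewrite /shift /= !addn0.
  have E10 i : shift i [:: (1, Ng o); (0, Ng o)]%N =
      shift (i + 1) [:: (0%N, Ng o)] ++ shift i [:: (0%N, Ng o)] by rewrite /shift /= !addn0.
  split; (apply: (@weqI _ [:: o; o; o]); [by case: (o)|by case: (o)|]) => l r;
    have [h1 h2 [r0 r1] [rE0 rE1]] := h l r; rewrite !shift_cat ?shift_shift ?E01 ?E10;
    by rewrite -!(@w_cat _ (l ++ [:: o; o; o] ++ r)) ?run_cat ?r0 ?r1 ?rE0 ?rE1 //= ?r0 ?r1 // !mulrA in h1 h2 *.
have eS1 : S = (l ++ [:: o]) ++ [:: o; o] ++ r by rewrite -catA.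
have eS : S = l ++ [:: o; o] ++ (o :: r) by [].
have [hsq _ hcu] := @EE_hecke o S l r 3 (size l) erefl erefl.
have h0 := hsq 0%N isT; have h1 := hsq 1%N isT; have h2 := hcu 0%N isT.
rewrite /EE !addn0 -/e0 -/e1 in h0 h1 h2.
have rE0 : run (shift (size l) (Eo o)) S = Some S by rewrite eS; apply: run_at => //; case: (o).
have rE1 : run (shift (size l + 1) (Eo o)) S = Some S.
  by rewrite eS1; apply: run_at; [case: (o)|rewrite size_cat].
have [ii ia ib ai bi] : [/\ w S [::] * w S [::] = w S [::], w S [::] * e1 = e1,
   w S [::] * e0 = e0, e1 * w S [::] = e1 & e0 * w S [::] = e0].
  by split; rewrite ?w1r ?w1l.
split; last 2 first.
- by split; [rewrite eS; apply: run_at => //; case: (o)|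
     rewrite eS1; apply: run_at; [case: (o)|rewrite size_cat]].
- by [].
- rewrite /n1 /n0 (crossN_w eS erefl) (crossN_w eS1) ?size_cat // -/e0 -/e1 !(zml, zmr).
  by rewrite braid_wi.
rewrite /n1 /n0 (crossN_w eS erefl) (crossN_w eS1) ?size_cat // -/e0 -/e1 !(zml, zmr).
by rewrite braid_wi.
Qed.

(** A pair of parallel strands passes through an antiparallel strand: both
    crossings are bent into parallel ones, where the Reidemeister move is known. *)
Lemma slide_l o : weq [:: o; o; ~~ o] (Eo o ++ [:: (1, Cr o); (0, Cr o)]%N)
  ([:: (1, Cr o); (0, Cr o)]%N ++ shift 1 (Eo o)).
Proof.
apply: weq_trans (weq_pre _ (bend2_l o)) _; first by case: o.
apply: weq_sym; apply: weq_trans (weq_post _ (bend2_l o)) _; apply: weq_sym.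
have r0 : run [:: (0%N, Cup (~~ o))] [::] = Some [:: ~~ o; o] by case: (o).
have h1 := weq_post [:: (1, Ng o); (2, Ng o); (3, Cap o)]%N
  (weq_sym (@weq_far _ _ _ _ [::] _ _ r0 (run_at_l [:: ~~ o] (run_Eo o)))).
have {h1}h1 : weq [:: o; o; ~~ o] (Eo o ++ [:: (0, Cup (~~ o)); (1, Ng o); (2, Ng o); (3, Cap o)]%N)
   ([:: (0, Cup (~~ o))]%N ++ shift 2 (Eo o) ++ [:: (1, Ng o); (2, Ng o); (3, Cap o)]%N).
  by move: h1; rewrite shift0 -!catA.
apply: weq_trans h1 _.
have h2 := @weq_in _ _ _ [:: o; o; ~~ o] [:: (0, Cup (~~ o))]%N [:: (3, Cap o)]%N [:: ~~ o] [:: ~~ o] (braid_ng o).1.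
have {h2}h2 := h2 (ltac:(by case: (o))).
move: h2; rewrite !shift_cat shift_shift -!catA => h2; apply: weq_trans h2 _.
have r3 : run [:: (0%N, Cap o)] [:: o; ~~ o] = Some [::] by case: (o).
have := @weq_in _ _ _ [:: o; o; ~~ o] [:: (0, Cup (~~ o)); (1, Ng o); (2, Ng o)]%N [::] [:: ~~ o] [::]
   (@weq_far _ _ _ _ [::] _ _ (run_Eo o) r3).
rewrite !cats0 => /(_ (ltac:(by case: (o)))); rewrite !shift_cat => h; apply: h.
Qed.

Lemma slide_r o : weq [:: o; ~~ o; ~~ o] (shift 1 (Eo (~~ o)) ++ [:: (0, Cr o); (1, Cr o)]%N)
  ([:: (0, Cr o); (1, Cr o)]%N ++ Eo (~~ o)).
Proof.
apply: weq_trans (weq_pre _ (bend2_r o)) _; first by case: o.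
apply: weq_sym; apply: weq_trans (weq_post _ (bend2_r o)) _; apply: weq_sym.
have r0 : run [:: (0%N, Cup (~~ o))] [::] = Some [:: ~~ o; o] by case: (o).
have h1 := @weq_in _ _ _ [:: o; ~~ o; ~~ o] [::] [:: (2, Ng (~~ o)); (1, Ng (~~ o)); (0, Cap o)]%N
   [:: o] [::] (@weq_far _ _ _ _ [::] _ _ (run_Eo (~~ o)) r0).
have {}h1 := h1 (ltac:(by case: (o))).
have {h1}h1 : weq [:: o; ~~ o; ~~ o] (shift 1 (Eo (~~ o)) ++ [:: (3, Cup (~~ o)); (2, Ng (~~ o)); (1, Ng (~~ o)); (0, Cap o)]%N)
   ([:: (3, Cup (~~ o))]%N ++ shift 1 (Eo (~~ o)) ++ [:: (2, Ng (~~ o)); (1, Ng (~~ o)); (0, Cap o)]%N).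
  by move: h1; rewrite !shift_cat -!catA.
apply: weq_trans h1 _.
have h2 := @weq_in _ _ _ [:: o; ~~ o; ~~ o] [:: (3, Cup (~~ o))]%N [:: (0, Cap o)]%N [:: o] [:: o] (braid_ng (~~ o)).2.
have {h2}h2 := h2 (ltac:(by case: (o))).
move: h2; rewrite !shift_cat shift_shift -!catA => h2; apply: weq_trans h2 _.
have r3 : run [:: (0%N, Cap o)] [:: o; ~~ o] = Some [::] by case: (o).
have := @weq_in _ _ _ [:: o; ~~ o; ~~ o] [:: (3, Cup (~~ o)); (2, Ng (~~ o)); (1, Ng (~~ o))]%N [::] [::] [:: o]
   (weq_sym (@weq_far _ _ _ _ [::] _ _ r3 (run_Eo (~~ o)))).
rewrite !cats0 => /(_ (ltac:(by case: (o)))); rewrite !shift_cat => h; apply: h.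
Qed.

(** * Grids of antiparallel crossings *)

Fixpoint chainL o k : diagram := if k is k'.+1 then (k', Cr o) :: chainL o k' else [::].
Fixpoint chainR o k : diagram := if k is k'.+1 then chainR o k' ++ [:: (k', Cr o)] else [::].
(** The cable of an antiparallel crossing between bundles of a and b strands. *)
Fixpoint gridw o a b : diagram := if b is b'.+1 then gridw o a b' ++ shift b' (chainL o a) else [::].
(** The parallel crossings left over when a strand of a grid is bent back. *)
Fixpoint ngL o k : diagram := if k is k'.+1 then (k', Ng o) :: ngL o k' else [::].
Fixpoint ngR o k : diagram := if k is k'.+1 then ngR o k' ++ [:: (k', Ng o)] else [::].

Lemma consE (x : bool) s : x :: s = nseq 1 x ++ s. Proof. by []. Qed.
Lemma nseq_cat a b (o : bool) r : nseq a o ++ nseq b o ++ r = nseq (a + b) o ++ r.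
Proof. by rewrite nseqD catA. Qed.
Lemma nseq_cat0 a b (o : bool) : nseq a o ++ nseq b o = nseq (a + b) o.
Proof. by rewrite nseqD. Qed.
Lemma nseq_congr a b (o : bool) r r' : a = b -> r = r' -> nseq a o ++ r = nseq b o ++ r'.
Proof. by move=> -> ->. Qed.
Lemma nseq_congr0 a b (o : bool) : a = b -> nseq a o = nseq b o.
Proof. by move=> ->. Qed.
Lemma cat_congr (l l' r r' : seq bool) : l = l' -> r = r' -> l ++ r = l' ++ r'.
Proof. by move=> -> ->. Qed.
Ltac lsteq := rewrite ?consE -?catA ?cat0s ?cats0 ?nseq_cat ?nseq_cat0;
  repeat first [reflexivity | apply: nseq_congr; [lia|] | apply: nseq_congr0; lia
    | apply: cat_congr; [reflexivity|]].
Ltac sizes := rewrite ?size_cat ?size_nseq ?addn0 ?add0n /= ?size_cat ?size_nseq; lia.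

Lemma nseqSr (o : bool) k r : nseq k o ++ o :: r = nseq k.+1 o ++ r.
Proof. by elim: k => //= k ->. Qed.

Lemma run_Cr o : run [:: (0%N, Cr o)] [:: o; ~~ o] = Some [:: ~~ o; o]. Proof. by case: o. Qed.
Lemma run_Ng o : run [:: (0%N, Ng o)] [:: o; o] = Some [:: o; o]. Proof. by case: o. Qed.
Lemma run_Cup o : run [:: (0%N, Cup o)] [::] = Some [:: o; ~~ o]. Proof. by case: o. Qed.
Lemma run_Cap o : run [:: (0%N, Cap o)] [:: o; ~~ o] = Some [::]. Proof. by case: o. Qed.

Lemma run_cats D1 D2 s s1 : run D1 s = Some s1 -> run (D1 ++ D2) s = run D2 s1.
Proof. by move=> h; rewrite run_cat h. Qed.

Lemma slice1E i g : [:: (i, g)] = shift i [:: (0%N, g)]. Proof. by rewrite shift1E addn0. Qed.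

Lemma run_chainL o k r : run (chainL o k) (nseq k o ++ ~~ o :: r) = Some (~~ o :: nseq k o ++ r).
Proof.
elim: k r => [|k IH] r //; rewrite [chainL _ _]/= -cat1s run_cat slice1E.
rewrite -nseqSr (@run_at _ [:: o; ~~ o] [:: ~~ o; o]) ?run_Cr ?size_nseq //=.
by rewrite IH nseqSr.
Qed.

Lemma run_chainR o k r : run (chainR o k) (o :: nseq k (~~ o) ++ r) = Some (nseq k (~~ o) ++ o :: r).
Proof.
elim: k r => [|k IH] r //; rewrite [chainR _ _]/= -nseqSr (run_cats _ (IH _)) slice1E.
by rewrite -(nseqSr _ k) (@run_at _ [:: o; ~~ o] [:: ~~ o; o]) ?run_Cr ?size_nseq.
Qed.

Lemma run_gridw o a b r : run (gridw o a b) (nseq a o ++ nseq b (~~ o) ++ r) =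
  Some (nseq b (~~ o) ++ nseq a o ++ r).
Proof.
elim: b r => [|b IH] r //; rewrite [gridw _ _ _]/= run_cat -nseqSr IH /=.
by rewrite (run_at_r (run_chainL o a r)) ?size_nseq // nseqSr.
Qed.

Lemma weq_far_at D1 D2 s s' m t t' a b i j k : run D1 s = Some s' -> run D2 t = Some t' ->
  i = size a -> j = (size a + size s' + size m)%N -> k = (size a + size s + size m)%N ->
  weq (a ++ s ++ m ++ t ++ b) (shift i D1 ++ shift j D2) (shift k D2 ++ shift i D1).
Proof.
move=> r1 r2 -> -> ->; have := weq_wide a b (weq_far m r1 r2).
by rewrite -!catA !shift_cat !shift_shift !addnA.
Qed.

Lemma run_gridw0 o a b : run (gridw o a b) (nseq a o ++ nseq b (~~ o)) =
  Some (nseq b (~~ o) ++ nseq a o).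
Proof. by have := run_gridw o a b [::]; rewrite !cats0. Qed.

Lemma weq_far_at' D1 D2 s s' m t t' a b S i j k : run D1 s = Some s' -> run D2 t = Some t' ->
  S = a ++ s ++ m ++ t ++ b ->
  i = size a -> j = (size a + size s' + size m)%N -> k = (size a + size s + size m)%N ->
  weq S (shift i D1 ++ shift j D2) (shift k D2 ++ shift i D1).
Proof. by move=> r1 r2 -> ei ej ek; exact: (weq_far_at _ r1 r2 ei ej ek). Qed.

Lemma weq_sub s1 X Y s a b i : weq s1 X Y -> s = a ++ s1 ++ b -> i = size a ->
  weq s (shift i X) (shift i Y).
Proof. by move=> h -> ->; exact: weq_wide. Qed.

Lemma weq_sub0 s1 X Y s b : weq s1 X Y -> s = s1 ++ b -> weq s X Y.
Proof. by move=> h e; have := weq_sub h (e : _ = [::] ++ s1 ++ b) erefl; rewrite !shift0. Qed.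

Lemma run_sub D s s' l r S S' i : run D s = Some s' -> S = l ++ s ++ r -> S' = l ++ s' ++ r ->
  i = size l -> run (shift i D) S = Some S'.
Proof. by move=> h -> -> e; exact: run_at. Qed.
Lemma run_sub0 D s s' r S S' : run D s = Some s' -> S = s ++ r -> S' = s' ++ r ->
  run D S = Some S'.
Proof. by move=> h -> ->; exact: run_at_l. Qed.

Lemma run_chainL0 o k : run (chainL o k) (nseq k o ++ [:: ~~ o]) = Some (~~ o :: nseq k o).
Proof. by rewrite run_chainL cats0. Qed.
Lemma run_chainR0 o k : run (chainR o k) (o :: nseq k (~~ o)) = Some (nseq k (~~ o) ++ [:: o]).
Proof. by have := run_chainR o k [::]; rewrite !cats0. Qed.

(** A grid can be read by rows or by columns. *)
Lemma gridw_regroup o a b : weq (nseq a.+1 o ++ nseq b (~~ o)) (gridw o a.+1 b)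
  (shift a (chainR o b) ++ gridw o a b).
Proof.
elim: b => [|b IH]; first exact: weq_refl.
have h1 : weq (nseq a.+1 o ++ nseq b.+1 (~~ o)) (gridw o a.+1 b) (shift a (chainR o b) ++ gridw o a b).
  by apply: (weq_sub0 (b := [:: ~~ o]) IH); lsteq.
apply: weq_trans (weq_post (shift b (chainL o a.+1)) h1) _.
rewrite [chainR _ _]/= shift_cat -!catA.
apply: (@weq_pre _ (nseq a o ++ nseq b (~~ o) ++ [:: o; ~~ o])).
  by apply: (run_sub (l := nseq a o) (r := [:: ~~ o]) (run_chainR0 o b)); [lsteq|lsteq|sizes].
rewrite [gridw _ _ b.+1]/= [shift b (chainL _ a.+1)]/shift /= -/(shift b (chainL o a)).
have E : weq (nseq a o ++ nseq b (~~ o) ++ [:: o; ~~ o])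
    (shift 0 (gridw o a b) ++ shift (b + a) [:: (0%N, Cr o)])
    (shift (b + a) [:: (0%N, Cr o)] ++ shift 0 (gridw o a b)).
  by apply: (weq_far_at' (a := [::]) (m := [::]) (b := [::]) (run_gridw0 o a b) (run_Cr o));
    [lsteq|by []|sizes|sizes].
have := weq_post (shift b (chainL o a)) E.
by rewrite !shift0 -!slice1E -!catA (addnC b a).
Qed.

Lemma slide_chainL o j k : (j.+1 < k)%N -> weq (nseq k o ++ [:: ~~ o])
  (shift j (Eo o) ++ chainL o k) (chainL o k ++ shift j.+1 (Eo o)).
Proof.
elim: k => // k IH; rewrite ltnS leq_eqVlt => /orP[/eqP e|h].
  case: k IH e => // k _ [->].
  have -> : chainL o k.+2 = shift k [:: (1, Cr o); (0, Cr o)]%N ++ chainL o k.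
    by rewrite /= /shift /= addn0 addn1.
  have h1 : weq (nseq k.+2 o ++ [:: ~~ o]) (shift k (Eo o) ++ shift k [:: (1, Cr o); (0, Cr o)]%N)
     (shift k [:: (1, Cr o); (0, Cr o)]%N ++ shift k.+1 (Eo o)).
    have := @weq_sub _ _ _ (nseq k.+2 o ++ [:: ~~ o]) (nseq k o) [::] k (slide_l o).
    rewrite !shift_cat shift_shift addn1; apply; [lsteq|sizes].
  have := weq_post (chainL o k) h1; rewrite -!catA => h2; apply: (weq_trans h2).
  apply: (@weq_pre _ (nseq k o ++ [:: ~~ o; o; o])).
    by apply: (run_sub (s := [:: o; o; ~~ o]) (s' := [:: ~~ o; o; o]) (l := nseq k o) (r := [::]));
     [case: (o)|lsteq|lsteq|sizes].
  have := @weq_far_at' _ _ _ _ [::] _ _ [::] [::] (nseq k o ++ [:: ~~ o; o; o]) 0 k.+1 k.+1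
    (run_chainL0 o k) (run_Eo o); rewrite shift0 => h; apply: weq_sym; apply: h; [lsteq|by []|sizes|sizes].
rewrite [chainL _ _]/= -cat1s.
have h1 : weq (nseq k.+1 o ++ [:: ~~ o]) (shift j (Eo o) ++ [:: (k, Cr o)]) ([:: (k, Cr o)] ++ shift j (Eo o)).
  have := @weq_far_at' _ _ _ _ (nseq (k - j - 2) o) _ _ (nseq j o) [::] (nseq k.+1 o ++ [:: ~~ o]) j k k
    (run_Eo o) (run_Cr o); rewrite shift1E addn0; apply; [lsteq|sizes|sizes|sizes].
have := weq_post (chainL o k) h1; rewrite -!catA => h2; apply: (weq_trans h2).
apply: (@weq_pre _ (nseq k o ++ [:: ~~ o; o])).
  by rewrite slice1E; apply: (run_sub (l := nseq k o) (r := [::]) (run_Cr o)); [lsteq|lsteq|sizes].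
by apply: (weq_sub0 (b := [:: o]) (IH h)); lsteq.
Qed.

Lemma slide_chainR o j k : (j.+1 < k)%N -> weq (o :: nseq k (~~ o))
  (shift j.+1 (Eo (~~ o)) ++ chainR o k) (chainR o k ++ shift j (Eo (~~ o))).
Proof.
elim: k => // k IH; rewrite ltnS leq_eqVlt => /orP[/eqP e|h].
  case: k IH e => // k _ [->].
  have -> : chainR o k.+2 = chainR o k ++ shift k [:: (0, Cr o); (1, Cr o)]%N.
    by rewrite /= /shift /= addn0 addn1 -catA.
  have h1 := @weq_far_at' _ _ _ _ [::] _ _ [::] [::] (o :: nseq k.+2 (~~ o)) 0 k.+1 k.+1
    (run_chainR0 o k) (run_Eo (~~ o)).
  have {}h1 := h1 ltac:(lsteq) erefl ltac:(sizes) ltac:(sizes).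
  rewrite shift0 in h1.
  have := weq_post (shift k [:: (0, Cr o); (1, Cr o)]%N) (weq_sym h1); rewrite -!catA => h2.
  apply: (weq_trans h2).
  apply: (@weq_pre _ (nseq k (~~ o) ++ [:: o; ~~ o; ~~ o])).
    by apply: (run_sub0 (r := [:: ~~ o; ~~ o]) (run_chainR0 o k)); lsteq.
  have := @weq_sub _ _ _ (nseq k (~~ o) ++ [:: o; ~~ o; ~~ o]) (nseq k (~~ o)) [::] k (slide_r o).
  rewrite !shift_cat shift_shift addn1; apply; [lsteq|sizes].
rewrite [chainR _ _]/= catA.
have h0 : weq (o :: nseq k.+1 (~~ o)) (shift j.+1 (Eo (~~ o)) ++ chainR o k) (chainR o k ++ shift j (Eo (~~ o))).
  by apply: (weq_sub0 (b := [:: ~~ o]) (IH h)); lsteq.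
apply: (weq_trans (weq_post [:: (k, Cr o)] h0)); rewrite -!catA.
apply: (@weq_pre _ (nseq k (~~ o) ++ [:: o; ~~ o])).
  by apply: (run_sub0 (r := [:: ~~ o]) (run_chainR0 o k)); lsteq.
have := @weq_far_at' _ _ _ _ (nseq (k - j - 2) (~~ o)) _ _ (nseq j (~~ o)) [::] (nseq k (~~ o) ++ [:: o; ~~ o]) j k k
    (run_Eo (~~ o)) (run_Cr o); rewrite shift1E addn0; apply; [lsteq|sizes|sizes|sizes].
Qed.

Lemma slide_grid_l o a b j : (j.+1 < a)%N -> weq (nseq a o ++ nseq b (~~ o))
  (shift j (Eo o) ++ gridw o a b) (gridw o a b ++ shift (b + j) (Eo o)).
Proof.
move=> h; elim: b => [|b IH]; first by rewrite /= cats0; exact: weq_refl.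
rewrite [gridw _ _ _]/= catA.
have h0 : weq (nseq a o ++ nseq b.+1 (~~ o)) (shift j (Eo o) ++ gridw o a b) (gridw o a b ++ shift (b + j) (Eo o)).
  by apply: (weq_sub0 (b := [:: ~~ o]) IH); lsteq.
apply: (weq_trans (weq_post _ h0)); rewrite -!catA.
apply: (@weq_pre _ (nseq b (~~ o) ++ nseq a o ++ [:: ~~ o])).
  by apply: (run_sub0 (r := [:: ~~ o]) (run_gridw0 o a b)); lsteq.
have := weq_wide (nseq b (~~ o)) [::] (slide_chainL o h).
by rewrite !shift_cat !shift_shift !size_nseq !cats0 addnS.
Qed.

Lemma slide_grid_r o a b j : (j.+1 < b)%N -> weq (nseq a o ++ nseq b (~~ o))
  (shift (a + j) (Eo (~~ o)) ++ gridw o a b) (gridw o a b ++ shift j (Eo (~~ o))).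
Proof.
move=> h; elim: a => [|a IH].
  have g0 k : gridw o 0 k = [::] by elim: k => //= k ->.
  by rewrite !g0 cats0; exact: weq_refl.
apply: (@weq_trans _ (shift (a.+1 + j) (Eo (~~ o)) ++ (shift a (chainR o b) ++ gridw o a b))).
  apply: weq_pre (gridw_regroup o a b).
  by apply: (run_sub (l := nseq a.+1 o ++ nseq j (~~ o)) (r := nseq (b - j - 2) (~~ o)) (run_Eo (~~ o)));
    [lsteq|lsteq|sizes].
apply: weq_sym; apply: (weq_trans (weq_post _ (gridw_regroup o a b))); apply: weq_sym.
rewrite catA.
have h0 : weq (nseq a.+1 o ++ nseq b (~~ o)) (shift (a.+1 + j) (Eo (~~ o)) ++ shift a (chainR o b))
   (shift a (chainR o b) ++ shift (a + j) (Eo (~~ o))).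
  have := @weq_sub _ _ _ (nseq a.+1 o ++ nseq b (~~ o)) (nseq a o) [::] a (slide_chainR o h).
  rewrite !shift_cat !shift_shift addnS; apply; [lsteq|sizes].
apply: (weq_trans (weq_post _ h0)); rewrite -!catA.
apply: (@weq_pre _ (nseq a o ++ nseq b (~~ o) ++ [:: o])).
  by apply: (run_sub (l := nseq a o) (r := [::]) (run_chainR0 o b)); [lsteq|lsteq|sizes].
by apply: (weq_sub0 (b := [:: o]) IH); lsteq.
Qed.

(** When the strand that crosses the bundle is capped off with its last strand, the
    other crossings become parallel crossings within the bundle, next to a cap. *)
Lemma cap_chain o b : weq (o :: nseq b.+1 (~~ o)) (chainR o b ++ [:: (b, Cap o)])
  (shift 1 (ngL (~~ o) b) ++ [:: (0, Cap o)])%N.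
Proof.
elim: b => [|b IH]; first exact: weq_refl.
rewrite [chainR _ _]/= -catA.
apply: (@weq_trans _ (chainR o b ++ [:: (b.+1, Ng (~~ o)); (b, Cap o)])).
  apply: (@weq_pre _ (nseq b (~~ o) ++ [:: o; ~~ o; ~~ o])).
    by apply: (run_sub0 (r := [:: ~~ o; ~~ o]) (run_chainR0 o b)); lsteq.
  have := @weq_sub _ _ _ (nseq b (~~ o) ++ [:: o; ~~ o; ~~ o]) (nseq b (~~ o)) [::] b (cap_bend o).
  by rewrite /shift /= addn0 addn1; apply; [lsteq|sizes].
have h : weq (o :: nseq b.+2 (~~ o)) (chainR o b ++ [:: (b.+1, Ng (~~ o))])
    ([:: (b.+1, Ng (~~ o))] ++ chainR o b).
  have := @weq_far_at' _ _ _ _ [::] _ _ [::] [::] (o :: nseq b.+2 (~~ o)) 0 b.+1 b.+1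
    (run_chainR0 o b) (run_Ng (~~ o)).
  by rewrite shift0 -!slice1E; apply; [lsteq|by []|sizes|sizes].
have := weq_post [:: (b, Cap o)] h; rewrite -!catA => h'; apply: (weq_trans h').
rewrite (_ : shift 1 (ngL (~~ o) b.+1) = [:: (b.+1, Ng (~~ o))] ++ shift 1 (ngL (~~ o) b)) // -catA.
apply: (@weq_pre _ (o :: nseq b.+2 (~~ o))).
  by rewrite slice1E; apply: (run_sub (l := o :: nseq b (~~ o)) (r := [::]) (run_Ng (~~ o)));
   [lsteq|lsteq|sizes].
by apply: (weq_sub0 (b := [:: ~~ o]) IH); lsteq.
Qed.

Lemma cup_chain o b : weq (nseq b o) ((b, Cup (~~ o)) :: chainL o b)
  ((0, Cup (~~ o)) :: shift 1 (ngR o b))%N.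
Proof.
elim: b => [|b IH]; first exact: weq_refl.
rewrite [chainL _ _]/=.
have h0 : weq (nseq b.+1 o) [:: (b.+1, Cup (~~ o)); (b, Cr o)] [:: (b, Cup (~~ o)); (b.+1, Ng o)].
  have := @weq_sub _ _ _ (nseq b.+1 o) (nseq b o) [::] b (cup_bend o).
  by rewrite /shift /= addn0 addn1; apply; [lsteq|sizes].
apply: (weq_trans (weq_post (chainL o b) h0)).
have rC : run [:: (b, Cup (~~ o))] (nseq b.+1 o) = Some (nseq b o ++ [:: ~~ o; o; o]).
  have := @run_sub _ _ _ (nseq b o) [:: o] (nseq b.+1 o) (nseq b o ++ [:: ~~ o; o; o]) b (run_Cup (~~ o)).
  by rewrite -!slice1E negbK; apply; [lsteq|lsteq|sizes].
apply: (@weq_trans _ ([:: (b, Cup (~~ o))] ++ chainL o b ++ [:: (b.+1, Ng o)])).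
  rewrite -[X in weq _ X _]/([:: (b, Cup (~~ o))] ++ ([:: (b.+1, Ng o)] ++ chainL o b)).
  apply: (weq_pre rC); apply: weq_sym.
  have := @weq_far_at' _ _ _ _ [::] _ _ [::] [::] (nseq b o ++ [:: ~~ o; o; o]) 0 b.+1 b.+1
    (run_chainL0 o b) (run_Ng o).
  by rewrite shift0 -!slice1E; apply; [lsteq|by []|sizes|sizes].
rewrite [ngR _ _]/= shift_cat catA; apply: (@weq_post _ _ _ ([:: _] ++ _)).
by apply: (weq_sub0 (b := [:: o]) IH); lsteq.
Qed.

Lemma cap_bend_l o : weq [:: o; o; ~~ o] [:: (1, Cr o); (0, Cap o)]%N
  [:: (0, Ng o); (1, Cap o)]%N.
Proof.
by case: o;
 [wst 0%N [:: U] s0 (bend_l U); wcomm' 2%N s0 s0 (Cap U) (Cap U) [:: U];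
  wcomm' 1%N s0 [:: D] (Cap U) (Ng U) s0; wst 0%N s0 [:: U; D] (zigr U); wend
 |wst 0%N [:: D] s0 (bend_l D); wcomm' 2%N s0 s0 (Cap D) (Cap D) [:: D];
  wcomm' 1%N s0 [:: U] (Cap D) (Ng D) s0; wst 0%N s0 [:: D; U] (zigr D); wend].
Qed.

Lemma cup_bend_l o : weq [:: o] [:: (0, Cup o); (1, Cr (~~ o))]%N
  [:: (1, Cup o); (0, Ng o)]%N.
Proof.
case: o.
  wst 1%N [:: U] s0 (bend_r D); wcomm 0%N s0 s0 (Cup U) (Cup U) [:: U].
  wcomm 1%N s0 [:: D] (Cup U) (Ng U) s0; wst 2%N s0 [:: U; D] (zigl U); wend.
wst 1%N [:: D] s0 (bend_r U); wcomm 0%N s0 s0 (Cup D) (Cup D) [:: D].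
wcomm 1%N s0 [:: U] (Cup D) (Ng D) s0; wst 2%N s0 [:: D; U] (zigl D); wend.
Qed.

Definition UU o : diagram := [:: (0, Cap o); (0, Cup o)]%N.

Lemma twist_id1 (F : fieldType) (t : F) : t != 0 ->
  t ^- 2 * t ^- 2 * ((t ^+ 3) ^+ 2 + 1 + (t ^- 3) ^+ 2) + t ^- 2 * - t * (t ^+ 3 + t ^- 3) +
   - t * t ^- 2 * (t ^+ 3 + t ^- 3) + - t * - t = t ^- 10 - t ^- 4.
Proof. by move=> t0; field. Qed.

(** Two antiparallel crossings: the terms with one smoothing are turnbacks, and
    the term with two copies of H is a square. *)
Lemma full_twist o : leq1 [:: o; ~~ o] [:: (0, Cr o); (0, Cr (~~ o))]%N
  [:: (q6 2, [::]); (q6 (-10) - q6 (-4), UU o)].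
Proof.
have E1 : leq1 [:: o; ~~ o] (Uo o ++ Uo (~~ o)) [:: (qint 3, UU o)].
  by case: o; [llin 1%N s0 s0 (circle D)|llin 1%N s0 s0 (circle U)]; exact: leqv_refl.
have E2 : leq1 [:: o; ~~ o] (Uo o ++ Ho (~~ o)) [:: (qint 2, UU o)].
  case: o {E1}; wred.
    lst 1%N s0 s0 (cupT U); llin 2%N [:: U] s0 (bigon D); exact: leqv_refl.
  lst 1%N s0 s0 (cupT D); llin 2%N [:: D] s0 (bigon U); exact: leqv_refl.
have E3 : leq1 [:: o; ~~ o] (Ho o ++ Uo (~~ o)) [:: (qint 2, UU o)].
  case: o {E1 E2}; wred.
    lst 1%N s0 s0 (capT D); llin 0%N s0 [:: D] (bigon U); exact: leqv_refl.
  lst 1%N s0 s0 (capT U); llin 0%N s0 [:: U] (bigon D); exact: leqv_refl.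
have E4 : leq1 [:: o; ~~ o] (Ho o ++ Ho (~~ o)) [:: (1, [::]); (1, UU o)].
  case: o {E1 E2 E3}; wred.
    lst 2%N s0 s0 (Hrot U); exact: (square D).
  lst 2%N s0 s0 (Hrot D); exact: (square U).
have E5 A : leq1 [:: o; ~~ o] (A ++ [:: (0%N, Cr (~~ o))])
   [:: (q6 (-2), A ++ Uo (~~ o)); (- q6 1, A ++ Ho (~~ o))] \/ run A [:: o; ~~ o] <> Some [:: ~~ o; o].
  have [rA|] := pselect (run A [:: o; ~~ o] = Some [:: ~~ o; o]); last by right.
  left; have := leqv_ctx (a := [::]) (b := [::]) [::] (cross_anti (~~ o)) (s := [:: o; ~~ o]) (E1 := A).
  by rewrite /leq1 /inctx; cbn [map fst snd size]; rewrite !shift0 !cats0 !negbK; apply.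
split=> S D1 l r D2 r1.
have e0 := leqvE (cross_anti o) (shift (size l) [:: (0%N, Cr (~~ o))] ++ D2) r1.
have [e5|[]] := E5 (Uo o); last by case: (o).
have [e6|[]] := E5 (Ho o); last by case: (o).
have {}e5 := leqvE e5 D2 r1; have {}e6 := leqvE e6 D2 r1.
have {}E1 := leqvE E1 D2 r1; have {}E2 := leqvE E2 D2 r1.
have {}E3 := leqvE E3 D2 r1; have {}E4 := leqvE E4 D2 r1.
move: e0 e5 e6 E1 E2 E3 E4; rewrite /wl !big_cons !big_nil; cbn [fst snd].
rewrite (_ : [:: (0%N, Cr o); (0%N, Cr (~~ o))] = [:: (0%N, Cr o)] ++ [:: (0%N, Cr (~~ o))]) // !addr0 !scale1r !shift_cat -!catA.
move=> -> -> -> -> -> -> ->.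
set Z := w S (D1 ++ shift (size l) (UU o) ++ D2); set I := w S _.
rewrite !scalerDr !scalerA [_ *: I + _ *: Z]addrC !addrA -!scalerDl [RHS]addrC.
congr (_ *: _ + _ *: _).
  rewrite Model.qint2E Model.qint3E (Model.q6E.2 2) (Model.q6E.2 10) (Model.q6E.2 4).
  exact: (twist_id1 Model.q6_1_neq0).
by rewrite mulrNN -q6D.
Qed.

(** * Clasped antiparallel bundles *)

(** Closing two copies of H on both sides of an antiparallel pair gives a square
    face. *)
Lemma loop_square o : leq1 [:: o; ~~ o]
  ([:: (1, Cup o)]%N ++ Eo o ++ shift 2 (Eo (~~ o)) ++ [:: (1, Cap o)]%N)
  [:: (1, [::]); (1, UU o)].
Proof.
case: o; wred.
  lcomm 2%N s0 s0 (V12 D) (V21 D) s0; lst 0%N s0 [:: D] (rotr U).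
  lst 3%N [:: U] s0 (unrot_l U); lst 2%N s0 s0 (Hrot U); exact: (square D).
lcomm 2%N s0 s0 (V12 U) (V21 U) s0; lst 0%N s0 [:: U] (rotr D).
lst 3%N [:: D] s0 (unrot_l D); lst 2%N s0 s0 (Hrot D); exact: (square U).
Qed.

Ltac sec := first [solve [sizes] | lsteq].
Definition E o S k : 'R := w S (shift k (Eo o)).
Lemma EEE o S p i : EE o S p i = E o S (p + i). Proof. by []. Qed.

Lemma efar_l o D s s' a m r S S' k i : run D s = Some s' ->
  S = a ++ [:: o; o] ++ m ++ s ++ r -> S' = a ++ [:: o; o] ++ m ++ s' ++ r ->
  k = size a -> i = (size a + 2 + size m)%N ->
  w S (shift i D) * E o S k = E o S' k * w S (shift i D).
Proof. by move=> rD eS eS' ek ei; apply: (w_far (run_Eo o) rD eS eS eS' ek ei ei). Qed.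

Lemma efar_r o D s s' a m r S S' k k' i : run D s = Some s' ->
  S = a ++ s ++ m ++ [:: o; o] ++ r -> S' = a ++ s' ++ m ++ [:: o; o] ++ r ->
  i = size a -> k = (size a + size s + size m)%N -> k' = (size a + size s' + size m)%N ->
  w S (shift i D) * E o S k = E o S' k' * w S (shift i D).
Proof.
by move=> rD eS eS' ei ek ek'; symmetry; apply: (w_far rD (run_Eo o) eS eS' eS ei ek ek').
Qed.

Lemma clasp_w1 o S p s n N l r : S = l ++ nseq N o ++ r -> p = size l -> (s + n <= N)%N ->
  w S [::] * clasp_at v0 (EE o S p) s n = clasp_at v0 (EE o S p) s n * w S [::].
Proof.
move=> eS ep h; symmetry; apply: clasp_comm => i hi hi'.
by rewrite /EE w1r w1l // ep eS run_EE //; lia.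
Qed.

Section ColumnDefs.
Variable o : bool.
Definition Sec (l r : seq bool) a b := l ++ nseq a o ++ nseq b (~~ o) ++ r.
Definition pd l r a b : 'R := clasp_at v0 (EE o (Sec l r a b) (size l)) 0 a.
Definition pu l r a b : 'R := clasp_at v0 (EE (~~ o) (Sec l r a b) (size l + a)) 0 b.
End ColumnDefs.

(** The two clasps of an antiparallel column. *)
HB.lock Definition pp o l r a b : 'R := pd o l r a b * pu o l r a b * w (Sec o l r a b) [::].
Lemma ppE o l r a b : pp o l r a b = pd o l r a b * pu o l r a b * w (Sec o l r a b) [::].
Proof. by rewrite pp.unlock. Qed.

Section Column.
Variable o : bool.
Local Notation Sec := (Sec o).
Local Notation pd := (pd o).
Local Notation pu := (pu o).
Local Notation pp := (pp o).
(** A turnback at the top of the column: the innermost strands are capped. *)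
Definition cp l r a b : 'R := w (Sec l r a.+1 b.+1) (shift (size l + a) [:: (0%N, Cap o)]).
Definition cu l r a b : 'R := w (Sec l r a b) (shift (size l + a) [:: (0%N, Cup o)]).
Definition uu l r a b : 'R := w (Sec l r a b) (shift (size l + a.-1) (UU o)).
(** The full twist of the two bundles, that is, two crossings of the column. *)
Definition XX l r a b : 'R := w (Sec l r a b) (shift (size l) (gridw o a b ++ gridw (~~ o) b a)).

Lemma hecke_d l r a b : hecke v0 (EE o (Sec l r a b) (size l)) a.
Proof. exact: EE_hecke. Qed.
Lemma hecke_u l r a b : hecke v0 (EE (~~ o) (Sec l r a b) (size l + a)) b.
Proof.
by apply: (@EE_hecke _ _ (l ++ nseq a o) r); [rewrite /Sec; lsteq|sizes].
Qed.

Lemma EdEu l r a b i j : (i.+1 < a)%N -> (j.+1 < b)%N ->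
  EE o (Sec l r a b) (size l) i * EE (~~ o) (Sec l r a b) (size l + a) j =
  EE (~~ o) (Sec l r a b) (size l + a) j * EE o (Sec l r a b) (size l) i.
Proof.
move=> hi hj; apply: (efar_r (D := Eo o) (s := [:: o; o]) (s' := [:: o; o]) (a := l ++ nseq i o)
  (m := nseq (a - i - 2) o ++ nseq j (~~ o)) (r := nseq (b - j - 2) (~~ o) ++ r) (run_Eo o));
  rewrite /Sec; sec.
Qed.

Section Fix.
Variables (l r : seq bool) (a b : nat).
Local Notation S := (Sec l r a b).
Local Notation S1 := (Sec l r a.+1 b.+1).
Local Notation ed := (EE o S (size l)).
Local Notation eu := (EE (~~ o) S (size l + a)).
Local Notation ed1 := (EE o S1 (size l)).
Local Notation eu1 := (EE (~~ o) S1 (size l + a.+1)).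
Local Notation cp := (cp l r a b).
Local Notation cu := (cu l r a b).

Lemma run_cp : run (shift (size l + a) [:: (0%N, Cap o)]) S1 = Some S.
Proof.
by apply: (run_sub (l := l ++ nseq a o) (r := nseq b (~~ o) ++ r) (run_Cap o)); rewrite /Sec; sec.
Qed.
Lemma run_cu : run (shift (size l + a) [:: (0%N, Cup o)]) S = Some S1.
Proof.
by apply: (run_sub (l := l ++ nseq a o) (r := nseq b (~~ o) ++ r) (run_Cup o)); rewrite /Sec; sec.
Qed.

Lemma cp_ed i : (i.+1 < a)%N -> cp * ed1 i = ed i * cp.
Proof.
move=> h; apply: (efar_l (a := l ++ nseq i o) (m := nseq (a - i - 2) o) (r := nseq b (~~ o) ++ r) (run_Cap o));
  rewrite /Sec; sec.
Qed.
Lemma cu_ed i : (i.+1 < a)%N -> cu * ed i = ed1 i * cu.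
Proof.
move=> h; apply: (efar_l (a := l ++ nseq i o) (m := nseq (a - i - 2) o) (r := nseq b (~~ o) ++ r) (run_Cup o));
  rewrite /Sec; sec.
Qed.
Lemma cp_eu j : (j.+1 < b)%N -> cp * eu1 j.+1 = eu j * cp.
Proof.
move=> h; apply: (efar_r (a := l ++ nseq a o) (m := nseq j (~~ o)) (r := nseq (b - j - 2) (~~ o) ++ r) (run_Cap o));
  rewrite /Sec; sec.
Qed.
Lemma cu_eu j : (j.+1 < b)%N -> cu * eu j = eu1 j.+1 * cu.
Proof.
move=> h; apply: (efar_r (a := l ++ nseq a o) (m := nseq j (~~ o)) (r := nseq (b - j - 2) (~~ o) ++ r) (run_Cup o));
  rewrite /Sec; sec.
Qed.

Local Notation P1 := (clasp_at v0 ed1 0 a).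
Local Notation Q1 := (clasp_at v0 eu1 1 b).

Lemma cp_P : cp * P1 = pd l r a b * cp.
Proof. by apply: (@clasp_intertwine _ _ _ _ _ _ 0 0) => i; exact: cp_ed. Qed.
Lemma cu_P : cu * pd l r a b = P1 * cu.
Proof. by apply: (@clasp_intertwine _ _ _ _ _ _ 0 0) => i; exact: cu_ed. Qed.
Lemma cp_Q : cp * Q1 = pu l r a b * cp.
Proof. by apply: (@clasp_intertwine _ _ _ _ _ _ 1 0) => i; exact: cp_eu. Qed.
Lemma cu_Q : cu * pu l r a b = Q1 * cu.
Proof. by apply: (@clasp_intertwine _ _ _ _ _ _ 0 1) => i; exact: cu_eu. Qed.

Lemma pd_w : pd l r a b * w S [::] = w S [::] * pd l r a b.
Proof. by rewrite /pd (@clasp_w1 _ _ _ _ _ a l (nseq b (~~ o) ++ r)) // /Sec. Qed.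
Lemma pu_w : pu l r a b * w S [::] = w S [::] * pu l r a b.
Proof.
by rewrite /pu (@clasp_w1 _ _ _ _ _ b (l ++ nseq a o) r) //; [rewrite /Sec; lsteq|sizes].
Qed.
Lemma pd_pu : pd l r a b * pu l r a b = pu l r a b * pd l r a b.
Proof.
apply: clasp_comm => i _ hi; symmetry; apply: clasp_comm => j _ hj.
by symmetry; apply: EdEu.
Qed.
Lemma pd_idem : pd l r a b * pd l r a b = pd l r a b.
Proof. exact: (clasp_idem v0_generic (hecke_d l r a b)). Qed.
Lemma pu_idem : pu l r a b * pu l r a b = pu l r a b.
Proof. exact: (clasp_idem v0_generic (hecke_u l r a b)). Qed.
Lemma pp_pd : pp l r a b * pd l r a b = pp l r a b.
Proof. by rewrite !ppE -mulrA -pd_w mulrA -[_ * _ * pd _ _ _ _]mulrA -pd_pu mulrA pd_idem. Qed.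
Lemma pd_pp : pd l r a b * pp l r a b = pp l r a b.
Proof. by rewrite !ppE !mulrA pd_idem. Qed.
Lemma pp_pu : pp l r a b * pu l r a b = pp l r a b.
Proof. by rewrite !ppE -mulrA -pu_w mulrA -[_ * _ * pu _ _ _ _]mulrA pu_idem. Qed.
Lemma pu_pp : pu l r a b * pp l r a b = pp l r a b.
Proof. by rewrite !ppE pd_pu !mulrA pu_idem. Qed.
Lemma pp_w : pp l r a b * w S [::] = pp l r a b.
Proof. by rewrite !ppE -mulrA w1r. Qed.
Lemma w_pp : w S [::] * pp l r a b = pp l r a b.
Proof. by rewrite !ppE mulrA mulrA -pd_w -[_ * _ * pu _ _ _ _]mulrA -pu_w -!mulrA w1r. Qed.
Lemma pp_idem : pp l r a b * pp l r a b = pp l r a b.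
Proof. by rewrite {2}ppE !mulrA pp_pd pp_pu pp_w. Qed.

End Fix.
End Column.

(** * Closing one loop between two clasps *)

(** The coefficient of the loop: a circle, two bigons and a square contribute. *)
Lemma qn_loop_id (F : fieldType) (v : F) a b : generic_q v ->
  qn v 3 - qn v 2 * (qn v a / qn v a.+1) - qn v 2 * (qn v b / qn v b.+1)
  + qn v a / qn v a.+1 * (qn v b / qn v b.+1) = qn v (a + b + 3) / (qn v a.+1 * qn v b.+1).
Proof.
move=> vg; have ha := vg _ (ltn0Sn a); have hb := vg _ (ltn0Sn b).
apply: (canRL (mulfK _)); first by rewrite mulf_neq0.
have -> : (qn v 3 - qn v 2 * (qn v a / qn v a.+1) - qn v 2 * (qn v b / qn v b.+1)
  + qn v a / qn v a.+1 * (qn v b / qn v b.+1)) * (qn v a.+1 * qn v b.+1) =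
  qn v 3 * qn v a.+1 * qn v b.+1 - qn v 2 * qn v a * qn v b.+1 - qn v 2 * qn v a.+1 * qn v b + qn v a * qn v b.
  by field; rewrite ha hb.
rewrite qn3 // qn2 // !qnE !exprD !exprS.
have d0 := qden_neq0 vg; have v0 := v_neq0 vg.
have := vX_neq0 vg a; have := vX_neq0 vg b; move: (v ^+ a) (v ^+ b) => A B hB hA.
have d1 : v ^+ 2 - 1 != 0.
  by rewrite -(mulfV v0) -[v ^+ 2]/(v * v) -mulrBr mulf_neq0.
by field; rewrite ?d1 ?v0 ?hA ?hB.
Qed.

Lemma loop_alg (F : fieldType) (R : algType F) (P Q e f c k p0 i u : R) (al be s2 s3 : F) :
  P * P = P -> Q * Q = Q -> P * Q = Q * P -> e * Q = Q * e -> f * P = P * f -> e * f = f * e ->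
  c * (P * Q) = p0 * c -> P * Q * k = k * p0 ->
  c * k = s3 *: i -> al *: (c * e * k) = (al * s2) *: i -> be *: (c * f * k) = (be * s2) *: i ->
  (al * be) *: (c * (f * e) * k) = (al * be) *: (i + u) ->
  c * ((P - al *: (P * e * P)) * (Q - be *: (Q * f * Q))) * k =
  (s3 - s2 * al - s2 * be + al * be) *: (p0 * i * p0) + (al * be) *: (p0 * u * p0).
Proof.
move=> PP QQ PQ eQ fP ef h1 h2 e1 e2 e3 e4; have [p pE] : exists p, p = P * Q by exists (P * Q).
rewrite -pE in h1 h2.
have pp : p * p = p by rewrite pE mulrA -(mulrA P) -PQ mulrA PP -mulrA QQ.
have pc x : c * (p * x * p) * k = p0 * (c * x * k) * p0 by rewrite -!mulrA h2 !mulrA h1 -!mulrA.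
have a1 : P * Q = p * 1 * p by rewrite mulr1 pp.
have a2 : P * e * P * Q = p * e * p.
  by rewrite pE -!mulrA; congr (P * _); rewrite [Q * _]mulrA -eQ -mulrA [Q * _]mulrA -PQ -mulrA QQ.
have a3 : P * (Q * f * Q) = p * f * p.
  by rewrite pE -!mulrA [f * (P * Q)]mulrA fP -[P * f * Q]mulrA [Q * (P * _)]mulrA -PQ !mulrA PP.
have a4 : P * e * P * (Q * f * Q) = p * (f * e) * p.
  rewrite pE -ef -!mulrA; congr (P * _); rewrite [f * (P * Q)]mulrA fP -[P * f * Q]mulrA.
  by rewrite [P * (Q * _)]mulrA PQ [e * (Q * _ * _)]mulrA [e * (Q * _)]mulrA eQ -!mulrA.
rewrite mulrBl !mulrBr !(zml, zmr) a1 a2 a3 a4 !(mulrBl, mulrBr, zml, zmr) !pc mulr1 e1 scalerA.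
have zc m x : m *: (p0 * x * p0) = p0 * (m *: x) * p0 by rewrite zmr zml.
rewrite -zc !zc e2 e3 e4 -!zc mulrDr mulrDl scalerDr opprB !addrA !scalerDl !scaleNr !(mulrC s2).
by rewrite addrAC; congr (_ + _); rewrite addrAC; congr (_ + _); rewrite addrAC.
Qed.

Lemma slice_congr i j (g : gen) (D D' : diagram) : i = j -> D = D' -> (i, g) :: D = (j, g) :: D'.
Proof. by move=> -> ->. Qed.
Ltac wordeq := rewrite /shift /Eo /UU /= ?negbK;
  repeat first [reflexivity | apply: slice_congr; [lia|]].

Section Loops.
Variables (o : bool) (l r : seq bool) (a b : nat).
Local Notation S := (Sec o l r a b).
Local Notation S1 := (Sec o l r a.+1 b.+1).
Local Notation k := (size l + a)%N.
Local Notation cp := (cp o l r a b).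
Local Notation cu := (cu o l r a b).
Local Notation pp' := (pp o l r a b).
Local Notation ed1 := (EE o S1 (size l)).
Local Notation eu1 := (EE (~~ o) S1 (size l + a.+1)).

Lemma run_ed l' r' a' b' i : (i.+1 < a')%N ->
  run (shift (size l' + i) (Eo o)) (Sec o l' r' a' b') = Some (Sec o l' r' a' b').
Proof. by move=> h; rewrite run_EE. Qed.
Lemma run_eu l' r' a' b' i : (i.+1 < b')%N ->
  run (shift (size l' + a' + i) (Eo (~~ o))) (Sec o l' r' a' b') = Some (Sec o l' r' a' b').
Proof.
move=> h; apply: (run_sub (l := l' ++ nseq a' o ++ nseq i (~~ o)) (r := nseq (b' - i - 2) (~~ o) ++ r')
  (run_Eo (~~ o))); rewrite /Sec; sec.
Qed.

Lemma cp_cu : cp * cu = qint 3 *: w S [::].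
Proof.
rewrite /cp /cu (w_cat _ (run_cu _ _ _ _ _)) -shift_cat.
have := leq_w (circle o) (_ : S = (l ++ nseq a o) ++ [::] ++ (nseq b (~~ o) ++ r)) (_ : k = _).
by rewrite !big_seq1 !scale1r => ->; rewrite /Sec; sec.
Qed.

Lemma cp_e_cu : (0 < a)%N -> cp * ed1 a.-1 * cu = qint 2 *: w S [::].
Proof.
case: a => // a' _; rewrite -mulrA /EE /cu (w_cat _ (run_cu _ _ _ _ _)) /cp w_cat; last first.
  by rewrite (run_cats _ (run_cu _ _ _ _ _)) run_ed.
rewrite (_ : (_ ++ _) = shift (size l + a') ((1, Cup o) :: Eo o ++ [:: (1, Cap o)])%N); last by wordeq.
have := leq_w (trace_r o) (_ : Sec o l r a'.+1 b = (l ++ nseq a' o) ++ [:: o] ++ (nseq b (~~ o) ++ r)) (_ : (size l + a')%N = _).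
by rewrite !big_seq1 !scale1r => ->; rewrite /Sec; sec.
Qed.

Lemma cp_f_cu : (0 < b)%N -> cp * eu1 0 * cu = qint 2 *: w S [::].
Proof.
case: b => // b' _; rewrite -mulrA /EE /cu (w_cat _ (run_cu _ _ _ _ _)) /cp w_cat; last first.
  by rewrite (run_cats _ (run_cu _ _ _ _ _)) run_eu.
rewrite (_ : (_ ++ _) = shift k ((0, Cup (~~ ~~ o)) :: shift 1 (Eo (~~ o)) ++ [:: (0, Cap (~~ ~~ o))])%N); last by wordeq.
have := leq_w (trace_l (~~ o)) (_ : Sec o l r a b'.+1 = (l ++ nseq a o) ++ [:: ~~ o] ++ (nseq b' (~~ o) ++ r)) (_ : k = _).
by rewrite !big_seq1 !scale1r => ->; rewrite /Sec; sec.
Qed.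

Lemma cp_fe_cu : (0 < a)%N -> (0 < b)%N -> cp * (eu1 0 * ed1 a.-1) * cu = w S [::] + uu o l r a b.
Proof.
case: a => // a' _; case: b => // b' _.
rewrite -mulrA -mulrA /EE /cu (w_cat _ (run_cu _ _ _ _ _)) w_cat; last first.
  by rewrite (run_cats _ (run_cu _ _ _ _ _)) run_ed.
rewrite /cp w_cat; last first.
  by rewrite -catA (run_cats _ (run_cu _ _ _ _ _)) (run_cats _ (run_ed _ _ _ _)) ?run_eu.
rewrite (_ : (_ ++ _) = shift (size l + a') ([:: (1, Cup o)] ++ Eo o ++ shift 2 (Eo (~~ o)) ++ [:: (1, Cap o)])%N); last by wordeq.
have := leq_w (loop_square o) (_ : Sec o l r a'.+1 b'.+1 = (l ++ nseq a' o) ++ [:: o; ~~ o] ++ (nseq b' (~~ o) ++ r)) (_ : (size l + a')%N = _).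
by rewrite big_seq1 !big_cons !big_nil; cbn [fst snd]; rewrite !addr0 !scale1r => ->; rewrite /Sec; sec.
Qed.

Lemma run_uu : (0 < a)%N -> (0 < b)%N -> run (shift (size l + a.-1) (UU o)) S = Some S.
Proof.
move=> a0 b0; apply: (run_sub (s := [:: o; ~~ o]) (s' := [:: o; ~~ o]) (l := l ++ nseq a.-1 o) (r := nseq b.-1 (~~ o) ++ r));
  [by case: (o)|rewrite /Sec; sec|rewrite /Sec; sec|sizes].
Qed.

Local Notation P1 := (clasp_at v0 ed1 0 a).
Local Notation Q1 := (clasp_at v0 eu1 1 b).

Lemma qn_loop : (qn v0 3 - qn v0 2 * (qn v0 a / qn v0 a.+1) - qn v0 2 * (qn v0 b / qn v0 b.+1)
  + qn v0 a / qn v0 a.+1 * (qn v0 b / qn v0 b.+1)) = qn v0 (a + b + 3) / (qn v0 a.+1 * qn v0 b.+1).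
Proof. exact: (qn_loop_id a b v0_generic). Qed.

(** Capping and cupping the innermost strands between clasps one strand wider:
    each clasp is expanded once by its recursion, which leaves a circle, two
    bigons and a square. *)
Lemma cap_pp : cp * pp o l r a.+1 b.+1 * cu =
  (qn v0 (a + b + 3) / (qn v0 a.+1 * qn v0 b.+1)) *: pp' +
  (qn v0 a * qn v0 b / (qn v0 a.+1 * qn v0 b.+1)) *: (pp' * uu o l r a b * pp').
Proof.
have vg := v0_generic; have H1 := hecke_d o l r a.+1 b.+1; have H2 := hecke_u o l r a.+1 b.+1.
set e := ed1 a.-1; set f := eu1 0.
have hd : pd o l r a.+1 b.+1 = P1 - (qn v0 a / qn v0 a.+1) *: (P1 * e * P1).
  by rewrite /pd clasp_atS add0n.
have hu : pu o l r a.+1 b.+1 = Q1 - (qn v0 b / qn v0 b.+1) *: (Q1 * f * Q1).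
  by rewrite /pu (clasp_recl vg H2).
have PP : P1 * P1 = P1 by rewrite (clasp_idem vg H1) // add0n.
have QQ : Q1 * Q1 = Q1 by rewrite (clasp_idem vg H2).
have PQ : P1 * Q1 = Q1 * P1.
  apply: clasp_comm => i _ hi; symmetry; apply: clasp_comm => j hj hj'.
  by symmetry; apply: EdEu; lia.
have Qe : (0 < a)%N -> Q1 * e = e * Q1.
  by move=> a0; apply: clasp_comm => j hj hj'; symmetry; apply: EdEu; lia.
have Pf : (0 < b)%N -> P1 * f = f * P1.
  by move=> b0; apply: clasp_comm => j hj hj'; apply: EdEu; lia.
pose e' := if (0 < a)%N then e else 0; pose f' := if (0 < b)%N then f else 0.
have hd' : pd o l r a.+1 b.+1 = P1 - (qn v0 a / qn v0 a.+1) *: (P1 * e' * P1).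
  by rewrite hd /e'; case: (a) => //; rewrite qn0 mul0r !scale0r.
have hu' : pu o l r a.+1 b.+1 = Q1 - (qn v0 b / qn v0 b.+1) *: (Q1 * f' * Q1).
  by rewrite hu /f'; case: (b) => //; rewrite qn0 mul0r !scale0r.
pose p0 := pd o l r a b * pu o l r a b.
have p00 : p0 * p0 = p0 by rewrite /p0 mulrA -(mulrA (pd _ _ _ _ _)) -pd_pu mulrA pd_idem -mulrA pu_idem.
have p0w : p0 * w S [::] = w S [::] * p0 by rewrite /p0 -mulrA pu_w !mulrA pd_w.
have h1 : cp * (P1 * Q1) = p0 * cp by rewrite /p0 mulrA cp_P -mulrA cp_Q mulrA.
have h2 : P1 * Q1 * cu = cu * p0 by rewrite /p0 -[LHS]mulrA -cu_Q [LHS]mulrA -cu_P -mulrA.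
have wu : w S1 [::] * cu = cu by rewrite /cu w1l // run_cu.
have := @loop_alg _ _ P1 Q1 e' f' cp cu p0 (w S [::]) (uu o l r a b) (qn v0 a / qn v0 a.+1) (qn v0 b / qn v0 b.+1) (qint 2) (qint 3) PP QQ PQ.
rewrite -hd' -hu'.
have fe : e' * f' = f' * e'.
  by rewrite /e' /f'; case: ifP => a0; case: ifP => b0; rewrite ?mul0r ?mulr0 //; apply: EdEu; lia.
have eQ : e' * Q1 = Q1 * e' by rewrite /e'; case: ifP => a0; rewrite ?mul0r ?mulr0 // Qe.
have fP : f' * P1 = P1 * f' by rewrite /f'; case: ifP => b0; rewrite ?mul0r ?mulr0 // Pf.
move=> /(_ eQ fP fe h1 h2 cp_cu) L.
rewrite {1}ppE -[LHS]mulrA -[_ * w _ _ * cu]mulrA wu mulrA L.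
- rewrite !qintE qn_loop !ppE -/p0 -[p0 * w S [::] * p0]mulrA -p0w mulrA p00.
  congr (_ + _); rewrite mulf_div.
  have [->|a0] := posnP a; first by rewrite qn0 !mul0r !scale0r.
  have [->|b0] := posnP b; first by rewrite qn0 !mulr0 !mul0r !scale0r.
  congr (_ *: _); rewrite -(mulrA p0 (w S [::])) /uu w1l; last exact: run_uu.
  by rewrite p0w mulrA -[p0 * w _ _ * w _ _]mulrA w1r.
- have [->|a0] := posnP a; first by rewrite qn0 !mul0r !scale0r.
  by rewrite /e' a0 cp_e_cu // scalerA.
- have [->|b0] := posnP b; first by rewrite qn0 !mul0r !scale0r.
  by rewrite /f' b0 cp_f_cu // scalerA.
have [->|a0] := posnP a; first by rewrite qn0 !mul0r !scale0r.
have [->|b0] := posnP b; first by rewrite qn0 !mul0r !mulr0 !scale0r.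
by rewrite /e' /f' a0 b0 cp_fe_cu.
Qed.
End Loops.

(** * The full twist of one strand around a bundle *)

(** The coefficient of the turnback in the full twist of one strand around a
    bundle of a strands. *)
Definition x1 (a : nat) : Kq := q6 (- (4 * a + 6)%N%:Z) * (1 - q6 (6 * a)%N%:Z).

Lemma x1_rec a : q6 (2 * a.+1)%N * x1 1 + x1 a.+1 * (q6 (-2) * q6 (-2)) = x1 a.+2.
Proof.
rewrite /x1 !mulrBr !mulr1 mulrBl -!q6D.
rewrite [X in q6 X - _ + _](_ : _ = (2 * a.+1)%N%:Z - 10); last by lia.
rewrite [X in _ - q6 X + _](_ : _ = (2 * a.+1)%N%:Z - 4); last by lia.
rewrite [X in _ + (q6 X - _)](_ : _ = - (4 * a.+2 + 6)%N%:Z); last by lia.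
rewrite [X in _ + (_ - q6 X)](_ : _ = (2 * a.+1)%N%:Z - 10); last by lia.
rewrite [X in _ = _ - q6 X](_ : _ = (2 * a.+1)%N%:Z - 4); last by lia.
by rewrite addrC addrA subrK.
Qed.

Lemma ng_absl o S l r k (x : 'R) : S = l ++ [:: o; o] ++ r -> k = size l -> E o S k * x = 0 ->
  w S [::] * x = x -> w S (shift k [:: (0%N, Ng o)]) * x = (q6 (- 2) : Kq) *: x.
Proof.
move=> eS ek ex wx; rewrite (crossN_w eS ek) zml mulrBl zml wx -/(E o S k) ex subr0 scalerA.
by rewrite /v0 (_ : (q6 3)^-1 = q6 (- 3)) -?q6D // !Model.q6E.
Qed.
Lemma ng_absr o S l r k (x : 'R) : S = l ++ [:: o; o] ++ r -> k = size l -> x * E o S k = 0 ->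
  x * w S [::] = x -> x * w S (shift k [:: (0%N, Ng o)]) = (q6 (- 2) : Kq) *: x.
Proof.
move=> eS ek ex wx; rewrite (crossN_w eS ek) zmr mulrBr zmr wx -/(E o S k) ex subr0 scalerA.
by rewrite /v0 (_ : (q6 3)^-1 = q6 (- 3)) -?q6D // !Model.q6E.
Qed.

Section Twist.
Variable o : bool.
Local Notation Sec := (Sec o).
Local Notation pd := (pd o).
Local Notation pu := (pu o).
Local Notation pp := (pp o).
Local Notation cp := (cp o).
Local Notation cu := (cu o).
Local Notation XX := (XX o).

Lemma ed_pp l r a b i : (i.+1 < a)%N -> E o (Sec l r a b) (size l + i) * pp l r a b = 0.
Proof.
move=> h; rewrite !ppE /pd -!mulrA mulrA (clasp_killl v0_generic (hecke_d o l r a b)) ?mul0r //; lia.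
Qed.
Lemma pp_ed l r a b i : (i.+1 < a)%N -> pp l r a b * E o (Sec l r a b) (size l + i) = 0.
Proof.
move=> h; rewrite -pp_pd /pd -mulrA (clasp_killr v0_generic (hecke_d o l r a b)) ?mulr0 //; lia.
Qed.
Lemma eu_pp l r a b i : (i.+1 < b)%N -> E (~~ o) (Sec l r a b) (size l + a + i) * pp l r a b = 0.
Proof.
move=> h; rewrite -pu_pp /pu mulrA (clasp_killl v0_generic (hecke_u o l r a b)) ?mul0r //; lia.
Qed.
Lemma pp_eu l r a b i : (i.+1 < b)%N -> pp l r a b * E (~~ o) (Sec l r a b) (size l + a + i) = 0.
Proof.
move=> h; rewrite -pp_pu /pu -mulrA (clasp_killr v0_generic (hecke_u o l r a b)) ?mulr0 //; lia.
Qed.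
Lemma pd_sub_pp l r a b s n : (s + n <= a)%N ->
  clasp_at v0 (EE o (Sec l r a b) (size l)) s n * pp l r a b = pp l r a b.
Proof.
by move=> h; rewrite !ppE /pd !mulrA (clasp_absl v0_generic (hecke_d o l r a b)).
Qed.
Lemma pp_sub_pd l r a b s n : (s + n <= a)%N ->
  pp l r a b * clasp_at v0 (EE o (Sec l r a b) (size l)) s n = pp l r a b.
Proof.
by move=> h; rewrite -{1}pp_pd /pd -mulrA (clasp_absr v0_generic (hecke_d o l r a b)) // -/(pd l r a b) pp_pd.
Qed.
Lemma pu_sub_pp l r a b s n : (s + n <= b)%N ->
  clasp_at v0 (EE (~~ o) (Sec l r a b) (size l + a)) s n * pp l r a b = pp l r a b.
Proof.
move=> h; rewrite -{1}pu_pp /pu mulrA (clasp_absl v0_generic (hecke_u o l r a b)) //.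
by rewrite -/(pu l r a b) pu_pp.
Qed.
Lemma pp_sub_pu l r a b s n : (s + n <= b)%N ->
  pp l r a b * clasp_at v0 (EE (~~ o) (Sec l r a b) (size l + a)) s n = pp l r a b.
Proof.
by move=> h; rewrite -{1}pp_pu /pu -mulrA (clasp_absr v0_generic (hecke_u o l r a b)) // -/(pu l r a b) pp_pu.
Qed.

Lemma weq_tw1 a : weq (nseq a o ++ [:: ~~ o]) (gridw o a 1 ++ gridw (~~ o) 1 a)
   (chainL o a ++ chainR (~~ o) a).
Proof.
rewrite [gridw o a 1]/= shift0; apply: (weq_pre (run_chainL0 o a)).
have := gridw_regroup (~~ o) 0 a; rewrite shift0 negbK.
have -> : gridw (~~ o) 0 a = [::] by elim: (a) => //= k ->.
by rewrite cats0.
Qed.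

Lemma XX1E l r a : XX l r a 1 = w (Sec l r a 1) (shift (size l) (chainL o a ++ chainR (~~ o) a)).
Proof. by apply: (weq_w (l := l) (r := r) (weq_tw1 a)); rewrite /Sec; sec. Qed.

Lemma uuE l r a b : uu o l r a.+1 b.+1 = cu l r a b * cp l r a b.
Proof.
rewrite /uu /cu /cp (w_cat _ (run_cp o l r a b)); congr (w _ _); wordeq.
Qed.

Lemma twist11 l r a : w (Sec l r a.+1 1) (shift (size l + a) [:: (0, Cr o); (0, Cr (~~ o))]%N) =
  (q6 2 : Kq) *: w (Sec l r a.+1 1) [::] + x1 1 *: (cu l r a 0 * cp l r a 0).
Proof.
have := leq_w (full_twist o) (_ : Sec l r a.+1 1 = (l ++ nseq a o) ++ [:: o; ~~ o] ++ r) (_ : (size l + a)%N = _).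
rewrite big_seq1 !big_cons !big_nil; cbn [fst snd]; rewrite !addr0 !scale1r => ->; rewrite ?/Sec; try sec.
rewrite -uuE /uu; congr (_ + _ *: _).
by rewrite /x1 mulrBr mulr1 -q6D.
Qed.

(** By induction on the width: the strand goes around a - 1 strands and around the
    last one; the crossings next to a turnback become curls within a clasp. *)
Lemma tw1 l r a : pp l r a.+1 1 * XX l r a.+1 1 * pp l r a.+1 1 =
  (q6 (2 * a.+1)%N%:Z : Kq) *: pp l r a.+1 1 +
  x1 a.+1 *: (pp l r a.+1 1 * cu l r a 0 * cp l r a 0 * pp l r a.+1 1).
Proof.
elim: a l r => [|a IH] l r.
  rewrite XX1E (_ : shift _ _ = shift (size l + 0) [:: (0, Cr o); (0, Cr (~~ o))]%N); last by wordeq.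
  by rewrite twist11 mulrDr mulrDl !(zmr, zml) pp_w pp_idem !mulrA.
set S := Sec l r a.+2 1; set M := Sec l (o :: r) a.+1 1.
pose C := w S (shift (size l + a.+1) [:: (0%N, Cr o)]).
pose C' := w M (shift (size l + a.+1) [:: (0%N, Cr (~~ o))]).
have rC : run (shift (size l + a.+1) [:: (0%N, Cr o)]) S = Some M.
  by apply: (run_sub (l := l ++ nseq a.+1 o) (r := r) (run_Cr o)); rewrite /S /M /Sec; sec.
have rC' : run (shift (size l + a.+1) [:: (0%N, Cr (~~ o))]) M = Some S.
  by apply: (run_sub (l := l ++ nseq a.+1 o) (r := r) (run_Cr (~~ o))); rewrite ?negbK /S /M /Sec; sec.
have rX : run (shift (size l) (chainL o a.+1 ++ chainR (~~ o) a.+1)) M = Some M.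
  apply: (run_sub (s := nseq a.+1 o ++ [:: ~~ o]) (s' := nseq a.+1 o ++ [:: ~~ o]) (l := l) (r := o :: r));
    [|rewrite /M /Sec; lsteq|rewrite /M /Sec; lsteq|by []].
  by rewrite (run_cats _ (run_chainL0 _ _)); have := run_chainR0 (~~ o) a.+1; rewrite negbK.
have EX : XX l r a.+2 1 = C' * XX l (o :: r) a.+1 1 * C.
  rewrite XX1E XX1E -/S -/M /C /C' -mulrA (w_cat _ rC) w_cat; last by rewrite (run_cats _ rC).
  congr (w _ _); rewrite [chainL _ a.+2]/= [chainR _ a.+2]/= -cat1s !shift_cat -!catA.
  by rewrite !shift1E !addn0.
pose P := clasp_at v0 (EE o S (size l)) 0 a.+1.
have CP : C * P = pd l (o :: r) a.+1 1 * C.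
  apply: (@clasp_intertwine _ _ _ _ _ _ 0 0) => i hi.
  by apply: (efar_l (a := l ++ nseq i o) (m := nseq (a.+1 - i - 2) o) (r := r) (run_Cr o)); rewrite /S /M /Sec; sec.
have CP' : C' * pd l (o :: r) a.+1 1 = P * C'.
  apply: (@clasp_intertwine _ _ _ _ _ _ 0 0) => i hi.
  by apply: (efar_l (a := l ++ nseq i o) (m := nseq (a.+1 - i - 2) o) (r := r) (run_Cr (~~ o))); rewrite ?negbK /S /M /Sec; sec.
have Pp : P * pp l r a.+2 1 = pp l r a.+2 1 by apply: pd_sub_pp.
have pP : pp l r a.+2 1 * P = pp l r a.+2 1 by apply: pp_sub_pd.
set p := pp l r a.+2 1 in Pp pP *; set pM := pp l (o :: r) a.+1 1 in IH *.
have C'pM : C' * pM = P * C'.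
  by rewrite /pM !ppE /pu clasp_at1 mulr1 pd_w mulrA /C' w1r CP'.
have pMC : pM * C = C * P.
  by rewrite /pM !ppE /pu clasp_at1 mulr1 -mulrA /C w1l // CP.
have Cpp x : p * C' * x * C * p = p * C' * (pM * x * pM) * C * p.
  have h1 : p * C' * pM = p * C' by rewrite -mulrA C'pM mulrA pP.
  have h2 : pM * (C * p) = C * p by rewrite mulrA pMC -mulrA Pp.
  by rewrite !mulrA h1 -!mulrA h2.
have -> : p * XX l r a.+2 1 * p = p * C' * XX l (o :: r) a.+1 1 * C * p by rewrite EX !mulrA.
rewrite Cpp IH -/pM mulrDr !mulrDl !(zmr, zml).
have -> : p * C' * pM * C * p = p * C' * 1 * C * p by rewrite [RHS]Cpp mulr1 pp_idem.
have -> : p * C' * (pM * cu l (o :: r) a 0 * cp l (o :: r) a 0 * pM) * C * p =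
  (p * (C' * cu l (o :: r) a 0)) * ((cp l (o :: r) a 0 * C) * p).
  by rewrite -[pM * _ * _]mulrA -Cpp !mulrA.
have wp : w S [::] * p = p by apply: w_pp.
have pw : p * w S [::] = p by apply: pp_w.
have E1 : cp l (o :: r) a 0 * C * p = (q6 (-2) : Kq) *: (cp l r a.+1 0 * p).
  have -> : cp l (o :: r) a 0 * C = cp l r a.+1 0 * w S (shift (size l + a) [:: (0%N, Ng o)]).
    rewrite /cp /C (w_cat _ rC) w_cat; last first.
      apply: (run_sub (l := l ++ nseq a o) (r := [:: ~~ o] ++ r) (run_Ng o)); rewrite /S /Sec; sec.
    have := weq_w (S := S) (l := l ++ nseq a o) (r := r) (i := (size l + a)%N) (cap_bend_l o).
    rewrite (_ : shift _ [:: (1%N, Cr o); _] = shift (size l + a.+1) [:: (0%N, Cr o)] ++ shift (size l + a) [:: (0%N, Cap o)]); last by wordeq.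
    rewrite (_ : shift _ [:: (0%N, Ng o); _] = shift (size l + a) [:: (0%N, Ng o)] ++ shift (size l + a.+1) [:: (0%N, Cap o)]); last by wordeq.
    by apply; rewrite ?/S ?/Sec; sec.
  rewrite -mulrA (@ng_absl _ _ (l ++ nseq a o) ([:: ~~ o] ++ r)) ?zmr //.
  - by rewrite /S /Sec; sec.
  - by sizes.
  by apply: ed_pp.
have E2 : p * (C' * cu l (o :: r) a 0) = (q6 (-2) : Kq) *: (p * cu l r a.+1 0).
  have -> : C' * cu l (o :: r) a 0 = w S (shift (size l + a) [:: (0%N, Ng o)]) * cu l r a.+1 0.
    have rcu : run (shift (size l + a) [:: (0%N, Cup o)]) (Sec l (o :: r) a 0) = Some M by apply: run_cu.
    have SE : Sec l (o :: r) a 0 = Sec l r a.+1 0 by rewrite /Sec; lsteq.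
    have rcu' : run (shift (size l + a.+1) [:: (0%N, Cup o)]) (Sec l r a.+1 0) = Some S by apply: run_cu.
    rewrite /cu /C' (w_cat _ rcu) SE (w_cat _ rcu').
    have := weq_w (S := Sec l r a.+1 0) (l := l ++ nseq a o) (r := r) (i := (size l + a)%N) (cup_bend_l o).
    rewrite (_ : shift _ [:: (0%N, Cup o); _] = shift (size l + a) [:: (0%N, Cup o)] ++ shift (size l + a.+1) [:: (0%N, Cr (~~ o))]); last by wordeq.
    rewrite (_ : shift _ [:: (1%N, Cup o); _] = shift (size l + a.+1) [:: (0%N, Cup o)] ++ shift (size l + a) [:: (0%N, Ng o)]); last by wordeq.
    by apply; rewrite ?/S ?/Sec; sec.
  rewrite mulrA (@ng_absr _ _ (l ++ nseq a o) ([:: ~~ o] ++ r)) ?zml //.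
  - by rewrite /S /Sec; sec.
  - by sizes.
  by apply: pp_ed.
rewrite E1 E2 !(zml, zmr) mulr1 -[p * C' * C]mulrA /C /C' (w_cat _ rC).
rewrite -shift_cat [_ ++ _]/= twist11 mulrDr mulrDl !(zmr, zml) -/S pw pp_idem !scalerA scalerDr !scalerA -addrA -!mulrA -scalerDl.
congr (_ *: _ + _ *: _); first by rewrite -q6D; congr q6; lia.
by rewrite -x1_rec; congr (_ + _); exact: mulrA.
Qed.
End Twist.

(** * The full twist of two antiparallel bundles *)

(** The coefficients of the full twist on the nested turnbacks, through the
    recursion that removes one strand of each bundle. *)
Fixpoint xc (A B m : nat) : Kq :=
  match A, B with
  | A'.+1, B'.+1 => q6 (2 * A'.+1)%N * xc A'.+1 B' m +
      (if m is m'.+1 then x1 A'.+1 * q6 (- (4 * B')%N%:Z) * xc A' B' m' else 0)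
  | _, _ => (m == 0%N)%:R
  end.

Lemma xc0 B m : xc 0 B m = (m == 0%N)%:R. Proof. by case: B. Qed.
Lemma xcx0 A m : xc A 0 m = (m == 0%N)%:R. Proof. by case: A. Qed.
Lemma xcSS A B m : xc A.+1 B.+1 m = q6 (2 * A.+1)%N * xc A.+1 B m +
      (if m is m'.+1 then x1 A.+1 * q6 (- (4 * B)%N%:Z) * xc A B m' else 0).
Proof. by []. Qed.

Lemma xc_gt A B m : (A < m)%N || (B < m)%N -> xc A B m = 0.
Proof.
elim: B A m => [|B IH] A m; first by rewrite xcx0; case: m => //; rewrite ltnn orbF.
case: A => [|A]; first by rewrite xc0; case: m.
case: m => // m; rewrite xcSS !ltnS => h; rewrite IH; last by lia.
by rewrite IH ?mulr0 ?addr0 //; lia.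
Qed.

Fixpoint CU_rec o l r a b m : 'R :=
  if m is m'.+1 then cu o l r (a + m') (b + m') * CU_rec o l r a b m' else w (Sec o l r a b) [::].
Fixpoint CA_rec o l r a b m : 'R :=
  if m is m'.+1 then CA_rec o l r a b m' * cp o l r (a + m') (b + m') else w (Sec o l r a b) [::].
HB.lock Definition CU := CU_rec.
HB.lock Definition CA := CA_rec.
Lemma CU0 o l r a b : CU o l r a b 0 = w (Sec o l r a b) [::]. Proof. by rewrite CU.unlock. Qed.
Lemma CA0 o l r a b : CA o l r a b 0 = w (Sec o l r a b) [::]. Proof. by rewrite CA.unlock. Qed.
Lemma CUS o l r a b m : CU o l r a b m.+1 = cu o l r (a + m) (b + m) * CU o l r a b m.
Proof. by rewrite CU.unlock. Qed.
Lemma CAS o l r a b m : CA o l r a b m.+1 = CA o l r a b m * cp o l r (a + m) (b + m).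
Proof. by rewrite CA.unlock. Qed.

Section TwistExpand.
Variable o : bool.
Local Notation Sec := (Sec o).
Local Notation pd := (pd o).
Local Notation pu := (pu o).
Local Notation pp := (pp o).
Local Notation cp := (cp o).
Local Notation cu := (cu o).
Local Notation XX := (XX o).
Local Notation CU := (CU o).
Local Notation CA := (CA o).

(** Nested turnbacks of m strands, between clasps; the other strands go through.
    The full twist is a combination of these. *)
Definition Dm l r A B m : 'R :=
  pp l r A B * CU l r (A - m) (B - m) m * CA l r (A - m) (B - m) m * pp l r A B.

Lemma Sec_r l r a b : Sec l (~~ o :: r) a b = Sec l r a b.+1.
Proof. by rewrite /Sec; lsteq. Qed.
Lemma cu_r l r a b : cu l (~~ o :: r) a b = cu l r a b.+1.
Proof. by rewrite /cu Sec_r. Qed.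
Lemma cp_r l r a b : cp l (~~ o :: r) a b = cp l r a b.+1.
Proof. by rewrite /cp Sec_r. Qed.
Lemma CU_r l r a b m : CU l (~~ o :: r) a b m = CU l r a b.+1 m.
Proof. by elim: m => [|m IH]; rewrite ?CU0 ?Sec_r // !CUS cu_r IH addSn. Qed.
Lemma CA_r l r a b m : CA l (~~ o :: r) a b m = CA l r a b.+1 m.
Proof. by elim: m => [|m IH]; rewrite ?CA0 ?Sec_r // !CAS cp_r IH addSn. Qed.

Lemma pp_pp_r l r a b : pp l r a b.+1 * pp l (~~ o :: r) a b = pp l r a b.+1.
Proof.
rewrite [pp l (~~ o :: r) a b]ppE /pd /pu Sec_r !mulrA pp_sub_pd // pp_sub_pu ?pp_w //; lia.
Qed.
Lemma pp_r_pp l r a b : pp l (~~ o :: r) a b * pp l r a b.+1 = pp l r a b.+1.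
Proof.
rewrite [pp l (~~ o :: r) a b]ppE /pd /pu Sec_r -!mulrA w_pp pu_sub_pp ?pd_sub_pp //; lia.
Qed.

Lemma cu_w l r a b : cu l r a b * w (Sec l r a b) [::] = cu l r a b.
Proof. by rewrite /cu w1r. Qed.
Lemma w_cp l r a b : w (Sec l r a b) [::] * cp l r a b = cp l r a b.
Proof. by rewrite /cp w1l // run_cp. Qed.

Lemma pp_cu l r a b : pp l r a.+1 b.+1 * cu l r a b * pp l r a b = pp l r a.+1 b.+1 * cu l r a b.
Proof.
rewrite [pp l r a b]ppE -!mulrA (mulrA (cu _ _ _ _)) cu_P -mulrA (mulrA (cu _ _ _ _)) cu_Q -mulrA cu_w.
by rewrite mulrA pp_sub_pd // mulrA pp_sub_pu //.
Qed.
Lemma cp_pp l r a b : pp l r a b * cp l r a b * pp l r a.+1 b.+1 = cp l r a b * pp l r a.+1 b.+1.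
Proof.
rewrite [pp l r a b]ppE -!mulrA (mulrA (w _ _)) w_cp (mulrA (pu _ _ _ _)) -cp_Q -mulrA (mulrA (pd _ _ _ _)) -cp_P -mulrA.
by rewrite pu_sub_pp // pd_sub_pp.
Qed.

End TwistExpand.

Lemma run_Ng_at o l N r k : (k.+1 < N)%N ->
  run (shift (size l + k) [:: (0%N, Ng o)]) (l ++ nseq N o ++ r) = Some (l ++ nseq N o ++ r).
Proof.
move=> h; apply: (run_sub (l := l ++ nseq k o) (r := nseq (N - k - 2) o ++ r) (run_Ng o)); sec.
Qed.

(** A crossing next to a clasp is a scalar, since the clasp kills H. *)
Lemma ngL_abs o S l r N b (x : 'R) : S = l ++ nseq N o ++ r -> (b < N)%N ->
  (forall i, (i.+1 < N)%N -> E o S (size l + i) * x = 0) -> w S [::] * x = x ->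
  w S (shift (size l) (ngL o b)) * x = (q6 (- 2) : Kq) ^+ b *: x.
Proof.
move=> eS bN ex wx; elim: b bN => [|b IH] bN; first by rewrite expr0 scale1r.
have -> : shift (size l) (ngL o b.+1) = shift (size l + b) [:: (0%N, Ng o)] ++ shift (size l) (ngL o b).
  by rewrite /= [LHS]/shift /= -/(shift _ _) /shift /= addn0.
have rN : run (shift (size l + b) [:: (0%N, Ng o)]) S = Some S by rewrite eS run_Ng_at.
rewrite -(w_cat _ rN) -mulrA (@ng_absl o S (l ++ nseq b o) (nseq (N - b - 2) o ++ r)) ?ex //.
- by rewrite zmr IH ?scalerA -?exprS //; lia.
- by rewrite eS; sec.
by sizes.
Qed.

Lemma ngR_abs o S l r N b (x : 'R) : S = l ++ nseq N o ++ r -> (b < N)%N ->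
  (forall i, (i.+1 < N)%N -> x * E o S (size l + i) = 0) -> x * w S [::] = x ->
  x * w S (shift (size l) (ngR o b)) = (q6 (- 2) : Kq) ^+ b *: x.
Proof.
move=> eS bN ex wx; elim: b bN => [|b IH] bN; first by rewrite expr0 scale1r.
have -> : shift (size l) (ngR o b.+1) = shift (size l) (ngR o b) ++ shift (size l + b) [:: (0%N, Ng o)].
  by rewrite /= shift_cat !shift1E !addn0.
have e1 j : shift (size l) [:: (j, Ng o)] = shift (size l + j) [:: (0%N, Ng o)].
  by rewrite !shift1E addn0.
have rN : run (shift (size l) (ngR o b)) S = Some S.
  elim: b bN {IH} => [|b IH] bN; first by [].
  by rewrite [ngR _ _]/= shift_cat (run_cats _ (IH (ltnW bN))) e1 eS run_Ng_at //; lia.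
rewrite -(w_cat _ rN) mulrA (@ng_absr o S (l ++ nseq b o) (nseq (N - b - 2) o ++ r)) ?ex //.
- by rewrite zml IH ?scalerA -?exprS //; lia.
- by rewrite eS; sec.
by sizes.
Qed.

Lemma run_ngL o b : run (ngL o b) (nseq b.+1 o) = Some (nseq b.+1 o).
Proof.
elim: b => [|b IH] //; rewrite [ngL _ _]/= -cat1s slice1E.
rewrite (@run_cats _ _ _ (nseq b.+2 o)); last by have := @run_Ng_at o [::] b.+2 [::] b (ltnSn _); rewrite cats0.
by have := run_at_l [:: o] IH; rewrite (nseqSr o b.+1 [::]) cats0.
Qed.

Section TwistStep.
Variable o : bool.
Local Notation Sec := (Sec o).
Local Notation pd := (pd o).
Local Notation pu := (pu o).
Local Notation pp := (pp o).
Local Notation cp := (cp o).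
Local Notation cu := (cu o).
Local Notation XX := (XX o).

(** The last strand of each bundle is detached from the grid when they are capped
    together. *)
Lemma cap_grid A B : weq (nseq A.+1 o ++ nseq B.+1 (~~ o))
  (gridw o A.+1 B ++ [:: (B + A, Cap o)]%N)
  (shift A.+1 (ngL (~~ o) B) ++ [:: (A, Cap o)] ++ gridw o A B).
Proof.
have h1 : weq (nseq A.+1 o ++ nseq B.+1 (~~ o)) (gridw o A.+1 B) (shift A (chainR o B) ++ gridw o A B).
  by apply: (weq_sub0 (b := [:: ~~ o]) (gridw_regroup o A B)); lsteq.
apply: (weq_trans (weq_post _ h1)); rewrite -catA.
have rC : run (shift A (chainR o B)) (nseq A.+1 o ++ nseq B.+1 (~~ o)) = Some (nseq A o ++ nseq B (~~ o) ++ [:: o; ~~ o]).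
  by apply: (run_sub (l := nseq A o) (r := [:: ~~ o]) (run_chainR0 o B)); [lsteq|lsteq|sizes].
have h2 : weq (nseq A o ++ nseq B (~~ o) ++ [:: o; ~~ o]) (gridw o A B ++ [:: (B + A, Cap o)]%N)
    ([:: (A + B, Cap o)]%N ++ gridw o A B).
  have := weq_far_at' (a := [::]) (m := [::]) (b := [::]) (i := 0) (j := (B + A)%N) (k := (A + B)%N)
    (run_gridw0 o A B) (run_Cap o) (S := nseq A o ++ nseq B (~~ o) ++ [:: o; ~~ o]).
  by rewrite shift0 -!slice1E; apply; [lsteq|by []|sizes|sizes].
apply: (weq_trans (weq_pre rC h2)); rewrite catA.
have h3 := @weq_sub _ _ _ (nseq A.+1 o ++ nseq B.+1 (~~ o)) (nseq A o) [::] A (cap_chain o B).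
have {}h3 := h3 ltac:(lsteq) ltac:(sizes).
have := weq_post (gridw o A B) h3; rewrite !shift_cat shift_shift !shift1E /= addn1 addn0 -!catA; exact.
Qed.

Lemma cup_grid A B : weq (nseq B (~~ o) ++ nseq A o)
  ([:: (B + A, Cup o)]%N ++ gridw (~~ o) B A.+1)
  (gridw (~~ o) B A ++ [:: (A, Cup o)] ++ shift A.+1 (ngR (~~ o) B)).
Proof.
have rg := run_gridw0 (~~ o) B A; rewrite negbK in rg.
have h2 : weq (nseq B (~~ o) ++ nseq A o) ([:: (B + A, Cup o)]%N ++ gridw (~~ o) B A)
    (gridw (~~ o) B A ++ [:: (A + B, Cup o)]%N).
  apply: weq_sym.
  have := weq_far_at' (a := [::]) (m := [::]) (b := [::]) (i := 0) (j := (A + B)%N) (k := (B + A)%N)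
    rg (run_Cup o) (S := nseq B (~~ o) ++ nseq A o).
  by rewrite shift0 -!slice1E; apply; [lsteq|by []|sizes|sizes].
rewrite [gridw _ _ A.+1]/= catA; apply: (weq_trans (weq_post _ h2)); rewrite -catA.
apply: (weq_pre rg).
have h3 := @weq_sub _ _ _ (nseq A o ++ nseq B (~~ o)) (nseq A o) [::] A (cup_chain (~~ o) B).
have {h3} := h3 ltac:(lsteq) ltac:(sizes).
by rewrite negbK -[_ :: chainL _ _]cat1s -[_ :: shift _ _]cat1s !shift_cat shift_shift !shift1E addn1 /= addn0.
Qed.

Variables (l r : seq bool) (A B : nat).
Local Notation S := (Sec l r A.+1 B.+1).
Local Notation l' := (l ++ nseq B (~~ o)).
Local Notation M := (Sec l' r A.+1 1).
Local Notation G := (w S (shift (size l) (gridw o A.+1 B))).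
Local Notation G' := (w M (shift (size l) (gridw (~~ o) B A.+1))).

Lemma run_G : run (shift (size l) (gridw o A.+1 B)) S = Some M.
Proof.
apply: (run_sub (l := l) (r := ~~ o :: r) (run_gridw0 o A.+1 B)); rewrite /Sec; sec.
Qed.
Lemma run_G' : run (shift (size l) (gridw (~~ o) B A.+1)) M = Some S.
Proof.
have := run_gridw0 (~~ o) B A.+1; rewrite negbK => rg.
by apply: (run_sub (l := l) (r := ~~ o :: r) rg); rewrite /Sec; sec.
Qed.
Lemma run_X1 a : run (shift (size l') (chainL o a ++ chainR (~~ o) a)) (Sec l' r a 1) = Some (Sec l' r a 1).
Proof.
apply: (run_sub (s := nseq a o ++ [:: ~~ o]) (s' := nseq a o ++ [:: ~~ o]) (l := l') (r := r));
    [|rewrite /Sec; lsteq|rewrite /Sec; lsteq|by []].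
by rewrite (run_cats _ (run_chainL0 _ _)); have := run_chainR0 (~~ o) a; rewrite negbK.
Qed.

(** The outermost strand of the second bundle goes first around the whole first
    bundle. *)
Lemma XX_peel : XX l r A.+1 B.+1 = G' * XX l' r A.+1 1 * G.
Proof.
have h : weq (nseq A.+1 o ++ nseq B.+1 (~~ o)) (gridw o A.+1 B.+1 ++ gridw (~~ o) B.+1 A.+1)
   (gridw o A.+1 B ++ shift B (chainL o A.+1 ++ chainR (~~ o) A.+1) ++ gridw (~~ o) B A.+1).
  have := gridw_regroup (~~ o) B A.+1; rewrite negbK => h0.
  have := weq_pre (run_gridw0 o A.+1 B.+1) h0.
  by rewrite [gridw o _ B.+1]/= shift_cat -!catA.
rewrite XX1E -mulrA (w_cat _ run_G) w_cat; last first.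
  by rewrite (run_cats _ run_G); have := run_X1 A.+1.
rewrite /XX (weq_w (l := l) (r := r) h); [|by rewrite /Sec; sec|by []].
by congr (w _ _); rewrite !shift_cat !shift_shift size_cat size_nseq -!catA.
Qed.

Lemma G_pd : G * pd l r A.+1 B.+1 = pd l' r A.+1 1 * G.
Proof.
apply: (@clasp_intertwine _ _ _ _ _ _ 0 0) => i hi; rewrite !add0n /EE.
have h := slide_grid_l o B hi.
have := weq_w (S := S) (l := l) (r := ~~ o :: r) (i := size l) h (ltac:(rewrite /Sec; sec)) erefl.
rewrite !shift_cat !shift_shift (w_cat _ run_G) w_cat ?run_ed // => ->.
by rewrite size_cat size_nseq addnA.
Qed.

Lemma G'_pd : G' * pd l' r A.+1 1 = pd l r A.+1 B.+1 * G'.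
Proof.
apply: (@clasp_intertwine _ _ _ _ _ _ 0 0) => i hi; rewrite !add0n /EE.
have := slide_grid_r (~~ o) B hi; rewrite negbK => h.
have := weq_w (S := M) (l := l) (r := ~~ o :: r) (i := size l) h (ltac:(rewrite /Sec; sec)) erefl.
rewrite (shift_cat _ (shift _ _)) (shift_cat _ (gridw _ _ _)) (shift_shift _ (B + i)) (shift_shift _ i).
rewrite (w_cat _ run_G') w_cat; last by rewrite run_ed.
by rewrite size_cat size_nseq addnA.
Qed.

Local Notation NG := (w S (shift (size l + A.+1) (ngL (~~ o) B))).
Local Notation NG' := (w S (shift (size l + A.+1) (ngR (~~ o) B))).

Lemma cap_G : cp l' r A 0 * G * pp l r A.+1 B.+1 = (q6 (-2) : Kq) ^+ B *:
  (w (Sec l r A B) (shift (size l) (gridw o A B)) * cp l r A B * pp l r A.+1 B.+1).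
Proof.
have E1 : cp l' r A 0 * G = w (Sec l r A B) (shift (size l) (gridw o A B)) * cp l r A B * NG.
  have rN : run (shift (size l + A.+1) (ngL (~~ o) B)) S = Some S.
    by apply: (run_sub (l := l ++ nseq A.+1 o) (r := r) (run_ngL (~~ o) B)); rewrite /Sec; sec.
  rewrite -mulrA /cp (w_cat _ run_G) (w_cat _ rN) w_cat; last by rewrite (run_cats _ rN) run_cp.
  have := weq_w (S := S) (l := l) (r := r) (i := size l) (cap_grid A B) (ltac:(rewrite /Sec; sec)) erefl.
  by rewrite !shift_cat !shift_shift !shift1E !addn0 size_cat size_nseq -!catA addnA.
have := @ngL_abs (~~ o) S (l ++ nseq A.+1 o) r B.+1 B (pp l r A.+1 B.+1).
rewrite E1 -mulrA size_cat size_nseq => ->; rewrite ?zmr //.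
- by rewrite /Sec; lsteq.
- by move=> i hi; exact: eu_pp.
exact: w_pp.
Qed.

Lemma cup_G : pp l r A.+1 B.+1 * (G' * cu l' r A 0) = (q6 (-2) : Kq) ^+ B *:
  (pp l r A.+1 B.+1 * cu l r A B *
   w (Sec (l ++ nseq B (~~ o)) r A 0) (shift (size l) (gridw (~~ o) B A))).
Proof.
have E1 : G' * cu l' r A 0 = NG' * (cu l r A B *
   w (Sec (l ++ nseq B (~~ o)) r A 0) (shift (size l) (gridw (~~ o) B A))).
  have rg : run (shift (size l) (gridw (~~ o) B A)) (Sec l' r A 0) = Some (Sec l r A B).
    have := run_gridw0 (~~ o) B A; rewrite negbK => rg.
    by apply: (run_sub (l := l) (r := r) rg); rewrite /Sec; sec.
  rewrite /cu (w_cat _ (run_cu _ _ _ _ _)) (w_cat _ rg) w_cat; last by rewrite (run_cats _ rg) run_cu.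
  have := weq_w (S := Sec l' r A 0) (l := l) (r := r) (i := size l) (cup_grid A B) (ltac:(rewrite /Sec; sec)) erefl.
  rewrite (shift_cat _ [:: _]) (shift_cat _ (gridw _ _ _)) (shift_cat _ [:: _]) shift_shift !shift1E !addn0.
  by rewrite size_cat size_nseq -!catA addnA.
have := @ngR_abs (~~ o) S (l ++ nseq A.+1 o) r B.+1 B (pp l r A.+1 B.+1).
rewrite E1 mulrA size_cat size_nseq => ->; rewrite ?zml ?mulrA //.
- by rewrite /Sec; lsteq.
- by move=> i hi; exact: pp_eu.
exact: pp_w.
Qed.

(** The full twist of the detached strand has two terms: it passes through, or it
    turns back, and in that case the grids on both sides lose one strand of each
    bundle, up to a scalar. *)
Lemma XX_step : pp l r A.+1 B.+1 * XX l r A.+1 B.+1 * pp l r A.+1 B.+1 =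
  (q6 (2 * A.+1)%N : Kq) *: (pp l r A.+1 B.+1 * XX l (~~ o :: r) A.+1 B * pp l r A.+1 B.+1) +
  (x1 A.+1 * q6 (- (4 * B)%N%:Z)) *:
    (pp l r A.+1 B.+1 * cu l r A B * XX l r A B * cp l r A B * pp l r A.+1 B.+1).
Proof.
set p := pp l r A.+1 B.+1; set pM := pp l' r A.+1 1.
have pME : pM = pd l' r A.+1 1 * w M [::] by rewrite /pM ppE /pu clasp_at1 mulr1.
have h1 : p * G' * pM = p * G'.
  by rewrite -mulrA pME pd_w (mulrA G') w1r G'_pd mulrA pp_pd.
have h2 : pM * (G * p) = G * p.
  by rewrite pME -mulrA (mulrA (w M _)) w1l ?run_G // mulrA -G_pd -mulrA pd_pp.
have Cpp x : p * G' * x * G * p = p * G' * (pM * x * pM) * G * p.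
  by rewrite !mulrA h1 -!mulrA h2.
have -> : p * XX l r A.+1 B.+1 * p = p * G' * XX l' r A.+1 1 * G * p by rewrite XX_peel !mulrA.
rewrite Cpp tw1 -/pM mulrDr !mulrDl !(zmr, zml).
have -> : p * G' * pM * G * p = p * G' * 1 * G * p by rewrite [RHS]Cpp mulr1 pp_idem.
have -> : p * G' * (pM * cu l' r A 0 * cp l' r A 0 * pM) * G * p =
  (p * (G' * cu l' r A 0)) * ((cp l' r A 0 * G) * p).
  by rewrite -[pM * _ * _]mulrA -Cpp !mulrA.
rewrite cap_G cup_G -/p !(zml, zmr) mulr1 !scalerA -[x1 _ * _ * _]mulrA -exprD.
congr (_ *: _ + _ *: _).
- rewrite -(mulrA p G') (w_cat _ run_G) /XX Sec_r shift_cat //.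
- congr (_ * _); elim: (B) => [|b IH]; first by rewrite muln0 oppr0.
  rewrite addnS addSn !exprS IH -!q6D; congr q6; lia.
have rg : run (shift (size l) (gridw o A B)) (Sec l r A B) = Some (Sec l' r A 0).
  by apply: (run_sub (l := l) (r := r) (run_gridw0 o A B)); rewrite /Sec; sec.
by rewrite -!mulrA; do 2!congr (_ * _); rewrite !mulrA (w_cat _ rg) -shift_cat.
Qed.

End TwistStep.

Lemma qn_step (F : fieldType) (v : F) n k : generic_q v ->
  qn v k.+1 * qn v n.+1 = qn v k * qn v n + qn v (n + k).+1.
Proof.
move=> vg; rewrite !qnE !exprS exprD.
have d0 := qden_neq0 vg; have v0 := v_neq0 vg.
have := vX_neq0 vg n; have := vX_neq0 vg k; move: (v ^+ n) (v ^+ k) => A B hB hA.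
have d1 : v ^+ 2 - 1 != 0.
  by rewrite -(mulfV v0) -[v ^+ 2]/(v * v) -mulrBr mulf_neq0.
by field; rewrite ?d1 ?v0 ?hA ?hB.
Qed.

Lemma dcoef_alg (F : fieldType) (x y z p1 p2 p3 p4 : F) : p1 != 0 -> p2 != 0 -> p3 != 0 -> p4 != 0 ->
  x + y = z -> x / (p3 * p4) + p1 * p2 / (p3 * p4) * (y / (p1 * p2)) = z / (p3 * p4).
Proof. by move=> h1 h2 h3 h4 <-; field; rewrite h1 h2 h3 h4. Qed.
Lemma dcoef_alg' (F : fieldType) (y p1 p2 p3 p4 : F) : p1 != 0 -> p2 != 0 -> p3 != 0 -> p4 != 0 ->
  p1 * p2 / (p3 * p4) * (y / (p1 * p2)) = y / (p3 * p4).
Proof. by move=> h1 h2 h3 h4; field; rewrite h1 h2 h3 h4. Qed.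

Section TwistSum.
Variable o : bool.
Local Notation Sec := (Sec o).
Local Notation pp := (pp o).
Local Notation cp := (cp o).
Local Notation cu := (cu o).
Local Notation XX := (XX o).
Local Notation CU := (CU o).
Local Notation CA := (CA o).
Local Notation Dm := (Dm o).

Lemma gridw0 u a : gridw u 0 a = [::]. Proof. by elim: a => //= a ->. Qed.
Lemma gridwx0 u a : gridw u a 0 = [::]. Proof. by []. Qed.

Lemma Dm0 l r A B : Dm l r A B 0 = pp l r A B.
Proof. by rewrite /Dm !subn0 CU0 CA0 -!mulrA !w_pp pp_idem. Qed.

Lemma sum_delta n (f : nat -> 'R) : \sum_(m < n.+1) ((m == 0%N :> nat)%:R : Kq) *: f m = f 0%N.
Proof.
rewrite big_ord_recl scale1r big1 ?addr0 // => i _; exact: scale0r.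
Qed.

Lemma cu_CU l r A B m : (m <= A)%N -> (m <= B)%N ->
  cu l r A B * CU l r (A - m) (B - m) m = CU l r (A.+1 - m.+1) (B.+1 - m.+1) m.+1.
Proof. by move=> hA hB; rewrite !subSS CUS !subnK. Qed.
Lemma CA_cp l r A B m : (m <= A)%N -> (m <= B)%N ->
  CA l r (A - m) (B - m) m * cp l r A B = CA l r (A.+1 - m.+1) (B.+1 - m.+1) m.+1.
Proof. by move=> hA hB; rewrite !subSS CAS !subnK. Qed.

Lemma XX_expand l r A B : pp l r A B * XX l r A B * pp l r A B =
  \sum_(m < B.+1) xc A B m *: Dm l r A B m.
Proof.
elim: B A l r => [|B IH] A l r.
  rewrite big_ord1 xcx0 scale1r Dm0 /XX gridw0 gridwx0 /= -mulrA; rewrite w_pp; exact: pp_idem.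
case: A => [|A].
  under eq_bigr do rewrite xc0.
  by rewrite sum_delta Dm0 /XX gridw0 gridwx0 /= -mulrA w_pp pp_idem.
rewrite XX_step; set p := pp l r A.+1 B.+1.
have -> : p * XX l (~~ o :: r) A.+1 B * p = \sum_(m < B.+1) xc A.+1 B m *: Dm l r A.+1 B.+1 m.
  transitivity (p * (pp l (~~ o :: r) A.+1 B * XX l (~~ o :: r) A.+1 B * pp l (~~ o :: r) A.+1 B) * p).
    by rewrite !mulrA pp_pp_r -!mulrA pp_r_pp.
  rewrite IH mulr_sumr mulr_suml; apply: eq_bigr => m _; rewrite zmr zml; congr (_ *: _).
  rewrite /Dm (subSn (_ : m <= B)%N); last by rewrite -ltnS.
  by rewrite !mulrA pp_pp_r -!mulrA pp_r_pp CU_r CA_r.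
have -> : p * cu l r A B * XX l r A B * cp l r A B * p =
    \sum_(m < B.+1) xc A B m *: Dm l r A.+1 B.+1 m.+1.
  transitivity (p * cu l r A B * (pp l r A B * XX l r A B * pp l r A B) * (cp l r A B * p)).
    by rewrite !mulrA pp_cu -!mulrA [pp l r A B * (cp _ _ _ _ * _)]mulrA cp_pp.
  rewrite IH mulr_sumr mulr_suml; apply: eq_bigr => m _; rewrite zmr zml.
  have [mA|mA] := leqP m A; last by rewrite xc_gt ?mA // !scale0r.
  have mB : (m <= B)%N by rewrite -ltnS.
  congr (_ *: _); rewrite /Dm -/p -cu_CU // -CA_cp // !mulrA pp_cu -!mulrA.
  by rewrite [pp l r A B * (cp _ _ _ _ * _)]mulrA cp_pp.
rewrite !scaler_sumr [RHS]big_ord_recl.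
have -> : \sum_(i < B.+1) (q6 (2 * A.+1)%N : Kq) *: (xc A.+1 B i *: Dm l r A.+1 B.+1 i) =
  (q6 (2 * A.+1)%N * xc A.+1 B 0) *: Dm l r A.+1 B.+1 0 +
  \sum_(i < B.+1) (q6 (2 * A.+1)%N * xc A.+1 B i.+1) *: Dm l r A.+1 B.+1 i.+1.
  transitivity (\sum_(i < B.+2) (q6 (2 * A.+1)%N * xc A.+1 B i) *: Dm l r A.+1 B.+1 i).
    rewrite [RHS]big_ord_recr /= [xc A.+1 B B.+1]xc_gt ?ltnSn ?orbT // mulr0 scale0r addr0.
    by apply: eq_bigr => i _; rewrite scalerA.
  by rewrite big_ord_recl.
rewrite -addrA -big_split; congr (_ + _); first by rewrite [xc _ _ ord0]xcSS addr0.
apply: eq_bigr => i _; rewrite lift0 [xc A.+1 B.+1 _]xcSS scalerDl; congr (_ + _).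
exact: scalerA.
Qed.

Lemma run_XX l r a b : run (shift (size l) (gridw o a b ++ gridw (~~ o) b a)) (Sec l r a b) = Some (Sec l r a b).
Proof.
apply: (run_sub (s := nseq a o ++ nseq b (~~ o)) (s' := nseq a o ++ nseq b (~~ o)) (l := l) (r := r));
  [|by rewrite /Sec; sec|by rewrite /Sec; sec|by []].
by rewrite (run_cats _ (run_gridw0 _ _ _)); have := run_gridw0 (~~ o) b a; rewrite negbK.
Qed.

Lemma XX_ed l r a b i : (i.+1 < a)%N ->
  XX l r a b * EE o (Sec l r a b) (size l) i = EE o (Sec l r a b) (size l) i * XX l r a b.
Proof.
move=> h; rewrite /XX /EE (w_cat _ (run_XX l r a b)) w_cat; last by rewrite run_ed.
have h1 := weq_post (gridw (~~ o) b a) (slide_grid_l o b h).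
have h2 := slide_grid_r (~~ o) b h; rewrite negbK in h2.
have h3 := weq_pre (run_gridw0 o a b) h2; rewrite catA in h3.
have := weq_w (S := Sec l r a b) (l := l) (r := r) (i := size l) (weq_trans h1 h3) (ltac:(rewrite /Sec; sec)) erefl.
by rewrite !shift_cat !shift_shift -!catA.
Qed.

Lemma XX_eu l r a b i : (i.+1 < b)%N ->
  XX l r a b * EE (~~ o) (Sec l r a b) (size l + a) i = EE (~~ o) (Sec l r a b) (size l + a) i * XX l r a b.
Proof.
move=> h; rewrite /XX /EE (w_cat _ (run_XX l r a b)) w_cat; last by rewrite run_eu.
have h1 := weq_post (gridw (~~ o) b a) (slide_grid_r o a h).
have h2 := slide_grid_l (~~ o) a h; rewrite negbK in h2.
have h3 := weq_pre (run_gridw0 o a b) h2; rewrite catA in h3.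
have := weq_w (S := Sec l r a b) (l := l) (r := r) (i := size l) (weq_trans h1 h3) (ltac:(rewrite /Sec; sec)) erefl.
by rewrite !shift_cat !shift_shift -!catA addnA.
Qed.

(** The generators slide through the grids. *)
Lemma XX_pp l r a b : XX l r a b * pp l r a b = pp l r a b * XX l r a b.
Proof.
have h1 : XX l r a b * pd o l r a b = pd o l r a b * XX l r a b.
  by apply: (@clasp_intertwine _ _ _ _ _ _ 0 0) => i; exact: XX_ed.
have h2 : XX l r a b * pu o l r a b = pu o l r a b * XX l r a b.
  by apply: (@clasp_intertwine _ _ _ _ _ _ 0 0) => i; exact: XX_eu.
rewrite ppE !mulrA h1 -!mulrA (mulrA (XX _ _ _ _)) h2 -!mulrA; do 2!congr (_ * _).
by rewrite /XX w1r w1l // run_XX.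
Qed.

Lemma XX_pp_expand l r A B : XX l r A B * pp l r A B = \sum_(m < B.+1) xc A B m *: Dm l r A B m.
Proof. by rewrite -XX_expand -mulrA XX_pp mulrA pp_idem. Qed.

Lemma CUl l r a b m : CU l r a b m.+1 = CU l r a.+1 b.+1 m * cu l r a b.
Proof.
elim: m => [|m IH]; first by rewrite CUS !CU0 !addn0 cu_w /cu w1l // run_cu.
by rewrite CUS IH mulrA CUS !addnS !addSn.
Qed.
Lemma CAl l r a b m : CA l r a b m.+1 = cp l r a b * CA l r a.+1 b.+1 m.
Proof.
elim: m => [|m IH]; first by rewrite CAS !CA0 !addn0 w_cp /cp w1r.
by rewrite CAS IH -mulrA CAS !addnS !addSn.
Qed.

Lemma CA_pp l r a b m : pp l r a b * CA l r a b m * pp l r (a + m) (b + m) = CA l r a b m * pp l r (a + m) (b + m).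
Proof.
elim: m => [|m IH]; first by rewrite !addn0 CA0 pp_w pp_idem w_pp.
rewrite CAS !addnS -!mulrA -[cp _ _ _ _ * _]cp_pp !mulrA; do 2!congr (_ * _).
by rewrite IH.
Qed.

(** The two coefficients in the product of a turnback with m nested turnbacks. *)
Definition dstay a b m : Kq := qn v0 m * qn v0 (a + b + m + 2) / (qn v0 (a + m) * qn v0 (b + m)).
Definition dup a b m : Kq := qn v0 a * qn v0 b / (qn v0 (a + m) * qn v0 (b + m)).

Lemma CU1 l r a b : CU l r a b 1 = cu l r a b.
Proof. by rewrite CUS CU0 !addn0 cu_w. Qed.

Lemma uuE' l r a b : (0 < a)%N -> (0 < b)%N ->
  uu o l r a b = cu l r a.-1 b.-1 * cp l r a.-1 b.-1.
Proof. by case: a b => [|a] [|b] // _ _; exact: uuE. Qed.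

Lemma dup0 a b m : (a == 0%N) || (b == 0%N) -> dup a b m = 0.
Proof. by case/orP=> /eqP ->; rewrite /dup qn0 ?mulr0 !mul0r. Qed.

(** The loop between clasps either closes up or passes the cap through one level of
    the nested cups. *)
Lemma capCU l r a b m :
  cp l r (a + m) (b + m) * pp l r (a + m).+1 (b + m).+1 * CU l r a b m.+1 * pp l r a b =
  dstay a b m.+1 *: (pp l r (a + m) (b + m) * CU l r a b m * pp l r a b) +
  dup a b m.+1 *: (pp l r (a + m) (b + m) * CU l r a.-1 b.-1 m.+1 * cp l r a.-1 b.-1 * pp l r a b).
Proof.
have L k : cp l r (a + k) (b + k) * pp l r (a + k).+1 (b + k).+1 * cu l r (a + k) (b + k) =
  (qn v0 (a + k + (b + k) + 3) / (qn v0 (a + k).+1 * qn v0 (b + k).+1)) *: pp l r (a + k) (b + k) +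
  (qn v0 (a + k) * qn v0 (b + k) / (qn v0 (a + k).+1 * qn v0 (b + k).+1)) *:
   (pp l r (a + k) (b + k) * cu l r (a + k).-1 (b + k).-1 * cp l r (a + k).-1 (b + k).-1 * pp l r (a + k) (b + k)).
  rewrite cap_pp; congr (_ + _).
  have [->|a0] := posnP (a + k)%N; first by rewrite qn0 !mul0r !scale0r.
  have [->|b0] := posnP (b + k)%N; first by rewrite qn0 mulr0 !mul0r !scale0r.
  by rewrite uuE' // !mulrA.
elim: m => [|m IH].
  have := L 0%N; rewrite !addn0 !CU1 /dstay /dup (qn1 v0_generic) mul1r => ->.
  rewrite CU0 pp_w mulrDl !zml pp_idem -!mulrA pp_idem !addn1.
  by rewrite (_ : (a + b).+1 + 2 = a + b + 3)%N //; lia.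
rewrite (CUS _ _ _ _ _ m.+1) !mulrA L mulrDl mulrDl !zml.
have e1 : (a + m.+1).-1 = (a + m)%N by lia.
have e2 : (b + m.+1).-1 = (b + m)%N by lia.
rewrite e1 e2 -[_ * pp l r (a + m.+1) (b + m.+1) * CU _ _ _ _ _ * _]mulrA.
have E1 : pp l r (a + m.+1) (b + m.+1) * cu l r (a + m) (b + m) * cp l r (a + m) (b + m) *
   pp l r (a + m.+1) (b + m.+1) * (CU l r a b m.+1 * pp l r a b) =
   pp l r (a + m.+1) (b + m.+1) * cu l r (a + m) (b + m) *
   (cp l r (a + m) (b + m) * pp l r (a + m).+1 (b + m).+1 * CU l r a b m.+1 * pp l r a b).
  by rewrite !addnS !mulrA.
rewrite E1 IH mulrDr !zmr !mulrA !addnS pp_cu -!addnS.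
rewrite -(mulrA (pp l r (a + m.+1) (b + m.+1)) (cu l r (a + m) (b + m)) (CU l r a b m)).
rewrite -CUS.
rewrite -(mulrA (pp l r (a + m.+1) (b + m.+1)) (cu l r (a + m) (b + m)) (CU l r a.-1 b.-1 m.+1)).
have T2 : dup a b m.+1 *: (pp l r (a + m.+1) (b + m.+1) * (cu l r (a + m) (b + m) * CU l r a.-1 b.-1 m.+1) *
    cp l r a.-1 b.-1 * pp l r a b) =
   dup a b m.+1 *: (pp l r (a + m.+1) (b + m.+1) * CU l r a.-1 b.-1 m.+2 * cp l r a.-1 b.-1 * pp l r a b).
  have [ab0|] := boolP ((a == 0%N) || (b == 0%N)); first by rewrite dup0 // !scale0r.
  rewrite negb_or -!lt0n => /andP[a0 b0]; congr (_ *: (_ * _ * _ * _)).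
  rewrite (CUS _ _ _ _ _ m.+1).
  have -> : (a.-1 + m.+1)%N = (a + m)%N by lia.
  by have -> : (b.-1 + m.+1)%N = (b + m)%N by lia.
rewrite T2.
rewrite scalerDr !scalerA addrA -scalerDl.
have n1 := v0_generic (ltn0Sn (a + m)); have n2 := v0_generic (ltn0Sn (b + m)).
have n3 := v0_generic (ltn0Sn (a + m.+1)); have n4 := v0_generic (ltn0Sn (b + m.+1)).
rewrite !addnS in n3 n4 *.
congr (_ *: _ + _ *: _).
  rewrite /dstay !addnS; apply: (dcoef_alg n1 n2 n3 n4).
  have -> : (((a + m).+1 + (b + m)).+1 + 0).+3 = (a + b + m + 3 + m.+1).+1 by lia.
  have -> : ((a + b + m).+1 + 0).+2 = (a + b + m + 3)%N by lia.
  by rewrite (qn_step _ _ v0_generic); exact: addrC.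
by rewrite /dup !addnS (dcoef_alg' _ n1 n2 n3 n4).
Qed.

(** A turnback on top of m nested ones closes one loop. *)
Lemma Dm_mul l r A B m : (0 < m)%N -> (m <= A)%N -> (m <= B)%N ->
  Dm l r A B 1 * Dm l r A B m = dstay (A - m) (B - m) m *: Dm l r A B m
   + dup (A - m) (B - m) m *: Dm l r A B m.+1.
Proof.
case: m => // m _ hA hB; set a := (A - m.+1)%N; set b := (B - m.+1)%N.
have eA : A = (a + m).+1 by rewrite /a; lia.
have eB : B = (b + m).+1 by rewrite /b; lia.
have E : Dm l r A B 1 * Dm l r A B m.+1 = pp l r A B * cu l r (a + m) (b + m) *
   (cp l r (a + m) (b + m) * pp l r (a + m).+1 (b + m).+1 * CU l r a b m.+1 * pp l r a b) *
   (CA l r a b m.+1 * pp l r A B).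
  have e1 : (A - 1)%N = (a + m)%N by lia.
  have e2 : (B - 1)%N = (b + m)%N by lia.
  have -> : Dm l r A B 1 = pp l r A B * cu l r (a + m) (b + m) * cp l r (a + m) (b + m) * pp l r A B.
    by rewrite /Dm e1 e2 CU1 (CAS _ _ _ _ _ 0) CA0 !addn0 w_cp.
  have Cp : pp l r a b * (CA l r a b m.+1 * pp l r A B) = CA l r a b m.+1 * pp l r A B.
    by rewrite mulrA eA eB -!addnS CA_pp.
  rewrite /Dm -/a -/b -eA -eB -!mulrA Cp; do 3!congr (_ * _); by rewrite [LHS]mulrA pp_idem.
have Cp0 : pp l r a b * (CA l r a b m.+1 * pp l r A B) = CA l r a b m.+1 * pp l r A B.
  by rewrite mulrA eA eB -!addnS CA_pp.
rewrite E.
have DmE : Dm l r A B m.+1 = pp l r A B * cu l r (a + m) (b + m) *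
    (pp l r (a + m) (b + m) * CU l r a b m * pp l r a b) * (CA l r a b m.+1 * pp l r A B).
  rewrite /Dm -/a -/b CUS eA eB !mulrA pp_cu -!addnS -!mulrA; do 3!congr (_ * _).
  by rewrite mulrA CA_pp.
rewrite capCU // !(mulrDl, mulrDr) !(zml, zmr) DmE; congr (_ + _).
have [ab0|] := boolP ((a == 0%N) || (b == 0%N)); first by rewrite dup0 // !scale0r.
rewrite negb_or -!lt0n => /andP[a0 b0]; congr (_ *: _).
have e1 : (A - m.+2)%N = a.-1 by rewrite /a; lia.
have e2 : (B - m.+2)%N = b.-1 by rewrite /b; lia.
rewrite /Dm e1 e2 (CUS _ _ _ _ _ m.+1) (CAl _ _ _ _ m.+1) !prednK //.
have -> : (a.-1 + m.+1)%N = (a + m)%N by lia.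
have -> : (b.-1 + m.+1)%N = (b + m)%N by lia.
rewrite -!mulrA Cp0 !mulrA eA eB pp_cu -!mulrA; do 2!congr (_ * _).
Qed.
End TwistSum.

(** * Powers of the full twist *)

Definition Qn (i : nat) : Kq := q6 (6 * i)%N.
(** The q-Pochhammer symbol (q; q)_a. *)
Definition qf (a : nat) : Kq := \prod_(i < a) (1 - Qn i.+1).
Lemma qf0 : qf 0 = 1. Proof. exact: big_ord0. Qed.
Lemma qfS a : qf a.+1 = qf a * (1 - Qn a.+1). Proof. exact: big_ord_recr. Qed.
Lemma q60 : q6 0 = 1. Proof. by []. Qed.
Lemma QnD i j : Qn (i + j) = Qn i * Qn j. Proof. by rewrite /Qn mulnDr -q6D. Qed.
Lemma Qn_neq1 i : (0 < i)%N -> 1 - Qn i != 0.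
Proof.
by move=> i0; rewrite subr_eq0 eq_sym /Qn q6_expn; apply: q6_root; rewrite muln_gt0.
Qed.
Lemma qf_neq0 a : qf a != 0.
Proof. by apply/prodf_neq0 => i _; exact: Qn_neq1. Qed.

Definition xe (A B m : nat) : int := (2 * A * B + 6 * m ^ 2)%N%:Z - (6 * m * (A + B) + 6 * m)%N%:Z.

Lemma xc_alg (F : fieldType) (E Y Z a b c d f g : F) :
  a != 0 -> c != 0 -> d != 0 -> f != 0 -> 1 - Z != 0 -> 1 - Y != 0 -> g != 0 ->
  E * Y * (a * g * b) / (c * d * (f * (1 - Y))) + E * g * (a * b) / (c * (d * (1 - Z)) * f) =
  E * (a * g * (b * (1 - Y * Z))) / (c * (d * (1 - Z)) * (f * (1 - Y))).
Proof. by move=> *; field; do !(apply/andP; split). Qed.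

Lemma xc_alg0 (F : fieldType) (E a b c y f g : F) : c != 0 -> f != 0 -> y != 0 ->
  E * g * (a * b) / (c * 1 * f) = E * (a * g * (b * y)) / (c * 1 * (f * y)).
Proof. by move=> *; field; do !(apply/andP; split). Qed.

(** The recursion of the coefficients is solved by a q-binomial form. *)
Lemma xcE A B m : (m <= A)%N -> (m <= B)%N ->
  xc A B m = q6 (xe A B m) * (qf A * qf B) / (qf (A - m) * qf (B - m) * qf m).
Proof.
elim: B A m => [|B IH] A m mA mB.
  rewrite (_ : m = 0%N); last by lia.
  rewrite xcx0 !subn0 (_ : xe A 0 0 = 0); last by rewrite /xe; lia.
  by rewrite q60 qf0 !mulr1 mul1r divff ?qf_neq0.
case: A mA => [|A] mA.
  rewrite (_ : m = 0%N); last by lia.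
  rewrite xc0 !subn0 (_ : xe 0 B.+1 0 = 0); last by rewrite /xe; lia.
  by rewrite q60 qf0 !mul1r !mulr1 divff ?qf_neq0.
have e1 : q6 (2 * A.+1)%N * q6 (xe A.+1 B m) = q6 (xe A.+1 B.+1 m) * Qn m.
  by rewrite -!q6D; congr q6; rewrite /xe; nia.
case: m mA mB e1 => [|m] mA mB e1; rewrite xcSS.
  rewrite addr0 IH // !subn0 !qf0 !mulr1 !mulfK ?mulf_neq0 ?qf_neq0 // e1.
  by rewrite /Qn muln0 mulr1.
have e2 : x1 A.+1 * q6 (- (4 * B)%N%:Z) * q6 (xe A B m) = q6 (xe A.+1 B.+1 m.+1) * (1 - Qn A.+1).
  rewrite /x1 -/(Qn A.+1) -!mulrA [(1 - _) * _]mulrC !mulrA -!q6D; congr (q6 _ * _).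
  by rewrite /xe; nia.
have e3 : x1 A.+1 * q6 (- (4 * B)%N%:Z) * xc A B m =
  q6 (xe A.+1 B.+1 m.+1) * (1 - Qn A.+1) * (qf A * qf B) / (qf (A - m) * qf (B - m) * qf m).
  by rewrite IH // mulrA mulrA e2.
rewrite !subSS e3.
have [mB'|mB'] := leqP m.+1 B; last first.
  rewrite (_ : m = B) in e1 e2 *; last by lia.
  rewrite xc_gt ?ltnSn ?orbT // mulr0 add0r subnn qf0 !qfS.
  by apply: xc_alg0; rewrite ?qf_neq0 ?Qn_neq1.
rewrite IH // mulrA mulrA e1 (_ : B - m = (B - m.+1).+1)%N; last by lia.
rewrite subSS !qfS -(_ : Qn m.+1 * Qn (B - m.+1).+1 = Qn B.+1); last by rewrite -QnD; congr Qn; lia.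
by apply: xc_alg; rewrite ?qf_neq0 ?Qn_neq1.
Qed.

Lemma qn_sub_id (F : fieldType) (v : F) k i j : generic_q v ->
  qn v (i + j) * qn v (k + k + i + j + 2) - qn v j * qn v (k + k + i + i + j + 2) =
  qn v i * qn v (k + k + i + 2).
Proof.
move=> vg; rewrite !qnE !exprD.
have d0 := qden_neq0 vg; have v0 := v_neq0 vg.
have := vX_neq0 vg i; have := vX_neq0 vg j; have := vX_neq0 vg k.
move: (v ^+ i) (v ^+ j) (v ^+ k) => A B C hC hB hA.
have d1 : v ^+ 2 - 1 != 0.
  by rewrite -(mulfV v0) -[v ^+ 2]/(v * v) -mulrBr mulf_neq0.
by field; rewrite ?d1 ?v0 ?hA ?hB ?hC.
Qed.

(** The matrix of the full twist in the basis of nested turnbacks, indexed by the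
    numbers l and k of strands that go through. *)
Definition tm (n l k : nat) : Kq :=
  q6 ((6 * (l + k ^ 2 + k))%N%:Z - (4 * n ^ 2 + 12 * n)%N%:Z) * qf l ^+ 2 / (qf k ^+ 2 * qf (l - k)).

Lemma tm_base n m : (m <= n)%N -> xc n n m = tm n n (n - m).
Proof.
move=> mn; rewrite xcE // /tm subKn // !expr2; congr (q6 _ * _ / _); rewrite /xe; nia.
Qed.

Lemma negdiv (F : fieldType) (a b c x y : F) : b != 0 -> y != 0 -> a = c * b ->
  - a * x / (- b * y) = c * x / y.
Proof.
move=> b0 y0 ->; rewrite !mulNr invrN mulrN opprK invfM -(mulrA c b x) -!mulrA; congr (c * _).
by rewrite [b * _]mulrC -!mulrA [y^-1 * b]mulrC [b^-1 * _]mulrA mulVf // mul1r.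
Qed.
Lemma mulfrac2 (F : fieldType) (p1 p2 s T d y : F) : d != 0 -> p1 * p2 = y ->
  p1 * s / d * (p2 * T / d) = s * T * y / d ^+ 2.
Proof. by move=> d0 <-; field. Qed.

Lemma qn_Qn i : qn v0 i.+1 = q6 (- (3 * i)%N%:Z) * (1 - Qn i.+1) / (1 - Qn 1).
Proof.
rewrite -qintE /qint; have d1 : q6 3 - q6 (-3) = - q6 (-3) * (1 - Qn 1).
  by rewrite mulrBr mulr1 mulNr opprK -q6D [RHS]addrC.
have -> : q6 (3 * i.+1)%N - q6 (- (3 * i.+1)%N%:Z) = - q6 (- (3 * i.+1)%N%:Z) * (1 - Qn i.+1).
  by rewrite mulrBr mulr1 mulNr opprK -q6D [RHS]addrC; congr (q6 _ - _); lia.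
rewrite d1; apply: negdiv; first by apply: expfz_neq0; rewrite -[_ 'X]expr1z; exact: Model.q6_1_neq0.
  exact: Qn_neq1.
by rewrite -q6D; congr q6; lia.
Qed.

Lemma tm_alg (F : fieldType) (P e1 d nn L K E y T l1 k1 s a b c st X Y Z : F) :
  nn != 0 -> d != 0 -> l1 != 0 -> k1 != 0 -> s != 0 -> b != 0 -> c != 0 ->
  L ^+ 2 * e1 = y * (l1 / d) ^+ 2 -> st = s * T * y / d ^+ 2 -> K ^+ 2 * E = (1 - T) * y * (k1 / d) ^+ 2 ->
  X = P * e1 * (a ^+ 2 / (b ^+ 2 * c)) -> Y = P * ((a * l1) ^+ 2 / (b ^+ 2 * (c * s))) ->
  Z = P * E * ((a * l1) ^+ 2 / ((b * k1) ^+ 2 * c)) ->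
  L * L / (nn * nn) * X = Y * (st / (nn * nn)) + Z * (K * K / (nn * nn)).
Proof.
move=> n0 d0 l0 k0 s0 b0 c0 hL hs hK -> -> ->.
have -> : P * E * ((a * l1) ^+ 2 / ((b * k1) ^+ 2 * c)) * (K * K / (nn * nn)) =
  K ^+ 2 * E * (P * ((a * l1) ^+ 2 / ((b * k1) ^+ 2 * c)) / (nn * nn)) by field; do !(apply/andP; split).
have -> : L * L / (nn * nn) * (P * e1 * (a ^+ 2 / (b ^+ 2 * c))) =
  L ^+ 2 * e1 * (P * (a ^+ 2 / (b ^+ 2 * c)) / (nn * nn)) by field; do !(apply/andP; split).
by rewrite hK hs hL; field; do !(apply/andP; split).
Qed.

Lemma qn_sub n k l : (k <= l)%N -> (l <= n)%N ->
  qn v0 (n - k) * qn v0 (k + k + (n - k) + 2) - qn v0 (n - l) * qn v0 (l + l + (n - l) + 2) =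
  qn v0 (l - k) * qn v0 (l + k + 2).
Proof.
move=> kl ln; have [i ei] : exists i, (l = k + i)%N by exists (l - k)%N; lia.
have [j ej] : exists j, (n = l + j)%N by exists (n - l)%N; lia.
rewrite ej ei.
have -> : (k + i + j - k = i + j)%N by lia.
have -> : (k + k + (i + j) + 2 = k + k + i + j + 2)%N by lia.
have -> : (k + i + j - (k + i) = j)%N by lia.
have -> : (k + i + (k + i) + j + 2 = k + k + i + i + j + 2)%N by lia.
have -> : (k + i - k = i)%N by lia.
have -> : (k + i + k + 2 = k + k + i + 2)%N by lia.
exact: (qn_sub_id k i j v0_generic).
Qed.

(** The full twist commutes with one turnback, which multiplies by a known
    two-term rule; comparing coefficients, the matrix is determined by its last
    row. *)
Lemma tm_step n l k : (k <= l)%N -> (l < n)%N ->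
  dup l.+1 l.+1 (n - l.+1) * tm n l k =
  tm n l.+1 k * (dstay k k (n - k) - dstay l.+1 l.+1 (n - l.+1)) +
  tm n l.+1 k.+1 * dup k.+1 k.+1 (n - k.+1).
Proof.
move=> kl ln; rewrite /dup /dstay !subnKC; try lia.
rewrite -mulrBl qn_sub ?(leqW kl) //.
have Qs i : q6 (6 * i)%N = Qn i by [].
apply: (@tm_alg _ (q6 ((6 * (l.+1 + k ^ 2 + k))%N%:Z - (4 * n ^ 2 + 12 * n)%N%:Z)) (q6 (- 6)) (1 - Qn 1) _ _ _
  (q6 (6 * (2 * k + 2))%N) (q6 (- (6 * l.+1)%N%:Z)) (1 - Qn (l + k + 3)) (1 - Qn l.+1) (1 - Qn k.+1)
  (1 - Qn (l - k).+1) (qf l) (qf k) (qf (l - k))).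
- by case: (n) ln => // m _; exact: v0_generic.
- exact: Qn_neq1.
- exact: Qn_neq1.
- exact: Qn_neq1.
- exact: Qn_neq1.
- exact: qf_neq0.
- exact: qf_neq0.
- rewrite qn_Qn -mulrA exprMn mulrAC; congr (_ * _); rewrite expr2 -!q6D; congr q6; lia.
- rewrite subSn // (_ : l.+1 + k + 2 = (l + k + 2).+1)%N; last by lia.
  rewrite !qn_Qn (_ : (l + k + 2).+1 = l + k + 3)%N; last by lia.
  apply: mulfrac2; first exact: Qn_neq1.
  by rewrite -q6D; congr q6; lia.
- rewrite qn_Qn -mulrA exprMn mulrAC; congr (_ * _); rewrite expr2 -!q6D subKr /Qn -q6D; congr q6; lia.
- rewrite /tm -q6D -mulrA; congr (q6 _ * _); lia.
- by rewrite /tm -mulrA subSn // !qfS.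
rewrite /tm -q6D -mulrA subSS !qfS; congr (q6 _ * _); nia.
Qed.

Section TwistPowers.
Variables (o : bool) (l r : seq bool) (n : nat).
Local Notation p := (pp o l r n n).
Local Notation X := (XX o l r n n).
Local Notation Dn := (Dm o l r n n).
Local Notation DD k := (Dm o l r n n (n - k)).

Lemma Dn_p k : Dn k * p = Dn k. Proof. by rewrite /Dm -!mulrA pp_idem. Qed.
Lemma p_Dn k : p * Dn k = Dn k. Proof. by rewrite /Dm !mulrA pp_idem. Qed.

Lemma dup_neq0 k : (0 < k)%N -> dup k k (n - k) != 0.
Proof. by move=> k0; rewrite /dup !mulf_neq0 ?invr_eq0 ?mulf_neq0 ?v0_generic //; lia. Qed.

Lemma DD_mul k : (0 < n)%N -> (k <= n)%N -> Dn 1 * DD k =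
  dstay k k (n - k) *: DD k + dup k k (n - k) *: DD k.-1.
Proof.
move=> n0 kn; have [k0|k0] := posnP k.
  by rewrite k0 (dup0 (a := 0)) // scale0r addr0 subn0 Dm_mul // subnn dup0 // scale0r addr0.
have [kn'|kn'] := ltnP k n.
  rewrite Dm_mul ?subn_gt0 ?leq_subr // subKn //; congr (_ + _ *: Dm _ _ _ _ _ _); lia.
have -> : k = n by lia.
rewrite subnn Dm0 Dn_p /dstay qn0 !mul0r scale0r add0r /dup !addn0 divff; last first.
  by rewrite mulf_neq0 // v0_generic.
by rewrite scale1r; congr (Dm _ _ _ _ _ _); lia.
Qed.

(** By the multiplication rule every nested turnback is a polynomial in the first
    one. *)
Lemma D1_comm k : (k <= n)%N -> Dn 1 * Dn k = Dn k * Dn 1.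
Proof.
elim: k => [|k IH] kn; first by rewrite Dm0 Dn_p p_Dn.
have E : Dn 1 * Dn k = dstay (n - k) (n - k) k *: Dn k + dup (n - k) (n - k) k *: Dn k.+1.
  have := @DD_mul (n - k) ltac:(lia) (leq_subr _ _).
  by rewrite subKn; [move=> ->; congr (_ + _ *: Dm _ _ _ _ _ _); lia|lia].
have t0 : dup (n - k) (n - k) k != 0.
  by have := @dup_neq0 (n - k) ltac:(lia); rewrite subKn; last lia.
have {}E : Dn k.+1 = (dup (n - k) (n - k) k)^-1 *: (Dn 1 * Dn k - dstay (n - k) (n - k) k *: Dn k).
  by rewrite E addrC addKr scalerA mulVf // scale1r.
have {}IH := IH (ltnW kn); rewrite E zmr zml mulrBr mulrBl zmr zml IH; congr (_ *: (_ - _)).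
by rewrite mulrA IH.
Qed.

Lemma X_D1 : X * Dn 1 = Dn 1 * X.
Proof.
have Xp : X * p = p * X := XX_pp _ _ _ _ _.
transitivity (X * p * Dn 1); first by rewrite -mulrA p_Dn.
transitivity (Dn 1 * (X * p)); last by rewrite Xp mulrA Dn_p.
rewrite XX_pp_expand mulr_suml mulr_sumr.
by apply: eq_bigr => m _; rewrite zml zmr D1_comm // -ltnS.
Qed.

(** Descending induction on j: for j = n this is the expansion of the full twist,
    and multiplying by one turnback passes from j + 1 to j. *)
Lemma twist_D j : (j <= n)%N -> X * DD j = \sum_(k < j.+1) tm n j k *: DD k.
Proof.
move=> jn; have [i ei] : exists i, (n = j + i)%N by exists (n - j)%N; lia.
elim: i j jn ei => [|i IH] j jn ei.
  have -> : j = n by lia.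
  rewrite subnn Dm0 XX_pp_expand (reindex_inj rev_ord_inj) /=.
  apply: eq_bigr => k _; rewrite subSS tm_base ?leq_subr // subKn //; exact: (ltn_ord k).
have {}IH := IH j.+1 ltac:(lia) ltac:(lia).
set s := dstay j.+1 j.+1 (n - j.+1); set t := dup j.+1 j.+1 (n - j.+1).
have t0 : t != 0 by apply: dup_neq0.
have E1 : t *: DD j = Dn 1 * DD j.+1 - s *: DD j.+1.
  by rewrite DD_mul; [rewrite addrC addKr|lia|lia].
apply: (can_inj (scalerK t0)); rewrite -zmr E1 mulrBr zmr mulrA X_D1 -mulrA IH.
rewrite mulr_sumr !scaler_sumr -sumrB.
transitivity (\sum_(k < j.+2) ((tm n j.+1 k * (dstay k k (n - k) - s)) *: DD k +
   (tm n j.+1 k * dup k k (n - k)) *: DD k.-1)).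
  apply: eq_bigr => k _; rewrite zmr DD_mul; [|lia|by have := ltn_ord k; lia].
  by rewrite scalerDr !scalerA mulrBr scalerBl addrAC [s * _]mulrC.
rewrite big_split big_ord_recr /= /s subrr mulr0 scale0r addr0 -/s.
rewrite [X in _ + X]big_ord_recl (dup0 (a := 0)) // mulr0 scale0r add0r -big_split /=.
apply: eq_bigr => k _; rewrite (_ : bump 0 k = k.+1) // add0n scalerA -scalerDl; congr (_ *: _).
by rewrite -tm_step //; [rewrite -ltnS|lia].
Qed.

(** The coefficients of the powers of the full twist. *)
Fixpoint twc (g k : nat) : Kq :=
  if g is g'.+1 then \sum_(j < n.+1 | (k <= j)%N) twc g' j * tm n j k else (k == n)%:R.

Lemma twist_powers g : iter g ( *%R X) p = \sum_(k < n.+1) twc g k *: DD k.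
Proof.
elim: g => [|g IH] /=.
  rewrite big_ord_recr /= eqxx scale1r subnn Dm0 big1 ?add0r // => i _.
  by rewrite ltn_eqF ?scale0r.
rewrite IH mulr_sumr.
transitivity (\sum_(j < n.+1) \sum_(k < n.+1 | (k <= j)%N) (twc g j * tm n j k) *: DD k).
  apply: eq_bigr => j _; rewrite zmr twist_D; last by rewrite -ltnS.
  rewrite scaler_sumr (big_ord_widen_cond n.+1 xpredT (fun k => twc g j *: (tm n j k *: DD k))) //.
  by apply: eq_big => k; rewrite ?ltnS // => _; rewrite scalerA.
rewrite (exchange_big_dep xpredT) //=; apply: eq_bigr => k _.
by rewrite -scaler_suml.
Qed.
End TwistPowers.

(** * Nested arcs *)

Fixpoint cupw o m : diagram := if m is m'.+1 then cupw o m' ++ [:: (m', Cup o)] else [::].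
Fixpoint capw o m : diagram := if m is m'.+1 then (m', Cap o) :: capw o m' else [::].

Lemma run_cupw o m : run (cupw o m) [::] = Some (nseq m o ++ nseq m (~~ o)).
Proof.
elim: m => //= m IH; rewrite (run_cats _ IH) slice1E.
by apply: (@run_sub _ [::] _ (nseq m o) (nseq m (~~ o)) _ _ _ (run_Cup o)); [|rewrite -cat1s; lsteq|sizes].
Qed.
Lemma run_capw o m : run (capw o m) (nseq m o ++ nseq m (~~ o)) = Some [::].
Proof.
elim: m => // m IH; rewrite -[capw o m.+1]/([:: (m, Cap o)] ++ capw o m).
rewrite (@run_cats _ _ _ (nseq m o ++ nseq m (~~ o))) // slice1E.
by apply: (@run_sub _ _ [::] (nseq m o) (nseq m (~~ o)) _ _ _ (run_Cap o)); [rewrite -cat1s; lsteq| |sizes].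
Qed.
Lemma cupwD o i k : cupw o (i + k) = cupw o i ++ shift i (cupw o k).
Proof.
elim: k => [|k IH]; first by rewrite addn0 cats0.
by rewrite addnS -[cupw o (i + k).+1]/(cupw o (i + k) ++ [:: ((i + k)%N, Cup o)]) IH -catA -[cupw o k.+1]/(cupw o k ++ [:: (k, Cup o)]) shift_cat shift1E.
Qed.
Lemma capwD o i k : capw o (i + k) = shift i (capw o k) ++ capw o i.
Proof.
elim: k => [|k IH]; first by rewrite addn0.
by rewrite addnS -[capw o (i + k).+1]/([:: ((i + k)%N, Cap o)] ++ capw o (i + k)) IH -[capw o k.+1]/([:: (k, Cap o)] ++ capw o k) shift_cat shift1E catA.
Qed.
Lemma cupwE o m : cupw o m = [seq (k, Cup o) | k <- iota 0 m].
Proof. by elim: m => // m IH; rewrite -addn1 iotaD map_cat -IH addn1. Qed.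
Lemma capwE o m : capw o m = [seq (k, Cap o) | k <- rev (iota 0 m)].
Proof. by elim: m => // m IH; rewrite -addn1 iotaD rev_cat map_cat -IH addn1. Qed.

(** The outermost of the nested arcs is straightened by a cap on its right. *)
Lemma zig_cupw o m : weq [:: o] (cupw o m.+1 ++ [:: ((m + m).+1, Cap (~~ o))]) (shift 1 (cupw o m)).
Proof.
rewrite -[m.+1]add1n cupwD -catA slice1E.
apply: (weq_trans (B := [:: (0%N, Cup o)] ++ shift 1 [:: (0%N, Cap (~~ o))] ++ shift 1 (cupw o m))); last first.
  exact: (weq_post (shift 1 (cupw o m)) (zigl o)).
rewrite -[cupw o 1]/[:: (0%N, Cup o)].
apply: (weq_pre (s1 := [:: o; ~~ o; o])); first by case: o.
apply: (weq_far_at' (a := [:: o]) (m := [::]) (b := [::]) (run_cupw o m) (run_Cap (~~ o))) => //; rewrite ?negbK //; sec.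
Qed.
Lemma zig_capw o m : weq (nseq m.+1 o ++ nseq m (~~ o))
  ([:: ((m + m).+1, Cup (~~ o))] ++ capw o m.+1) (shift 1 (capw o m)).
Proof.
rewrite -[m.+1]add1n capwD slice1E catA.
apply: (weq_trans (B := (shift 1 (capw o m) ++ shift 1 [:: (0%N, Cup (~~ o))]) ++ [:: (0%N, Cap o)])).
  apply: weq_post; apply: weq_sym.
  by apply: (weq_far_at' (a := [:: o]) (m := [::]) (b := [::]) (run_capw o m) (run_Cup (~~ o))) => //; [rewrite consE; lsteq|sizes].
rewrite -catA -[X in weq _ _ X]cats0; apply: (weq_pre (s1 := [:: o])); last exact: (zigr o).
by apply: (run_sub (l := [:: o]) (r := [::]) (run_capw o m)); [rewrite consE; lsteq| |].
Qed.

(** A generator on the left legs of nested arcs slides to their right legs. *)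
Lemma slide_cupw o m i : (i.+1 < m)%N ->
  weq [::] (cupw o m ++ shift i (Eo o)) (cupw o m ++ shift (m + m - 2 - i) (Eo (~~ o))).
Proof.
move=> im; have -> : m = (i + (2 + (m - i - 2)))%N by lia.
set k := (m - i - 2)%N; rewrite (cupwD o i).
have -> : (i + (2 + k) + (i + (2 + k)) - 2 - i = i + (2 + k + k))%N by lia.
rewrite -shift_shift -!catA -!shift_cat.
apply: (weq_pre (run_cupw o i)); apply: (weq_sub (s1 := [::]) (b := nseq i (~~ o))); [|by []|by rewrite size_nseq].
rewrite cupwD -!catA.
apply: (weq_trans (B := cupw o 2 ++ Eo o ++ shift 2 (cupw o k))).
  apply: (weq_pre (run_cupw o 2)); apply: weq_sym; rewrite -[X in X ++ shift 2 _]shift0 -[shift 0 _ ++ _]/(shift 0 (Eo o) ++ _) -{2}(shift0 (Eo o)).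
  by apply: (weq_far_at' (a := [::]) (m := [::]) (b := [:: ~~ o; ~~ o]) (run_Eo o) (run_cupw o k)).
rewrite catA; apply: (weq_trans (B := (cupw o 2 ++ shift 2 (Eo (~~ o))) ++ shift 2 (cupw o k))).
  by apply: weq_post; exact: cup_slide.
rewrite -catA; apply: (weq_pre (run_cupw o 2)); apply: weq_sym.
by apply: (weq_far_at' (a := [:: o; o]) (m := [::]) (b := [::]) (run_cupw o k) (run_Eo (~~ o))) => //; sizes.
Qed.
Lemma slide_capw o m i : (i.+1 < m)%N -> weq (nseq m o ++ nseq m (~~ o))
  (shift i (Eo o) ++ capw o m) (shift (m + m - 2 - i) (Eo (~~ o)) ++ capw o m).
Proof.
move=> im; have -> : m = (i + (2 + (m - i - 2)))%N by lia.
set k := (m - i - 2)%N; rewrite (capwD o i).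
have -> : (i + (2 + k) + (i + (2 + k)) - 2 - i = i + (2 + k + k))%N by lia.
rewrite -shift_shift !catA -!shift_cat; apply: weq_post.
apply: (weq_sub (s1 := nseq (2 + k) o ++ nseq (2 + k) (~~ o)) (a := nseq i o) (b := nseq i (~~ o))); [|lsteq|by rewrite size_nseq].
rewrite capwD !catA.
apply: (weq_trans (B := (shift 2 (capw o k) ++ Eo o) ++ capw o 2)).
  apply: weq_post; have := @weq_far_at' (Eo o) (capw o k) _ _ [::] _ _ [::] [:: ~~ o; ~~ o] (nseq (2 + k) o ++ nseq (2 + k) (~~ o)) 0 2 2 (run_Eo o) (run_capw o k).
  by rewrite shift0; apply => //; rewrite [in RHS]consE; lsteq.
rewrite -catA; apply: (weq_trans (B := shift 2 (capw o k) ++ shift 2 (Eo (~~ o)) ++ capw o 2)).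
  apply: (weq_pre (s1 := [:: o; o; ~~ o; ~~ o])); last exact: cap_slide.
  by apply: (run_sub (l := [:: o; o]) (r := [:: ~~ o; ~~ o]) (run_capw o k)) => //; rewrite consE; lsteq.
rewrite catA; apply: weq_post.
by apply: (weq_far_at' (a := [:: o; o]) (m := [::]) (b := [::]) (run_capw o k) (run_Eo (~~ o))) => //; sec.
Qed.

Lemma CU_w o l r a b m : CU o l r a b m = w (Sec o l r a b) (shift (size l + a) (cupw o m)).
Proof.
elim: m => [|m IH]; first by rewrite CU0.
rewrite CUS IH /cu w_cat; last first.
  by apply: (@run_sub _ [::] _ (l ++ nseq a o) (nseq b (~~ o) ++ r) _ _ _ (run_cupw o m)); rewrite /Sec; sec.
congr w; rewrite -[cupw o m.+1]/(cupw o m ++ [:: (m, Cup o)]) shift_cat shift1E addn0 addnA.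
by rewrite shift1E.
Qed.
Lemma CA_w o l r a b m : CA o l r a b m = w (Sec o l r (a + m) (b + m)) (shift (size l + a) (capw o m)).
Proof.
elim: m => [|m IH]; first by rewrite CA0 !addn0.
rewrite CAS IH /cp w_cat; last first.
  by apply: (@run_sub _ _ [::] (l ++ nseq (a + m) o) (nseq (b + m) (~~ o) ++ r) _ _ _ (run_Cap o)); rewrite /Sec ?consE; sec.
by rewrite !addnS -[capw o m.+1]/([:: (m, Cap o)] ++ capw o m) shift_cat !shift1E addn0 addnA.
Qed.

Lemma zig_cupw_many o k r : weq (nseq r o)
  (cupw o (k + r) ++ shift (k + r + k) (capw (~~ o) r)) (shift r (cupw o k)).
Proof.
elim: r => [|r IH]; first by rewrite addn0 cats0 shift0.
rewrite -[capw (~~ o) r.+1]/([:: (r, Cap (~~ o))] ++ capw (~~ o) r) shift_cat catA addnS shift1E.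
apply: (weq_trans (B := shift 1 (cupw o (k + r)) ++ shift ((k + r).+1 + k) (capw (~~ o) r))).
  apply: weq_post; have := zig_cupw o (k + r).
  rewrite (_ : (k + r + (k + r)).+1 = (k + r).+1 + k + r)%N; last by lia.
  by move=> h; apply: (weq_sub0 (b := nseq r o) h); rewrite consE; lsteq.
rewrite (_ : (k + r).+1 + k = 1 + (k + r + k))%N; last by lia.
rewrite -[X in weq _ _ (shift X _)]add1n -(shift_shift 1 (k + r + k)) -(shift_shift 1 r) -shift_cat.
by apply: (weq_sub (a := [:: o]) (b := [::]) IH) => //; rewrite cats0.
Qed.
Lemma zig_capw_many o k r : weq (nseq (k + r) o ++ nseq k (~~ o))
  (shift (k + r + k) (cupw (~~ o) r) ++ capw o (k + r)) (shift r (capw o k)).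
Proof.
elim: r => [|r IH]; first by rewrite addn0 shift0.
rewrite -[cupw (~~ o) r.+1]/(cupw (~~ o) r ++ [:: (r, Cup (~~ o))]) shift_cat -catA addnS shift1E.
apply: (weq_trans (B := shift ((k + r).+1 + k) (cupw (~~ o) r) ++ shift 1 (capw o (k + r)))).
  have := zig_capw o (k + r).
  rewrite (_ : (k + r + (k + r)).+1 = (k + r).+1 + k + r)%N; last by lia.
  move=> h; apply: (weq_pre (s1 := nseq (k + r).+1 o ++ nseq (k + r) (~~ o) ++ nseq r o)).
    apply: (@run_sub _ [::] _ (nseq (k + r).+1 o ++ nseq k (~~ o)) [::] _ _ _ (run_cupw (~~ o) r)); rewrite ?negbK; sec.
  by apply: (weq_sub0 (b := nseq r o) h); lsteq.
rewrite (_ : (k + r).+1 + k = 1 + (k + r + k))%N; last by lia.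
rewrite -[X in weq _ _ (shift X _)]add1n -(shift_shift 1 (k + r + k)) -(shift_shift 1 r) -shift_cat.
by apply: (weq_sub (a := [:: o]) (b := [::]) IH) => //; rewrite ?consE; lsteq.
Qed.

(** Turnbacks at the top of a column, next to nested arcs, straighten some of
    these arcs and shorten the others. *)
Lemma CA_CU_zig o l k r : CA (~~ o) (l ++ nseq (k + r) o) [::] k k r * CU o l (nseq (k + r) o) 0 0 (k + r) =
  CU o (l ++ nseq r o) (nseq k o) 0 0 k.
Proof.
rewrite !CU_w CA_w.
have S1 : Sec (~~ o) (l ++ nseq (k + r) o) [::] (k + r) (k + r) = l ++ nseq (k + r) o ++ nseq (k + r) (~~ o) ++ nseq (k + r) o.
  by rewrite /Sec negbK; lsteq.
rewrite S1 w_cat; last first.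
  by apply: (@run_sub _ [::] _ l (nseq (k + r) o) _ _ _ (run_cupw o (k + r))); rewrite /Sec; sec.
have -> : Sec o (l ++ nseq r o) (nseq k o) 0 0 = Sec o l (nseq (k + r) o) 0 0 by rewrite /Sec; lsteq.
rewrite size_cat size_nseq -addnA addn0 -shift_shift -shift_cat.
rewrite (weq_w (l := l) (r := nseq k o) (zig_cupw_many o k r)) //; last by rewrite /Sec; lsteq.
by rewrite shift_shift size_cat size_nseq addn0.
Qed.
Lemma CA_CU_zig' o l k r : CA o l (nseq (k + r) o) 0 0 (k + r) * CU (~~ o) (l ++ nseq (k + r) o) [::] k k r =
  CA o (l ++ nseq r o) (nseq k o) 0 0 k.
Proof.
rewrite !CA_w CU_w !add0n.
have S1 : Sec (~~ o) (l ++ nseq (k + r) o) [::] k k = l ++ nseq (k + r) o ++ nseq k (~~ o) ++ nseq k o.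
  by rewrite /Sec negbK; lsteq.
rewrite S1 w_cat; last first.
  apply: (@run_sub _ [::] _ (l ++ nseq (k + r) o ++ nseq k (~~ o)) (nseq k o) _ _ _ (run_cupw (~~ o) r)); rewrite /Sec ?negbK; sec.
have -> : Sec o (l ++ nseq r o) (nseq k o) k k = l ++ nseq (k + r) o ++ nseq k (~~ o) ++ nseq k o by rewrite /Sec; lsteq.
rewrite size_cat size_nseq -addnA addn0 -shift_shift -shift_cat.
rewrite (weq_w (l := l) (r := nseq k o) (zig_capw_many o k r)) //; last by rewrite /Sec; lsteq.
by rewrite shift_shift size_cat size_nseq addn0.
Qed.

Lemma E_CU o l r m i : (i.+1 < m)%N -> E o (Sec o l r m m) (size l + i) * CU o l r 0 0 m =
  E (~~ o) (Sec o l r m m) (size l + (m + m - 2 - i)) * CU o l r 0 0 m.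
Proof.
move=> im; rewrite CU_w /E addn0.
have R0 : run (shift (size l) (cupw o m)) (Sec o l r 0 0) = Some (Sec o l r m m).
  by apply: (@run_sub _ [::] _ l r _ _ _ (run_cupw o m)); rewrite /Sec; sec.
rewrite !(w_cat _ R0) -!shift_shift -!shift_cat.
by apply: (weq_w (l := l) (r := r) (slide_cupw o im)).
Qed.
Lemma CA_E o l r m i : (i.+1 < m)%N -> CA o l r 0 0 m * E o (Sec o l r m m) (size l + i) =
  CA o l r 0 0 m * E (~~ o) (Sec o l r m m) (size l + (m + m - 2 - i)).
Proof.
move=> im; rewrite CA_w /E addn0.
rewrite !add0n !w_cat -?shift_shift -?shift_cat; first last.
- rewrite shift_shift; apply: (@run_sub _ _ _ (l ++ nseq i o) (nseq (m - i - 2) o ++ nseq m (~~ o) ++ r) _ _ _ (run_Eo o)); rewrite /Sec ?consE; sec.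
- rewrite shift_shift; apply: (@run_sub _ _ _ (l ++ nseq m o ++ nseq (m - 2 - i) (~~ o)) (nseq i (~~ o) ++ r) _ _ _ (run_Eo (~~ o))); rewrite /Sec ?consE; sec.
by apply: (weq_w (l := l) (r := r) (slide_capw o im)) => //; rewrite /Sec; lsteq.
Qed.

(** * Closing the diagram *)

Section TraceWords.
Variables (o : bool) (l r : seq bool).
Local Notation Sec := (Sec o l r).
Local Notation ee a b := (EE o (Sec a b) (size l)).

Lemma w_cu N j : w (Sec N.+1 j.+1) [::] * cu o l r N j = cu o l r N j.
Proof. by rewrite /cu (w1l (run_cu _ _ _ _ _)). Qed.
Lemma cp_w N j : cp o l r N j * w (Sec N.+1 j.+1) [::] = cp o l r N j.
Proof. by rewrite /cp w1r. Qed.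

Lemma w_ed N j i : (i.+1 < N)%N -> ee N j i * w (Sec N j) [::] = w (Sec N j) [::] * ee N j i.
Proof. by move=> iN; rewrite /EE w1r (w1l (run_ed _ _ _ _ iN)). Qed.

Lemma trace_word n b j d x a : n = (b.+1 + d)%N ->
  rep v0 (flip (b.+1 + n) (ee (n + b).+1 j.+1)) b.+1 n b.+2 (level v0 n b.+1) x a ->
  exists2 x', rep v0 (flip (b + n) (ee (n + b) j)) b n b.+1 (level v0 n b) x' (trace_fun v0 d b a) &
    cp o l r (n + b) j * x * cu o l r (n + b) j = x' * w (Sec (n + b) j) [::].
Proof.
move=> nE xr; apply: (rep_trace v0_generic (e1 := ee (n + b).+1 j.+1)) nE xr => //.
- exact: hecke_d.
- exact: hecke_d.
- exact: cp_ed.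
- exact: cu_ed.
- exact: w_ed.
- by rewrite cp_cu qintE.
- by move=> nb; rewrite -qintE cp_e_cu.
Qed.

(** Partial traces are taken one strand at a time, starting from the innermost
    arc. *)
Lemma trace_words n k j x a : (k <= n)%N ->
  rep v0 (flip (n + n) (ee (n + n) (j + k))) n n n.+1 (level v0 n n) x a ->
  exists2 x', rep v0 (flip (n - k + n) (ee (n + (n - k)) j)) (n - k) n (n - k).+1 (level v0 n (n - k)) x'
      (trs v0 n k a) &
    CA o l r (n + (n - k)) j k * x * CU o l r (n + (n - k)) j k = x' * w (Sec (n + (n - k)) j) [::].
Proof.
elim: k j x => [|k IH] j x kn xr.
  exists x; first by rewrite addn0 in xr; rewrite subn0.
  rewrite addn0 in xr; rewrite subn0 CA0 CU0.
  have xw : x * w (Sec (n + n) j) [::] = w (Sec (n + n) j) [::] * x.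
    by apply: rep_comm v0_generic xr _ => i iN; rewrite /flip w_ed //; lia.
  by rewrite -xw -mulrA w1r.
rewrite -addSnnS in xr; have [x1 x1r E1] := IH j.+1 x (ltnW kn) xr.
have nk : (n - k = (n - k.+1).+1)%N by lia.
rewrite nk addnS in x1r E1.
have [x2 x2r E2] := @trace_word n (n - k.+1) j k x1 _ ltac:(lia) x1r.
exists x2 => //; rewrite CAl CUl -E2.
by rewrite -!mulrA (mulrA x) (mulrA _ _ (cu _ _ _ _ _)) (mulrA (CA _ _ _ _ _ _)) (mulrA _ x) E1 -!mulrA w_cu.
Qed.

(** When the second bundle is exhausted the only rung left is a clasp. *)
Lemma rep_point n (e : nat -> 'R) x a : (0 < n)%N -> hecke v0 e n ->
  rep v0 (flip (0 + n) e) 0 n 1 (level v0 n 0) x a -> x = a 0%N *: clasp_at v0 e 0 n.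
Proof.
move=> n0 eH xr; have eH' : hecke v0 e (n + 0) by rewrite addn0.
have [||c [-> ac]] := rep_flip v0_generic eH' _ _ xr; first by rewrite addn0.
  by move=> u; rewrite ltnS leqn0 => /eqP->; exists 0%N.
rewrite ac // !big_ord1 /= rung_eig0 mulr1 (rung0 v0_generic eH'); congr (_ *: _).
by rewrite (ladderE v0) addn0 subnn clasp_at0 mulr1.
Qed.
End TraceWords.

Lemma mulf_cancel (F : fieldType) (a b c d : F) : b != 0 -> a / b * (b * c / d) = c * (a / d).
Proof. by move=> b0; rewrite -[b * c / d]mulrA mulrA divfK // mulrCA. Qed.

(** The strands of the clasp are closed one by one, and the factors telescope. *)
Lemma close_clasp o n : CA o [::] [::] 0 0 n * clasp_at v0 (EE o (Sec o [::] [::] n n) 0) 0 n * CU o [::] [::] 0 0 n =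
  (qn v0 n.+1 * qn v0 n.+2 / qn v0 2) *: w [::] [::].
Proof.
elim: n => [|n IH].
  by rewrite CA0 CU0 clasp_at0 mulr1 w1r qn1 ?mul1r ?divff ?scale1r //; exact: v0_generic.
have q2 : qn v0 2 != 0 by exact: v0_generic.
have qn1' : qn v0 n.+1 != 0 by exact: v0_generic.
rewrite CAS CUS !add0n -!mulrA (mulrA _ (cu _ _ _ _ _)) (mulrA (cp _ _ _ _ _)) mulrA (mulrA (cp _ _ _ _ _)).
have := @trace_clasp _ v0 _ v0_generic (EE o (Sec o [::] [::] n n) 0) (EE o (Sec o [::] [::] n.+1 n.+1) 0) n
  (cp o [::] [::] n n) (cu o [::] [::] n n) (w (Sec o [::] [::] n n) [::]) (hecke_d o [::] [::] n n)
  (@cp_ed o [::] [::] n n) (@cu_ed o [::] [::] n n) (@w_ed o [::] [::] n n).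
rewrite cp_cu -qintE => /(_ erefl) h.
have {}h := h _ 0%N n (add0n n).
rewrite h; last by move=> n0; rewrite cp_e_cu // qintE.
rewrite zmr zml -!mulrA (_ : w _ [::] * CU o [::] [::] 0 0 n = CU o [::] [::] 0 0 n); last first.
  by case: n {IH q2 qn1' h} => [|n]; [rewrite CU0 w1r|rewrite CUS !add0n mulrA w_cu].
rewrite mulrA IH scalerA; congr (_ *: _).
by rewrite addn3 addn1 mulf_cancel.
Qed.

Lemma CA_add o l r a b m k : CA o l r a b (m + k) = CA o l r a b m * CA o l r (a + m) (b + m) k.
Proof.
elim: k => [|k IH]; last by rewrite addnS !CAS IH mulrA !addnA.
rewrite addn0 CA0; case: m => [|m]; first by rewrite CA0 !addn0 w1r.
by rewrite CAS !addnS -mulrA cp_w.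
Qed.
Lemma CU_add o l r a b m k : CU o l r a b (m + k) = CU o l r (a + m) (b + m) k * CU o l r a b m.
Proof.
elim: k => [|k IH]; last by rewrite addnS !CUS IH mulrA !addnA.
rewrite addn0 CU0; case: m => [|m]; first by rewrite CU0 !addn0 w1r.
by rewrite CUS !addnS mulrA w_cu.
Qed.
Lemma w_CU o l r a b m : w (Sec o l r (a + m) (b + m)) [::] * CU o l r a b m = CU o l r a b m.
Proof. by case: m => [|m]; [rewrite CU0 !addn0 w1r|rewrite CUS mulrA !addnS w_cu]. Qed.

Section CloseUp.
Variables (n : nat).
Hypothesis n0 : (0 < n)%N.
Local Notation N := (n + n)%N.
Local Notation S0 := (Sec false [::] [::] N N).
Local Notation ed := (EE false S0 0).
Local Notation eu := (EE true S0 N).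
Local Notation Om := (CA false [::] [::] 0 0 N).
Local Notation Ps := (CU false [::] [::] 0 0 N).
Local Notation Rep := (fun e => rep v0 e n n n.+1 (level v0 n n)).

Lemma zspec u : (u < n.+1)%N -> exists2 s, (s <= n)%N & level v0 n n u = level v0 n n s.
Proof. by move=> un; exists u; rewrite // -ltnS. Qed.
Lemma ed_hecke : hecke v0 ed N. Proof. exact: hecke_d. Qed.
Lemma eu_hecke : hecke v0 eu N. Proof. exact: (@hecke_u false [::] [::] N N). Qed.
Lemma ed_eu i j : (i.+1 < N)%N -> (j.+1 < N)%N -> ed i * eu j = eu j * ed i.
Proof. exact: (@EdEu false [::] [::] N N). Qed.
Lemma ed_Ps i : (i.+1 < N)%N -> ed i * Ps = flip N eu i * Ps.
Proof.
move=> iN; have := @E_CU false [::] [::] N i iN; rewrite /flip !EEE add0n => ->.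
by rewrite (_ : size (Nil bool) + (N + N - 2 - i) = N + (N - i.+2))%N //=; lia.
Qed.
Lemma eu_Ps i : (i.+1 < N)%N -> eu i * Ps = flip N ed i * Ps.
Proof.
move=> iN; rewrite /flip ed_Ps; last by lia.
by rewrite /flip; congr (eu _ * _); lia.
Qed.
Lemma Om_ed i : (i.+1 < N)%N -> Om * ed i = Om * flip N eu i.
Proof.
move=> iN; have := @CA_E false [::] [::] N i iN; rewrite /flip !EEE add0n => ->.
by rewrite (_ : size (Nil bool) + (N + N - 2 - i) = N + (N - i.+2))%N //=; lia.
Qed.
Local Notation ld := (ladder v0 ed N n).
Local Notation lu := (ladder v0 eu N n).
Lemma ld_Ps : ld * Ps = lu * Ps.
Proof.
rewrite (nest_ladderl (f := flip N eu)) ?leq_addr //.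
- by rewrite (flip_ladder v0_generic eu_hecke) ?leq_addr // addnK.
- exact: flip_hecke eu_hecke.
- exact: ed_Ps.
- by move=> i j iN jN; rewrite /flip ed_eu //; lia.
Qed.
Lemma Om_ld : Om * ld = Om * lu.
Proof.
rewrite (nest_ladderr (f := flip N eu)) ?leq_addr //.
- by rewrite (flip_ladder v0_generic eu_hecke) ?leq_addr // addnK.
- exact: flip_hecke eu_hecke.
- exact: Om_ed.
- by move=> i j iN jN; rewrite /flip ed_eu //; lia.
Qed.

(** The second bundle is traced away; then one clasp is left to be closed. *)
Lemma close_d y a : Rep ed y a ->
  Om * y * Ps = (qdim v0 n n 0 * trs v0 n n a 0) *: w [::] [::].
Proof.
move=> yr; have -> : qdim v0 n n 0 = qn v0 n.+1 * qn v0 n.+2 / qn v0 2.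
  by rewrite /qdim muln0 add0n addn1 subnn sub0n add0n (qn1 v0_generic) mulr1 addn0 addn2.
have {}yr := rep_unflip v0_generic ed_hecke n0 yr.
have [x' x'r E1] := @trace_words false [::] [::] n n n y a (leqnn n) yr.
rewrite subnn addn0 in x'r E1.
rewrite CA_add CU_add !add0n -!mulrA (mulrA y) (mulrA (CA _ _ _ n n n)) (mulrA _ y) E1.
have -> := rep_point n0 (hecke_d false [::] [::] n n) x'r.
have h := w_CU false [::] [::] 0 0 n; rewrite !add0n in h.
rewrite -mulrA h zml zmr mulrA close_clasp scalerA; congr (_ *: _).
by rewrite mulrC !mulrA.
Qed.

(** The second column is partially traced along the arcs and lifted back; the
    clasps needed for the lift come from the first column along the nested arcs.
    Transported to the other legs of the arcs, it multiplies the first column, and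
    the adjointness of lifts and traces gives the symmetric form. *)
Lemma close_k k xA xB a b : (k <= n)%N ->
  let Sk := Sec true (nseq N false) (nseq k true) N k in
  Rep (EE false Sk 0) xA a -> Rep (EE true Sk N) xB b ->
  Om * (CA true (nseq N false) (nseq k true) (n + (n - k)) 0 k * (xB * xA) *
        CU true (nseq N false) (nseq k true) (n + (n - k)) 0 k) * Ps =
  (\sum_(u < (n - k).+1) qdim v0 n k u * (trs v0 n k a u * trs v0 n k b u)) *: w [::] [::].
Proof.
move=> kn Sk Ar Br; set Ck := CU true _ _ _ _ _; set Fk := CA true _ _ _ _ _.
have S0E : Sec true (nseq N false) (nseq k true) (n + (n - k)) 0 = S0 by rewrite /Sec; lsteq.
have SkE : Sec true (nseq N false) (nseq k true) (n + (n - k) + k) (0 + k) = Sk.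
  by rewrite /Sk /Sec; lsteq.
have [i iN|xA0 A0r A0] := rep_intertwine' (e' := ed) (x := Ck) _ Ar.
  rewrite /Ck CU_w !EEE S0E add0n.
  apply/esym; apply: (@efar_l _ (cupw true k) _ _ (nseq i false) (nseq (N - i - 2) false ++ nseq (n + (n - k)) true) (nseq k true) _ _ _ _ (run_cupw true k)).
  - by rewrite /Sec ?consE; sec.
  - by rewrite /Sk /Sec ?consE; sec.
  - by sec.
  - by sec.
have eH : hecke v0 (EE true Sk N) N.
  have := hecke_d true (nseq N false) (nseq k true) N k.
  by rewrite size_nseq.
have Bf := rep_unflip v0_generic eH n0 Br.
have := @trace_words true (nseq N false) (nseq k true) n k 0 xB b kn.
rewrite add0n size_nseq S0E -/Fk -/Ck => /(_ Bf) [x1 x1r E1].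
have eH0 : hecke v0 eu (n + (n - k)) by apply: hecke_le eu_hecke _; lia.
have {}x1r : rep v0 eu n (n - k) (n - k).+1 (level v0 n (n - k)) x1 (trs v0 n k b).
  apply: rep_flip x1r => //; [exact: v0_generic|lia|].
  by move=> u un; exists u; rewrite // -ltnS.
have x2r := rep_lfs v0_generic eu_hecke kn x1r.
set x2 := lu * x1 * lu in x2r.
have [|||x3 x3r E3] := nest_rep v0_generic (f := flip N ed) (x := Ps) _ _ _ x2r.
- exact: flip_hecke ed_hecke.
- exact: eu_Ps.
- by move=> i j iN jN; rewrite /flip ed_eu //; lia.
have {}x3r : Rep ed x3 (lfs v0 n k (trs v0 n k b)).
  by apply: rep_flip x3r; [exact: v0_generic|exact: ed_hecke|lia|exact: zspec].
have yr := rep_mul v0_generic ed_hecke zspec A0r x3r.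
have edw i : (i.+1 < N)%N -> ed i * w S0 [::] = w S0 [::] * ed i.
  exact: (@w_ed false [::] [::] N N).
have wA : xA0 * w S0 [::] = w S0 [::] * xA0 by apply: rep_comm v0_generic A0r edw.
have wPs : w S0 [::] * Ps = Ps by have := w_CU false [::] [::] 0 0 N.
have x1d y : (forall i, (i.+1 < N)%N -> ed i * y = y * ed i) -> xA0 * y = y * xA0.
  by move=> h; apply: rep_comm v0_generic A0r h.
have edx1 i : (i.+1 < N)%N -> ed i * x1 = x1 * ed i.
  move=> iN; apply/esym; apply: rep_comm v0_generic x1r _ => j jN.
  by rewrite ed_eu //; lia.
have edlu i : (i.+1 < N)%N -> ed i * lu = lu * ed i.
  move=> iN; apply/esym; apply: ladder_comm; first exact: leq_addr.
  by move=> j jN; rewrite ed_eu.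
have ldx1 : ld * x1 = x1 * ld by apply: ladder_comm; [exact: leq_addr|exact: edx1].
have ldlu : ld * lu = lu * ld by apply: ladder_comm; [exact: leq_addr|exact: edlu].
have edx2 i : (i.+1 < N)%N -> ed i * x2 = x2 * ed i.
  by move=> iN; rewrite /x2 !mulrA edlu // -!mulrA (mulrA (ed i)) edx1 // -!mulrA edlu.
have -> : Fk * (xB * xA) * Ck = x1 * w S0 [::] * xA0.
  by rewrite -!mulrA A0 !mulrA E1.
rewrite -!mulrA (mulrA (w _ _)) -wA -mulrA wPs.
have -> : Om * (x1 * (xA0 * Ps)) = Om * (x2 * (xA0 * Ps)).
  rewrite -{1}(rep_ladl v0_generic ed_hecke A0r) -{1}(rep_ladr v0_generic ed_hecke A0r).
  transitivity (Om * ld * x1 * xA0 * (ld * Ps)).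
    by rewrite -(mulrA Om) ldx1 !mulrA.
  by rewrite Om_ld ld_Ps /x2 -!mulrA (mulrA xA0 lu) (x1d _ edlu) !mulrA.
rewrite (mulrA x2) -(x1d _ edx2) -mulrA E3 !mulrA -(mulrA Om) (close_d yr) -(trs_pairing v0_generic) //.
by congr ((_ * trs v0 n n _ 0%N) *: _); apply/funext => u; rewrite mulrC.
Qed.
End CloseUp.

(** * The cabled pretzel diagram *)

Lemma E_comm o o' S l m r A B i j p q : S = l ++ nseq A o ++ m ++ nseq B o' ++ r ->
  (i.+1 < A)%N -> (j.+1 < B)%N -> p = size l -> q = (size l + A + size m)%N ->
  EE o S p i * EE o' S q j = EE o' S q j * EE o S p i.
Proof.
move=> SE iA jB -> ->; rewrite !EEE; apply/esym.
apply: (@efar_l o _ _ _ (l ++ nseq i o) (nseq (A - i - 2) o ++ m ++ nseq j o')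
  (nseq (B - j - 2) o' ++ r) _ _ _ _ (run_Eo o')); rewrite ?SE ?consE; sec.
Qed.

Lemma clasps_comm (e f : nat -> 'R) s t n : (forall i j, (s <= i)%N -> (i.+1 < s + n)%N ->
  (t <= j)%N -> (j.+1 < t + n)%N -> e i * f j = f j * e i) ->
  clasp_at v0 e s n * clasp_at v0 f t n = clasp_at v0 f t n * clasp_at v0 e s n.
Proof. by move=> ef; apply: clasp_comm => i h1 h2; apply/esym/clasp_comm => j h3 h4; rewrite ef. Qed.

Lemma bgrid_comm (e : nat -> 'R) s a b (y : 'R) :
  (forall i, (s <= i)%N -> (i.+1 < s + a + b)%N -> e i * y = y * e i) ->
  bgrid v0 e s a b * y = y * bgrid v0 e s a b.
Proof.
move=> ey; have G i : (s <= i)%N -> (i.+1 < s + a + b)%N -> braid_gen v0 e i * y = y * braid_gen v0 e i.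
  by move=> h1 h2; rewrite /braid_gen mulrBl mulrBr ey // mulr_algl mulr_algr.
have Cc t c : (s <= t)%N -> (t + c < s + a + b)%N -> chain v0 e t c * y = y * chain v0 e t c.
  move=> h1; elim: c => [|c IH] h2; first by rewrite mul1r mulr1.
  by rewrite chainS -mulrA G ?mulrA ?IH //; lia.
have : (b <= b)%N by []; elim: {-2}b => [|c IH] cb; first by rewrite mul1r mulr1.
rewrite bgridS -mulrA IH ?mulrA; last by lia.
by case: a Cc {ey G IH} => [|a] Cc; [rewrite mul1r mulr1|rewrite Cc //; lia].
Qed.

Section Pretzel.
Variable n : nat.
Hypothesis n0 : (0 < n)%N.
Local Notation N := (n + n)%N.
Definition Lb : seq bool := nseq N false ++ nseq N true.
Lemma size_Lb : size Lb = (N + N)%N. Proof. by rewrite size_cat !size_nseq. Qed.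
Local Notation S1 := (Sec false Lb [::] n n).
Definition fd := EE false S1 0.
Definition fu := EE true S1 N.
Definition f4 := EE false S1 (size Lb).
Definition f5 := EE true S1 (size Lb + n).
Lemma S1E : S1 = nseq N false ++ nseq N true ++ nseq n false ++ nseq n true.
Proof. by rewrite /Sec /Lb cats0 -!catA. Qed.
Lemma fd_hecke : hecke v0 fd N.
Proof. by apply: (EE_hecke (l := [::]) (o := false) (N := N)); [exact: S1E|]. Qed.
Lemma fu_hecke : hecke v0 fu N.
Proof. by apply: (EE_hecke (l := nseq N false) (o := true) (N := N)); [exact: S1E|rewrite size_nseq]. Qed.
Lemma f4_hecke : hecke v0 f4 n. Proof. exact: hecke_d. Qed.
Lemma f5_hecke : hecke v0 f5 n. Proof. exact: (@hecke_u false). Qed.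

Lemma fd_fu i j : (i.+1 < N)%N -> (j.+1 < N)%N -> fd i * fu j = fu j * fd i.
Proof. by move=> h1 h2; apply: (E_comm (l := [::]) (m := [::]) S1E h1 h2); rewrite //= addn0. Qed.
Lemma fd_f4 i j : (i.+1 < N)%N -> (j.+1 < n)%N -> fd i * f4 j = f4 j * fd i.
Proof.
move=> h1 h2; apply: (E_comm (l := [::]) (m := nseq N true) S1E h1 h2) => //.
by rewrite size_Lb size_nseq.
Qed.
Lemma fd_f5 i j : (i.+1 < N)%N -> (j.+1 < n)%N -> fd i * f5 j = f5 j * fd i.
Proof.
move=> h1 h2; apply: (E_comm (l := [::]) (m := nseq N true ++ nseq n false) (r := [::]) _ h1 h2) => //.
  by rewrite S1E cats0 -!catA.
by rewrite size_Lb size_cat !size_nseq /= ?addnA.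
Qed.
Lemma fu_f4 i j : (i.+1 < N)%N -> (j.+1 < n)%N -> fu i * f4 j = f4 j * fu i.
Proof.
move=> h1 h2; apply: (E_comm (l := nseq N false) (m := [::]) S1E h1 h2).
  by rewrite size_nseq.
by rewrite size_Lb size_nseq addn0.
Qed.
Lemma fu_f5 i j : (i.+1 < N)%N -> (j.+1 < n)%N -> fu i * f5 j = f5 j * fu i.
Proof.
move=> h1 h2; apply: (E_comm (l := nseq N false) (m := nseq n false) (r := [::]) _ h1 h2).
- by rewrite S1E cats0.
- by rewrite size_nseq.
- by rewrite size_Lb !size_nseq.
Qed.
Lemma f4_f5 i j : (i.+1 < n)%N -> (j.+1 < n)%N -> f4 i * f5 j = f5 j * f4 i.
Proof. exact: (@EdEu false). Qed.

(** The clasps on the six bundles, from left to right. *)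
Definition Qc (i : nat) : 'R :=
  match i with
  | 0 => clasp_at v0 fd 0 n | 1 => clasp_at v0 fd n n
  | 2 => clasp_at v0 fu 0 n | 3 => clasp_at v0 fu n n
  | 4 => clasp_at v0 f4 0 n | 5 => clasp_at v0 f5 0 n
  | _ => 1
  end.

Lemma Qc_comm i j : Qc i * Qc j = Qc j * Qc i.
Proof.
have c01 : clasp_at v0 fd 0 n * clasp_at v0 fd n n = clasp_at v0 fd n n * clasp_at v0 fd 0 n.
  by apply: (clasp_clasp_comm fd_hecke); lia.
have c23 : clasp_at v0 fu 0 n * clasp_at v0 fu n n = clasp_at v0 fu n n * clasp_at v0 fu 0 n.
  by apply: (clasp_clasp_comm fu_hecke); lia.
have du s t : (s <= n)%N -> (t <= n)%N -> clasp_at v0 fd s n * clasp_at v0 fu t n = clasp_at v0 fu t n * clasp_at v0 fd s n.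
  by move=> *; apply: clasps_comm => *; apply: fd_fu; lia.
have d4 s : (s <= n)%N -> clasp_at v0 fd s n * clasp_at v0 f4 0 n = clasp_at v0 f4 0 n * clasp_at v0 fd s n.
  by move=> *; apply: clasps_comm => *; apply: fd_f4; lia.
have d5 s : (s <= n)%N -> clasp_at v0 fd s n * clasp_at v0 f5 0 n = clasp_at v0 f5 0 n * clasp_at v0 fd s n.
  by move=> *; apply: clasps_comm => *; apply: fd_f5; lia.
have u4 s : (s <= n)%N -> clasp_at v0 fu s n * clasp_at v0 f4 0 n = clasp_at v0 f4 0 n * clasp_at v0 fu s n.
  by move=> *; apply: clasps_comm => *; apply: fu_f4; lia.
have u5 s : (s <= n)%N -> clasp_at v0 fu s n * clasp_at v0 f5 0 n = clasp_at v0 f5 0 n * clasp_at v0 fu s n.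
  by move=> *; apply: clasps_comm => *; apply: fu_f5; lia.
have c45 : clasp_at v0 f4 0 n * clasp_at v0 f5 0 n = clasp_at v0 f5 0 n * clasp_at v0 f4 0 n.
  by apply: clasps_comm => *; apply: f4_f5; lia.
by case: i => [|[|[|[|[|[|i]]]]]]; case: j => [|[|[|[|[|[|j]]]]]]; rewrite /Qc ?mulr1 ?mul1r ?du ?d4 ?d5 ?u4 ?u5.
Qed.
Lemma Qc_idem i : Qc i * Qc i = Qc i.
Proof.
have I (e : nat -> 'R) s M : hecke v0 e M -> (s + n <= M)%N -> clasp_at v0 e s n * clasp_at v0 e s n = clasp_at v0 e s n.
  by move=> eH sM; apply: (clasp_idem v0_generic eH).
case: i => [|[|[|[|[|[|i]]]]]]; rewrite ?mul1r //; by [apply: (I _ _ _ fd_hecke); lia|apply: (I _ _ _ fu_hecke); lia|apply: (I _ _ _ f4_hecke); lia|apply: (I _ _ _ f5_hecke); lia].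
Qed.

(** The nested arcs below the columns, and those above them. *)
Definition Psi : 'R := CU true (nseq N false ++ nseq n true) (nseq n true) 0 0 n * CU false [::] [::] 0 0 N.
Definition Ome : 'R := CA false [::] [::] 0 0 N * CA true (nseq N false ++ nseq n true) (nseq n true) 0 0 n.
Local Notation M1 := (Sec true (nseq N false ++ nseq n true) (nseq n true) 0 0).
Local Notation Cn := (CU true (nseq N false ++ nseq n true) (nseq n true) 0 0 n).
Local Notation Fn := (CA true (nseq N false ++ nseq n true) (nseq n true) 0 0 n).
Lemma M1E : M1 = Sec false [::] [::] N N. Proof. by rewrite /Sec; lsteq. Qed.
Lemma S1E' : S1 = Sec true (nseq N false ++ nseq n true) (nseq n true) n n.
Proof. by rewrite /Sec /Lb /=; lsteq. Qed.

Lemma CnE : Cn = w M1 (shift (N + n) (cupw true n)).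
Proof. by rewrite CU_w size_cat !size_nseq addn0. Qed.
Lemma FnE : Fn = w S1 (shift (N + n) (capw true n)).
Proof. by rewrite CA_w size_cat !size_nseq addn0 !add0n -S1E'. Qed.

Lemma Cn_left o A m l i : nseq N false ++ nseq n true = l ++ nseq A o ++ m ->
  (i.+1 < A)%N -> E o S1 (size l + i) * Cn = Cn * E o M1 (size l + i) /\
                  Fn * E o S1 (size l + i) = E o M1 (size l + i) * Fn.
Proof.
move=> ML iA; rewrite CnE FnE.
have sz : (size l + A + size m)%N = (N + n)%N.
  by have := congr1 size ML; rewrite !size_cat !size_nseq; lia.
have ME : M1 = l ++ nseq A o ++ m ++ nseq n true by rewrite /Sec /= ML -!catA.
have S1' : S1 = l ++ nseq A o ++ m ++ nseq n true ++ nseq n false ++ nseq n true.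
  by rewrite S1E' /Sec ML -!catA.
split.
  apply/esym; apply: (@efar_l o (cupw true n) _ _ (l ++ nseq i o) (nseq (A - i - 2) o ++ m) (nseq n true) _ _ _ _ (run_cupw true n)).
  - by rewrite ME ?consE; sec.
  - by rewrite S1' ?consE; sec.
  - by sec.
  - by rewrite !size_cat !size_nseq; lia.
apply: (@efar_l o (capw true n) _ _ (l ++ nseq i o) (nseq (A - i - 2) o ++ m) (nseq n true) _ _ _ _ (run_capw true n)).
- by rewrite S1' ?consE; sec.
- by rewrite ME ?consE; sec.
- by sec.
- by rewrite !size_cat !size_nseq; lia.
Qed.

Lemma Cn_right i : (i.+1 < n)%N -> f5 i * Cn = Cn * E true M1 (N + n + i) /\
  Fn * f5 i = E true M1 (N + n + i) * Fn.
Proof.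
move=> iN; rewrite CnE FnE /f5 EEE; split.
  apply/esym; apply: (@efar_r true (cupw true n) _ _ (nseq N false ++ nseq n true) (nseq i true) (nseq (n - i - 2) true) _ _ _ _ _ (run_cupw true n)).
  - by rewrite /Sec ?consE; sec.
  - by rewrite S1E' /Sec ?consE; sec.
  - by sec.
  - by sec.
  - by rewrite size_Lb; sec.
apply: (@efar_r true (capw true n) _ _ (nseq N false ++ nseq n true) (nseq i true) (nseq (n - i - 2) true) _ _ _ _ _ (run_capw true n)).
- by rewrite S1E' /Sec ?consE; sec.
- by rewrite /Sec ?consE; sec.
- by sec.
- by rewrite size_Lb; sec.
- by sec.
Qed.

(** The outer arcs join the first bundle to the last one. *)
Lemma nest05 i : (i.+1 < n)%N -> fd i * Psi = f5 (n - i.+2) * Psi /\ Ome * fd i = Ome * f5 (n - i.+2).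
Proof.
move=> iN; have h : nseq N false ++ nseq n true = [::] ++ nseq N false ++ nseq n true by [].
have [e1 e2] := Cn_left h (i := i) ltac:(lia).
have [e3 e4] := @Cn_right (n - i.+2) ltac:(lia).
have k0 : (i.+1 < N)%N by lia.
have k1 : (size (Nil bool) + (N + N - 2 - i) = N + n + (n - i.+2))%N by rewrite /=; lia.
rewrite /Psi /Ome !mulrA e3 -(mulrA _ Fn (f5 _)) e4 /fd EEE e1 -[(_ * Fn) * _]mulrA e2.
rewrite M1E -!mulrA (E_CU _ _ _ k0) k1 !mulrA (CA_E _ _ _ k0) k1.
by split.
Qed.

Lemma nest12 i : (i.+1 < n)%N -> fd (n + i) * Psi = fu (n - i.+2) * Psi /\
  Ome * fd (n + i) = Ome * fu (n - i.+2).
Proof.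
move=> iN; have h : nseq N false ++ nseq n true = [::] ++ nseq N false ++ nseq n true by [].
have [e1 e2] := Cn_left h (i := n + i) ltac:(lia).
have h' : nseq N false ++ nseq n true = nseq N false ++ nseq n true ++ [::] by rewrite cats0.
have [e3 e4] := Cn_left h' (i := n - i.+2) ltac:(lia).
have k0 : ((n + i).+1 < N)%N by lia.
have k1 : (size (Nil bool) + (N + N - 2 - (n + i)) = N + (n - i.+2))%N by rewrite /=; lia.
rewrite size_nseq in e3 e4.
rewrite /Psi /Ome !mulrA /fu EEE e3 -(mulrA _ Fn (E true _ _)) e4 /fd EEE e1 -[(_ * Fn) * _]mulrA e2.
rewrite M1E -!mulrA (E_CU _ _ _ k0) k1 !mulrA (CA_E _ _ _ k0) k1.
by split.
Qed.

Lemma nest43 i : (i.+1 < n)%N -> f4 i * Psi = fu (n + (n - i.+2)) * Psi /\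
  Ome * f4 i = Ome * fu (n + (n - i.+2)).
Proof.
move=> iN; have k0 : ((n - i.+2).+1 < n)%N by lia.
have e1 := E_CU true (nseq N false ++ nseq n true) (nseq n true) k0.
have e2 := CA_E true (nseq N false ++ nseq n true) (nseq n true) k0.
rewrite -S1E' size_cat !size_nseq in e1 e2.
have k1 : (N + n + (n - i.+2) = N + (n + (n - i.+2)))%N by lia.
have k2 : (N + n + (n + n - 2 - (n - i.+2)) = size Lb + i)%N by rewrite size_Lb; lia.
rewrite k1 k2 in e1 e2.
by rewrite /Psi /Ome !mulrA /fu /f4 !EEE e1 -!(mulrA (CA false _ _ _ _ _)) e2.
Qed.

Lemma Q05 : Qc 0 * Psi = Qc 5 * Psi /\ Ome * Qc 0 = Ome * Qc 5.
Proof.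
have c i j : (0 <= i)%N -> (i.+1 < 0 + n)%N -> (0 <= j)%N -> (j.+1 < 0 + n)%N ->
    fd i * flip n f5 j = flip n f5 j * fd i by move=> *; rewrite /flip fd_f5 //; lia.
have F : clasp_at v0 (flip n f5) 0 n = Qc 5.
  by rewrite (flip_clasp v0_generic f5_hecke) ?add0n // subn0 subnn.
rewrite -F; split; [apply: nest_claspl|apply: nest_claspr] => // i _ iN; by have [] := nest05 iN.
Qed.
Lemma Q12 : Qc 1 * Psi = Qc 2 * Psi /\ Ome * Qc 1 = Ome * Qc 2.
Proof.
have c i j : (n <= i)%N -> (i.+1 < n + n)%N -> (n <= j)%N -> (j.+1 < n + n)%N ->
    fd i * flip N fu j = flip N fu j * fd i by move=> *; rewrite /flip fd_fu //; lia.
have F : clasp_at v0 (flip N fu) n n = Qc 2.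
  by rewrite (flip_clasp v0_generic fu_hecke) // addnK subnn.
have r i : (n <= i)%N -> (i.+1 < n + n)%N -> fd i * Psi = flip N fu i * Psi /\ Ome * fd i = Ome * flip N fu i.
  move=> h1 h2; have := @nest12 (i - n) ltac:(lia).
  by rewrite subnKC // /flip (_ : n - (i - n).+2 = N - i.+2)%N //; lia.
by rewrite -F; split; [apply: nest_claspl|apply: nest_claspr] => // i h1 h2; have [] := r i h1 h2.
Qed.
Lemma Q34 : Qc 3 * Psi = Qc 4 * Psi /\ Ome * Qc 3 = Ome * Qc 4.
Proof.
have c i j : (0 <= i)%N -> (i.+1 < 0 + n)%N -> (0 <= j)%N -> (j.+1 < 0 + n)%N ->
    f4 i * flip N fu j = flip N fu j * f4 i by move=> *; rewrite /flip fu_f4 //; lia.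
have F : clasp_at v0 (flip N fu) 0 n = Qc 3.
  by rewrite (flip_clasp v0_generic fu_hecke) // ?leq_addl // subn0 addnK.
have r i : (0 <= i)%N -> (i.+1 < 0 + n)%N -> f4 i * Psi = flip N fu i * Psi /\ Ome * f4 i = Ome * flip N fu i.
  move=> _ h2; have := nest43 h2.
  by rewrite /flip (_ : n + (n - i.+2) = N - i.+2)%N //; lia.
rewrite -F; split; apply/esym; [apply: nest_claspl|apply: nest_claspr] => // i h1 h2; by have [] := r i h1 h2.
Qed.

End Pretzel.

Fixpoint xrow (g : gen) k : diagram := if k is k'.+1 then (k', g) :: xrow g k' else [::].
(** The cable of a crossing g between bundles of a and b strands. *)
Fixpoint xgrid (g : gen) a b : diagram := if b is b'.+1 then xgrid g a b' ++ shift b' (xrow g a) else [::].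
Lemma xgridE o a b : xgrid (Cr o) a b = gridw o a b.
Proof.
elim: b => //= b ->; congr (_ ++ shift b _).
by elim: a => //= a ->.
Qed.
Lemma xrowE g k : xrow g k = [seq (j, g) | j <- rev (iota 0 k)].
Proof. by elim: k => // k IH; rewrite -addn1 iotaD rev_cat map_cat -IH addn1. Qed.
Lemma cable_cross n i b o1 o2 :
  cable_slice n (i, Cross b o1 o2) = shift (n * i) (xgrid (Cross b o1 o2) n n).
Proof.
rewrite /cable_slice; set g := Cross b o1 o2.
suff H m : [seq ((n * i + j + k)%N, g) | j <- iota 0 m, k <- rev (iota 0 n)] =
    shift (n * i) (xgrid g n m) by exact: H.
elim: m => // m IH; rewrite -[in LHS]addn1 iotaD allpairs_cat IH add0n.
rewrite -[xgrid g n m.+1]/(xgrid g n m ++ shift m (xrow g n)) shift_cat; congr (_ ++ _).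
rewrite /= cats0 xrowE shift_shift /shift -map_comp.
by apply: eq_map => k.
Qed.

Lemma run_cross1 o l M r i : (i.+1 < M)%N ->
  run (shift (size l + i) [:: (0%N, Cross true o o)]) (l ++ nseq M o ++ r) = Some (l ++ nseq M o ++ r).
Proof.
move=> iM; apply: (@run_sub _ [:: o; o] [:: o; o] (l ++ nseq i o) (nseq (M - i - 2) o ++ r)); rewrite ?consE; try sec.
by case: o.
Qed.

Section CrossingGrid.
Variables (o : bool) (S l r : seq bool) (M p : nat).
Hypotheses (SE : S = l ++ nseq M o ++ r) (pE : p = size l).
Local Notation e := (EE o S p).
Local Notation W := (w S [::]).
Let e_w i : (i.+1 < M)%N -> e i * W = W * e i.
Proof.
by move=> iM; rewrite /EE w1r w1l // SE pE run_EE.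
Qed.
Let WW : W * W = W. Proof. by rewrite w1r. Qed.

Lemma xrow_w s a : (s + a < M)%N ->
  run (shift (p + s) (xrow (Cross true o o) a)) S = Some S /\
  w S (shift (p + s) (xrow (Cross true o o) a)) = (q6 (-1) : Kq) ^+ a *: (chain v0 e s a * W).
Proof.
elim: a => [|a IH] sa; first by split=> //; rewrite expr0 scale1r mul1r.
have [IH1 IH2] := IH ltac:(lia).
rewrite -[xrow _ a.+1]/([:: (a, Cross true o o)] ++ xrow (Cross true o o) a) shift_cat shift1E.
have E1 : [:: ((p + s + a)%N, Cross true o o)] = shift (p + (s + a)) [:: (0%N, Cross true o o)].
  by rewrite shift1E addn0 addnA.
have R1 : run [:: ((p + s + a)%N, Cross true o o)] S = Some S.
  by rewrite E1 SE pE run_cross1 //; lia.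
rewrite (run_cats _ R1); split=> //.
rewrite -(w_cat _ R1) E1 IH2.
rewrite (crossP_w (o := o) (l := l ++ nseq (s + a) o) (r := nseq (M - (s + a) - 2) o ++ r)).
- rewrite chainS zmr zml scalerA -exprS; congr (_ *: _).
  rewrite -[w S (shift _ (Eo o))]/(e (s + a)) -!mulrA; congr (_ * _).
  rewrite mulrBr zmr WW -e_w; last by lia.
  by rewrite /braid_gen mulrBl mulr_algl.
- by rewrite SE ?consE; sec.
- by rewrite pE; sec.
Qed.

(** Each crossing is a braid generator up to the scalar q^(-1/6). *)
Lemma xgrid_w a b : (a + b <= M)%N ->
  run (shift p (xgrid (Cross true o o) a b)) S = Some S /\
  w S (shift p (xgrid (Cross true o o) a b)) = (q6 (-1) : Kq) ^+ (a * b) *: (bgrid v0 e 0 a b * W).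
Proof.
elim: b => [|b IH] ab; first by split=> //; rewrite muln0 expr0 scale1r mul1r.
have [IH1 IH2] := IH ltac:(lia).
rewrite -[xgrid _ a b.+1]/(xgrid (Cross true o o) a b ++ shift b (xrow (Cross true o o) a)) shift_cat shift_shift.
have [|h1 h2] := @xrow_w b a; first by lia.
rewrite (run_cats _ IH1); split=> //.
rewrite -(w_cat _ IH1) h2 IH2 zml zmr scalerA -exprD mulnS [(a + _)%N]addnC addnC; congr (_ *: _).
rewrite -mulrA (mulrA W) -bgrid_comm ?mulrA => [|i _ iM]; last by apply: e_w; lia.
by rewrite -mulrA WW.
Qed.
End CrossingGrid.

Section Value.
Definition ground_fun (S : seq bool) (T : diagram) : Kq := if S == [::] then bval T else 0.
Fact ground_state S : is_state S (ground_fun S).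
Proof.
case: S => [|x S]; last exact: is_state0.
exists [:: (1, [::])] => //; apply/funext => T; rewrite /ground_fun /=.
by rewrite big_cons big_nil mul1r addr0.
Qed.
(** The bracket of an operator between empty sections, recovered by applying it
    to the empty diagram. *)
Definition val (f : 'R) : Kq := f (States ground_state) [::] [::].
Lemma valZ a f : val (a *: f) = a * val f. Proof. by rewrite /val lendZE statesZE. Qed.
Lemma val_sum (I : Type) (s : seq I) (f : I -> 'R) : val (\sum_(i <- s) f i) = \sum_(i <- s) val (f i).
Proof. by rewrite /val lend_sumE states_sumE. Qed.
Lemma val_w W : run W [::] = Some [::] -> val (w [::] W) = A2_bracket W.
Proof. by move=> RW; rewrite /val wE RW eqxx /= /ground_fun /= cats0 /bval RW eqxx. Qed.
End Value.

Lemma eq_big_all (V : zmodType) (T : Type) (P : pred T) (s : seq T) (f g : T -> V) :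
  all P s -> (forall x, P x -> f x = g x) -> \sum_(x <- s) f x = \sum_(x <- s) g x.
Proof.
move=> Ps fg; elim: s Ps => [|x s IH] /=; first by rewrite !big_nil.
by case/andP=> Px Ps; rewrite !big_cons fg // IH.
Qed.
Lemma all_allpairs2 (T T' : Type) (P : pred T) (Q : pred T') (f : T -> T -> T') (s t : seq T) :
  all P s -> all P t -> (forall x y, P x -> P y -> Q (f x y)) -> all Q [seq f x y | x <- s, y <- t].
Proof.
move=> Ps Pt PQ; elim: s Ps => //= x s IH /andP[Px Ps]; rewrite all_cat IH // andbT all_map.
by elim: t Pt {IH} => //= y t IHt /andP[Py Pt]; rewrite PQ // IHt.
Qed.

Section ClaspSum.
Variables (S l r : seq bool) (M p : nat).
Hypotheses (SE : S = l ++ nseq M true ++ r) (pE : p = size l).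
(** The expansion of the clasp as a combination of diagrams follows the same
    recursion as the algebraic clasp. *)
Lemma clasp_sum m : (m <= M)%N ->
  all (fun x => run (shift p x.2) S == Some S) (clasp m) /\
  \sum_(x <- clasp m) (x.1 : Kq) *: w S (shift p x.2) = clasp_at v0 (EE true S p) 0 m * w S [::].
Proof.
elim: m => [|m IH] mM; first by rewrite /= eqxx big_cons big_nil addr0 scale1r clasp_at0 mul1r.
case: m IH mM => [|m] IH mM; first by rewrite /= eqxx big_cons big_nil addr0 scale1r clasp_at1 mul1r.
have [A1 E1] := IH (ltnW mM).
have RE : run (shift (p + m) (Eo true)) S = Some S by rewrite SE pE run_EE.
have -> : clasp m.+2 = clasp m.+1 ++ [seq (- (qint m.+1 / qint m.+2) * x.1 * y.1,
   x.2 ++ shift m (Eo true) ++ y.2) | x <- clasp m.+1, y <- clasp m.+1] by [].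
move: (clasp m.+1) A1 E1 => s A1 E1.
have H x y : run (shift p x) S = Some S -> run (shift p y) S = Some S ->
    run (shift p (x ++ shift m (Eo true) ++ y)) S = Some S /\
    w S (shift p (x ++ shift m (Eo true) ++ y)) = w S (shift p y) * (EE true S p m * w S (shift p x)).
  move=> Rx Ry; rewrite !shift_cat shift_shift (run_cats _ Rx) (run_cats _ RE) Ry; split=> //.
  by rewrite -(w_cat _ Rx) -(w_cat _ RE) mulrA.
split.
  rewrite all_cat A1 /=; apply: (all_allpairs2 A1 A1) => x y /eqP Rx /eqP Ry /=.
  by have [-> _] := H _ _ Rx Ry.
rewrite big_cat big_allpairs_dep clasp_atS mulrBl [LHS]/(_ + _) E1; apply: congr1.
transitivity (- (qn v0 m.+1 / qn v0 m.+2) *: ((\sum_(y <- s) (y.1 : Kq) *: w S (shift p y.2)) *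
   (EE true S p m * (\sum_(x <- s) (x.1 : Kq) *: w S (shift p x.2))))); last first.
  rewrite E1 -!mulrA scaleNr zml add0n /= -!mulrA; congr (- (_ *: (_ * _))).
  rewrite (mulrA (w S [::])) (_ : w S [::] * _ = EE true S p m); last by rewrite /EE (w1l RE).
  by [].
rewrite !mulr_sumr scaler_sumr; apply: (eq_big_all A1) => x /eqP Rx.
rewrite mulr_suml scaler_sumr; apply: (eq_big_all A1) => y /eqP Ry.
have [_ ->] := H _ _ Rx Ry.
rewrite !zmr !zml !scalerA -!qintE; congr (_ *: _).
by rewrite mulrA.
Qed.
End ClaspSum.

Lemma cable_cat n D1 D2 : cable n (D1 ++ D2) = cable n D1 ++ cable n D2.
Proof. by rewrite /cable map_cat flatten_cat. Qed.
Lemma cable_cons n x D : cable n (x :: D) = cable_slice n x ++ cable n D. Proof. by []. Qed.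
Lemma cable_cup n i o : cable_slice n (i, Cup o) = shift (n * i) (cupw o n).
Proof. by rewrite cupwE /shift -map_comp. Qed.
Lemma cable_cap n i o : cable_slice n (i, Cap o) = shift (n * i) (capw o n).
Proof. by rewrite capwE /shift -map_comp. Qed.

Section Columns.
Variable n : nat.
Local Notation N := (n + n)%N.
Local Notation S1' := (Sec false (Lb n) [::] n n).

Lemma col_w o l r i m : S1' = l ++ nseq N o ++ r -> (n * i)%N = size l ->
  run (cable n (twist m i true o o)) S1' = Some S1' /\
  w S1' (cable n (twist m i true o o)) =
    (q6 (-1) : Kq) ^+ (n * n * m) *: (bgrid v0 (EE o S1' (size l)) 0 n n ^+ m * w S1' [::]).
Proof.
move=> SE iE; elim: m => [|m [IH1 IH2]]; first by split=> //; rewrite muln0 !expr0 scale1r mul1r.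
rewrite -[twist m.+1 i true o o]/((i, Cross true o o) :: twist m i true o o) cable_cons cable_cross iE.
have [h1 h2] := xgrid_w SE erefl (leqnn N).
rewrite (run_cats _ h1); split=> //.
rewrite -(w_cat _ h1) h2 IH2 zmr zml scalerA -exprD mulnS; congr (_ *: _).
set g := bgrid _ _ _ _ _.
have gw : g * w S1' [::] = w S1' [::] * g.
  by apply: bgrid_comm => k _ kN; rewrite /EE w1r w1l // SE run_EE.
by rewrite exprSr -!mulrA; congr (_ * _); rewrite mulrA -gw -mulrA w1r.
Qed.

Lemma col4_w m : run (cable n (twist (2 * m) 4 true false true)) S1' = Some S1' /\
  w S1' (cable n (twist (2 * m) 4 true false true)) = XX false (Lb n) [::] n n ^+ m * w S1' [::].
Proof.
elim: m => [|m [IH1 IH2]]; first by split=> //; rewrite mul1r.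
rewrite mulnS -[twist _ _ _ _ _]/((4%N, Cr false) :: (4%N, Cr true) :: twist (2 * m) 4 true false true).
rewrite !cable_cons !cable_cross catA -shift_cat !xgridE.
have -> : (n * 4)%N = size (Lb n) by rewrite size_Lb; lia.
have h1 := run_XX false (Lb n) [::] n n.
rewrite (run_cats _ h1); split=> //.
rewrite -(w_cat _ h1) IH2 -/(XX false (Lb n) [::] n n) exprSr -!mulrA; congr (_ * _).
by rewrite /XX w1l // w1r.
Qed.

Lemma cups_w : run (cable n [:: (0, Cup false); (1, Cup false); (3, Cup true)]%N) [::] = Some S1' /\
  w [::] (cable n [:: (0, Cup false); (1, Cup false); (3, Cup true)]%N) = Psi n.
Proof.
rewrite !cable_cons !cable_cup muln0 muln1 shift0 cats0 catA -cupwD.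
have h1 := run_cupw false N; rewrite (run_cats _ h1) -(w_cat _ h1).
have E3 : (n * 3 = N + n)%N by lia.
split.
  by rewrite E3; apply: (@run_sub _ [::] _ (nseq N false ++ nseq n true) (nseq n true) _ _ _ (run_cupw true n)); rewrite /Sec /Lb; sec.
rewrite /Psi CnE CU_w E3 (_ : Sec true (nseq N false ++ nseq n true) (nseq n true) 0 0 = nseq N false ++ nseq N true) //.
  by rewrite shift0.
by rewrite /Sec; lsteq.
Qed.
Lemma caps_w : run (cable n [:: (3, Cap true); (1, Cap false); (0, Cap false)]%N) S1' = Some [::] /\
  w S1' (cable n [:: (3, Cap true); (1, Cap false); (0, Cap false)]%N) = Ome n.
Proof.
rewrite !cable_cons !cable_cap muln0 muln1 shift0 cats0 -capwD.
have E3 : (n * 3 = N + n)%N by lia.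
have h1 : run (shift (N + n) (capw true n)) S1' = Some (nseq N false ++ nseq N true).
  by apply: (@run_sub _ _ [::] (nseq N false ++ nseq n true) (nseq n true) _ _ _ (run_capw true n)); rewrite /Sec /Lb; sec.
rewrite E3 (run_cats _ h1) -(w_cat _ h1); split; first exact: run_capw.
rewrite /Ome FnE CA_w addn0 -[size _]/0%N shift0; congr (w _ _ * _).
by rewrite /Sec !add0n cats0.
Qed.
End Columns.

Lemma iter_mul (R : nzRingType) (x y : R) k : iter k ( *%R x) y = x ^+ k * y.
Proof. by elim: k => [|k IH] /=; [rewrite mul1r|rewrite IH mulrA -exprS]. Qed.
Lemma iter_idem (R : nzRingType) (g l : R) k : g * l = l * g -> l * l = l ->
  iter k ( *%R (g * l)) l = g ^+ k * l.
Proof.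
move=> gl ll; elim: k => [|k IH] /=; first by rewrite mul1r.
by rewrite IH -mulrA (mulrA l) (commrX k (esym gl)) -mulrA ll mulrA -exprS.
Qed.
(** An odd number of crossings exchanges the two bundles of a column. *)
Lemma odd_swap (R : nzRingType) (g x y : R) m : g * x = y * g -> g * y = x * g ->
  g ^+ (2 * m + 1) * x = y * g ^+ (2 * m + 1).
Proof.
move=> gx gy; elim: m => [|m IH]; first by rewrite expr1.
rewrite (_ : 2 * m.+1 + 1 = (2 * m + 1).+2)%N; last by lia.
by rewrite !exprS -!mulrA IH (mulrA g y) gy !mulrA gx.
Qed.

Lemma CU_l o l r c a b m : CU o (l ++ nseq c o) r a b m = CU o l r (c + a) b m.
Proof.
rewrite !CU_w size_cat size_nseq -addnA (_ : Sec o (l ++ nseq c o) r a b = Sec o l r (c + a) b) //.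
by rewrite /Sec; lsteq.
Qed.
Lemma CA_l o l r c a b m : CA o (l ++ nseq c o) r a b m = CA o l r (c + a) b m.
Proof.
rewrite !CA_w size_cat size_nseq -addnA (_ : Sec o (l ++ nseq c o) r (a + m) (b + m) = Sec o l r (c + a + m) (b + m)) //.
by rewrite /Sec; lsteq.
Qed.

Section Evaluate.
Variable n : nat.
Hypothesis n0 : (0 < n)%N.
Local Notation N := (n + n)%N.
Local Notation L := (Lb n).
Local Notation S1 := (Sec false L [::] n n).
Local Notation Q := (Qc n).
Local Notation X := (XX false L [::] n n).
Local Notation gA := (bgrid v0 (fd n) 0 n n).
Local Notation gB := (bgrid v0 (fu n) 0 n n).

Lemma left_comm o A l m i D s s' : L = l ++ nseq A o ++ m -> (i.+1 < A)%N -> run D s = Some s' ->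
  w (L ++ s) (shift (size L) D) * E o (L ++ s) (size l + i) =
  E o (L ++ s') (size l + i) * w (L ++ s) (shift (size L) D).
Proof.
move=> LE iA RD.
apply: (@efar_l o D _ _ (l ++ nseq i o) (nseq (A - i - 2) o ++ m) [::] _ _ _ _ RD).
- by rewrite LE ?consE cats0; sec.
- by rewrite LE ?consE cats0; sec.
- by sec.
- by rewrite LE !size_cat !size_nseq; lia.
Qed.
Lemma left_fd i D s s' : (i.+1 < N)%N -> run D s = Some s' ->
  w (L ++ s) (shift (size L) D) * EE false (L ++ s) 0 i = EE false (L ++ s') 0 i * w (L ++ s) (shift (size L) D).
Proof. by move=> iN RD; exact: (left_comm (l := [::]) (m := nseq N true) erefl iN RD). Qed.
Lemma left_fu i D s s' : (i.+1 < N)%N -> run D s = Some s' ->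
  w (L ++ s) (shift (size L) D) * EE true (L ++ s) N i = EE true (L ++ s') N i * w (L ++ s) (shift (size L) D).
Proof.
move=> iN RD; have LE : L = nseq N false ++ nseq N true ++ [::] by rewrite cats0.
by have := left_comm LE iN RD; rewrite size_nseq.
Qed.

Lemma X_Q i : X * Q i = Q i * X.
Proof.
have RX : run (gridw false n n ++ gridw true n n) (nseq n false ++ nseq n true ++ [::]) = Some (nseq n false ++ nseq n true ++ [::]).
  by rewrite cats0 (run_cats _ (run_gridw0 false n n)) (run_gridw0 true n n).
have Xd i' : (i'.+1 < N)%N -> X * fd n i' = fd n i' * X by move=> h; exact: left_fd h RX.
have Xu i' : (i'.+1 < N)%N -> X * fu n i' = fu n i' * X by move=> h; exact: left_fu h RX.
case: i => [|[|[|[|[|[|i]]]]]]; rewrite /Qc ?mulr1 ?mul1r //; apply/esym/clasp_comm => j h1 h2; apply/esym.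
- by apply: Xd; lia.
- by apply: Xd; lia.
- by apply: Xu; lia.
- by apply: Xu; lia.
- by apply: XX_ed; lia.
- by apply: XX_eu; lia.
Qed.

Lemma gA_Q i : (1 < i)%N -> gA * Q i = Q i * gA.
Proof.
move=> i1; apply: bgrid_comm => j _ jN; apply/esym.
case: i i1 => [|[|[|[|[|[|i]]]]]] // _; rewrite /Qc ?mulr1 ?mul1r //; apply/clasp_comm => k h1 h2; apply/esym.
- by apply: fd_fu; lia.
- by apply: fd_fu; lia.
- by apply: fd_f4; lia.
- by apply: fd_f5; lia.
Qed.
Lemma gB_Q i : (i < 2)%N || (3 < i)%N -> gB * Q i = Q i * gB.
Proof.
move=> i1; apply: bgrid_comm => j _ jN; apply/esym.
case: i i1 => [|[|[|[|[|[|i]]]]]] // _; rewrite /Qc ?mulr1 ?mul1r //; apply/clasp_comm => k h1 h2.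
- by apply: fd_fu; lia.
- by apply: fd_fu; lia.
- by apply/esym/fu_f4; lia.
- by apply/esym/fu_f5; lia.
Qed.

Lemma Q01 : Q 0 * Q 1 = ladder v0 (fd n) N n. Proof. by rewrite ladderE addnK. Qed.
Lemma Q23 : Q 2 * Q 3 = ladder v0 (fu n) N n. Proof. by rewrite ladderE addnK. Qed.

(** The clasps are absorbed, so the powers of the grid are computed on
    eigenvalues. *)
Lemma grid_rep (e : nat -> 'R) a : hecke v0 e N ->
  rep v0 e n n n.+1 (level v0 n n) (bgrid v0 e 0 n n ^+ a * ladder v0 e N n) (fun u => twist_eig v0 n u ^+ a).
Proof.
move=> eH; have lE : ladder v0 e N n = clasp_at v0 e 0 n * clasp_at v0 e n n by rewrite ladderE addnK.
have c01 : clasp_at v0 e 0 n * clasp_at v0 e n n = clasp_at v0 e n n * clasp_at v0 e 0 n.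
  by apply: (clasp_clasp_comm eH); lia.
rewrite -iter_idem; first last.
- by apply: (lad_idem v0_generic eH); lia.
- rewrite lE mulrA (bgrid_claspl v0_generic eH) // -mulrA (bgrid_claspr v0_generic eH (s := 0) (a := n)) //.
  by rewrite mulrA -c01.
by apply: (rep_exp v0_generic eH); [exact: zspec|exact: rep_braid v0_generic eH].
Qed.

Lemma w1_fd i : (i.+1 < N)%N -> fd n i * w S1 [::] = w S1 [::] * fd n i.
Proof.
by move=> iN; rewrite /fd /EE w1r w1l // S1E (@run_EE false N i [::]).
Qed.
Lemma w1_fu i : (i.+1 < N)%N -> fu n i * w S1 [::] = w S1 [::] * fu n i.
Proof.
move=> iN; have := @run_EE true N i (nseq N false) (nseq n false ++ nseq n true) iN.
by rewrite size_nseq -S1E => h; rewrite /fu /EE w1r w1l.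
Qed.
Lemma CUCA_Q k i : (k <= n)%N -> (i < 4)%N ->
  Q i * (CU false L [::] k k (n - k) * CA false L [::] k k (n - k)) =
  (CU false L [::] k k (n - k) * CA false L [::] k k (n - k)) * Q i.
Proof.
move=> kn i4; have kr : (k + (n - k) = n)%N by rewrite subnKC.
have R1 : run (shift k (cupw false (n - k))) (nseq k false ++ nseq k true ++ [::]) = Some (nseq n false ++ nseq n true ++ [::]).
  by apply: (@run_sub _ [::] _ (nseq k false) (nseq k true) _ _ _ (run_cupw false (n - k))); sec.
have R2 : run (shift k (capw false (n - k))) (nseq n false ++ nseq n true ++ [::]) = Some (nseq k false ++ nseq k true ++ [::]).
  by apply: (@run_sub _ _ [::] (nseq k false) (nseq k true) _ _ _ (run_capw false (n - k))); sec.
rewrite CU_w CA_w kr -!shift_shift.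
set U := w _ (shift (size L) (shift k (cupw _ _))); set V := w _ (shift (size L) (shift k (capw _ _))).
have Cd j : (j.+1 < N)%N -> fd n j * (U * V) = U * V * fd n j.
  move=> jN; have hV : V * fd n j = EE false (Sec false L [::] k k) 0 j * V by exact: left_fd jN R2.
  have hU : U * EE false (Sec false L [::] k k) 0 j = fd n j * U by exact: left_fd jN R1.
  by rewrite mulrA -hU -!mulrA hV.
have Cu j : (j.+1 < N)%N -> fu n j * (U * V) = U * V * fu n j.
  move=> jN; have hV : V * fu n j = EE true (Sec false L [::] k k) N j * V by exact: left_fu jN R2.
  have hU : U * EE true (Sec false L [::] k k) N j = fu n j * U by exact: left_fu jN R1.
  by rewrite mulrA -hU -!mulrA hV.
by case: i i4 => [|[|[|[|i]]]] // _; apply: clasp_comm => j h1 h2; [apply: Cd|apply: Cd|apply: Cu|apply: Cu]; lia.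
Qed.

(** With clasps on all bundles the third column is a power of the full twist and
    can be expanded in nested turnbacks. *)
Lemma spread a b g : Ome n * X ^+ g * gB ^+ (2 * b + 1) * gA ^+ (2 * a + 1) * Q 5 * Psi n =
  \sum_(k < n.+1) twc n g k *:
   (Ome n * (CU false L [::] k k (n - k) * CA false L [::] k k (n - k)) *
     (gB ^+ (2 * b + 1) * (Q 2 * Q 3)) * (gA ^+ (2 * a + 1) * (Q 0 * Q 1)) * Psi n).
Proof.
have [p05 o05] := Q05 n0; have [p12 o12] := Q12 n0; have [p34 o34] := Q34 n0.
have QQ := Qc_comm n0; have Qid := Qc_idem n0.
have A0 : gA ^+ (2 * a + 1) * Q 0 = Q 1 * gA ^+ (2 * a + 1).
  by apply: odd_swap; [exact: (bgrid_claspl v0_generic (fd_hecke n) (s := 0))|exact: (bgrid_claspr v0_generic (fd_hecke n) (s := 0) (a := n))].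
have A1 : gA ^+ (2 * a + 1) * Q 1 = Q 0 * gA ^+ (2 * a + 1).
  by apply: odd_swap; [exact: (bgrid_claspr v0_generic (fd_hecke n) (s := 0) (a := n))|exact: (bgrid_claspl v0_generic (fd_hecke n) (s := 0))].
have B2 : gB ^+ (2 * b + 1) * Q 2 = Q 3 * gB ^+ (2 * b + 1).
  by apply: odd_swap; [exact: (bgrid_claspl v0_generic (fu_hecke n) (s := 0))|exact: (bgrid_claspr v0_generic (fu_hecke n) (s := 0) (a := n))].
have B3 : gB ^+ (2 * b + 1) * Q 3 = Q 2 * gB ^+ (2 * b + 1).
  by apply: odd_swap; [exact: (bgrid_claspr v0_generic (fu_hecke n) (s := 0) (a := n))|exact: (bgrid_claspl v0_generic (fu_hecke n) (s := 0))].
have AQ i : (1 < i)%N -> gA ^+ (2 * a + 1) * Q i = Q i * gA ^+ (2 * a + 1).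
  by move=> i1; apply/esym/commrX/esym/gA_Q.
have BQ i : (i < 2)%N || (3 < i)%N -> gB ^+ (2 * b + 1) * Q i = Q i * gB ^+ (2 * b + 1).
  by move=> i1; apply/esym/commrX/esym/gB_Q.
have GQ i : X ^+ g * Q i = Q i * X ^+ g by apply/esym/commrX/esym/X_Q.
have wQ i : (i < 4)%N -> w S1 [::] * Q i = Q i * w S1 [::].
  case: i => [|[|[|[|i]]]] // _; apply/esym/clasp_comm => j h1 h2.
  - by apply: w1_fd; lia.
  - by apply: w1_fd; lia.
  - by apply: w1_fu; lia.
  - by apply: w1_fu; lia.
have wA : w S1 [::] * gA ^+ (2 * a + 1) = gA ^+ (2 * a + 1) * w S1 [::].
  by apply/commrX/esym/bgrid_comm => j _ jN; exact: w1_fd.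
have wB : w S1 [::] * gB ^+ (2 * b + 1) = gB ^+ (2 * b + 1) * w S1 [::].
  by apply/commrX/esym/bgrid_comm => j _ jN; exact: w1_fu.
rewrite (spread_clasp QQ Qid A0 A1 AQ B3 BQ GQ p05 p12 p34 o05 o12).
move: (gA ^+ _) (gB ^+ _) A0 A1 B2 B3 AQ BQ wA wB => A B A0 A1 B2 B3 AQ BQ wA wB.
have wPsi : w S1 [::] * Psi n = Psi n.
  by rewrite /Psi mulrA; have := w_CU true (nseq N false ++ nseq n true) (nseq n true) 0 0 n; rewrite !add0n -S1E' => ->.
have wY : w S1 [::] * (B * (Q 2 * Q 3) * (A * (Q 0 * Q 1)) * Psi n) =
    B * (Q 2 * Q 3) * (A * (Q 0 * Q 1)) * Psi n.
  have wA' y : w S1 [::] * (A * y) = A * (w S1 [::] * y) by rewrite mulrA wA -mulrA.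
  have wB' y : w S1 [::] * (B * y) = B * (w S1 [::] * y) by rewrite mulrA wB -mulrA.
  have wQ' i y : (i < 4)%N -> w S1 [::] * (Q i * y) = Q i * (w S1 [::] * y).
    by move=> i4; rewrite mulrA wQ // -mulrA.
  by rewrite -!mulrA wB' (wQ' 2) // (wQ' 3) // wA' (wQ' 0) // (wQ' 1) // wPsi.
set Y := B * (Q 2 * Q 3) * (A * (Q 0 * Q 1)) * Psi n in wY.
have ppQ : pp false L [::] n n = Q 4 * Q 5 * w S1 [::] by rewrite ppE.
have := twist_powers false L [::] n g; rewrite iter_mul ppQ => E1.
transitivity (Ome n * (X ^+ g * (Q 4 * Q 5 * w S1 [::])) * Y).
  by rewrite -!mulrA wY /Y -!mulrA.
rewrite E1 mulr_sumr mulr_suml; apply: eq_bigr => k _; rewrite zmr zml; congr (_ *: _).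
have kn : (k <= n)%N by rewrite -ltnS.
rewrite -(spread_absorb QQ Qid A1 AQ B2 BQ p05 p34 o05 o34); last first.
  by move=> i i4; exact: CUCA_Q.
have wCU : w S1 [::] * CU false L [::] k k (n - k) = CU false L [::] k k (n - k).
  by have := w_CU false L [::] k k (n - k); rewrite subnKC.
rewrite /Dm ppQ subKn // -!mulrA wY (mulrA (w S1 [::])) wCU /Y -!mulrA.
by [].
Qed.

(** The turnbacks of the third column straighten some of the arcs above and below
    the other columns; what is left is a closure of two parallel columns. *)
Lemma term_value k a b : (k <= n)%N ->
  Ome n * (CU false L [::] k k (n - k) * CA false L [::] k k (n - k)) *
     (gB ^+ b * (Q 2 * Q 3)) * (gA ^+ a * (Q 0 * Q 1)) * Psi n =
  (\sum_(u < (n - k).+1) qdim v0 n k u *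
     (trs v0 n k (fun u => twist_eig v0 n u ^+ a) u * trs v0 n k (fun u => twist_eig v0 n u ^+ b) u)) *: w [::] [::].
Proof.
move=> kn; have kr : (k + (n - k) = n)%N by rewrite subnKC.
have Ar := grid_rep a (fd_hecke n); have Br := grid_rep b (fu_hecke n).
rewrite Q01 Q23; move: (_ * ladder _ (fd n) _ _) (_ * ladder _ (fu n) _ _) Ar Br => xA xB Ar Br.
have R2 : run (shift k (capw false (n - k))) (nseq n false ++ nseq n true ++ [::]) = Some (nseq k false ++ nseq k true ++ [::]).
  by apply: (@run_sub _ _ [::] (nseq k false) (nseq k true) _ _ _ (run_capw false (n - k))); sec.
have CAdE : CA false L [::] k k (n - k) = w S1 (shift (size L) (shift k (capw false (n - k)))).
  by rewrite CA_w kr -shift_shift.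
have [|xA' Ar' EA] := rep_intertwine (e' := EE false (Sec false L [::] k k) 0) (x := CA false L [::] k k (n - k)) _ Ar.
  by move=> i iN; rewrite CAdE; exact: left_fd iN R2.
have [|xB' Br' EB] := rep_intertwine (e' := EE true (Sec false L [::] k k) N) (x := CA false L [::] k k (n - k)) _ Br.
  by move=> i iN; rewrite CAdE; exact: left_fu iN R2.
have LE : L = (nseq N false ++ nseq n true) ++ nseq n true by rewrite /Lb; lsteq.
have hC : CA false L [::] k k (n - k) * CU true (nseq N false ++ nseq n true) (nseq n true) 0 0 n =
    CU true (nseq N false) (nseq k true) (n + (n - k)) 0 k.
  by have := CA_CU_zig true (nseq N false ++ nseq n true) k (n - k); rewrite kr -LE => ->; rewrite !CU_l addn0.
have hF : CA true (nseq N false ++ nseq n true) (nseq n true) 0 0 n * CU false L [::] k k (n - k) =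
    CA true (nseq N false) (nseq k true) (n + (n - k)) 0 k.
  by have := CA_CU_zig' true (nseq N false ++ nseq n true) k (n - k); rewrite kr -LE => ->; rewrite !CA_l addn0.
have SE : Sec false L [::] k k = Sec true (nseq N false) (nseq k true) N k.
  by rewrite /Sec /Lb /=; lsteq.
rewrite SE in Ar' Br'.
rewrite -(close_k n0 kn Ar' Br') /Ome /Psi -hC -hF -!mulrA; congr (_ * (_ * (_ * _))).
by rewrite (mulrA _ xB) EB -mulrA (mulrA _ xA) EA -!mulrA.
Qed.
End Evaluate.

(** The eigenvalue of m crossings of a parallel column, with the scalars that the
    crossing relation attaches to them. *)
Definition lam n m u : Kq := (q6 (-1) ^+ (n * n) * twist_eig v0 n u) ^+ m.

(** The exact value of the clasped bracket: k is the number of strands that go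
    through the third column, and u runs over the components of the two parallel
    columns after k partial traces. *)
Lemma bracket_value n a b g : (0 < n)%N ->
  clasped_bracket n (pretzel down (2 * a + 1)%N%:Z down up (2 * b + 1)%N%:Z up down (2 * g)%N%:Z up) 3 5 =
  \sum_(k < n.+1) twc n g k * \sum_(u < (n - k).+1) qdim v0 n k u *
     (trs v0 n k (lam n (2 * a + 1)) u * trs v0 n k (lam n (2 * b + 1)) u).
Proof.
move=> n0; rewrite /clasped_bracket /pretzel take_size_cat // drop_size_cat //.
rewrite /column !absz_nat !le0z_nat !cable_cat.
set S1 := Sec false (Lb n) [::] n n; set W := w S1 [::].
have [rP wP] := cups_w n; have [rO wO] := caps_w n.
have S1u : S1 = nseq (n + n) false ++ nseq (n + n) true ++ nseq n false ++ nseq n true := S1E n.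
have i0 : (n * 0 = size (Nil bool))%N by rewrite muln0.
have i2 : (n * 2 = size (nseq (n + n) false))%N by rewrite size_nseq; lia.
have [rA wA] := @col_w n false [::] _ 0 (2 * a + 1) S1u i0.
have [rB wB] := @col_w n true _ _ 2 (2 * b + 1) S1u i2.
have [rX wX] := col4_w n g.
rewrite size_nseq in wB.
set TA := cable n (twist _ 0 _ _ _) in rA wA *; set TB := cable n (twist _ 2 _ _ _) in rB wB *.
set TX := cable n (twist _ 4 _ _ _) in rX wX *; set TO := cable n [:: (3%N, _); _; _] in rO wO *.
set TP := cable n [:: _; _; _] in rP wP *.
have rT : run (TA ++ TB ++ TX ++ TO) S1 = Some [::].
  by rewrite (run_cats _ rA) (run_cats _ rB) (run_cats _ rX).
have wT : w S1 (TA ++ TB ++ TX ++ TO) = Ome n * w S1 TX * w S1 TB * w S1 TA.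
  by rewrite -(w_cat _ rA) -(w_cat _ rB) -(w_cat _ rX) wO.
have SQ : S1 = (Lb n ++ nseq n false) ++ nseq n true ++ [::] by rewrite /S1 /Sec -!catA.
have p5 : (n * 5 = size (Lb n ++ nseq n false))%N by rewrite size_cat size_Lb size_nseq; lia.
have [cR cS] := clasp_sum SQ p5 (leqnn n).
transitivity (val (w S1 (TA ++ TB ++ TX ++ TO) *
    (\sum_(x <- clasp n) (x.1 : Kq) *: w S1 (shift (n * 5) x.2)) * Psi n)).
  rewrite mulr_sumr mulr_suml val_sum; apply: (eq_big_all cR) => x /eqP Rx.
  rewrite zmr zml valZ -mulrA -wP (w_cat _ rP) (w_cat (S' := S1)); last by rewrite (run_cats _ rP).
  by rewrite -catA val_w // (run_cats _ rP) (run_cats _ Rx).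
rewrite cS wT wX wB wA -/W.
have p5' : (n * 5 = size (Lb n) + n)%N by rewrite size_Lb; lia.
rewrite p5' -[clasp_at _ _ _ _]/(Qc n 5).
have WPsi : W * Psi n = Psi n.
  by rewrite /W /Psi mulrA; have := w_CU true (nseq (n + n) false ++ nseq n true) (nseq n true) 0 0 n; rewrite !add0n -S1E' => ->.
have W5 y : W * (Qc n 5 * y) = Qc n 5 * (W * y).
  by rewrite !mulrA; congr (_ * _); have := pu_w false (Lb n) [::] n n.
have WA y m : W * (bgrid v0 (fd n) 0 n n ^+ m * y) = bgrid v0 (fd n) 0 n n ^+ m * (W * y).
  by rewrite !mulrA; congr (_ * _); apply/commrX/esym/bgrid_comm => j _ jN; exact: w1_fd.
have WB y m : W * (bgrid v0 (fu n) 0 n n ^+ m * y) = bgrid v0 (fu n) 0 n n ^+ m * (W * y).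
  by rewrite !mulrA; congr (_ * _); apply/commrX/esym/bgrid_comm => j _ jN; exact: w1_fu.
rewrite -[EE true _ (n + n)]/(fu n) -[EE false _ _]/(fd n) !zmr !zml scalerA -!mulrA WPsi W5 WPsi WA W5 WPsi WB WA W5 WPsi.
have := spread n0 a b g; rewrite -!mulrA => ->.
rewrite valZ val_sum mulr_sumr; apply: eq_bigr => k _.
have kn : (k <= n)%N by rewrite -ltnS.
rewrite (term_value n0) // !valZ val_w // (_ : A2_bracket [::] = 1); last by case: A2_bracketP.
rewrite mulr1 mulrCA; congr (_ * _).
have trsZ m c f u : trs v0 n m (fun u => c * f u) u = c * trs v0 n m f u.
  elim: m u => //= m IH u; rewrite /trace_fun !IH mulrDr; congr (_ + _); exact: mulrCA.
have lamE m : lam n m = (fun u => q6 (-1) ^+ (n * n * m) * twist_eig v0 n u ^+ m).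
  by apply/funext => u; rewrite /lam exprMn -exprM.
rewrite mulr_sumr; apply: eq_bigr => u _; rewrite !lamE !trsZ.
rewrite mulrCA; congr (_ * _).
exact: mulrACA.
Qed.

(** * Integral power series *)

(** Integral polynomials in q, inside rational functions of q^(1/6). *)
Definition ev (p : {poly int}) : Kq := FracField.tofrac (map_poly (intr : int -> rat) p \Po 'X^6).

Lemma evD p r : ev (p + r) = ev p + ev r.
Proof. by rewrite /ev rmorphD comp_polyD rmorphD. Qed.
Lemma evN p : ev (- p) = - ev p.
Proof. by rewrite /ev rmorphN /= raddfN /= rmorphN. Qed.
Lemma evM p r : ev (p * r) = ev p * ev r.
Proof. by rewrite /ev rmorphM comp_polyM rmorphM. Qed.
Lemma ev1 : ev 1 = 1.
Proof. by rewrite /ev rmorph1 comp_polyC rmorph1. Qed.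
Lemma ev0 : ev 0 = 0.
Proof. by rewrite /ev rmorph0 comp_poly0 rmorph0. Qed.
Lemma evX i : ev 'X^i = Qn i.
Proof. by rewrite /ev rmorphXn /= map_polyX comp_Xn_poly -exprM rmorphXn /= /Qn q6_expn Model.q6E. Qed.

Lemma coef_ev (p : {poly int}) k : (map_poly (intr : int -> rat) p \Po 'X^6)`_k =
  if (6 %| k)%N then (p`_(k %/ 6))%:~R else 0.
Proof. by rewrite coef_comp_poly_Xn // coef_map. Qed.

Lemma ev_inj p r : ev p = ev r -> p = r.
Proof.
move=> /eqP; rewrite tofrac_eq => /eqP E; apply/polyP => i.
have := congr1 (fun s : {poly rat} => s`_(6 * i)) E; rewrite !coef_ev dvdn_mulr // mulKn //.
exact: intr_inj.
Qed.
Lemma ev_neq0 (r : {poly int}) : r`_0 = 1 -> ev r != 0.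
Proof.
move=> r0; apply/eqP => E; have : r = 0 by apply: ev_inj; rewrite ev0.
by move=> rE; move: r0; rewrite rE coef0 => /eqP; rewrite eq_sym oner_eq0.
Qed.

(** The series divisible by q^m among the quotients of integral polynomials in q by
    polynomials of constant term 1.  Such quotients expand in integral power
    series, and they form a ring that is closed under the divisions that occur. *)
Definition oq (m : nat) (x : Kq) : Prop :=
  exists p r : {poly int}, r`_0 = 1 /\ x = Qn m * (ev p / ev r).

Lemma coef0M1 (p r : {poly int}) : p`_0 = 1 -> r`_0 = 1 -> (p * r)`_0 = 1.
Proof. by move=> p0 r0; rewrite coefM big_ord1 p0 r0. Qed.
Lemma oq_alg (F : fieldType) (m p r p' r' : F) : r != 0 -> r' != 0 ->
  m * (p / r) + m * (p' / r') = m * ((p * r' + p' * r) / (r * r')).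
Proof. by move=> h h'; field; rewrite h h'. Qed.
Lemma oq_alg' (F : fieldType) (m m' p r p' r' : F) :
  (m * (p / r)) * (m' * (p' / r')) = m * m' * ((p * p') / (r * r')).
Proof. by rewrite invfM mulrACA; congr (_ * _); exact: mulrACA. Qed.
Lemma oqD m x y : oq m x -> oq m y -> oq m (x + y).
Proof.
move=> [p [r [r0 ->]]] [p' [r' [r0' ->]]]; exists (p * r' + p' * r), (r * r').
by split; [exact: coef0M1|rewrite oq_alg ?ev_neq0 // evD !evM].
Qed.
Lemma oqN m x : oq m x -> oq m (- x).
Proof. by move=> [p [r [r0 ->]]]; exists (- p), r; split; rewrite // evN mulNr mulrN. Qed.
Lemma oqB m x y : oq m x -> oq m y -> oq m (x - y).
Proof. by move=> hx hy; apply: oqD hx (oqN hy). Qed.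
Lemma oqM m m' x y : oq m x -> oq m' y -> oq (m + m') (x * y).
Proof.
move=> [p [r [r0 ->]]] [p' [r' [r0' ->]]]; exists (p * p'), (r * r').
by split; [exact: coef0M1|rewrite oq_alg' QnD !evM].
Qed.
Lemma oq_Qn m : oq m (Qn m).
Proof. by exists 1, 1; rewrite coef1 ev1 divff ?mulr1 ?oner_neq0. Qed.
Lemma Qn0 : Qn 0 = 1. Proof. by rewrite /Qn muln0 q60. Qed.
Lemma oq1 : oq 0 1. Proof. by rewrite -Qn0; exact: oq_Qn. Qed.
Lemma oq0 m : oq m 0.
Proof. by exists 0, 1; rewrite coef1 ev0 mul0r mulr0. Qed.
Lemma oq_le m m' x : (m' <= m)%N -> oq m x -> oq m' x.
Proof.
move=> mm [p [r [r0 ->]]]; exists ('X^(m - m') * p), r; split=> //.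
by rewrite evM evX -{1}(subnKC mm) QnD -!mulrA.
Qed.
Lemma oqMl m x y : oq 0 x -> oq m y -> oq m (x * y).
Proof. by move=> hx hy; have := oqM hx hy. Qed.
Lemma oqMr m x y : oq m x -> oq 0 y -> oq m (x * y).
Proof. by rewrite mulrC => hx hy; apply: oqMl. Qed.
Lemma oq_1Q i : oq 0 (1 - Qn i).
Proof. by apply: oqB oq1 _; apply: oq_le (oq_Qn i). Qed.
Lemma oq_inv i : (0 < i)%N -> oq 0 (1 - Qn i)^-1.
Proof.
move=> i0; exists 1, (1 - 'X^i); split.
  by rewrite coefB coef1 coefXn /= ltn_eqF // subr0.
by rewrite Qn0 mul1r ev1 mul1r evD ev1 evN evX.
Qed.
Lemma oq_sum m (I : Type) (s : seq I) (P : pred I) (f : I -> Kq) : (forall i, P i -> oq m (f i)) ->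
  oq m (\sum_(i <- s | P i) f i).
Proof. by move=> h; elim/big_ind: _ => //; [exact: oq0|exact: oqD]. Qed.
Lemma oq_prod (I : Type) (s : seq I) (P : pred I) (f : I -> Kq) : (forall i, P i -> oq 0 (f i)) ->
  oq 0 (\prod_(i <- s | P i) f i).
Proof. by move=> h; elim/big_ind: _ => //; [exact: oq1|exact: oqMl]. Qed.
Lemma oq_sign m u x : oq m x -> oq m ((-1) ^+ u * x).
Proof.
move=> hx; apply: oqMl hx; elim: u => [|u IH]; first exact: oq1.
by rewrite exprS; apply: oqMl IH; apply: oqN oq1.
Qed.
Lemma Qn_neq0 m : Qn m != 0.
Proof. by rewrite /Qn q6_expn expf_neq0 // Model.q6_1_neq0. Qed.
Lemma oq_shift m k x : oq (k + m) x -> oq m ((Qn k)^-1 * x).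
Proof.
by move=> [p [r [r0 ->]]]; exists p, r; split=> //; rewrite QnD !mulrA mulVf ?mul1r // Qn_neq0.
Qed.

Lemma sum_dvd6 (V : zmodType) (G : nat -> V) k :
  \sum_(j < (6 * k).+1) (if (6 %| j)%N then G (j %/ 6)%N else 0) = \sum_(j < k.+1) G j.
Proof.
elim: k => [|k IH]; first by rewrite muln0 !big_ord1 dvdn0 div0n.
rewrite mulnS addnC [RHS]big_ord_recr /= -IH; move: (6 * k)%N (dvdn_mulr k (dvdnn 6)) (mulKn k (isT : 0 < 6)%N) => M M6 Mk.
rewrite !addnS addn0 6!big_ord_recr /= -!addrA; congr (_ + _).
have [z1 z2 z3 z4 z5] : [/\ (6 %| M.+1)%N = false, (6 %| M.+2)%N = false, (6 %| M.+3)%N = false,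
   (6 %| M.+4)%N = false & (6 %| M.+4.+1)%N = false] by split; apply/negbTE; lia.
have z6 : (6 %| M.+4.+2)%N by lia.
have e6 : (M.+4.+2 %/ 6 = k.+1)%N by lia.
by rewrite z1 z2 z3 z4 z5 z6 e6 !add0r.
Qed.

(** The difference 1 - r is divisible by the variable, so each step of the
    geometric series gains one power. *)
Lemma poly_inv_mod (r : {poly int}) N : r`_0 = 1 -> exists s t, r * s = 1 - 'X^N * t.
Proof.
move=> r0; elim: N => [|N [s [t E]]]; first by exists 0, 1; rewrite mulr0 expr0 mul1r subrr.
have [u hu] : exists u, 1 - r = 'X * u.
  exists (drop_poly 1 (1 - r)); rewrite -[LHS](poly_take_drop 1) expr1 mulrC.
  rewrite -[RHS]add0r; congr (_ + _); apply/polyP => i; rewrite coef_take_poly coef0.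
  by case: i => // ; rewrite coefB coef1 r0 subrr.
have rE : r = 1 - 'X * u by rewrite -hu opprB addrC subrK.
exists (s + 'X^N * t), (u * t); rewrite mulrDr E rE exprSr; ring.
Qed.

(** In the product of c with a series of constant term 1, the lowest coefficient
    of c survives. *)
Lemma oq_poly N c : oq N (ev c) -> forall i, (i < N)%N -> c`_i = 0.
Proof.
move=> [p [r [r0 E]]] i iN.
have E1 : c * r = 'X^N * p by apply: ev_inj; rewrite !evM evX E -mulrA divfK // ev_neq0.
have [s [t E2]] := poly_inv_mod N r0.
have -> : c = 'X^N * (c * t + p * s).
  have : c * (r * s) = c * (1 - 'X^N * t) by rewrite E2.
  rewrite mulrA E1 => h; rewrite -[LHS](subrK (c * ('X^N * t))) -{1}[c]mulr1 -mulrBr -h; ring.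
by rewrite mulrC coefMXn iN.
Qed.

Lemma oq_approx x N : oq 0 x -> exists c, oq N (x - ev c).
Proof.
move=> [p [r [r0 ->]]]; have [s [t E]] := poly_inv_mod N r0.
exists (p * s), (p * t), r; split=> //; rewrite Qn0 mul1r -!evX mulrA -evM.
have rn := ev_neq0 r0; apply: (mulIf rn); rewrite mulrBl !divfK // -evM.
by rewrite -evN -evD; congr ev; rewrite -mulrA (mulrC s) E; ring.
Qed.

Lemma sub_tri (V : zmodType) (x a b : V) : b - a = (x - a) - (x - b).
Proof. by rewrite opprB [RHS]addrC addrA subrK. Qed.

(** The coefficients of x are those of polynomial approximations of x, which are
    unique up to the order of the approximation. *)
Lemma oq_series x : oq 0 x -> exists a : nat -> int,
  (forall N c, oq N (x - ev c) -> forall i, (i < N)%N -> a i = c`_i) /\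
  expands_to x (fun k => if (6 %| k)%N then (a (k %/ 6)%N)%:~R else 0).
Proof.
move=> xO; have [c cP] := choice (fun N => oq_approx N xO).
have A N d : oq N (x - ev d) -> forall i, (i < N)%N -> (c i.+1)`_i = d`_i.
  move=> h i iN; apply/eqP; rewrite -subr_eq0 -coefB; apply/eqP.
  apply: (@oq_poly i.+1); last by [].
  rewrite evD evN (_ : _ - _ = (x - ev d) - (x - ev (c i.+1))); last exact: sub_tri.
  by apply: oqB => //; exact: oq_le h.
exists (fun i => (c i.+1)`_i); split=> //.
have [p [r [r0 xE]]] := xO; rewrite Qn0 mul1r in xE.
have R k : \sum_(j < k.+1) r`_j * (c (k - j).+1)`_(k - j) = p`_k.
  transitivity ((r * c k.+1)`_k).
    by rewrite coefM; apply: eq_bigr => j _; rewrite (A _ _ (cP k.+1)) // ltnS leq_subr.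
  apply/eqP; rewrite -subr_eq0 -coefB; apply/eqP; apply: (@oq_poly k.+1) => //.
  rewrite evD evN evM (_ : ev p = ev r * x); last by rewrite xE mulrC divfK // ev_neq0.
  rewrite -mulrBr -opprB mulrN; apply: oqN; apply: oqMl (cP k.+1).
  by exists r, 1; rewrite coef1 ev1 Qn0 mul1r divr1.
exists (map_poly intr p \Po 'X^6), (map_poly intr r \Po 'X^6); split=> //.
  by rewrite coef_ev dvdn0 div0n r0.
move=> k; rewrite [RHS]coef_ev.
under eq_bigr => j _ do rewrite coef_ev.
have [k6|k6] := boolP (6 %| k)%N; last first.
  rewrite big1 // => j _; have [j6|_] := boolP (6 %| j)%N; last by rewrite mul0r.
  rewrite ifN ?mulr0 //; apply: contra k6 => h.
  by rewrite -(@subnKC j k) ?dvdn_addr // -ltnS.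
rewrite -R; have kE : k = (6 * (k %/ 6))%N by rewrite mulnC divnK.
have := sum_dvd6 (fun j => r`_j * (c (k %/ 6 - j).+1)`_(k %/ 6 - j)) (k %/ 6).
rewrite -kE => <-; rewrite rmorph_sum; apply: eq_bigr => j _; have [j6|_] := boolP (6 %| j)%N; last by rewrite mul0r rmorph0.
have jk : (j <= k)%N by rewrite -ltnS.
have e : ((k - j) %/ 6 = k %/ 6 - j %/ 6)%N by lia.
by rewrite dvdn_sub // e; exact/esym/intrM.
Qed.

(** * Stabilization of the coefficients *)

(** The eigenvalues of a parallel column with M crossings after k partial traces,
    divided by a common scalar, for M odd.  Only integral powers of q occur, since
    u^2 + u is even. *)
Fixpoint ac (n M k u : nat) : Kq :=
  if k is k'.+1 then
    ((1 - Qn (u + k'.+1)) * (1 - Qn (n - k' - u + 1)) * Qn u * ac n M k' u +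
     (1 - Qn (u.+1)) * (1 - Qn (n + u + 3)) * ((Qn 1)^-1 * ac n M k' u.+1)) /
    ((1 - Qn (n - k')) * (1 - Qn (2 * u + k'.+2)))
  else (-1) ^+ u * Qn (M * (u ^ 2 + u))./2.

Definition arat (i n : nat) : Kq := (1 - Qn i) / (1 - Qn n).
Lemma acS_alg (F : fieldType) (c0 c1 x y z t q p a b : F) :
  (c0 * x * q * a + c1 * y * (p * b)) / (z * t) = t^-1 * (c0 * (q * (x / z * a)) + c1 * (p * (y / z * b))).
Proof. by rewrite invfM; ring. Qed.
Lemma acS n M k u : ac n M k.+1 u = (1 - Qn (2 * u + k.+2))^-1 *
  ((1 - Qn (u + k.+1)) * (Qn u * (arat (n - k - u + 1) (n - k) * ac n M k u)) +
   (1 - Qn u.+1) * ((Qn 1)^-1 * (arat (n + u + 3) (n - k) * ac n M k u.+1))).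
Proof. exact: acS_alg. Qed.

Lemma oq_arat i n : (0 < n)%N -> oq 0 (arat i n).
Proof. by move=> n0; apply: oqMl (oq_1Q i) (oq_inv n0). Qed.

(** The exponent M (u^2 + u) / 2 is at least 3 u when M > 2, and a trace moves
    from u + 1 to u at the cost of only one power of q. *)
Lemma ac_bound n M k u : (2 < M)%N -> (k <= n)%N -> oq (3 * u) (ac n M k u).
Proof.
move=> M3; elim: k u => [|k IH] u kn.
  by apply: oq_sign; apply: oq_le (oq_Qn _); nia.
have f0 i : oq 0 (arat i (n - k)) by apply: oq_arat; lia.
rewrite acS; apply: oqMl; first by apply: oq_inv; lia.
apply: oqD; apply: oqMl (oq_1Q _) _.
  apply: (oq_le (m := u + 3 * u)); first by lia.
  by apply: oqM (oq_Qn u) _; apply: oqMl (f0 _) (IH _ (ltnW kn)).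
by apply: oq_shift; apply: oqMl (f0 _) _; apply: oq_le (IH _ (ltnW kn)); lia.
Qed.

Lemma inv_diff (F : fieldType) (x y a b : F) : x != 0 -> y != 0 ->
  a / x - b / y = (a * y - b * x) / (x * y).
Proof. by move=> x0 y0; rewrite -mulNr addf_div // mulNr. Qed.
Lemma ratio_alg (R : comNzRingType) (i i' n n' : R) :
  (1 - i') * (1 - n) - (1 - i) * (1 - n') = (i - i') + (n' - n) + (i' * n - i * n').
Proof. by ring. Qed.

(** Written over a common denominator, the products of powers of q cancel. *)
Lemma ratio_diff i n : (0 < n)%N -> oq (minn i n) (arat i.+1 n.+1 - arat i n).
Proof.
move=> n0; rewrite inv_diff ?Qn_neq1 //.
apply: oqMr; last by rewrite invfM; apply: oqMl; apply: oq_inv.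
rewrite ratio_alg -!QnD addSnnS subrr addr0.
by apply: oqD; apply: oqB; apply: oq_le (oq_Qn _); lia.
Qed.

Lemma mulf_diff (R : comNzRingType) (f f' a a' : R) : f' * a' - f * a = (f' - f) * a' + f * (a' - a).
Proof. by ring. Qed.
Lemma ac_diff_alg (R : comNzRingType) (d c0 c1 q p x x' y y' : R) :
  d * (c0 * (q * x') + c1 * (p * y')) - d * (c0 * (q * x) + c1 * (p * y)) =
  d * (c0 * (q * (x' - x)) + c1 * (p * (y' - y))).
Proof. by ring. Qed.

(** Only the weights of the traces depend on n, through powers q^(n - k - u)
    and higher; the bound on the eigenvalues compensates for the loss of order in u. *)
Lemma ac_diff n M k u : (2 < M)%N -> (k <= n)%N -> (u <= n - k)%N ->
  oq (n + 1 - k + u) (ac n.+1 M k u - ac n M k u).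
Proof.
move=> M3; elim: k u => [|k IH] u kn un; first by rewrite /= subrr; exact: oq0.
have f0 i : oq 0 (arat i (n - k)) by apply: oq_arat; lia.
rewrite !acS ac_diff_alg; apply: oqMl; first by apply: oq_inv; lia.
apply: oqD; apply: oqMl (oq_1Q _) _; rewrite mulf_diff.
  apply: (oq_le (m := u + (n + 1 - k.+1))); first by lia.
  apply: oqM (oq_Qn u) _; apply: oqD.
    apply: (oq_le (m := (n - k - u) + 3 * u)); first by lia.
    apply: oqM; last by apply: ac_bound; lia.
    have := @ratio_diff (n - k - u + 1) (n - k) ltac:(lia).
    rewrite (_ : (n - k - u + 1).+1 = n.+1 - k - u + 1)%N; last by lia.
    by rewrite (_ : (n - k).+1 = n.+1 - k)%N; [apply: oq_le; lia|lia].
  by apply: oqMl (f0 _) _; apply: oq_le (IH u _ _); lia.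
apply: oq_shift; apply: oqD.
  apply: (oq_le (m := (n - k) + 3 * u.+1)); first by lia.
  apply: oqM; last by apply: ac_bound; lia.
  have := @ratio_diff (n + u + 3) (n - k) ltac:(lia).
  rewrite (_ : (n + u + 3).+1 = n.+1 + u + 3)%N; last by lia.
  by rewrite (_ : (n - k).+1 = n.+1 - k)%N; [apply: oq_le; lia|lia].
by apply: oqMl (f0 _) _; apply: oq_le (IH u.+1 _ _); lia.
Qed.

(** The part of the quotient of quantum dimensions that depends on n. *)
Definition hrat n k u : Kq := arat (n - k - u + 1) (n + 1) * arat (n + u + 2) (n + 2).
Definition pterm Ma Mb n k u : Kq :=
  arat (2 * u + k + 1) 1 * ((Qn u)^-1 * (hrat n k u * (ac n Ma k u * ac n Mb k u))).
Definition psum Ma Mb n k : Kq := \sum_(u < (n - k).+1) pterm Ma Mb n k u.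

Section Terms.
Variables Ma Mb : nat.
Hypotheses (Ma3 : (2 < Ma)%N) (Mb3 : (2 < Mb)%N).
Lemma oq_hrat n k u : oq 0 (hrat n k u).
Proof. by apply: oqMl; apply: oq_arat; lia. Qed.
Lemma pterm_bound n k u : (k <= n)%N -> oq (5 * u) (pterm Ma Mb n k u).
Proof.
move=> kn; apply: oqMl; first exact: oq_arat.
apply: oq_shift; apply: oqMl (oq_hrat _ _ _) _.
by apply: (oq_le (m := 3 * u + 3 * u)); [lia|apply: oqM; exact: ac_bound].
Qed.
Lemma hrat_diff n k u : (k <= n)%N -> (u <= n - k)%N ->
  oq (n - k - u + 1) (hrat n.+1 k u - hrat n k u).
Proof.
move=> kn un; rewrite /hrat mulf_diff; apply: oqD.
  apply: oqMr; last by apply: oq_arat; lia.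
  have := @ratio_diff (n - k - u + 1) (n + 1) ltac:(lia).
  rewrite (_ : (n - k - u + 1).+1 = n.+1 - k - u + 1)%N; last by lia.
  by rewrite -addSn; apply: oq_le; lia.
apply: oqMl; first by apply: oq_arat; lia.
by have := @ratio_diff (n + u + 2) (n + 2) ltac:(lia); rewrite -!addSn; apply: oq_le; lia.
Qed.
Lemma pterm_diff_alg (R : comNzRingType) (c q x x' : R) : c * (q * x') - c * (q * x) = c * (q * (x' - x)).
Proof. by ring. Qed.
Lemma pterm_diff n k u : (k <= n)%N -> (u <= n - k)%N ->
  oq (n + 1 - k) (pterm Ma Mb n.+1 k u - pterm Ma Mb n k u).
Proof.
move=> kn un; rewrite /pterm pterm_diff_alg; apply: oqMl; first exact: oq_arat.
have ba m M : (2 < M)%N -> (k <= m)%N -> oq (3 * u) (ac m M k u) by exact: ac_bound.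
apply: oq_shift; rewrite mulf_diff; apply: oqD.
  apply: (oq_le (m := (n - k - u + 1) + (3 * u + 3 * u))); first by lia.
  by apply: oqM (hrat_diff kn un) _; apply: oqM; apply: ba => //; lia.
apply: oqMl (oq_hrat _ _ _) _; rewrite mulf_diff.
apply: (oq_le (m := (n + 1 - k + u) + 3 * u)); first by lia.
apply: oqD; first by apply: oqM; [exact: ac_diff|apply: ba => //; lia].
by rewrite mulrC; apply: oqM; [exact: ac_diff|apply: ba].
Qed.
Lemma psum_oq n k : (k <= n)%N -> oq 0 (psum Ma Mb n k).
Proof. by move=> kn; apply: oq_sum => u _; apply: oq_le (pterm_bound _ kn). Qed.
Lemma psum_diff n k : (k <= n)%N -> oq (n + 1 - k) (psum Ma Mb n.+1 k - psum Ma Mb n k).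
Proof.
move=> kn; rewrite /psum (_ : n.+1 - k = (n - k).+1)%N; last by lia.
rewrite big_ord_recr /= addrAC -sumrB; apply: oqD.
  by apply: oq_sum => u _; apply: pterm_diff => //; rewrite -ltnS.
by apply: oq_le (pterm_bound _ _); lia.
Qed.

Definition qrat l k : Kq := qf l ^+ 2 / (qf k ^+ 2 * qf (l - k)).
(** The coefficients of the powers of the full twist, divided by a common scalar. *)
Fixpoint cc n g k : Kq :=
  if g is g'.+1 then \sum_(l < n.+1 | (k <= l)%N) cc n g' l * (Qn (l + k ^ 2 + k) * qrat l k)
  else if (k <= n)%N then Qn (k ^ 2 + k) * qrat n k else 0.

Lemma oq_qf i : oq 0 (qf i). Proof. by apply: oq_prod => j _; exact: oq_1Q. Qed.
Lemma oq_qfV i : oq 0 (qf i)^-1.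
Proof.
elim: i => [|i IH]; first by rewrite qf0 invr1; exact: oq1.
by rewrite qfS invfM; apply: oqMl IH _; exact: oq_inv.
Qed.
Lemma oq_qrat l k : oq 0 (qrat l k).
Proof.
have h i : oq 0 (qf i ^+ 2) by rewrite expr2; apply: oqMl; exact: oq_qf.
apply: oqMl (h l) _; rewrite invfM -exprVn expr2; apply: oqMl (oq_qfV _).
by apply: oqMl; exact: oq_qfV.
Qed.
Lemma cc_bound n g k : oq (k ^ 2 + k) (cc n g k).
Proof.
case: g => [|g] /=.
  by case: ifP => _; [apply: oqMr (oq_Qn _) (oq_qrat _ _)|exact: oq0].
have B : forall l, oq 0 (cc n g l); last first.
  apply: oq_sum => l kl; apply: oqMl (B l) _; apply: oqMr (oq_qrat _ _).
  by apply: oq_le (oq_Qn _); lia.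
elim: g => [|g IH] l /=.
  by case: ifP => _; [apply: oq_le (oqMr (oq_Qn _) (oq_qrat _ _))|exact: oq0].
by apply: oq_sum => j _; apply: oqMl (IH j) _; apply: oq_le (oqMr (oq_Qn _) (oq_qrat _ _)).
Qed.
Lemma cc_gt n g k : (n < k)%N -> cc n g k = 0.
Proof.
move=> nk; case: g => [|g] /=; first by rewrite leqNgt nk.
by rewrite big_pred0 // => l; apply/negbTE; rewrite -ltnNge; apply: leq_trans nk; exact: ltn_ord.
Qed.
Lemma qrat_alg (F : fieldType) (a b c x y : F) : y != 0 -> b != 0 -> c != 0 ->
  (a * (1 - x)) ^+ 2 / (b * (c * y)) - a ^+ 2 / (b * c) =
  a * a / b / c / y * ((1 - y) - x - (x - x * x)).
Proof. by move=> y0 b0 c0; field; do !(apply/andP; split). Qed.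
Lemma qrat_diff n k : (k <= n)%N -> oq (n + 1 - k) (qrat n.+1 k - qrat n k).
Proof.
move=> kn; rewrite /qrat (_ : n.+1 - k = (n - k).+1)%N; last by lia.
rewrite !qfS qrat_alg ?Qn_neq1 ?expf_neq0 ?qf_neq0 //.
apply: oqMl.
  apply: oqMl; last exact: oq_inv.
  apply: oqMl; last exact: oq_qfV.
  by apply: oqMl; [apply: oqMl; exact: oq_qf|rewrite -exprVn expr2; apply: oqMl; exact: oq_qfV].
rewrite opprB addrCA subrr addr0 -QnD; apply: oqB; last by apply: oqB; apply: oq_le (oq_Qn _); lia.
by apply: oqB; apply: oq_le (oq_Qn _); lia.
Qed.
(** Up to the common scalar, the matrix of the full twist does not depend on n;
    only its row n, from which the powers start, changes with n. *)
Lemma cc_diff n g k : oq (n + 1) (cc n.+1 g k - cc n g k).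
Proof.
elim: g k => [|g IH] k.
  have [kn|kn] := leqP k n.
    rewrite /= kn (leqW kn) -mulrBr.
    by apply: (oq_le (m := (k ^ 2 + k) + (n + 1 - k))); [lia|apply: oqM (oq_Qn _) (qrat_diff kn)].
  by rewrite (cc_gt _ kn) subr0; apply: oq_le (cc_bound _ _ _); nia.
have -> : cc n g.+1 k = \sum_(l < n.+2 | (k <= l)%N) cc n g l * (Qn (l + k ^ 2 + k) * qrat l k).
  rewrite [RHS]big_mkcond big_ord_recr -big_mkcond /=.
  by rewrite cc_gt // mul0r if_same addr0.
rewrite /= -sumrB; apply: oq_sum => l _; rewrite -mulrBl.
by apply: oqMr (IH _) _; apply: oq_le (oqMr (oq_Qn _) (oq_qrat _ _)).
Qed.

(** The normalized colored Jones polynomial; Ma and Mb are the numbers of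
    crossings of the parallel columns, and the third column has 2 (g + 1). *)
Definition Jhat g n : Kq := \sum_(k < n.+1) cc n g k * psum Ma Mb n k.
Lemma Jhat_oq g n : oq 0 (Jhat g n).
Proof.
apply: oq_sum => k _; apply: oqMl (oq_le _ (cc_bound _ _ _)) (psum_oq _) => //.
by rewrite -ltnS.
Qed.
(** In the term k, the factor q^(k^2 + k) makes up for the order k that is missing
    from the stabilization of the eigenvalues; the new terms at the end of the
    ranges of k and u are small by the bounds on their factors. *)
Lemma Jhat_diff g n : oq n.+1 (Jhat g n.+1 - Jhat g n).
Proof.
rewrite /Jhat big_ord_recr /= addrAC -sumrB; apply: oqD; last first.
  by apply: oqMr; [apply: oq_le (cc_bound _ _ _); nia|exact: psum_oq].
apply: oq_sum => k _; have kn : (k <= n)%N by rewrite -ltnS.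
have cd := cc_diff n g k; rewrite addn1 in cd.
rewrite mulf_diff; apply: oqD.
  by apply: oqMr cd _; apply: psum_oq; exact: leqW.
by apply: (oq_le (m := (k ^ 2 + k) + (n + 1 - k))); [lia|apply: oqM (cc_bound _ _ _) (psum_diff kn)].
Qed.
Lemma Jhat0 g : Jhat g 0 = 1.
Proof.
have q00 : qrat 0 0 = 1 by rewrite /qrat subnn qf0 !expr1n mulr1 divr1.
have c0 : cc 0 g 0 = 1.
  elim: g => [|g IH] /=; first by rewrite Qn0 q00 mulr1.
  by rewrite big_mkcond big_ord1 /= IH Qn0 q00 !mulr1.
have a0 M : ac 0 M 0 0 = 1 by rewrite /= muln0 Qn0 mulr1.
rewrite /Jhat big_ord1 c0 mul1r /psum big_ord1 /pterm !a0 Qn0 invr1 !mul1r !mulr1.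
by rewrite /hrat /arat !divff ?mulr1 // Qn_neq1.
Qed.
End Terms.

(** * The colored Jones polynomial of the pretzel knot *)

Lemma stay_alg (F : fieldType) (e1 e2 e3 e4 q x1 x2 x3 x4 d : F) :
  e3 != 0 -> e4 != 0 -> d != 0 -> x3 != 0 -> x4 != 0 -> e1 * e2 = q * e3 * e4 ->
  e1 * x1 / d * (e2 * x2 / d) / (e3 * x3 / d * (e4 * x4 / d)) = x4^-1 * (x1 * (q * (x2 / x3))).
Proof.
move=> h3 h4 hd hx3 hx4 E.
have -> : e1 * x1 / d * (e2 * x2 / d) / (e3 * x3 / d * (e4 * x4 / d)) =
  (e1 * e2) * (x1 * x2 / (e3 * e4 * x3 * x4)) by field; rewrite h3 h4 hd hx3 hx4.
by rewrite E; field; rewrite h3 h4 hx3 hx4.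
Qed.

Lemma q6_neq0 i : q6 i != 0 :> Kq.
Proof. by apply: expfz_neq0; rewrite -[_ 'X]expr1z; exact: Model.q6_1_neq0. Qed.
Lemma q6X a m : q6 a ^+ m = q6 (a * m%:Z).
Proof.
elim: m => [|m IH]; first by rewrite mulr0.
by rewrite exprS IH -q6D; congr q6; lia.
Qed.
Lemma q6V a : (q6 a)^-1 = q6 (- a).
Proof. by apply: (mulfI (q6_neq0 a)); rewrite mulfV ?q6_neq0 // -q6D subrr. Qed.

Lemma trace_stayE k b u : (u <= b.+1)%N -> trace_stay v0 k b u =
  (1 - Qn (2 * u + k.+2))^-1 * ((1 - Qn (u + k.+1)) * (Qn u * ((1 - Qn (b.+2 - u)) / (1 - Qn b.+1)))).
Proof.
move=> ub; rewrite /trace_stay.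
rewrite (_ : b.+2 - u = (b.+1 - u).+1)%N ?addnS; last by lia.
rewrite !qn_Qn; apply: stay_alg; rewrite ?q6_neq0 ?Qn_neq1 //.
by rewrite -!q6D; congr q6; lia.
Qed.
Lemma trace_downE k b u n : n = (b + k.+1)%N -> trace_down v0 k b u =
  (1 - Qn (2 * u + k.+2))^-1 * ((1 - Qn u.+1) * ((Qn 1)^-1 * ((1 - Qn (n + u + 3)) / (1 - Qn b.+1)))).
Proof.
move=> nE; rewrite /trace_down (_ : b + k + u + 4 = (n + u + 2).+1)%N; last by lia.
rewrite (_ : n + u + 3 = (n + u + 2).+1)%N; last by lia.
rewrite !addnS !qn_Qn; apply: stay_alg; rewrite ?q6_neq0 ?Qn_neq1 //.
by rewrite /Qn q6V -!q6D; congr q6; lia.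
Qed.

Lemma lam_alg (R : comNzRingType) (x s t v y : R) : x * (s * (t * (v * y))) = s * (x * y) * (t * v).
Proof. by ring. Qed.
Lemma lam_ac n m u : lam n (2 * m + 1) u =
  ((-1) ^+ n * q6 (- (n ^ 2 + 3 * n)%N%:Z)) ^+ (2 * m + 1) * ac n (2 * m + 1) 0 u.
Proof.
rewrite /lam /twist_eig /= (exprD (-1) n u) -!mulrA.
have E1 : q6 (-1) ^+ (n * n) / v0 ^+ n = q6 (- (n ^ 2 + 3 * n)%N%:Z).
  by rewrite /v0 !q6X q6V -q6D; congr q6; lia.
have E2 : (v0 ^+ (u ^ 2 + u)) ^+ (2 * m + 1) = Qn ((2 * m + 1) * (u ^ 2 + u))./2.
  rewrite /v0 /Qn !q6X; congr q6.
  have : ~~ odd (u ^ 2 + u) by rewrite oddD oddX /= addbb.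
  by move=> h; have := odd_double_half ((2 * m + 1) * (u ^ 2 + u)); rewrite oddM (negbTE h) andbF -muln2; lia.
have E3 : ((-1) ^+ u) ^+ (2 * m + 1) = (-1) ^+ u :> Kq.
  by rewrite -exprM -signr_odd oddM addn1 /= oddM andbT signr_odd.
rewrite -E1 -E2 -{2}E3 -!exprMn; congr (_ ^+ _).
exact: lam_alg.
Qed.

(** All the half powers of q in the weights of the traces and in the eigenvalues
    combine to a common factor. *)
Lemma trs_ac n m k u : (k <= n)%N -> (u <= n - k)%N -> trs v0 n k (lam n (2 * m + 1)) u =
  ((-1) ^+ n * q6 (- (n ^ 2 + 3 * n)%N%:Z)) ^+ (2 * m + 1) * ac n (2 * m + 1) k u.
Proof.
elim: k u => [|k IH] u kn un; first exact: lam_ac.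
rewrite acS -[trs _ _ k.+1 _ _]/(trace_fun v0 k (n - k.+1) (trs v0 n k (lam n (2 * m + 1))) u) /trace_fun !IH; try lia.
rewrite trace_stayE; last by lia.
rewrite (@trace_downE _ _ _ n); last by lia.
rewrite (_ : (n - k.+1).+2 - u = n - k - u + 1)%N; last by lia.
rewrite (_ : (n - k.+1).+1 = n - k)%N; last by lia.
rewrite /arat; move: (_ ^+ (2 * m + 1)) => K; ring.
Qed.

Lemma q6Xz a (b : int) : q6 a ^ b = q6 (a * b). Proof. by rewrite /q6 exprz_exp. Qed.

Lemma qdim_alg (F : fieldType) (e1 e2 e3 f1 f2 q x1 x2 x3 y1 y2 d t : F) :
  d != 0 -> t != 0 -> y1 != 0 -> y2 != 0 -> e1 * e2 * e3 = q * f1 * f2 ->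
  e1 * x1 / d * (e2 * x2 / d) * (e3 * x3 / d) / t =
  f1 * y1 / d * (f2 * y2 / d) / t * (x1 / d * (q * (x2 / y1 * (x3 / y2)))).
Proof.
move=> hd ht h1 h2 E.
have -> : e1 * x1 / d * (e2 * x2 / d) * (e3 * x3 / d) / t = (e1 * e2 * e3) * (x1 * x2 * x3 / (d * d * d * t)).
  by field; rewrite hd ht.
by rewrite E; field; rewrite hd ht h1 h2.
Qed.

Lemma qdimE n k u : (k <= n)%N -> (u <= n - k)%N ->
  qdim v0 n k u = Delta n * (arat (2 * u + k + 1) 1 * ((Qn u)^-1 * hrat n k u)).
Proof.
move=> kn un; rewrite /qdim /Delta /hrat /arat !qintE.
rewrite (_ : 2 * u + k + 1 = (2 * u + k).+1)%N; last by lia.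
rewrite (_ : n - k - u + 1 = (n - k - u).+1)%N; last by lia.
rewrite (_ : n + u + 2 = (n + u + 1).+1)%N; last by lia.
rewrite (_ : n + 1 = n.+1)%N; last by lia.
rewrite (_ : n + 2 = n.+2)%N; last by lia.
have q2 : qn v0 2 != 0 by exact: v0_generic.
rewrite !(qn_Qn (_ + _)) !(qn_Qn (n - k - u)) !(qn_Qn n) !(qn_Qn n.+1).
apply: qdim_alg; rewrite ?Qn_neq1 //.
by rewrite /Qn q6V -!q6D; congr q6; lia.
Qed.

Lemma Delta_neq0 n : Delta n != 0.
Proof. by rewrite /Delta !qintE !mulf_neq0 ?invr_eq0 //; exact: v0_generic. Qed.

Lemma tmE n l k : tm n l k = q6 (- (4 * n ^ 2 + 12 * n)%N%:Z) * (Qn (l + k ^ 2 + k) * qrat l k).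
Proof. by rewrite /tm /qrat addrC q6D -/(Qn _) -!mulrA. Qed.

Lemma twc_alg (R : comNzRingType) (p t q c x : R) : p * q * c * (t * x) = p * t * q * (c * x).
Proof. by ring. Qed.
Lemma twcE n g k : (k <= n)%N ->
  twc n g.+1 k = q6 (- (4 * n ^ 2 + 12 * n)%N%:Z) ^+ g.+1 * Qn n * cc n g k.
Proof.
elim: g k => [|g IH] k kn.
  rewrite /= kn big_mkcond big_ord_recr /= eqxx kn big1 ?add0r ?mul1r; last first.
    by move=> i _; rewrite ltn_eqF ?mul0r ?if_same.
  by rewrite tmE expr1 -[(n + k ^ 2 + k)%N]addnA QnD -!mulrA.
rewrite -[twc n g.+2 k]/(\sum_(j < n.+1 | (k <= j)%N) twc n g.+1 j * tm n j k) [cc _ _ _]/=.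
rewrite mulr_sumr; apply: eq_bigr => j _; have jn : (j <= n)%N by rewrite -ltnS.
by rewrite (IH j jn) tmE (exprSr _ g.+1) twc_alg.
Qed.

(** All the scalars are powers of q^(1/6); there is no sign, because the total
    number of crossings of the two parallel columns is even. *)
Lemma jones_form n a b g : (0 < n)%N -> exists d,
  colored_jones n (pretzel down (2 * a + 1)%N%:Z down up (2 * b + 1)%N%:Z up down (2 * g.+1)%N%:Z up) 3 5 =
  q6 d * Jhat (2 * a + 1) (2 * b + 1) g n.
Proof.
move=> n0; rewrite /colored_jones bracket_value //; set K := pretzel _ _ _ _ _ _ _ _ _.
set kap := (-1) ^+ n * q6 (- (n ^ 2 + 3 * n)%N%:Z) : Kq.
set tau := q6 (- (4 * n ^ 2 + 12 * n)%N%:Z).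
have kapE : kap ^+ (2 * a + 1) * kap ^+ (2 * b + 1) = q6 (- (n ^ 2 + 3 * n)%N%:Z * (2 * a + 1 + (2 * b + 1))%N%:Z).
  rewrite -exprD /kap exprMn -exprM -signr_odd oddM (_ : odd (2 * a + 1 + (2 * b + 1)) = false); last by lia.
  by rewrite andbF mul1r q6X.
exists ((2 * (n ^ 2 + 3 * n))%N%:Z * - writhe K + (- (4 * n ^ 2 + 12 * n)%N%:Z * g.+1%:Z + (6 * n)%N%:Z +
  - (n ^ 2 + 3 * n)%N%:Z * (2 * a + 1 + (2 * b + 1))%N%:Z)).
rewrite q6Xz !q6D -!mulrA; congr (_ * _); rewrite -kapE -q6X -/tau -/(Qn n).
apply: (canLR (mulfK (Delta_neq0 n))).
rewrite /Jhat !mulr_sumr mulr_suml; apply: eq_bigr => k _.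
have kn : (k <= n)%N by rewrite -ltnS.
rewrite twcE // -/tau /psum !mulr_sumr mulr_suml; apply: eq_bigr => u _.
have un : (u <= n - k)%N by rewrite -ltnS.
rewrite qdimE // !trs_ac // -/kap /pterm.
move: (kap ^+ _) (kap ^+ _) (tau ^+ _) (Qn n) (cc n g k) (Delta n) => x y t q c D.
move: (arat _ 1) (Qn u)^-1 (hrat n k u) (ac _ _ _ _) (ac _ _ _ _) => r s h A B.
ring.
Qed.

Lemma Jhat_le Ma Mb g m n : (2 < Ma)%N -> (2 < Mb)%N -> (m <= n)%N ->
  oq m.+1 (Jhat Ma Mb g n - Jhat Ma Mb g m).
Proof.
move=> Ma3 Mb3; elim: n => [|n IH] mn; first by rewrite (_ : m = 0%N) ?subrr; [exact: oq0|lia].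
have [->|mn'] := eqVneq m n.+1; first by rewrite subrr; exact: oq0.
rewrite -(subrKA (Jhat Ma Mb g n)); apply: oqD; last by apply: IH; lia.
by apply: oq_le (Jhat_diff Ma3 Mb3 g n); lia.
Qed.

Theorem theorem5p3 (alpha beta gamma : nat)
    (alpha_gt0 : (0 < alpha)%N) (beta_gt0 : (0 < beta)%N)
    (gamma_gt0 : (0 < gamma)%N) :
  let K := pretzel down (2 * alpha + 1)%N%:Z down
                   up (2 * beta + 1)%N%:Z up
                   down (2 * gamma)%N%:Z up in
  exists T : nat -> int, forall n : nat, (0 < n)%N ->
    exists J : nat -> int,
      normalization (colored_jones n K 3 5) J /\
      (forall i : nat, (i < n.+1)%N -> T i - J i = 0).
Proof.
case: gamma gamma_gt0 => // g _ K.
have a3 : (2 < 2 * alpha + 1)%N by lia.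
have b3 : (2 < 2 * beta + 1)%N by lia.
pose Jn := Jhat (2 * alpha + 1) (2 * beta + 1) g.
have [A AP] := choice (fun n => oq_series (Jhat_oq a3 b3 g n)).
exists (fun i => A i i) => n n0; exists (A n); split.
  split.
    have [h _] := AP n; rewrite (h 1%N 1) ?coef1 //.
    by rewrite ev1 -(Jhat0 (2 * alpha + 1) (2 * beta + 1) g); exact: Jhat_le.
  have [d E] := jones_form alpha beta g n0; exists false, (- d).
  rewrite E expr0 mul1r mulrA -q6D addNr mul1r.
  by have [_ h] := AP n.
move=> i iN; have [c cP] := oq_approx n.+1 (Jhat_oq a3 b3 g n).
have [h _] := AP n; have [h' _] := AP i.
rewrite (h _ _ cP) // (h' i.+1 c) ?subrr //.
rewrite -(subrKA (Jn n)); apply: oqD; last by apply: oq_le cP.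
by rewrite -opprB; apply: oqN; exact: Jhat_le.
Qed.
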